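(* Let $n\ge3$. There exist $\boldsymbol\varepsilon^{\mathfrak E}\in\,]\mathbf 0,\boldsymbol\varepsilon^{\rm ad}[$ and a real analytic map $\mathfrak E$ from $]-\boldsymbol\varepsilon^{\mathfrak E},\boldsymbol\varepsilon^{\mathfrak E}[$ to $\mathbb R$ such that $$\int_{\Omega_{\boldsymbol\varepsilon}}|\nabla u_{\boldsymbol\varepsilon}|^2\,dx=\mathfrak E(\boldsymbol\varepsilon)\qquad\forall\,\boldsymbol\varepsilon\in\,]\mathbf 0,\boldsymbol\varepsilon^{\mathfrak E}[$$ and $$\mathfrak E(\mathbf 0)=\int_\Omega|\nabla u_0|^2\,dx.$$
   Context: Let $n\ge3$, $\alpha\in\,]0,1[$ (open intervals are written $]a,b[$), $\mathbb R^n_+=\{x\in\mathbb R^n: x_n>0\}$, $B(0,r)$ the open ball, $B^+(0,r)=B(0,r)\cap\mathbb R^n_+$. $C^{k,\alpha}$ denotes the usual Schauder classes. Domain: $\Omega$ is an open bounded connected subset of $\mathbb R^n_+$ of class $C^{1,\alpha}$. Set $\partial_0\Omega=\partial\Omega\cap\partial\mathbb R^n_+$, $\partial_+\Omega=\partial\Omega\cap\mathbb R^n_+$. Assume $\partial_0\Omega$ is a neighbourhood of $0$ in $\partial\mathbb R^n_+$ and that $\overline{\partial_+\Omega}$ is a compact submanifold with boundary of $\mathbb R^n$ of class $C^{1,\alpha}$. Hole: $\omega$ is a bounded open connected subset of $\mathbb R^n$ of class $C^{1,\alpha}$ with $0\in\omega$; $p=(p_1,\dots,p_n)\in\mathbb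 R^n_+$ is fixed. For $\boldsymbol\varepsilon=(\varepsilon_1,\varepsilon_2)\in\mathbb R^2$ let $\omega_{\boldsymbol\varepsilon}=\varepsilon_1p+\varepsilon_1\varepsilon_2\,\omega$. Inequalities between pairs are componentwise, $]\boldsymbol\varepsilon',\boldsymbol\varepsilon''[$ is the open rectangle of $\boldsymbol\varepsilon\in\mathbb R^2$ with $\boldsymbol\varepsilon'<\boldsymbol\varepsilon<\boldsymbol\varepsilon''$, and $\mathbf 0=(0,0)$. Fix $\boldsymbol\varepsilon^{\rm ad}\in\,]0,+\infty[^2$ with $\varepsilon^{\rm ad}_1<1<\varepsilon_2^{\rm ad}<1/\varepsilon_1^{\rm ad}$ such that $\overline{\omega_{\boldsymbol\varepsilon}}\subseteq\Omega$ for all $\boldsymbol\varepsilon\in\,]\mathbf 0,\boldsymbol\varepsilon^{\rm ad}[$; set $\Omega_{\boldsymbol\varepsilon}=\Omega\setminus\overline{\omega_{\boldsymbol\varepsilon}}$. Data: $g^{\mathrm o}\in C^{1,\alpha}(\partial\Omega)$, $g^{\mathrm i}\in C^{1,\alpha}(\partial\omega)$, and there is $r_0>0$ such that the restriction of $g^{\mathrm o}$ to $B(0,r_0)\cap\partial_0\Omega$ is real analytic. For $\boldsymbol\varepsilon\in\,]\mathbf 0,\boldsymbol\varepsilon^{\rm ad}[$, $u_{\boldsymbol\varepsilon}\in C^{1,\alpha}(\overline{\Omega_{\boldsymbol\varepsilon}})$ is the unique solution of $\Delta u=0$ in $\Omega_{\boldsymbol\varepsilon}$, $u=g^{\mathrm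 o}$ on $\partial\Omega$, $u(x)=g^{\mathrm i}\big(\frac{x-\varepsilon_1p}{\varepsilon_1\varepsilon_2}\big)$ for $x\in\partial\omega_{\boldsymbol\varepsilon}$. $u_0\in C^{1,\alpha}(\overline\Omega)$ is the unique solution of $\Delta u_0=0$ in $\Omega$, $u_0=g^{\mathrm o}$ on $\partial\Omega$. There are $r_1\in\,]0,r_0]$ with $B^+(0,r_1)\subseteq\Omega$ and a function $U_0$ on $\overline{B(0,r_1)}$, harmonic in $B(0,r_1)$, with $U_0=u_0$ on $\overline{B^+(0,r_1)}$; these are fixed and $\varepsilon_1^{\rm ad}$ is taken so small that $\varepsilon_1p+\varepsilon_1\varepsilon_2\overline\omega\subseteq B(0,r_1)$ for all $\boldsymbol\varepsilon\in\,]-\boldsymbol\varepsilon^{\rm ad},\boldsymbol\varepsilon^{\rm ad}[$. Real analytic maps between (open subsets of) Banach spaces are those locally given by convergent power series. *)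

(* Defs.v *)
From HB Require Import structures.
From mathcomp Require Import all_boot all_order all_algebra.
From mathcomp Require Import all_classical all_reals all_analysis.
Set Implicit Arguments. Unset Strict Implicit. Unset Printing Implicit Defensive.
Import Order.TTheory GRing.Theory Num.Theory.
Import numFieldNormedType.Exports.
Local Open Scope classical_set_scope.
Local Open Scope ring_scope.

(* R^n is the type 'rV[R]_n of row vectors; its topology is that of the
   library's sup norm, but balls and Hoelder conditions below use the Euclidean
   norm. *)

(* The library has no n-dimensional Lebesgue measure: equip row vectors with the
   product sigma-algebra (as the library does for tuples) and iterate the binary
   product measure along R^(n+1) = R * R^n. *)
Section rV_measurable.
Context {d : measure_display} {T : measurableType d}.
Variable n : nat.

Let coord : 'I_n -> 'rV[T]_n -> T := fun i x => x ord0 i.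

Let rV_set0 : g_sigma_preimage coord set0.
Proof. exact: sigma_algebra0. Qed.

Let rV_setC A : g_sigma_preimage coord A -> g_sigma_preimage coord (~` A).
Proof. exact: sigma_algebraC. Qed.

Let rV_bigcup (F : (set 'rV[T]_n)^nat) :
  (forall i, g_sigma_preimage coord (F i)) ->
  g_sigma_preimage coord (\bigcup_i F i).
Proof. exact: sigma_algebra_bigcup. Qed.

HB.instance Definition _ := @isMeasurable.Build (measure_tuple_display d)
  'rV[T]_n (g_sigma_preimage coord) rV_set0 rV_setC rV_bigcup.

Lemma measurable_coord (i : 'I_n) :
  measurable_fun [set: 'rV[T]_n] (fun x : 'rV[T]_n => x ord0 i).
Proof.
move=> _ Y mY; rewrite setTI; apply: sub_sigma_algebra.
rewrite (bigD1 i)//=; left; exists Y => //; exact: setTI.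
Qed.

Lemma measurable_to_rV (d' : measure_display) (S : measurableType d')
    (h : S -> 'rV[T]_n) :
  (forall i, measurable_fun [set: S] (fun t => h t ord0 i)) ->
  measurable_fun [set: S] h.
Proof.
move=> mh.
apply: (@measurability _ _ _ _ _ _
  (\big[setU/set0]_(i < n) preimage_set_system setT (coord i) measurable)) => //.
move=> _ [B + <-]; rewrite setTI.
elim/big_ind : _ => //.
- by move=> A C hA hC [/hA|/hC].
- by move=> i _ [Y mY <-]; rewrite setTI -[X in measurable X]setTI; exact: mh.
Qed.

End rV_measurable.

Section lebesgue_rV.
Context {R : realType}.
Notation mR := (measurableTypeR R).

Definition cons_rV n (z : mR * 'rV[mR]_n) : 'rV[mR]_n.+1 :=
  \row_i if unlift ord0 i is Some j then z.2 ord0 j else z.1.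

Definition uncons_rV n (x : 'rV[mR]_n.+1) : mR * 'rV[mR]_n :=
  (x ord0 ord0, \row_j x ord0 (lift ord0 j)).

Lemma measurable_cons_rV n : measurable_fun setT (@cons_rV n).
Proof.
apply: measurable_to_rV => i; rewrite /cons_rV.
case: (unliftP ord0 i) => [j ->|->].
- rewrite (_ : (fun _ => _) = (fun x : 'rV[mR]_n => x ord0 j) \o snd).
    by apply: measurableT_comp => //; exact: measurable_coord.
  by apply/funext => z; rewrite !mxE liftK.
- by rewrite (_ : (fun _ => _) = fst)//; apply/funext => z; rewrite !mxE unlift_none.
Qed.

Lemma measurable_uncons_rV n : measurable_fun setT (@uncons_rV n).
Proof.
apply/measurable_fun_pairP; split; first exact: measurable_coord.
apply: measurable_to_rV => i.
rewrite (_ : (fun _ => _) = fun x : 'rV[mR]_n.+1 => x ord0 (lift ord0 i)).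
  exact: measurable_coord.
by apply/funext => z; rewrite !mxE.
Qed.

Lemma cons_rVK n : cancel (@cons_rV n) (@uncons_rV n).
Proof.
move=> [t x]; congr pair; first by rewrite mxE unlift_none.
by apply/rowP => j; rewrite !mxE liftK.
Qed.

Lemma uncons_rVK n : cancel (@uncons_rV n) (@cons_rV n).
Proof.
move=> x; apply/rowP => i; rewrite !mxE.
by case: (unliftP ord0 i) => [j ->|->] //; rewrite mxE.
Qed.

Section step.
Variables (n : nat) (mu : {sigma_finite_measure set 'rV[mR]_n -> \bar R}).

Definition lebesgue_rV_step : set 'rV[mR]_n.+1 -> \bar R :=
  pushforward (lebesgue_measure \x mu)%E (@cons_rV n).

HB.instance Definition _ := Measure.copy lebesgue_rV_step
  (measure_function_pushforward__canonical__measure_function_Measure _ (@measurable_cons_rV n)).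

Let step_sigma_finite : sigma_finite setT lebesgue_rV_step.
Proof.
have /sigma_finiteP[F [TF ndF Foo]] := sigma_finiteT (@lebesgue_measure R).
have /sigma_finiteP[G [TG ndG Goo]] := sigma_finiteT mu.
pose H k : set (mR * 'rV[mR]_n) := F k `*` G k.
have HT : [set: mR * 'rV[mR]_n] = \bigcup_k H k.
  apply/esym; rewrite -subTset => -[x y] _.
  have [k _ Fkx] : (\bigcup_k F k) x by rewrite -TF.
  have [j _ Gjy] : (\bigcup_j G j) y by rewrite -TG.
  exists (maxn k j) => //; split.
  - by move: x Fkx; exact/subsetPset/ndF/leq_maxl.
  - by move: y Gjy; exact/subsetPset/ndG/leq_maxr.
exists (fun k => @uncons_rV n @^-1` H k).
  by rewrite -preimage_bigcup -HT preimage_setT.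
move=> k; have [mF Fk] := Foo k; have [mG Gk] := Goo k.
have mH : measurable (H k) by exact: measurableX.
split.
  by rewrite -[X in measurable X]setTI; exact: measurable_uncons_rV.
rewrite /lebesgue_rV_step /pushforward -comp_preimage.
rewrite (_ : _ \o _ = id); last by apply/funext => z /=; exact: cons_rVK.
by rewrite preimage_id product_measure1E// lte_mul_pinfty// ge0_fin_numE.
Qed.

HB.instance Definition _ := Measure_isSigmaFinite.Build _ _ _
  lebesgue_rV_step step_sigma_finite.

End step.

Fixpoint lebesgue_rV n : {sigma_finite_measure set 'rV[mR]_n -> \bar R} :=
  if n is n'.+1 then lebesgue_rV_step (lebesgue_rV n')
  else @dirac _ 'rV[mR]_0 (const_mx (0 : R)) R.

Lemma lebesgue_rV_box n (A : 'I_n -> set mR) :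
  (forall i, measurable (A i)) ->
  lebesgue_rV n [set x | forall i, A i (x ord0 i)]
  = (\prod_(i < n) lebesgue_measure (A i))%E.
Proof.
elim: n A => [|n IH] A mA.
  by rewrite big_ord0 /= diracE mem_set// => -[].
have mB : measurable [set x : 'rV[mR]_n | forall j, A (lift ord0 j) (x ord0 j)].
  rewrite (_ : mkset _ = \bigcap_(j in [set: 'I_n])
      ((fun x : 'rV[mR]_n => x ord0 j) @^-1` A (lift ord0 j))).
    apply: fin_bigcap_measurable => // j _.
    by rewrite -[X in measurable X]setTI; exact: measurable_coord.
  by apply/seteqP; split => [x Ax j _|x Ax j]; [exact: Ax|exact: Ax].
rewrite big_ord_recl -(IH (fun j => A (lift ord0 j)))// -product_measure1E//.
rewrite [LHS]/= /lebesgue_rV_step /pushforward; congr (_ _).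
apply/seteqP; split => [[t x] /= Atx|[t x] /= [At Ax] i].
  split; first by have := Atx ord0; rewrite mxE unlift_none.
  by move=> j; have := Atx (lift ord0 j); rewrite mxE liftK.
by rewrite mxE; case: (unliftP ord0 i) => [j ->|->].
Qed.

End lebesgue_rV.

Section analysis_in_Rn.
Context {R : realType}.

Definition enorm n (x : 'rV[R]_n) : R := Num.sqrt (\sum_i x ord0 i ^+ 2).

Definition eball n (c : 'rV[R]_n) (r : R) : set 'rV[R]_n :=
  [set x | enorm (x - c) < r].

Definition boundary (T : topologicalType) (A : set T) : set T :=
  closure A `\` interior A.

(* The upper half-space R^n_+ for n = m.+1; its boundary is { x_n = 0 }. *)
Definition halfspace m : set 'rV[R]_m.+1 := [set x | 0 < x ord0 ord_max].
Arguments halfspace : clear implicits.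

(* y in R^m |-> (y, 0) in R^m.+1, identifying R^m with the boundary of the
   half-space. *)
Definition flat m (y : 'rV[R]_m) : 'rV[R]_m.+1 :=
  \row_i if unlift ord_max i is Some j then y ord0 j else 0.

Definition partial n (i : 'I_n) (f : 'rV[R]_n -> R) : 'rV[R]_n -> R :=
  fun x => 'D_(delta_mx ord0 i) f x.

Definition gradsq n (f : 'rV[R]_n -> R) (x : 'rV[R]_n) : R :=
  \sum_i partial i f x ^+ 2.

Definition laplacian n (f : 'rV[R]_n -> R) (x : 'rV[R]_n) : R :=
  \sum_i partial i (partial i f) x.

(* f is of class C^k in the open set U. *)
Fixpoint class_C (k n : nat) (U : set 'rV[R]_n) (f : 'rV[R]_n -> R) : Prop :=
  (forall x, U x -> {for x, continuous f}) /\
  (if k is k'.+1 then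
     forall i, (forall x, U x -> derivable f x (delta_mx ord0 i)) /\
               class_C k' U (partial i f)
   else True).

Definition harmonic_on n (U : set 'rV[R]_n) (f : 'rV[R]_n -> R) : Prop :=
  class_C 2 U f /\ forall x, U x -> laplacian f x = 0.

Definition energy n (D : set 'rV[R]_n) (f : 'rV[R]_n -> R) : \bar R :=
  (\int[lebesgue_rV n]_(x in D) (gradsq f x)%:E)%E.

Definition holder n (alpha : R) (A : set 'rV[R]_n) (f : 'rV[R]_n -> R) : Prop :=
  exists C : R, forall x y, A x -> A y ->
    `|f x - f y| <= C * enorm (x - y) `^ alpha.

Definition loc_holder n (alpha : R) (A : set 'rV[R]_n) (f : 'rV[R]_n -> R) :=
  forall K, compact K -> K `<=` A -> holder alpha K f.

(* The Schauder classes C^{1,alpha}(U) and C^{1,alpha}(closure U) of an open set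
   U, as in Gilbarg-Trudinger: first derivatives locally Hoelder in U,
   respectively extending to Hoelder functions on the closure. *)
Definition C1a_open n (alpha : R) (U : set 'rV[R]_n) (f : 'rV[R]_n -> R) :=
  class_C 1 U f /\ forall i, loc_holder alpha U (partial i f).

Definition C1a_closure n (alpha : R) (U : set 'rV[R]_n) (f : 'rV[R]_n -> R) :=
  [/\ class_C 1 U f, {within closure U, continuous f} &
      forall i, exists g : 'rV[R]_n -> R,
        holder alpha (closure U) g /\ forall x, U x -> g x = partial i f x].

Definition C1a_map n (alpha : R) (U : set 'rV[R]_n) (f : 'rV[R]_n -> 'rV[R]_n) :=
  forall i, C1a_open alpha U (fun x => f x ord0 i).

(* psi is a C^{1,alpha} diffeomorphism of B onto D with inverse phi. *)
Definition C1a_diffeo n (alpha : R) (B D : set 'rV[R]_n)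
    (psi phi : 'rV[R]_n -> 'rV[R]_n) : Prop :=
  [/\ open B /\ open D, psi @` B = D, {in B, cancel psi phi},
      C1a_map alpha B psi & C1a_map alpha D phi].

(* psi flattens the boundary of Om near x0 (Gilbarg-Trudinger, Section 6.2). *)
Definition boundary_chart m (alpha : R) (Om : set 'rV[R]_m.+1)
    (x0 : 'rV[R]_m.+1) (r : R) (psi phi : 'rV[R]_m.+1 -> 'rV[R]_m.+1) : Prop :=
  [/\ 0 < r, C1a_diffeo alpha (eball x0 r) (psi @` eball x0 r) psi phi,
      psi @` (eball x0 r `&` Om) `<=` halfspace m &
      psi @` (eball x0 r `&` boundary Om) `<=` boundary (halfspace m)].

Definition C1a_set m (alpha : R) (Om : set 'rV[R]_m.+1) : Prop :=
  forall x0, boundary Om x0 ->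
    exists r psi phi, boundary_chart alpha Om x0 r psi phi.

(* f is in C^{1,alpha}(boundary Om): locally, f read in a flattening chart is a
   C^{1,alpha} function of m variables. *)
Definition C1a_boundary m (alpha : R) (Om : set 'rV[R]_m.+1)
    (f : 'rV[R]_m.+1 -> R) : Prop :=
  forall x0, boundary Om x0 -> exists r psi phi,
    boundary_chart alpha Om x0 r psi phi /\
    C1a_open alpha (@flat m @^-1` (psi @` (eball x0 r `&` boundary Om)))
                   (fun y => f (phi (flat y))).

(* M is an embedded hypersurface with boundary, of class C^{1,alpha}: near each
   of its points M is, up to an ambient diffeomorphism, the hyperplane
   { y_n = 0 } or its half { y_n = 0, y_1 >= 0 }. *)
Definition C1a_hypersurface_with_boundary m (alpha : R)
    (M : set 'rV[R]_m.+1) : Prop :=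
  forall x0, M x0 -> exists B D psi phi,
    [/\ B x0, C1a_diffeo alpha B D psi phi &
        psi @` (B `&` M) = D `&` [set y | y ord0 ord_max = 0] \/
        psi @` (B `&` M) =
          D `&` [set y | y ord0 ord_max = 0 /\ 0 <= y ord0 ord0]].

(* The degree k part, at x, of the power series with coefficients c. *)
Definition homog_part n (c : {ffun 'I_n -> nat} -> R) (k : nat)
    (x : 'rV[R]_n) : R :=
  \sum_(nu : {ffun 'I_n -> 'I_k.+1} | (\sum_i nu i)%N == k)
     c [ffun i => nat_of_ord (nu i)] * \prod_i x ord0 i ^+ nu i.

(* Real analyticity on a set A: around each point of A, f agrees on A with the
   sum of an absolutely convergent power series. *)
Definition real_analytic_on n (A : set 'rV[R]_n) (f : 'rV[R]_n -> R) : Prop :=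
  forall a, A a -> exists (c : {ffun 'I_n -> nat} -> R) (delta : R),
    0 < delta /\
    forall x, enorm (x - a) < delta ->
      cvgn (series (fun k =>
        homog_part (fun nu => `|c nu|) k (\row_i `|(x - a) ord0 i|))) /\
      (A x -> series (fun k => homog_part c k (x - a)) @ \oo --> f x).

Definition rect n (a b : 'rV[R]_n) : set 'rV[R]_n :=
  [set x | forall i, a ord0 i < x ord0 i < b ord0 i].

Definition eps1 (e : 'rV[R]_2) : R := e ord0 ord0.
Definition eps2 (e : 'rV[R]_2) : R := e ord0 ord_max.

(* eps1 p + eps1 eps2 om *)
Definition hole n (p : 'rV[R]_n) (om : set 'rV[R]_n) (e : 'rV[R]_2) :=
  [set eps1 e *: p + (eps1 e * eps2 e) *: x | x in om].

Definition perforated n (Om : set 'rV[R]_n) (p : 'rV[R]_n) (om : set 'rV[R]_n)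
    (e : 'rV[R]_2) : set 'rV[R]_n :=
  Om `\` closure (hole p om e).

Definition boundary0 m (Om : set 'rV[R]_m.+1) : set 'rV[R]_m.+1 :=
  boundary Om `&` boundary (halfspace m).

Definition boundary_plus m (Om : set 'rV[R]_m.+1) : set 'rV[R]_m.+1 :=
  boundary Om `&` halfspace m.

End analysis_in_Rn.
Arguments halfspace {R} m.

(* Main.v *)
(* The perturbation v = u_e - u_0 is governed by two of its traces: its values on a fixed annulus
   around 0, and the values of the rescaled function t |-> v(e1 p + e1 e2 t) on a fixed annulus
   around the hole. Green's representation in the half-space expresses each trace by both, through
   commutators of the Laplacian with radial cutoffs; Riesz representation in the Dirichlet space
   turns these into bilinear pairings which do not depend on e and which, by Hardy's inequality, are
   bounded for the sup norms on the annuli. The traces thus solve a 2 x 2 linear system whose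
   kernels are values of the Green function. As the fundamental solution is homogeneous of degree
   2 - n, the factor (e1 e2)^(n-2) makes these kernels convergent power series in (e1, e2) near
   (0, 0), and they are small for a good choice of the annuli: the Neumann series then yields the
   traces analytically in e. By Green's identities, the energy is that of u_0 plus (e1 e2)^(n-2)
   times an expression in these traces. Integration by parts
   is applied to functions truncated near the value 0, which makes them vanish near the boundary. *)
Require Import Defs.
From HB Require Import structures.
From mathcomp Require Import all_boot all_order all_algebra.
From mathcomp Require Import all_classical all_reals all_analysis.
From mathcomp Require Import measurable_realfun.
From mathcomp Require Import ring lra.
Set Implicit Arguments.
Unset Strict Implicit.
Unset Printing Implicit Defensive.
Import Order.TTheory GRing.Theory Num.Theory.
Import numFieldNormedType.Exports.
Local Open Scope classical_set_scope.
Local Open Scope ring_scope.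

(** * Integrals of bounded measurable functions *)

Section bounded_measurable.
Context {d : measure_display} {T : measurableType d} {R : realType}.
Variable mu : {measure set T -> \bar R}.
Implicit Types (D E : set T) (f g h : T -> R).

(** The smallness is a matter of scaling. A commutator functional on the annulus of radius t has
    norm of order t^((n-2)/2), while the kernel |x|^(2-n) is of order la^(2-n) on the inner annulus
    [ann la]: a large la makes the inner diagonal block small. The outer form carries mu^((n-2)/2)
    and its kernel stays bounded, tau being fixed: a small mu settles that column. What is left
    carries a power of the bound r on the parameters, chosen last. The datum on the hole comes
    without a harmonic extension. The rescaled solution at one fixed parameter (s, s) serves as
    such, because all rescaled solutions share their boundary values on the hole; it is the function
    G. From the Schauder classes the argument draws bounds on the solutions and their gradients, and
    continuity up to the boundary. The space of test functions is not completed: Riesz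
    representatives are approximate minimizers, and pairings are limits along them. A formula found
    for positive parameters continues to both signs because u_0 is harmonic across the flat boundary
    near 0 and because every series is bounded in terms of |e_1| and |e_2| alone. *)

Definition fin_meas D : Prop := measurable D /\ (mu D < +oo)%E.

(** On a set of finite measure these functions form an algebra of integrable functions, so that
    integrability conditions reduce to closure lemmas; bounded solutions with bounded gradients stay
    inside it. *)
Definition bmf D f : Prop :=
  measurable_fun D f /\ exists M : R, forall x, D x -> `|f x| <= M.

Definition vol D : R := fine (mu D).

Lemma vol_ge0 D : 0 <= vol D.
Proof. exact: fine_ge0. Qed.

Lemma le_vol D E : fin_meas D -> fin_meas E -> D `<=` E -> vol D <= vol E.
Proof.
move=> [mD fD] [mE fE] DE; rewrite /vol fine_le ?ge0_fin_numE//.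
by apply: le_measure; rewrite ?inE.
Qed.

Lemma fin_measS D E : measurable D -> fin_meas E -> D `<=` E -> fin_meas D.
Proof.
move=> mD [mE fE] DE; split => //; apply: le_lt_trans fE.
by apply: le_measure; rewrite ?inE.
Qed.

Lemma bmf_cst D (c : R) : bmf D (fun=> c).
Proof. by split; [exact: measurable_cst | exists `|c|]. Qed.

Lemma bmfD D f g : bmf D f -> bmf D g -> bmf D (fun x => f x + g x).
Proof.
move=> [mf [M fM]] [mg [N gN]]; split; first exact: measurable_funD.
by exists (M + N) => x Dx; rewrite (le_trans (ler_normD _ _))// lerD ?fM ?gN.
Qed.

Lemma bmfN D f : bmf D f -> bmf D (fun x => - f x).
Proof.
move=> [mf [M fM]]; split; last by exists M => x Dx; rewrite normrN fM.
exact: measurableT_comp.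
Qed.

Lemma bmfB D f g : bmf D f -> bmf D g -> bmf D (fun x => f x - g x).
Proof. by move=> bf bg; apply: bmfD => //; exact: bmfN. Qed.

Lemma bmfM D f g : bmf D f -> bmf D g -> bmf D (fun x => f x * g x).
Proof.
move=> [mf [M fM]] [mg [N gN]]; split; first exact: measurable_funM.
by exists (M * N) => x Dx; rewrite normrM ler_pM ?fM ?gN.
Qed.

Lemma bmfZ D (c : R) f : bmf D f -> bmf D (fun x => c * f x).
Proof. by move=> bf; apply: bmfM => //; exact: bmf_cst. Qed.

Lemma bmfX D f (k : nat) : bmf D f -> bmf D (fun x => f x ^+ k).
Proof.
move=> bf; elim: k => [|k IH].
  by under eq_fun do rewrite expr0; exact: bmf_cst.
by under eq_fun do rewrite exprS; exact: bmfM.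
Qed.

Lemma bmf_norm D f : bmf D f -> bmf D (fun x => `|f x|).
Proof.
move=> [mf [M fM]]; split; first exact: measurableT_comp.
by exists M => x Dx; rewrite normr_id fM.
Qed.

Lemma bmf_sum D (I : Type) (r : seq I) (P : pred I) (F : I -> T -> R) :
  (forall i, bmf D (F i)) -> bmf D (fun x => \sum_(i <- r | P i) F i x).
Proof.
move=> bF; elim: r => [|i r IH].
  by under eq_fun do rewrite big_nil; exact: bmf_cst.
under eq_fun do rewrite big_cons.
by case: (P i) => //; exact: bmfD.
Qed.

Lemma bmfS D E f : measurable E -> D `<=` E -> measurable D -> bmf E f -> bmf D f.
Proof.
move=> mE DE mD [mf [M fM]]; split; first exact: measurable_funS mf.
by exists M => x /DE; exact: fM.
Qed.

Lemma eq_bmf D f g : (forall x, D x -> f x = g x) -> bmf D f -> bmf D g.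
Proof.
move=> fg [mf [M fM]]; split.
  by apply: eq_measurable_fun mf => x; rewrite inE => /fg.
by exists M => x Dx; rewrite -fg// fM.
Qed.

Lemma bmf_ext0 D E f : measurable E -> measurable D -> D `<=` E -> bmf D f ->
  (forall x, E x -> ~ D x -> f x = 0) -> bmf E f.
Proof.
move=> mE mD DE [mf [M fM]] f0; split.
  have -> : E = D `|` (E `\` D).
    by apply/seteqP; split => x; [move=> Ex; have [|] := pselect (D x); [left|right]|
      case=> [/DE|[]]].
  apply/measurable_funU => //; first exact: measurableD.
  split => //; apply: (@eq_measurable_fun _ _ _ _ _ (fun=> 0 : R)).
    by move=> x; rewrite inE => -[Ex nDx]; rewrite f0.
  exact: measurable_cst.
exists (Num.max M 0) => x Ex; have [Dx|nDx] := pselect (D x).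
  by rewrite le_max fM.
by rewrite f0// normr0 le_max lexx orbT.
Qed.

Lemma bmf_integrable D f : fin_meas D -> bmf D f -> mu.-integrable D (EFin \o f).
Proof.
move=> [mD fD] [mf [M fM]]; apply: measurable_bounded_integrable => //.
exists M; split; first exact: num_real.
by move=> y My x /= Dx; rewrite (le_trans (fM _ Dx))// ltW.
Qed.

Definition int D f : R := \int[mu]_(x in D) f x.

Lemma intE D f : fin_meas D -> bmf D f ->
  (\int[mu]_(x in D) (f x)%:E)%E = (int D f)%:E.
Proof.
move=> mD bf; rewrite /int /Rintegral fineK//.
exact: (integrable_fin_num mD.1 (bmf_integrable mD bf)).
Qed.

Lemma eq_int D f g : (forall x, D x -> f x = g x) -> int D f = int D g.
Proof. by move=> fg; apply: eq_Rintegral => x; rewrite inE => /fg. Qed.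

Lemma intD D f g : fin_meas D -> bmf D f -> bmf D g ->
  int D (fun x => f x + g x) = int D f + int D g.
Proof. by move=> mD bf bg; apply: RintegralD; [case: mD|exact: bmf_integrable..]. Qed.

Lemma intB D f g : fin_meas D -> bmf D f -> bmf D g ->
  int D (fun x => f x - g x) = int D f - int D g.
Proof. by move=> mD bf bg; apply: RintegralB; [case: mD|exact: bmf_integrable..]. Qed.

Lemma intZ D (c : R) f : fin_meas D -> bmf D f ->
  int D (fun x => c * f x) = c * int D f.
Proof. by move=> mD bf; apply: RintegralZl; [case: mD|exact: bmf_integrable]. Qed.

Lemma int0 D : int D (fun=> 0) = 0.
Proof. by rewrite /int /Rintegral integral0. Qed.

Lemma intN D f : fin_meas D -> bmf D f -> int D (fun x => - f x) = - int D f.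
Proof.
by move=> mD bf; under eq_int do rewrite -mulN1r; rewrite intZ// mulN1r.
Qed.

Lemma int_cst D (c : R) : fin_meas D -> int D (fun=> c) = c * vol D.
Proof. by move=> [mD _]; exact: Rintegral_cst. Qed.

Lemma int_sum D (I : Type) (r : seq I) (P : pred I) (F : I -> T -> R) :
  fin_meas D -> (forall i, bmf D (F i)) ->
  int D (fun x => \sum_(i <- r | P i) F i x) = \sum_(i <- r | P i) int D (F i).
Proof.
move=> mD bF; elim: r => [|i r IH].
  by under eq_int do rewrite big_nil; rewrite int0 big_nil.
under eq_int do rewrite big_cons; rewrite big_cons; case: (P i) => //.
by rewrite intD ?IH//; exact: bmf_sum.
Qed.

Lemma int_ge0 D f : (forall x, D x -> 0 <= f x) -> 0 <= int D f.
Proof. exact: Rintegral_ge0. Qed.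

Lemma le_int D f g : fin_meas D -> bmf D f -> bmf D g ->
  (forall x, D x -> f x <= g x) -> int D f <= int D g.
Proof. by move=> mD bf bg; apply: le_Rintegral; [case: mD|exact: bmf_integrable..]. Qed.

Lemma le_abs_int D f : fin_meas D -> bmf D f -> `|int D f| <= int D (fun x => `|f x|).
Proof. by move=> mD bf; apply: le_normr_Rintegral; [case: mD|exact: bmf_integrable]. Qed.

Lemma abs_int_le D f (M : R) : fin_meas D -> bmf D f ->
  (forall x, D x -> `|f x| <= M) -> `|int D f| <= M * vol D.
Proof.
move=> mD bf fM; rewrite (le_trans (le_abs_int _ _))// -int_cst//.
by apply: le_int => //; [exact: bmf_norm|exact: bmf_cst].
Qed.

Lemma int_setU D E f : measurable D -> measurable E ->
  fin_meas (D `|` E) -> bmf (D `|` E) f -> (forall x, D x -> ~ E x) ->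
  int (D `|` E) f = int D f + int E f.
Proof.
move=> mD mE mDE bf DE; apply: Rintegral_setU => //; first exact: bmf_integrable.
by apply/disj_setPS => x [/= /DE].
Qed.

Lemma int_sub D E f : fin_meas E -> measurable D -> D `<=` E -> bmf E f ->
  int E f = int D f + int (E `\` D) f.
Proof.
move=> mE mD DE bf.
have ED : E = D `|` (E `\` D).
  by apply/seteqP; split => x; [move=> Ex; have [|] := pselect (D x); [left|right]|
    case=> [/DE|[]]].
rewrite {1}ED int_setU -?ED//; first by apply: measurableD => //; case: mE.
by move=> x Dx [].
Qed.

Lemma int_restrict D E f : fin_meas E -> measurable D -> D `<=` E -> bmf E f ->
  (forall x, E x -> ~ D x -> f x = 0) -> int E f = int D f.
Proof.
move=> mE mD DE bf f0; rewrite (int_sub mE mD DE bf) [X in _ + X](_ : _ = 0) ?addr0//.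
by rewrite -(int0 (E `\` D)); apply: eq_int => x [Ex nDx]; exact: f0.
Qed.

Lemma le_int_set D E f : fin_meas E -> measurable D -> D `<=` E -> bmf E f ->
  (forall x, E x -> 0 <= f x) -> int D f <= int E f.
Proof.
move=> mE mD DE bf f0; rewrite (int_sub mE mD DE bf) lerDl int_ge0// => x [Ex _].
exact: f0.
Qed.

Lemma int_cauchy_schwarz D f g : fin_meas D -> bmf D f -> bmf D g ->
  int D (fun x => f x * g x) ^+ 2 <=
  int D (fun x => f x ^+ 2) * int D (fun x => g x ^+ 2).
Proof.
move=> mD bf bg.
set A := int D (fun x => f x ^+ 2); set B := int D (fun x => g x ^+ 2).
set C := int D _.
have bff := bmfX 2 bf; have bgg := bmfX 2 bg; have bfg := bmfM bf bg.
have A0 : 0 <= A by apply: int_ge0 => x _; rewrite sqr_ge0.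
have B0 : 0 <= B by apply: int_ge0 => x _; rewrite sqr_ge0.
have pos t : 0 <= A * t ^+ 2 + 2 * C * t + B.
  have -> : A * t ^+ 2 + 2 * C * t + B = int D (fun x => (t * f x + g x) ^+ 2).
    have E x : (t * f x + g x) ^+ 2 = t ^+ 2 * f x ^+ 2 + (2 * t) * (f x * g x)
      + g x ^+ 2 by ring.
    under eq_int do rewrite E.
    rewrite intD// ?intD//; [|exact: bmfZ..|by apply: bmfD; exact: bmfZ].
    by rewrite !intZ// -/A -/B -/C; ring.
  by apply: int_ge0 => x _; rewrite sqr_ge0.
have [A0'|A0'] := eqVneq A 0.
  have C0 : C = 0.
    apply/eqP/negP => /negP C0.
    (* If [A] is 0 and [C] is not, the affine function takes the value -1 at this point. *)
    have := pos (- (B + 1) / (2 * C)); rewrite A0' mul0r add0r mulrCA mulfV ?mulr1 ?mulf_neq0//.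
    by lra.
  by rewrite C0 A0' mul0r expr0n.
have Ap : 0 < A by rewrite lt_neqAle eq_sym A0' A0.
have := pos (- C / A).
rewrite (_ : _ + B = (A * B - C ^+ 2) / A); last by field.
by rewrite pmulr_lge0 ?invr_gt0// subr_ge0.
Qed.

(** Convergence is asked almost everywhere only, because the gradient of a function is controlled on
    its zero set up to a null set. *)
Lemma int_dct D (F : nat -> T -> R) f (M : R) : fin_meas D ->
  (forall k, measurable_fun D (F k)) -> measurable_fun D f ->
  (forall k x, D x -> `|F k x| <= M) ->
  {ae mu, forall x, D x -> F k x @[k --> \oo] --> f x} ->
  int D (F k) @[k --> \oo] --> int D f.
Proof.
move=> mD mF mf FM Ff; have [mD1 fD] := mD.
have iM : mu.-integrable D (EFin \o (fun=> M)).
  by apply: bmf_integrable => //; exact: bmf_cst.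
have [] := @dominated_convergence _ _ _ mu D mD1 (fun k => EFin \o F k)
  (EFin \o f) (EFin \o (fun=> M)).
- by move=> k; exact/measurable_EFinP.
- exact/measurable_EFinP.
- move: Ff; apply: filterS => x h /h.
  by move=> h2; apply: cvg_comp h2 _; exact: cvg_refl.
- exact: iM.
- by apply: aeW => x k Dx; rewrite lee_fin FM.
move=> intf _ cv.
apply: fine_cvg => //=.
rewrite /int /Rintegral fineK//.
exact: integrable_fin_num.
Qed.

End bounded_measurable.

(** * Borel sets and iterated integrals on row vectors *)

Section borel_rV.
Context {R : realType}.
Notation mR := (measurableTypeR R).

Lemma rV_norm_lt n (x : 'rV[R]_n) (e : R) : 0 < e ->
  (forall i, `|x ord0 i| < e) -> `|x| < e.
Proof.
move=> e0 xe; rewrite [ltLHS]mx_normrE; apply: bigmax_lt => // -[i j] _ /=.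
by have -> : i = ord0 by exact: ord1.
Qed.

Lemma le_coord_norm n (x : 'rV[R]_n) i : `|x ord0 i| <= `|x|.
Proof.
rewrite [leRHS]mx_normrE.
exact: (le_bigmax _ (fun ij : 'I_1 * 'I_n => `|x ij.1 ij.2|) (ord0, i)).
Qed.

(** The sigma-algebra is generated by the coordinates, the topology by the sup norm; they meet
    because an open set is a countable union of boxes with rational centres and radii 1/(k+1). *)
Lemma open_measurable_rV n (U : set 'rV[R]_n) : open U ->
  measurable (U : set 'rV[mR]_n).
Proof.
move=> oU.
pose box (z : 'rV[rat]_n * nat) : set 'rV[mR]_n :=
  [set x : 'rV[R]_n | forall i, x ord0 i \in `]ratr (z.1 ord0 i) - z.2.+1%:R^-1,
                                   ratr (z.1 ord0 i) + z.2.+1%:R^-1[].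
have mbox z : measurable (box z).
  rewrite (_ : box z = \bigcap_(i in [set: 'I_n])
    ((fun x : 'rV[mR]_n => x ord0 i) @^-1`
       [set` `]ratr (z.1 ord0 i) - z.2.+1%:R^-1, ratr (z.1 ord0 i) + z.2.+1%:R^-1[])).
    apply: fin_bigcap_measurable => // i _.
    by rewrite -[X in measurable X]setTI; exact: measurable_coord.
  by apply/seteqP; split => [x bx i _|x bx i]; exact: bx.
(* Pairs of a centre and a radius index are enumerated by [unpickle]; a box that leaves [U], or an
   index coding nothing, contributes the empty set. *)
pose F (k : nat) : set 'rV[mR]_n :=
  if unpickle k is Some z then if pselect (box z `<=` U) then box z else set0
  else set0.
rewrite (_ : U = \bigcup_k F k).
  apply: bigcupT_measurable => k; rewrite /F; case: unpickle => // z.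
  by case: pselect => H /=; [exact: mbox|exact: measurable0].
apply/seteqP; split => [x Ux|x [k _]]; last first.
  by rewrite /F; case: unpickle => // z; case: pselect => // h; exact: h.
have /nbhs_ballP[e /= e0 eU] := oU _ Ux.
have [N _ hN] := near_infty_natSinv_lt (PosNum (divr_gt0 e0 (ltr0Sn R 1))).
have {}hN : N.+1%:R^-1 < e / 2 by apply: (hN N) => /=.
have q_ex i : exists q : rat, x ord0 i - N.+1%:R^-1 < ratr q < x ord0 i + N.+1%:R^-1.
  have : x ord0 i - N.+1%:R^-1 < x ord0 i + N.+1%:R^-1.
    by rewrite ltrD2l (@lt_trans _ _ 0)// ?oppr_lt0 invr_gt0.
  by move/rat_in_itvoo => [q]; rewrite in_itv/= => h; exists q.
pose q : 'rV[rat]_n := \row_i xget 0 [set q | x ord0 i - N.+1%:R^-1 < ratr q < x ord0 i + N.+1%:R^-1].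
have qP i : x ord0 i - N.+1%:R^-1 < ratr (q ord0 i) < x ord0 i + N.+1%:R^-1.
  rewrite mxE; case: xgetP => [y _ h|h]; first exact: h.
  by have [y hy] := q_ex i; case: (h y).
have bU : box (q, N) `<=` U.
  move=> y by_; apply: eU; rewrite -ball_normE /=.
  apply: rV_norm_lt => // j; rewrite !mxE; have := qP j; have := by_ j.
  rewrite in_itv/=; move: (y ord0 j) (x ord0 j) (ratr _) (N.+1%:R^-1) hN => b a c' r.
  by move=> hr /andP[? ?] /andP[? ?]; rewrite ltr_norml; apply/andP; split; lra.
exists (pickle (q, N)) => //; rewrite /F pickleK; case: pselect => // _ i.
rewrite in_itv/=; have := qP i; move: (x ord0 i) (ratr _) (N.+1%:R^-1) => a c r.
by move=> /andP[? ?]; apply/andP; split; lra.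
Qed.

Lemma closed_measurable_rV n (U : set 'rV[R]_n) : closed U ->
  measurable (U : set 'rV[mR]_n).
Proof.
by move=> cU; rewrite -(setCK U); apply: measurableC; apply: open_measurable_rV;
  exact: closed_openC.
Qed.

Lemma continuous_measurable_rV n (U : set 'rV[R]_n) (f : 'rV[R]_n -> R) :
  open U -> (forall x, U x -> {for x, continuous f}) ->
  measurable_fun (U : set 'rV[mR]_n) f.
Proof.
move=> oU cf; apply: (measurability _ (RGenOInfty.measurableE R)).
move=> _ [_ [a ->]] <-; apply: open_measurable_rV.
rewrite openE => x [Ux fx]; rewrite /interior.
apply: filterI; first exact: open_nbhs_nbhs.
by apply: (cf _ Ux); apply: open_nbhs_nbhs; split.
Qed.

Lemma measurable_cons_l n (t : mR) : measurable_fun setT (fun y : 'rV[mR]_n => cons_rV (t, y)).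
Proof. exact: (measurableT_comp (@measurable_cons_rV R n) (pair1_measurable t)). Qed.

Lemma measurable_cons_r n (y : 'rV[mR]_n) : measurable_fun setT (fun t : mR => cons_rV (t, y)).
Proof. exact: (measurableT_comp (@measurable_cons_rV R n) (pair2_measurable y)). Qed.

Section iterated.
Variable n : nat.
Implicit Type f : 'rV[mR]_n.+1 -> \bar R.

Lemma tonelli_rV1 f : measurable_fun setT f -> (forall x, (0 <= f x)%E) ->
  (\int[lebesgue_rV n.+1]_x f x =
   \int[lebesgue_measure]_t \int[lebesgue_rV n]_y f (cons_rV (t, y)))%E.
Proof.
move=> mf f0; have mg : measurable_fun setT (f \o @cons_rV R n).
  exact: (measurableT_comp mf (@measurable_cons_rV R n)).
transitivity (\int[(lebesgue_measure \x lebesgue_rV n)%E]_z (f \o @cons_rV R n) z)%E.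
  exact: (ge0_integral_pushforward (@measurable_cons_rV R n) _ measurableT mf).
exact: (fubini_tonelli1 (f \o @cons_rV R n) mg (fun=> f0 _)).
Qed.

Lemma tonelli_rV2 f : measurable_fun setT f -> (forall x, (0 <= f x)%E) ->
  (\int[lebesgue_rV n.+1]_x f x =
   \int[lebesgue_rV n]_y \int[lebesgue_measure]_t f (cons_rV (t, y)))%E.
Proof.
move=> mf f0; have mg : measurable_fun setT (f \o @cons_rV R n).
  exact: (measurableT_comp mf (@measurable_cons_rV R n)).
transitivity (\int[(lebesgue_measure \x lebesgue_rV n)%E]_z (f \o @cons_rV R n) z)%E.
  exact: (ge0_integral_pushforward (@measurable_cons_rV R n) _ measurableT mf).
exact: (fubini_tonelli2 (f \o @cons_rV R n) mg (fun=> f0 _)).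
Qed.

Lemma integrable_cons f : (lebesgue_rV n.+1).-integrable setT f ->
  (lebesgue_measure \x lebesgue_rV n)%E.-integrable setT (f \o @cons_rV R n).
Proof.
move=> /integrableP[mf fi]; apply/integrableP; split.
  exact: (measurableT_comp mf (@measurable_cons_rV R n)).
move: fi; congr (_ < _)%E.
apply: (ge0_integral_pushforward (@measurable_cons_rV R n) _ measurableT
  (f := fun x => `|f x|%E)) => //.
exact: measurableT_comp.
Qed.

Lemma fubini_rV1 f : (lebesgue_rV n.+1).-integrable setT f ->
  (\int[lebesgue_rV n.+1]_x f x =
   \int[lebesgue_measure]_t \int[lebesgue_rV n]_y f (cons_rV (t, y)))%E.
Proof.
move=> fi; have gi := integrable_cons fi.
rewrite (integral12_prod_meas1 gi).
have [mf _] := integrableP _ _ _ fi.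
exact: (integral_pushforward (@measurable_cons_rV R n) mf _ measurableT).
Qed.

Lemma fubini_rV2 f : (lebesgue_rV n.+1).-integrable setT f ->
  (\int[lebesgue_rV n.+1]_x f x =
   \int[lebesgue_rV n]_y \int[lebesgue_measure]_t f (cons_rV (t, y)))%E.
Proof.
move=> fi; have gi := integrable_cons fi.
rewrite (integral21_prod_meas1 gi).
have [mf _] := integrableP _ _ _ fi.
exact: (integral_pushforward (@measurable_cons_rV R n) mf _ measurableT).
Qed.

End iterated.

(** The measure s times the image of Lebesgue measure under t |-> a + s t agrees with Lebesgue
    measure on half-open intervals, which determine it. *)
Lemma lebesgue_scale (s a : R) (f : mR -> \bar R) : 0 < s -> measurable_fun setT f ->
  (forall x, (0 <= f x)%E) ->
  (\int[lebesgue_measure]_x f x =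
   s%:E * \int[lebesgue_measure]_t f (a + s * t)%R)%E.
Proof.
move=> s0 mf f0.
pose phi : mR -> mR := fun t => a + s * t.
have mphi : measurable_fun setT phi.
  exact: measurable_realfun.measurable_funD.
pose nu : measure mR R :=
  measure_function_pushforward__canonical__measure_function_Measure lebesgue_measure mphi.
pose m : measure mR R := mscale (NngNum (ltW s0)) nu.
transitivity (\int[m]_x f x)%E.
  apply: eq_measure_integral => A mA _.
  apply: lebesgue_measure_unique => // X [[u v] /= uv <-].
  rewrite /m /= /mscale /= /pushforward.
  rewrite (_ : phi @^-1` _ = `](u - a) / s, (v - a) / s]%classic); last first.
    apply/seteqP; split => t /=; rewrite !in_itv/= /phi ltr_pdivrMr// ler_pdivlMr//;
      rewrite ltrBlDl lerBrDl mulrC//.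
  rewrite lebesgue_measure_itv/= lebesgue_measure_itv/= !lte_fin ltr_pM2r ?invr_gt0// ltrD2r.
  case: ifP => _; last by rewrite mule0.
  by rewrite -!EFinD -EFinM; congr (_%:E); field; exact: lt0r_neq0.
rewrite ge0_integral_mscale// /=.
congr (_ * _)%E.
exact: (ge0_integral_pushforward mphi _ measurableT).
Qed.

Lemma measurable_affine n (a : 'rV[R]_n) (s : R) :
  measurable_fun setT (fun x : 'rV[mR]_n => (a + s *: x : 'rV[mR]_n)).
Proof.
apply: measurable_to_rV => i.
rewrite (_ : (fun _ => _) = fun x : 'rV[mR]_n => a ord0 i + s * x ord0 i).
  apply: measurable_realfun.measurable_funD => //.
  apply: measurable_realfun.measurable_funM => //; exact: measurable_coord.
by apply/funext => x; rewrite !mxE.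
Qed.

(** Induction on the dimension: [lebesgue_scale] treats the first coordinate, the induction
    hypothesis the others, and each contributes one factor s. *)
Lemma tonelli_affine n (a : 'rV[R]_n) (s : R) (f : 'rV[mR]_n -> \bar R) :
  0 < s -> measurable_fun setT f -> (forall x, (0 <= f x)%E) ->
  (\int[lebesgue_rV n]_x f x =
   (s ^+ n)%:E * \int[lebesgue_rV n]_x f (a + s *: x)%R)%E.
Proof.
move=> s0; elim: n a f => [|n IH] a f mf f0.
  rewrite expr0 mul1e; apply: eq_integral => x _; congr (f _).
  by apply/rowP => -[].
pose a' : 'rV[R]_n := \row_j a ord0 (lift ord0 j).
have E t y : a + s *: cons_rV (t, y) = cons_rV (a ord0 ord0 + s * t, a' + s *: y) :> 'rV[mR]_n.+1.
  by apply/rowP => i; rewrite !mxE; case: unliftP => [j ->|->] //; rewrite !mxE.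
have mfc : measurable_fun setT (f \o @cons_rV R n).
  exact: (measurableT_comp mf (@measurable_cons_rV R n)).
rewrite tonelli_rV1// tonelli_rV1//; last first.
  exact: (measurableT_comp mf (measurable_affine _ _)).
pose h (t : mR) : \bar R := (\int[lebesgue_rV n]_y f (cons_rV (t, y)))%E.
have mh : measurable_fun setT h.
  exact: (measurable_fun_fubini_tonelli_F (f \o @cons_rV R n) mfc (fun=> f0 _)).
have h0 t : (0 <= h t)%E by apply: integral_ge0.
rewrite (lebesgue_scale (a ord0 ord0) s0 mh h0) exprS EFinM -muleA; congr (_ * _)%E.
rewrite -ge0_integralZl//=; last 3 first.
- exact: (measurable_fun_fubini_tonelli_F ((fun x => f (a + s *: x)%R) \o @cons_rV R n)
    (measurableT_comp (measurableT_comp mf (measurable_affine _ _))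
      (@measurable_cons_rV R n)) (fun=> f0 _)).
- by move=> t _; apply: integral_ge0.
- by rewrite lee_fin exprn_ge0// ltW.
apply: eq_integral => t _; rewrite /h (IH a')//; last first.
  exact: (measurableT_comp mf (measurable_cons_l _)).
by congr (_ * _)%E; apply: eq_integral => y _; rewrite E.
Qed.

End borel_rV.

(** * Directional derivatives and the classes C^k *)

Section directional.
Context {R : realType}.

(** A directional derivative only sees a line, so the one-variable rules for composition apply
    without passing through total differentiability. *)
Lemma is_derive_line n (f : 'rV[R]_n -> R) (x v : 'rV[R]_n) (df : R) :
  is_derive x v f df <-> is_derive (0 : R) (1 : R) (fun h : R => f (h *: v + x)) df.
Proof.
have E : (fun h : R => h^-1 *: ((f \o shift x) (h *: v) - f x)) =
    (fun h : R => h^-1 *: (((fun h : R => f (h *: v + x)) \o shift 0) (h *: (1 : R)) -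
       f (0 *: v + x))).
  apply/funext => h /=; congr (_ *: (f _ - f _)); last by rewrite scale0r add0r.
  by rewrite addr0 -[h *: 1]/(h * 1) mulr1.
have D : 'D_v f x = 'D_1 (fun h : R => f (h *: v + x)) 0 by rewrite /derive E.
split=> -[d1 d2]; apply: DeriveDef.
- by move: d1; rewrite /derivable E.
- by rewrite -D.
- by rewrite /derivable E.
- by rewrite D.
Qed.

Lemma is_derive_comp1 n (f : 'rV[R]_n -> R) (F : R -> R) (x v : 'rV[R]_n) (df dF : R) :
  is_derive x v f df -> is_derive (f x) (1 : R) F dF ->
  is_derive x v (fun y => F (f y)) (dF * df).
Proof.
move=> /is_derive_line hf hF; apply/is_derive_line.
have hF' : is_derive (f (0 *: v + x)) (1 : R) F dF by rewrite scale0r add0r.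
exact: (@is_derive1_comp _ F (fun h : R => f (h *: v + x)) 0 dF df hF' hf).
Qed.

Lemma is_derive_affine n (f : 'rV[R]_n -> R) (a x v : 'rV[R]_n) (s df : R) :
  is_derive (a + s *: x) v f df ->
  is_derive x v (fun y => f (a + s *: y)) (s * df).
Proof.
move=> /is_derive_line hf; apply/is_derive_line.
pose g (h : R) := f (h *: v + (a + s *: x)).
rewrite (_ : (fun h : R => _) = g \o (fun h => s * h)); last first.
  apply/funext => h; rewrite /g /=; congr f.
  by rewrite scalerDr scalerA addrCA.
rewrite mulrC; apply: is_derive1_comp; first by rewrite mulr0.
rewrite -[X in is_derive _ _ _ X]mulr1.
exact: is_deriveZ.
Qed.

Lemma is_derive_partial n (i : 'I_n) (f : 'rV[R]_n -> R) x df :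
  is_derive x (delta_mx ord0 i) f df -> partial i f x = df.
Proof. by move=> h; exact: derive_val. Qed.

Lemma continuous_near (T : topologicalType) (f g : T -> R) (x : T) :
  {near x, f =1 g} -> {for x, continuous f} -> {for x, continuous g}.
Proof.
move=> fg cf; rewrite /prop_for /continuous_at -(nbhs_singleton fg).
by apply: cvg_trans cf; apply: near_eq_cvg.
Qed.

Lemma is_derive_coord n (i : 'I_n) (x v : 'rV[R]_n) :
  is_derive x v (fun y : 'rV[R]_n => y ord0 i) (v ord0 i).
Proof.
apply/is_derive_line.
rewrite (_ : (fun h : R => _) = fun h : R => v ord0 i * h + x ord0 i); last first.
  by apply/funext => h; rewrite !mxE mulrC.
rewrite -[X in is_derive _ _ _ X]addr0 -[X in is_derive _ _ _ (X + _)]mulr1.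
apply: is_deriveD; exact: is_deriveZ.
Qed.

End directional.

Section class_C_theory.
Context {R : realType} {n : nat}.
Implicit Types (U V : set 'rV[R]_n) (f g : 'rV[R]_n -> R) (k : nat).

Lemma class_C_cont k U f x : class_C k U f -> U x -> {for x, continuous f}.
Proof. by case: k => [|k] [h _]; exact: h. Qed.

Lemma class_C_is_derive k U f (i : 'I_n) x : class_C k.+1 U f -> U x ->
  is_derive x (delta_mx ord0 i) f (partial i f x).
Proof. by move=> [_ /(_ i)[h _]] Ux; apply: DeriveDef => //; exact: h. Qed.

Lemma class_C_partial k U f (i : 'I_n) : class_C k.+1 U f -> class_C k U (partial i f).
Proof. by move=> [_ /(_ i)[]]. Qed.

Lemma class_CS k U V f : V `<=` U -> class_C k U f -> class_C k V f.
Proof.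
move=> VU; elim: k f => [|k IH] f [h1 h2]; split=> //; try by move=> x /VU; exact: h1.
move=> i; have [d p] := h2 i; split; last exact: IH.
by move=> x /VU; exact: d.
Qed.

Lemma class_CW k l U f : (k <= l)%N -> class_C l U f -> class_C k U f.
Proof.
elim: l k f => [|l IH] [|k] f // kl [h1 h2]; split => // i.
by have [d p] := h2 i; split => //; exact: IH.
Qed.

Lemma eq_partial_near (i : 'I_n) f g x : {near x, f =1 g} -> partial i f x = partial i g x.
Proof. exact: near_eq_derive. Qed.

(** Derivatives only depend on germs. All extensions by 0 below are shown to be regular through this
    criterion, with the constant 0 as the local model off the original domain. *)
Lemma class_C_local k U f :
  (forall x, U x -> exists V g, [/\ open V, V x, class_C k V g & forall y, V y -> f y = g y]) ->
  class_C k U f.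
Proof.
elim: k f => [|k IH] f H; split => //.
- move=> x /H[V [g [oV Vx [cg _] fg]]].
  apply: continuous_near (cg _ Vx).
  by have := open_nbhs_nbhs (conj oV Vx); apply: filterS => y /fg.
- move=> x /H[V [g [oV Vx [cg _] fg]]].
  apply: continuous_near (cg _ Vx).
  by have := open_nbhs_nbhs (conj oV Vx); apply: filterS => y /fg.
move=> i; split.
  move=> x /H[V [g [oV Vx [_ /(_ i)[dg _]] fg]]].
  apply: near_eq_derivable (dg _ Vx).
  by have := open_nbhs_nbhs (conj oV Vx); apply: filterS => y /fg.
apply: IH => x /H[V [g [oV Vx [_ /(_ i)[_ pg]] fg]]].
exists V, (partial i g); split => // y Vy; apply: eq_partial_near.
by have := open_nbhs_nbhs (conj oV Vy); apply: filterS => z /fg.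
Qed.

Lemma eq_class_C k U f g : open U -> (forall x, U x -> f x = g x) ->
  class_C k U f -> class_C k U g.
Proof.
move=> oU fg Cf; apply: class_C_local => x Ux; exists U, f; split => // y Uy.
exact/esym/fg.
Qed.

Lemma class_C_deriv k U f (df : 'I_n -> 'rV[R]_n -> R) : open U ->
  (forall x, U x -> {for x, continuous f}) ->
  (forall i x, U x -> is_derive x (delta_mx ord0 i) f (df i x)) ->
  (forall i, class_C k U (df i)) -> class_C k.+1 U f.
Proof.
move=> oU cf hd hC; split => // i; split; first by move=> x /(hd i)[].
apply: eq_class_C (hC i) => // x Ux.
by rewrite (is_derive_partial (hd i x Ux)).
Qed.

Lemma class_C_cst k U (c : R) : open U -> class_C k U (fun=> c).
Proof.
move=> oU; elim: k c => [|k IH] c.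
  by split => // x _; exact: cst_continuous.
apply: (class_C_deriv (df := fun _ _ => 0)) => // x _; exact: cst_continuous.
Qed.

Lemma class_C_coord k U (i : 'I_n) : open U ->
  class_C k U (fun x : 'rV[R]_n => x ord0 i).
Proof.
move=> oU; have cc x : U x -> {for x, continuous (fun x : 'rV[R]_n => x ord0 i)}.
  by move=> _; exact: coord_continuous.
case: k => [|k]; first by split.
apply: (class_C_deriv (df := fun j _ => (delta_mx ord0 j : 'rV[R]_n) ord0 i)) => //.
  by move=> j x _; exact: is_derive_coord.
by move=> j; exact: class_C_cst.
Qed.

Lemma class_CD k U f g : open U -> class_C k U f -> class_C k U g ->
  class_C k U (fun x => f x + g x).
Proof.
move=> oU; elim: k f g => [|k IH] f g Cf Cg.
  by split => // x Ux; apply: continuousD; [exact: class_C_cont Cf Ux|exact: class_C_cont Cg Ux].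
apply: (class_C_deriv (df := fun i x => partial i f x + partial i g x)) => //.
- by move=> x Ux; apply: continuousD; [exact: class_C_cont Cf Ux|exact: class_C_cont Cg Ux].
- move=> i x Ux; apply: is_deriveD; [exact: class_C_is_derive Cf Ux|].
  exact: class_C_is_derive Cg Ux.
- by move=> i; apply: IH; exact: class_C_partial.
Qed.

Lemma class_CM k U f g : open U -> class_C k U f -> class_C k U g ->
  class_C k U (fun x => f x * g x).
Proof.
move=> oU; elim: k f g => [|k IH] f g Cf Cg.
  by split => // x Ux; apply: continuousM; [exact: class_C_cont Cf Ux|exact: class_C_cont Cg Ux].
apply: (class_C_deriv (df := fun i x => f x * partial i g x + g x * partial i f x)) => //.
- by move=> x Ux; apply: continuousM; [exact: class_C_cont Cf Ux|exact: class_C_cont Cg Ux].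
- move=> i x Ux; apply: is_deriveM; [exact: class_C_is_derive Cf Ux|].
  exact: class_C_is_derive Cg Ux.
- move=> i; apply: class_CD => //; apply: IH; try exact: class_C_partial;
    exact: (class_CW (leqnSn k)).
Qed.

Lemma class_CZ k U (c : R) f : open U -> class_C k U f -> class_C k U (fun x => c * f x).
Proof. by move=> oU Cf; apply: class_CM => //; exact: class_C_cst. Qed.

Lemma class_CN k U f : open U -> class_C k U f -> class_C k U (fun x => - f x).
Proof.
move=> oU Cf; apply: (eq_class_C oU _ (class_CZ (-1) oU Cf)) => x _.
by rewrite mulN1r.
Qed.

Lemma class_CB k U f g : open U -> class_C k U f -> class_C k U g ->
  class_C k U (fun x => f x - g x).
Proof. by move=> oU Cf Cg; apply: class_CD => //; exact: class_CN. Qed.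

Lemma class_C_sum k U (I : Type) (r : seq I) (P : pred I) (F : I -> 'rV[R]_n -> R) :
  open U -> (forall i, class_C k U (F i)) ->
  class_C k U (fun x => \sum_(i <- r | P i) F i x).
Proof.
move=> oU CF; elim: r => [|i r IH].
  by under eq_fun do rewrite big_nil; exact: class_C_cst.
under eq_fun do rewrite big_cons.
by case: (P i) => //; exact: class_CD.
Qed.

Lemma class_C_affine k U V f (a : 'rV[R]_n) (s : R) : open U -> open V ->
  (forall x, U x -> V (a + s *: x)) -> class_C k V f ->
  class_C k U (fun x => f (a + s *: x)).
Proof.
move=> oU oV UV; elim: k f => [|k IH] f Cf.
  split => // x Ux; have ca : {for x, continuous (fun x : 'rV[R]_n => a + s *: x)}.
    apply: (@continuousD _ _ _ (fun=> a) (fun x : 'rV[R]_n => s *: x)).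
      exact: cst_continuous.
    exact: scaler_continuous.
  exact: (continuous_comp ca (class_C_cont Cf (UV _ Ux))).
have C0 := IH _ (class_CW (leqnSn k) Cf).
apply: (class_C_deriv (df := fun i x => s * partial i f (a + s *: x))) => //.
- by move=> x Ux; exact: class_C_cont C0 Ux.
- move=> i x Ux; apply: is_derive_affine; apply: class_C_is_derive Cf _.
  exact: UV.
- by move=> i; apply: class_CZ => //; apply: IH; exact: class_C_partial.
Qed.

Lemma partial_affine U f (a : 'rV[R]_n) (s : R) (i : 'I_n) x :
  class_C 1 U f -> U (a + s *: x) ->
  partial i (fun x => f (a + s *: x)) x = s * partial i f (a + s *: x).
Proof.
move=> Cf Ux; apply: is_derive_partial; apply: is_derive_affine.
exact: class_C_is_derive Cf Ux.
Qed.

Section partial_rules.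
Variables (U : set 'rV[R]_n) (i : 'I_n) (x : 'rV[R]_n).
Hypothesis Ux : U x.

Lemma partialD f g : class_C 1 U f -> class_C 1 U g ->
  partial i (fun x => f x + g x) x = partial i f x + partial i g x.
Proof.
by move=> Cf Cg; apply: is_derive_partial; apply: is_deriveD;
  [exact: class_C_is_derive Cf Ux|exact: class_C_is_derive Cg Ux].
Qed.

Lemma partialM f g : class_C 1 U f -> class_C 1 U g ->
  partial i (fun x => f x * g x) x = f x * partial i g x + g x * partial i f x.
Proof.
by move=> Cf Cg; apply: is_derive_partial; apply: is_deriveM;
  [exact: class_C_is_derive Cf Ux|exact: class_C_is_derive Cg Ux].
Qed.

Lemma partialB f g : class_C 1 U f -> class_C 1 U g ->
  partial i (fun x => f x - g x) x = partial i f x - partial i g x.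
Proof.
by move=> Cf Cg; apply: is_derive_partial; apply: is_deriveB;
  [exact: class_C_is_derive Cf Ux|exact: class_C_is_derive Cg Ux].
Qed.

Lemma partial_comp1 (F : R -> R) (dF : R) f : class_C 1 U f ->
  is_derive (f x) (1 : R) F dF ->
  partial i (fun x => F (f x)) x = dF * partial i f x.
Proof.
move=> Cf dFx; apply: is_derive_partial; apply: is_derive_comp1 => //.
exact: class_C_is_derive Cf Ux.
Qed.

End partial_rules.

Lemma partial_cst (i : 'I_n) (c : R) x : partial i (fun=> c) x = 0.
Proof. exact: derive_cst. Qed.

Lemma partial_coord (i j : 'I_n) x :
  partial i (fun x : 'rV[R]_n => x ord0 j) x = (i == j)%:R.
Proof.
by rewrite (is_derive_partial (is_derive_coord j x _)) mxE eqxx eq_sym.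
Qed.

(** The derivative is quantified existentially so that a closed formula can be supplied at each
    order; such functions are the outer factors in [class_C_comp1]. *)
Fixpoint smooth1 k (J : set R) (F : R -> R) : Prop :=
  (forall y, J y -> {for y, continuous F}) /\
  (if k is k'.+1 then exists dF, (forall y, J y -> is_derive y (1 : R) F (dF y)) /\
     smooth1 k' J dF else True).

Lemma smooth1_cont k J F y : smooth1 k J F -> J y -> {for y, continuous F}.
Proof. by case: k => [|k] [h _]; exact: h. Qed.

Lemma class_C_comp1 k U J F f : open U -> (forall x, U x -> J (f x)) ->
  smooth1 k J F -> class_C k U f -> class_C k U (fun x => F (f x)).
Proof.
move=> oU UJ; have cc k' G x : smooth1 k' J G -> class_C k' U f -> U x ->
    {for x, continuous (fun x => G (f x))}.
  move=> sG Cf Ux; apply: continuous_comp; first exact: class_C_cont Cf Ux.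
  by apply: smooth1_cont sG _; exact: UJ.
elim: k F => [|k IH] F sF Cf; first by split => // x; exact: cc sF Cf.
have [_ [dF [hd sdF]]] := sF.
apply: (class_C_deriv (df := fun i x => dF (f x) * partial i f x)) => //.
- by move=> x; exact: cc sF Cf.
- move=> i x Ux; apply: is_derive_comp1; first exact: class_C_is_derive Cf Ux.
  exact/hd/UJ.
- move=> i; apply: class_CM => //; last exact: class_C_partial.
  by apply: IH => //; exact: (class_CW (leqnSn k)).
Qed.

End class_C_theory.

(** * Integration of derivatives along coordinate lines *)

Section coordinate_lines.
Context {R : realType}.
Notation mR := (measurableTypeR R).

Definition cube n (c : R) : set 'rV[R]_n := [set x | forall i, `|x ord0 i| <= c].

Lemma fin_meas_cube n (c : R) : fin_meas (lebesgue_rV n) (cube c : set 'rV[mR]_n).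
Proof.
have E : cube c = [set x : 'rV[mR]_n | forall i, [set` `[- c, c]] (x ord0 i)].
  by apply/seteqP; split => x h i; have := h i; rewrite /= in_itv/= ler_norml.
split.
  rewrite E (_ : mkset _ = \bigcap_(i in [set: 'I_n])
    ((fun x : 'rV[mR]_n => x ord0 i) @^-1` [set` `[- c, c]])).
    apply: fin_bigcap_measurable => // i _.
    by rewrite -[X in measurable X]setTI; exact: measurable_coord.
  by apply/seteqP; split => [x Ax j _|x Ax j]; [exact: Ax|exact: Ax].
have aux (x y : \bar R) : x = y -> (0 <= y)%E && (y < +oo)%E -> (x < +oo)%E.
  by move=> -> /andP[].
rewrite E; apply: (aux _ _ (@lebesgue_rV_box R n (fun=> [set` `[- c, c]]) (fun=> measurable_itv _))).
elim/big_rec : _ => [|i y _ /andP[y0 yoo]]; first by rewrite lee01 ltry.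
rewrite mule_ge0//= lte_mul_pinfty//.
by rewrite lebesgue_measure_itv/=; case: ifP => _; rewrite ?ltry// -EFinD ltry.
Qed.

Lemma cons_delta0 n (h t : R) (y : 'rV[R]_n) :
  h *: delta_mx ord0 ord0 + cons_rV (t, y) = cons_rV (h + t, y) :> 'rV[R]_n.+1.
Proof.
apply/rowP => i; rewrite !mxE eqxx/=; case: unliftP => [j ->|->] /=.
  by rewrite mulr0 add0r.
by rewrite mulr1.
Qed.

Lemma cons_deltaS n (j : 'I_n) (h t : R) (y : 'rV[R]_n) :
  h *: delta_mx ord0 (lift ord0 j) + cons_rV (t, y) =
  cons_rV (t, h *: delta_mx ord0 j + y) :> 'rV[R]_n.+1.
Proof.
apply/rowP => i; rewrite !mxE eqxx/=; case: unliftP => [k ->|->] /=.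
  by rewrite (inj_eq lift_inj) !mxE eqxx.
by rewrite mulr0 add0r.
Qed.

Lemma contraction_continuous (V W : normedModType R) (f : V -> W) :
  (forall y z, `|f y - f z| <= `|y - z|) -> continuous f.
Proof.
move=> fl y; apply/cvgrPdist_lt => e e0; near=> z.
apply: le_lt_trans (fl y z) _.
by near: z; apply: cvgr_dist_lt => //; exact: cvg_id.
Unshelve. all: by end_near. Qed.

Lemma continuous_cons_l n (t : R) : continuous (fun y : 'rV[R]_n => cons_rV (t, y) : 'rV[R]_n.+1).
Proof.
apply: contraction_continuous => y z.
rewrite [leLHS]mx_normrE; apply: bigmax_le => // -[i k] _ /=.
have -> : i = ord0 by exact: ord1.
rewrite !mxE; case: unliftP => [l _|_]; last by rewrite subrr normr0.
by have := le_coord_norm (y - z) l; rewrite !mxE.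
Qed.

Lemma continuous_cons_r n (y : 'rV[R]_n) : continuous (fun t : R => cons_rV (t, y) : 'rV[R]_n.+1).
Proof.
apply: (@contraction_continuous R 'rV[R]_n.+1) => t z.
rewrite [leLHS]mx_normrE; apply: bigmax_le => // -[i k] _ /=.
have -> : i = ord0 by exact: ord1.
by rewrite !mxE; case: unliftP => [l _|_]; first by rewrite subrr normr0.
Qed.

(** Tonelli: the indicator integrated along direction i already gives 0. The induction on the
    dimension brings i to the first coordinate. *)
Lemma null_lines n (i : 'I_n) (A : set 'rV[mR]_n) : measurable A ->
  (forall x : 'rV[R]_n, lebesgue_measure [set h : mR | A (h *: delta_mx ord0 i + x)] = 0%E) ->
  lebesgue_rV n A = 0%E.
Proof.
elim: n i A => [[]//|n IH] i A mA lA.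
have mI : measurable_fun setT (fun x : 'rV[mR]_n.+1 => (\1_A x : R)%:E).
  by apply/measurable_EFinP; exact: measurable_indic.
rewrite -(setIT A) -integral_indic//.
have [j ij|i0] := unliftP ord0 i.
  rewrite tonelli_rV1//; apply: integral0_eq => t _.
  have mS : measurable ((fun y : 'rV[mR]_n => cons_rV (t, y)) @^-1` A).
    by rewrite -[X in measurable X]setTI; exact: measurable_cons_l.
  transitivity (\int[lebesgue_rV n]_y (\1_((fun y : 'rV[mR]_n => cons_rV (t, y)) @^-1` A) y : R)%:E)%E.
    by apply: eq_integral => y _; rewrite !indicE.
  rewrite integral_indic// setIT; apply: (IH j) => // y.
  rewrite -[RHS](lA (cons_rV (t, y))); congr (lebesgue_measure _).
  by apply/seteqP; split => h /=; rewrite ij cons_deltaS.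
rewrite tonelli_rV2//; apply: integral0_eq => y _.
have mS : measurable ((fun t : mR => cons_rV (t, y)) @^-1` A).
  by rewrite -[X in measurable X]setTI; exact: measurable_cons_r.
transitivity (\int[lebesgue_measure]_t (\1_((fun t : mR => cons_rV (t, y)) @^-1` A) t : R)%:E)%E.
  by apply: eq_integral => t _; rewrite !indicE.
rewrite integral_indic// setIT -[RHS](lA (cons_rV (0, y))); congr (lebesgue_measure _).
by apply/seteqP; split => h /=; rewrite i0 cons_delta0 addr0.
Qed.

(** Sort the points by an isolation radius 1/(k+1). On each class h |-> floor(h (k+1)) is injective,
    since two points with the same floor are closer than 1/(k+1). *)
Lemma countable_isolated (E : set R) :
  (forall h, E h -> exists2 e : R, 0 < e & forall h', E h' -> `|h' - h| < e -> h' = h) ->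
  countable E.
Proof.
move=> iso.
pose F (k : nat) := [set h | E h /\ forall h', E h' -> `|h' - h| < k.+1%:R^-1 -> h' = h].
apply: (@sub_countable _ _ _ (\bigcup_k F k)).
  apply: subset_card_le => h Eh; have [e e0 he] := iso h Eh.
  have [N _ hN] := near_infty_natSinv_lt (PosNum e0).
  exists N => //; split => // h' Eh' hh; apply: he => //.
  by apply: lt_trans hh _; exact: (hN N (leqnn N)).
apply: bigcup_countable => // k _; apply/countable_injP.
exists (fun h => pickle (Num.floor (h * k.+1%:R))) => h h' /set_mem[Eh hh] /set_mem[Eh' _].
move=> /(pcan_inj pickleK) fl; apply/esym; apply: hh => //.
have k0 : (0 : R) < k.+1%:R by [].
rewrite -(ltr_pM2r k0) mulVf ?gt_eqF// -[X in _ * X]gtr0_norm// -normrM mulrBl.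
have /andP[a1 a2] := floor_itv (h * k.+1%:R).
have /andP[b1 b2] := floor_itv (h' * k.+1%:R).
move: a1 a2 b1 b2; rewrite fl intrD; move: (h * _) (h' * _) (_%:~R) => a b c.
by move=> ? ? ? ?; rewrite ltr_norml; apply/andP; split; lra.
Qed.

(** On a line in direction i, a zero of w where the derivative is not 0 is isolated among such
    zeros; they are therefore countable on every line, and the exceptional set is null. This is the
    classical form of the Sobolev fact that a gradient vanishes a.e. on a level set. *)
Lemma ae_partial0 n (D : set 'rV[R]_n) (w : 'rV[R]_n -> R) (i : 'I_n) : open D ->
  class_C 1 D w ->
  {ae lebesgue_rV n, forall x : 'rV[mR]_n, D x -> w x = 0 -> partial i w x = 0}.
Proof.
move=> oD Cw.
have mD := open_measurable_rV oD.
pose A : set 'rV[mR]_n := (D `&` w @^-1` [set 0]) `&` (D `&` (partial i w @^-1` [set~ 0])).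
have mA : measurable A.
  apply: measurableI.
    apply: (continuous_measurable_rV oD (fun x Dx => class_C_cont Cw Dx)) => //.
  apply: (continuous_measurable_rV oD
    (fun x Dx => class_C_cont (class_C_partial i Cw) Dx)) => //.
  exact: measurableC.
exists A; split => //; last first.
  move=> x /= h; split; split; try (by apply: contrapT => nD; apply: h);
    by apply: contrapT => nD; apply: h => // Dx w0; apply: contrapT.
apply: (null_lines (i := i)) => // x.
apply: countable_lebesgue_measure0; apply: countable_isolated => h [[Dh wh] [_ dw]].
have := class_C_is_derive i Cw Dh => -[cv dv].
have : (fun t : R => t^-1 *: ((w \o shift (h *: delta_mx ord0 i + x)) (t *: delta_mx ord0 i) -
    w (h *: delta_mx ord0 i + x))) t @[t --> 0^'] --> partial i w (h *: delta_mx ord0 i + x).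
  exact: cv.
move=> /(_ [set~ 0]); rewrite /nbhs/= => cv0.
have : nbhs (partial i w (h *: delta_mx ord0 i + x)) [set~ 0].
  apply: open_nbhs_nbhs; split; first exact: (closed_openC (@closed_eq R 0)).
  exact: dw.
move=> /cv0; rewrite /nbhs/= => -[e /= e0 he]; exists e => // h' [[Dh' wh'] _] hh'.
apply: contrapT => ne; apply: (he (h' - h)) => /=.
- by rewrite sub0r normrN.
- by apply/eqP => /subr0_eq.
by rewrite addrA -scalerDl subrK wh' wh subrr scaler0.
Qed.

Lemma integral_derivative0 (h g : R -> R) (c : R) : (forall t, is_derive t (1 : R) h (g t)) ->
  continuous g -> (forall t, c < `|t| -> h t = 0) -> (forall t, c < `|t| -> g t = 0) ->
  (\int[lebesgue_measure]_t (g t)%:E = 0)%E.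
Proof.
move=> hd cg h0 g0; pose b : R := `|c| + 1.
have b0 : 0 < b by rewrite ltr_wpDl.
have cb : c < b by rewrite (le_lt_trans (ler_norm c))// ltrDl.
have ch : continuous h.
  by move=> t; have [d _] := hd t; apply: differentiable_continuous; exact/derivable1_diffP.
have -> : (\int[lebesgue_measure]_t (g t)%:E =
    \int[lebesgue_measure]_(t in `[(- b)%R, b]%classic) (g t)%:E)%E.
  rewrite [RHS]integral_mkcond; apply: eq_integral => t _; rewrite patchE.
  case: ifPn => //; rewrite notin_setE /= in_itv/= -ler_norml => /negP.
  by rewrite -ltNge => bt; rewrite g0// (lt_trans cb).
rewrite (@continuous_FTC2 _ g h)//.
- by rewrite !h0 ?subee// ?normrN gtr0_norm.
- by rewrite gt0_cp.
- exact: continuous_subspaceT.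
- split.
  + by move=> t _; have [] := hd t.
  + exact: cvg_at_right_filter (ch _).
  + exact: cvg_at_left_filter (ch _).
- by move=> t _; rewrite derive1E; exact: derive_val.
Qed.

(** Integrating first along direction i, the fundamental theorem of calculus gives 0 on each line;
    Fubini and an induction on the dimension do the rest. *)
Lemma integral_partial0 n (i : 'I_n) (f : 'rV[R]_n -> R) (M c : R) :
  (forall x, derivable f x (delta_mx ord0 i)) -> continuous (partial i f) ->
  (forall x, `|partial i f x| <= M) -> (forall x, ~ cube c x -> f x = 0) ->
  (\int[lebesgue_rV n]_(x in [set: 'rV[mR]_n]) (partial i f x)%:E = 0)%E.
Proof.
elim: n i f => [[]//|n IH] i f df cf fM f0.
have oC : open (~` cube c : set 'rV[R]_n.+1).
  rewrite openE => x /= /existsNP[k /negP]; rewrite -ltNge => ck.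
  rewrite /interior; near=> y => /= /(_ k); apply/negP; rewrite -ltNge.
  near: y; apply: (cvgr_gt _ _ _ ck).
  apply: (@cvg_norm _ _ _ _ _ (fun y : 'rV[R]_n.+1 => y ord0 k)).
  exact: coord_continuous.
have p0 x : ~ cube c x -> partial i f x = 0.
  move=> cx; rewrite -(partial_cst i 0 x); apply: eq_partial_near.
  by have := open_nbhs_nbhs (conj oC cx); apply: filterS => y /f0.
have mp : measurable_fun [set: 'rV[mR]_n.+1] (partial i f).
  by apply: (continuous_measurable_rV openT) => x _; exact: cf.
have ip : (lebesgue_rV n.+1).-integrable setT (EFin \o partial i f).
  have [mQ fQ] := fin_meas_cube n.+1 c.
  have : (lebesgue_rV n.+1).-integrable (cube c : set 'rV[mR]_n.+1) (EFin \o partial i f).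
    apply: bmf_integrable; first exact: fin_meas_cube.
    by split; [exact: measurable_funTS|exists M].
  move=> /(integrable_mkcond _ mQ); congr (integrable _ _ _).
  apply/funext => x; rewrite patchE; case: ifPn => //.
  by rewrite notin_setE => /p0 /= ->.
have [j ij|i0] := unliftP ord0 i.
  rewrite fubini_rV1//; apply: integral0_eq => t _.
  have D y : is_derive y (delta_mx ord0 j : 'rV[R]_n) (fun y : 'rV[R]_n => f (cons_rV (t, y)))
      (partial i f (cons_rV (t, y))).
    apply/is_derive_line.
    have : is_derive (cons_rV (t, y) : 'rV[R]_n.+1) (delta_mx ord0 i) f
      (partial i f (cons_rV (t, y))) by apply: DeriveDef => //; exact: df.
    move=> /is_derive_line; congr is_derive; apply/funext => h.
    by rewrite ij cons_deltaS.
  have E y : partial j (fun y : 'rV[R]_n => f (cons_rV (t, y))) y = partial i f (cons_rV (t, y)).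
    by rewrite (is_derive_partial (D y)).
  under eq_integral do rewrite -E.
  apply: IH => [y||y|y cy].
  - by have [] := D y.
  - rewrite (funext E) => y; apply: continuous_comp; last exact: cf.
    exact: continuous_cons_l.
  - by rewrite E.
  - by apply: f0 => h; apply: cy => k; have := h (lift ord0 k); rewrite mxE liftK.
rewrite fubini_rV2//; apply: integral0_eq => y _.
apply: (@integral_derivative0 (fun t => f (cons_rV (t, y))) _ c).
- move=> t.
  have : is_derive (cons_rV (t, y) : 'rV[R]_n.+1) (delta_mx ord0 i) f
    (partial i f (cons_rV (t, y))) by apply: DeriveDef => //; exact: df.
  have Q : (fun h : R => h^-1 *: ((f \o shift (cons_rV (t, y) : 'rV[R]_n.+1)) (h *: delta_mx ord0 i)
      - f (cons_rV (t, y)))) = (fun h : R => h^-1 *: (((fun t => f (cons_rV (t, y))) \o shift t) (h *: (1 : R))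
      - f (cons_rV (t, y)))).
    by apply/funext => h /=; rewrite i0 cons_delta0 -[h *: 1]/(h * 1) mulr1.
  move=> [d1 d2]; apply: DeriveDef; first by move: d1; rewrite /derivable Q.
  by move: d2; rewrite /derive Q.
- move=> t; apply: continuous_comp; last exact: cf.
  exact: continuous_cons_r.
- move=> t ct; apply: f0 => /(_ ord0); rewrite mxE unlift_none /= => /(lt_le_trans ct).
  by rewrite ltxx.
- move=> t ct; apply: p0 => /(_ ord0); rewrite mxE unlift_none /= => /(lt_le_trans ct).
  by rewrite ltxx.
Unshelve. all: by end_near. Qed.

End coordinate_lines.

(** * Smooth functions of one variable *)

Section smooth_real.
Context {R : realType}.

Lemma smooth1W k l J (F : R -> R) : (k <= l)%N -> smooth1 l J F -> smooth1 k J F.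
Proof.
elim: l k F => [|l IH] [|k] F // kl [h1 [dF [h2 h3]]]; split => //.
by exists dF; split => //; exact: IH.
Qed.

Lemma is_derive_continuous (F : R -> R) (y dF : R) :
  is_derive y (1 : R) F dF -> {for y, continuous F}.
Proof. by move=> [d _]; apply: differentiable_continuous; exact/derivable1_diffP. Qed.

Lemma smooth1_deriv k J (F dF : R -> R) : (forall y, J y -> is_derive y (1 : R) F (dF y)) ->
  smooth1 k J dF -> smooth1 k.+1 J F.
Proof.
by move=> h s; split; [move=> y /h; exact: is_derive_continuous|exists dF].
Qed.

Lemma smooth1_cst k J (c : R) : smooth1 k J (fun=> c).
Proof.
elim: k c => [|k IH] c; first by split => // y _; exact: cst_continuous.
by apply: (smooth1_deriv (dF := fun=> 0)).
Qed.

Lemma smooth1_id k J : smooth1 k J (fun y : R => y).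
Proof.
case: k => [|k]; first by split => // y _; exact: cvg_id.
by apply: (smooth1_deriv (dF := fun=> 1)) => //; exact: smooth1_cst.
Qed.

Lemma smooth1D k J (F G : R -> R) : smooth1 k J F -> smooth1 k J G ->
  smooth1 k J (fun y => F y + G y).
Proof.
elim: k F G => [|k IH] F G.
  by move=> [cF _] [cG _]; split => // y Jy; apply: continuousD; [exact: cF|exact: cG].
move=> [_ [dF [hF sF]]] [_ [dG [hG sG]]].
apply: (smooth1_deriv (dF := fun y => dF y + dG y)); last exact: IH.
by move=> y Jy; apply: is_deriveD; [exact: hF|exact: hG].
Qed.

Lemma smooth1M k J (F G : R -> R) : smooth1 k J F -> smooth1 k J G ->
  smooth1 k J (fun y => F y * G y).
Proof.
elim: k F G => [|k IH] F G.
  by move=> [cF _] [cG _]; split => // y Jy; apply: continuousM; [exact: cF|exact: cG].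
move=> sF0 sG0; have [_ [dF [hF sF]]] := sF0; have [_ [dG [hG sG]]] := sG0.
apply: (smooth1_deriv (dF := fun y => F y * dG y + G y * dF y)).
  by move=> y Jy; apply: is_deriveM; [exact: hF|exact: hG].
by apply: smooth1D; apply: IH => //; exact: (smooth1W (leqnSn k)).
Qed.

Lemma smooth1_comp k J J' (F G : R -> R) : (forall y, J y -> J' (G y)) ->
  smooth1 k J' F -> smooth1 k J G -> smooth1 k J (fun y => F (G y)).
Proof.
move=> JJ; elim: k F => [|k IH] F sF0 sG0.
  by split => // y Jy; apply: continuous_comp; [exact: sG0.1|exact/sF0.1/JJ].
have [_ [dF [hF sF]]] := sF0; have [_ [dG [hG sG]]] := sG0.
apply: (smooth1_deriv (dF := fun y => dF (G y) * dG y)).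
  by move=> y Jy; apply: is_derive1_comp; [exact/hF/JJ|exact: hG].
by apply: smooth1M => //; apply: IH => //; exact: (smooth1W (leqnSn k)).
Qed.

Lemma is_derive_exprn k (y : R) : is_derive y (1 : R) (fun z : R => z ^+ k) (k%:R * y ^+ k.-1).
Proof.
rewrite (_ : (fun z : R => z ^+ k) = (fun z : R => z) ^+ k); last first.
  by apply/funext => z; rewrite exprfctE.
have := @is_deriveX _ _ (fun z : R => z) k y 1 1 (is_derive_id y 1).
by rewrite /GRing.scale/= mulr1.
Qed.

(** This is y^(-k/2) for y > 0. Applied to squared norms it yields all inverse powers of distances
    with natural exponents, and differentiation merely shifts k by 2. *)
Definition isq k (y : R) : R := (Num.sqrt y)^-1 ^+ k.

Lemma isqS k y : isq k.+1 y = (Num.sqrt y)^-1 * isq k y.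
Proof. by rewrite /isq exprS. Qed.

Lemma isq_ge0 k y : 0 <= isq k y.
Proof. by rewrite exprn_ge0// invr_ge0 sqrtr_ge0. Qed.

Lemma isq_gt0 k y : 0 < y -> 0 < isq k y.
Proof. by move=> y0; rewrite exprn_gt0// invr_gt0 sqrtr_gt0. Qed.

Lemma isqSS k y : 0 < y -> y * isq k.+2 y = isq k y.
Proof.
move=> y0; rewrite !isqS mulrA -{1}(sqr_sqrtr (ltW y0)) expr2.
have : Num.sqrt y != 0 by rewrite gt_eqF// sqrtr_gt0.
by move: (Num.sqrt y) (isq k y) => a b a0; field.
Qed.

Lemma isq2 y : 0 < y -> isq 2 y = y^-1.
Proof. by move=> y0; rewrite /isq exprVn sqr_sqrtr// ltW. Qed.

Lemma is_derive_isq k (y : R) : 0 < y ->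
  is_derive y (1 : R) (isq k) (- (k%:R / 2) * isq k.+2 y).
Proof.
move=> y0; have s0 : Num.sqrt y != 0 by rewrite gt_eqF// sqrtr_gt0.
have h1 : is_derive y (1 : R) (@Num.sqrt R) (2 * Num.sqrt y)^-1 by exact: is_derive1_sqrt.
have h2 := is_deriveV s0 h1.
have h3 := @is_derive1_comp _ (fun z : R => z ^+ k) (fun y : R => (Num.sqrt y)^-1) y _ _
  (is_derive_exprn k (Num.sqrt y)^-1) h2.
apply: (is_derive_eq h3).
rewrite /GRing.scale/= !isqS /isq; case: k {h3} => [|k]; first by rewrite !mul0r oppr0 mul0r.
rewrite /= [_^-1 ^+ k.+1]exprS; move: ((Num.sqrt y)^-1 ^+ k) s0 => b.
by move: (Num.sqrt y) => a a0; field.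
Qed.

Lemma smooth1_isq j k (c : R) : smooth1 j [set y | 0 < y] (fun y => c * isq k y).
Proof.
elim: j k c => [|j IH] k c.
  split => // y y0; apply: continuousM; first exact: cst_continuous.
  exact: is_derive_continuous (is_derive_isq k y0).
apply: (smooth1_deriv (dF := fun y => (c * - (k%:R / 2)) * isq k.+2 y)) => // y y0.
rewrite -mulrA; have := is_derive_isq k y0; exact: is_deriveZ.
Qed.

(** A truncated power, of class C^(k-1) for k > 0: the cutoffs need two continuous derivatives only,
    so polynomial pieces replace the usual exponential bump. *)
Definition ppow k (y : R) : R := Num.max y 0 ^+ k.

Lemma ppow_ge0 k y : 0 <= ppow k y.
Proof. by rewrite exprn_ge0// le_max lexx orbT. Qed.

Lemma ppow_gt0 k y : 0 < y -> 0 < ppow k y.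
Proof. by move=> y0; rewrite exprn_gt0// lt_max y0. Qed.

Lemma ppow_npos k y : y <= 0 -> ppow k.+1 y = 0.
Proof. by move=> y0; rewrite /ppow (max_idPr y0) expr0n. Qed.

Lemma ppow_pos k y : 0 <= y -> ppow k y = y ^+ k.
Proof. by move=> y0; rewrite /ppow (max_idPl y0). Qed.

Lemma near_gt0 (y : R) : 0 < y -> \forall z \near y, 0 < z.
Proof. by move=> y0; apply: lt_nbhsr. Qed.

Lemma is_derive_ppow k y : is_derive y (1 : R) (ppow k.+2) (k.+2%:R * ppow k.+1 y).
Proof.
have [y0|y0|<-] := ltgtP 0 y.
- have h : is_derive y (1 : R) (fun z : R => z ^+ k.+2) (k.+2%:R * ppow k.+1 y).
    rewrite ppow_pos ?ltW//.
    exact: is_derive_exprn.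
  have e : {near y, (fun z : R => z ^+ k.+2) =1 ppow k.+2}.
    by near=> z; rewrite ppow_pos// ltW//; near: z; exact: near_gt0.
  case: h => d1 d2; apply: DeriveDef; first exact: near_eq_derivable d1.
  by rewrite -(near_eq_derive (1 : R) e).
- have e : {near y, (fun z : R => 0 : R) =1 ppow k.+2}.
    near=> z; rewrite ppow_npos// ltW//; near: z; exact: lt_nbhsl.
  rewrite ppow_npos ?ltW// mulr0.
  case: (is_derive_cst (0 : R) y (1 : R)) => d1 d2; apply: DeriveDef; first exact: near_eq_derivable d1.
  by rewrite -(near_eq_derive (1 : R) e).
- rewrite ppow_npos// mulr0.
  (* At 0 the difference quotient is at most |h|^(k+1), hence at most |h| once |h| <= 1. *)
  have cv : h^-1 *: ((ppow k.+2 \o shift 0) (h *: (1 : R)) - ppow k.+2 0) @[h --> (0 : R)^'] --> (0 : R).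
    apply/cvgrPdist_lt => e e0; near=> h.
    have h0 : h != 0 by near: h; exact: nbhs_dnbhs_neq.
    rewrite /= addr0 (ppow_npos k.+1 (lexx 0)) subr0 sub0r normrN -[h *: 1]/(h * 1) mulr1.
    rewrite -[_ *: _]/(h^-1 * _) /ppow exprS.
    have hm : `|Num.max h 0| <= `|h|.
      by have [h1|h1] := leP h 0; rewrite ?normr0.
    rewrite mulrA normrM normrX (@le_lt_trans _ _ (1 * `|h|))//.
      apply: ler_pM => //.
        by rewrite normrM normfV ler_pdivrMl ?normr_gt0// mulr1.
      rewrite exprS -[leRHS]mulr1 ler_pM ?exprn_ge0// exprn_ile1//.
      apply: le_trans hm _; near: h; apply: dnbhs0_le; exact: ltr01.
    by rewrite mul1r; near: h; exact: dnbhs0_lt.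
  apply: DeriveDef; first by apply/cvg_ex; exists 0.
  exact: (cvg_lim (@Rhausdorff R) cv).
Unshelve. all: by end_near. Qed.

Lemma smooth1_ppow j : smooth1 j setT (ppow j.+1).
Proof.
elim: j => [|j IH].
  split => // y _; rewrite (_ : ppow 1 = fun y => Num.max y 0); last first.
    by apply/funext => z; rewrite /ppow expr1.
  apply: continuous_max; [exact: cvg_id|exact: cvg_cst].
apply: (smooth1_deriv (dF := fun y => j.+2%:R * ppow j.+1 y)).
  by move=> y _; exact: is_derive_ppow.
by apply: smooth1M => //; exact: smooth1_cst.
Qed.

(* A smooth step, equal to 1 on ]-oo, 2] and to 0 on [3, +oo[. *)
Definition step (y : R) : R :=
  ppow 3 (3 - y) * (1 * isq 2 (ppow 3 (3 - y) + ppow 3 (y - 2))).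

Definition dstep : R -> R := derive1 step.
Definition ddstep : R -> R := derive1 dstep.

Lemma step_den_gt0 y : 0 < ppow 3 (3 - y) + ppow 3 (y - 2).
Proof.
have [h|h] := ltP y 3.
  by rewrite ltr_pwDl ?ppow_ge0// ppow_gt0// subr_gt0.
by rewrite ltr_wpDl ?ppow_ge0// ppow_gt0//; lra.
Qed.

Lemma step1 y : y <= 2 -> step y = 1.
Proof.
move=> y2; rewrite /step isq2 ?step_den_gt0// mul1r (@ppow_npos 2 (y - 2)) ?subr_le0//.
by rewrite addr0 mulfV// gt_eqF// ppow_gt0//; lra.
Qed.

Lemma step0 y : 3 <= y -> step y = 0.
Proof. by move=> y3; rewrite /step ppow_npos ?mul0r// subr_le0. Qed.

Lemma step_ge0 y : 0 <= step y.
Proof. by rewrite /step mul1r mulr_ge0 ?ppow_ge0 ?isq_ge0. Qed.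

Lemma step_le1 y : step y <= 1.
Proof.
rewrite /step isq2 ?step_den_gt0// mul1r ler_pdivrMr ?step_den_gt0// mul1r.
by rewrite lerDl ppow_ge0.
Qed.

Lemma smooth1_step : smooth1 2 setT step.
Proof.
have a1 : smooth1 2 setT (fun y : R => ppow 3 (3 - y)).
  apply: (smooth1_comp (J' := setT) (F := ppow 3) (G := fun y => 3 - y)) => //.
    exact: smooth1_ppow.
  apply: smooth1D; first exact: smooth1_cst.
  rewrite (_ : -%R = fun y : R => -1 * y); last by apply/funext => y; rewrite mulN1r.
  by apply: smooth1M; [exact: smooth1_cst|exact: smooth1_id].
have a2 : smooth1 2 setT (fun y : R => ppow 3 (y - 2)).
  apply: (smooth1_comp (J' := setT) (F := ppow 3) (G := fun y => y - 2)) => //.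
    exact: smooth1_ppow.
  by apply: smooth1D; [exact: smooth1_id|exact: smooth1_cst].
apply: smooth1M => //.
apply: (smooth1_comp (J' := [set y | 0 < y]) (F := fun y => 1 * isq 2 y)); last exact: smooth1D.
  by move=> y _; exact: step_den_gt0.
exact: smooth1_isq.
Qed.

Lemma is_derive_step y : is_derive y (1 : R) step (dstep y).
Proof.
have [_ [d1 [h1 _]]] := smooth1_step; have := h1 y I.
by case=> a b; apply: DeriveDef; [exact: a|rewrite /dstep derive1E].
Qed.

Lemma smooth1_dstep : smooth1 1 setT dstep.
Proof.
have [_ [d1 [h1 s1]]] := smooth1_step.
by rewrite (_ : dstep = d1)//; apply/funext => y; have [_ <-] := h1 y I; rewrite /dstep derive1E.
Qed.

Lemma is_derive_dstep y : is_derive y (1 : R) dstep (ddstep y).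
Proof.
have [_ [d1 [h1 _]]] := smooth1_dstep; have := h1 y I.
by case=> a b; apply: DeriveDef; [exact: a|rewrite /ddstep derive1E].
Qed.

Lemma continuous_ddstep : continuous ddstep.
Proof.
have [_ [d1 [h1 [s1 _]]]] := smooth1_dstep.
rewrite (_ : ddstep = d1); first by move=> y; exact: s1.
by apply/funext => y; have [_ <-] := h1 y I; rewrite /ddstep derive1E.
Qed.

Lemma dstep0 y : y < 2 \/ 3 < y -> dstep y = 0.
Proof.
move=> h; rewrite /dstep derive1E; case: h => h.
  rewrite -(derive_cst (1 : R) y (1 : R)); apply: near_eq_derive.
  by near=> z; rewrite step1// ltW//; near: z; exact: lt_nbhsl.
rewrite -(derive_cst (0 : R) y (1 : R)); apply: near_eq_derive.
by near=> z; rewrite step0// ltW//; near: z; exact: lt_nbhsr.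
Unshelve. all: by end_near. Qed.

Lemma ddstep0 y : y < 2 \/ 3 < y -> ddstep y = 0.
Proof.
move=> h; rewrite /ddstep derive1E -(derive_cst (0 : R) y (1 : R)); apply: near_eq_derive.
case: h => h; near=> z; rewrite dstep0//.
  by left; near: z; exact: lt_nbhsl.
by right; near: z; exact: lt_nbhsr.
Unshelve. all: by end_near. Qed.

Lemma bounded_outside (f : R -> R) : continuous f -> (forall y, y < 2 \/ 3 < y -> f y = 0) ->
  exists2 c, 0 <= c & forall y, `|f y| <= c.
Proof.
move=> cf f0.
have cn : {within `[2, 3], continuous (fun y => `|f y|)}.
  by apply: continuous_subspaceT => y; apply: cvg_norm; exact: cf.
have [c _ hc] := EVT_max (ler_nat R 2 3) cn.
exists `|f c| => // y; have [y2|y2] := ltP y 2; first by rewrite f0 ?normr0//; left.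
have [y3|y3] := leP y 3; last by rewrite f0 ?normr0//; right.
by apply: hc; rewrite in_itv/= y2.
Qed.

Lemma step_bound : exists2 c, 0 <= c & forall y, `|dstep y| <= c /\ `|ddstep y| <= c.
Proof.
have [c1 c10 h1] := bounded_outside (fun y => smooth1_cont smooth1_dstep (I : [set: R] y)) dstep0.
have [c2 c20 h2] := bounded_outside continuous_ddstep ddstep0.
exists (c1 + c2); first exact: addr_ge0.
by move=> y; split; [rewrite (le_trans (h1 y))// lerDl|rewrite (le_trans (h2 y))// lerDr].
Qed.

(* Truncation near the value 0: [vtrunc d] vanishes near 0 and is the identity away from [-2d, 2d]. *)
Definition vtrunc (d w : R) : R := w * (1 - step (w ^+ 2 / d ^+ 2)).

Definition dvtrunc (d w : R) : R :=
  1 - step (w ^+ 2 / d ^+ 2) - 2 * (w ^+ 2 / d ^+ 2) * dstep (w ^+ 2 / d ^+ 2).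

Lemma vtrunc0 d w : 0 < d -> `|w| <= d -> vtrunc d w = 0.
Proof.
move=> d0 wd; rewrite /vtrunc step1 ?subrr ?mulr0//.
rewrite ler_pdivrMr ?exprn_gt0// -(real_normK (num_real w)).
have : `|w| ^+ 2 <= d ^+ 2 by rewrite ler_pXn2r// nnegrE// ltW.
have : 0 < d ^+ 2 by rewrite exprn_gt0.
lra.
Qed.

Lemma vtrunc_dist d w : 0 < d -> `|vtrunc d w - w| <= 2 * d.
Proof.
move=> d0; rewrite /vtrunc (_ : _ - w = - (w * step (w ^+ 2 / d ^+ 2))); last by ring.
rewrite normrN normrM; have [h|h] := leP `|w| (2 * d).
  rewrite -[leRHS]mulr1 ler_pM// ger0_norm ?step_ge0//; exact: step_le1.
rewrite step0 ?normr0 ?mulr0 ?mulr_ge0// ?ltW//.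
rewrite ltr_pdivlMr ?exprn_gt0// -(real_normK (num_real w)).
have : (2 * d) ^+ 2 < `|w| ^+ 2 by rewrite ltr_pXn2r// nnegrE// mulr_ge0// ltW.
rewrite exprMn; have : 0 < d ^+ 2 by rewrite exprn_gt0.
by move: (d ^+ 2) (`|w| ^+ 2) => a b; lra.
Qed.

Lemma is_derive_vtrunc d w : 0 < d -> is_derive w (1 : R) (vtrunc d) (dvtrunc d w).
Proof.
move=> d0.
have h1 : is_derive w (1 : R) (fun w : R => d ^- 2 * w ^+ 2) (d ^- 2 * (2 * w)).
  by apply: is_deriveZ; exact: is_derive_exprn 2 w.
have h1' : is_derive (d ^- 2 * w ^+ 2) (1 : R) step (dstep (d ^- 2 * w ^+ 2)).
  exact: is_derive_step.
have h2 := @is_derive1_comp _ step (fun w : R => d ^- 2 * w ^+ 2) w _ _ h1' h1.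
have h3 := is_deriveB (is_derive_cst (1 : R) w 1) h2.
have h4 := is_deriveM (is_derive_id w 1) h3.
rewrite (_ : vtrunc d = (fun x : R => x) * (cst 1 - step \o (fun w : R => d ^- 2 * w ^+ 2))).
  apply: is_derive_eq; rewrite /dvtrunc /GRing.scale/= !fctE/= [d ^- 2 * _]mulrC.
  move: (step _) (dstep _) => a b.
  by field; exact: lt0r_neq0.
by apply/funext => z; rewrite /vtrunc !fctE/= [d ^- 2 * _]mulrC.
Qed.

(** The derivative depends on w and d only through w^2 / d^2, so one bound serves all d and can
    dominate the limit d -> 0. The 6 is 2 * 3, because [dstep] vanishes beyond 3. *)
Lemma dvtrunc_bound : exists2 K, 0 <= K & forall d w, 0 < d -> `|dvtrunc d w| <= K.
Proof.
have [c c0 hc] := step_bound.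
exists (1 + 6 * c); first by rewrite addr_ge0// mulr_ge0.
move=> d w d0; rewrite /dvtrunc.
have : 0 <= w ^+ 2 / d ^+ 2 by rewrite divr_ge0// sqr_ge0.
move: (w ^+ 2 / d ^+ 2) => y y0.
rewrite (le_trans (ler_normB _ _))// lerD//.
  by rewrite ler_norml; have := step_ge0 y; have := step_le1 y; move: (step y) => a; lra.
rewrite !normrM (ger0_norm y0) normr_nat.
have [y3|y3] := leP y 3; last first.
  by rewrite dstep0 ?normr0 ?mulr0 ?mulr_ge0//; right.
rewrite (_ : 6 = 2 * 3); last by rewrite -natrM.
by apply: ler_pM => //; [rewrite mulr_ge0|rewrite ler_pM2l|have [] := hc y].
Qed.

Lemma smooth1_vtrunc d : 0 < d -> smooth1 1 setT (vtrunc d).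
Proof.
move=> d0; apply: (smooth1_deriv (dF := dvtrunc d)).
  by move=> y _; exact: is_derive_vtrunc.
have c1 (w : R) : {for w, continuous (fun w : R => w ^+ 2 / d ^+ 2)}.
  apply: (@continuousM _ _ (fun w : R => w ^+ 2) (fun=> (d ^+ 2)^-1)).
    exact: exprn_continuous.
  exact: cst_continuous.
split=> // w _; apply: continuousB; first apply: continuousB.
- exact: cst_continuous.
- apply: (continuous_comp (c1 w)); exact: is_derive_continuous (is_derive_step _).
apply: continuousM.
  by apply: continuousM; [exact: cst_continuous|exact: c1].
apply: (continuous_comp (c1 w)); exact: is_derive_continuous (is_derive_dstep _).
Qed.

Lemma dvtrunc1 d w : 0 < d -> 2 * d < `|w| -> dvtrunc d w = 1.
Proof.
move=> d0 h; have h3 : 3 < w ^+ 2 / d ^+ 2.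
  rewrite ltr_pdivlMr ?exprn_gt0// -(real_normK (num_real w)).
  have : (2 * d) ^+ 2 < `|w| ^+ 2 by rewrite ltr_pXn2r// nnegrE// mulr_ge0// ltW.
  rewrite exprMn; have : 0 < d ^+ 2 by rewrite exprn_gt0.
  by move: (d ^+ 2) (`|w| ^+ 2) => a b; lra.
by rewrite /dvtrunc step0 ?ltW// dstep0 ?mulr0 ?subr0//; right.
Qed.

End smooth_real.

(** * Euclidean geometry and radial cutoffs *)

Section euclid.
Context {R : realType} {n : nat}.
Implicit Types x y : 'rV[R]_n.

Definition sqn x : R := \sum_i x ord0 i ^+ 2.

Definition hball (r : R) : set 'rV[R]_n := [set x | sqn x < r ^+ 2].

Definition ann (t : R) : set 'rV[R]_n := [set x | t ^+ 2 < sqn x < (2 * t) ^+ 2].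

Definition gdot (f g : 'rV[R]_n -> R) x : R := \sum_i partial i f x * partial i g x.

Lemma sqn_ge0 x : 0 <= sqn x.
Proof. by apply: sumr_ge0 => i _; rewrite sqr_ge0. Qed.

Lemma sqn0 : sqn (0 : 'rV[R]_n) = 0.
Proof. by rewrite /sqn big1// => i _; rewrite mxE expr0n. Qed.

Lemma sqnZ s x : sqn (s *: x) = s ^+ 2 * sqn x.
Proof. by rewrite /sqn mulr_sumr; apply: eq_bigr => i _; rewrite mxE exprMn. Qed.

Lemma sqnN x : sqn (- x) = sqn x.
Proof. by apply: eq_bigr => i _; rewrite mxE sqrrN. Qed.

Lemma coord_le_sqn x i : x ord0 i ^+ 2 <= sqn x.
Proof.
by rewrite /sqn (bigD1 i)//= lerDl sumr_ge0// => j _; rewrite sqr_ge0.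
Qed.

Lemma sqnD_le x y : sqn (x + y) <= 2 * sqn x + 2 * sqn y.
Proof.
rewrite /sqn !mulr_sumr -big_split; apply: ler_sum => i _ /=; rewrite mxE.
have : 0 <= (x ord0 i - y ord0 i) ^+ 2 by rewrite sqr_ge0.
by move: (x _ _) (y _ _) => a b; rewrite !expr2; lra.
Qed.

Lemma sqnB_ge x y : sqn x / 2 - sqn y <= sqn (x - y).
Proof.
by have := sqnD_le (x - y) y; rewrite subrK; move: (sqn x) (sqn y) (sqn (x - y)) => a b c; lra.
Qed.

Lemma cube_sqn c x : cube c x -> sqn x <= n%:R * c ^+ 2.
Proof.
move=> cx; rewrite /sqn -[X in X%:R * _]card_ord -sum1_card natr_sum mulr_suml.
apply: ler_sum => i _; rewrite mul1r -(real_normK (num_real (x _ _))).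
by rewrite ler_pXn2r// nnegrE// (le_trans _ (cx i)).
Qed.

Lemma sqn_cube c x : 0 <= c -> sqn x <= c ^+ 2 -> cube c x.
Proof.
move=> c0 xc i; rewrite -(ler_pXn2r (n := 2))// ?nnegrE// real_normK ?num_real//.
exact: le_trans (coord_le_sqn x i) xc.
Qed.

Lemma hball_cube r : 0 <= r -> hball r `<=` cube r.
Proof. by move=> r0 x /ltW; exact: sqn_cube. Qed.

Lemma ann_hball t : ann t `<=` hball (2 * t).
Proof. by move=> x /andP[]. Qed.

Lemma class_C_sqn k : class_C k setT sqn.
Proof.
apply: class_C_sum; first exact: openT.
by move=> i; under eq_fun do rewrite expr2; apply: class_CM; first exact: openT;
  apply: class_C_coord; exact: openT.
Qed.

Lemma continuous_sqn : continuous sqn.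
Proof. by move=> x; exact: (class_C_cont (class_C_sqn 0) (I : [set: _] x)). Qed.

Lemma partial_sqn i x : partial i sqn x = 2 * x ord0 i.
Proof.
have h (j : 'I_n) : is_derive x (delta_mx ord0 i) (fun x : 'rV[R]_n => x ord0 j ^+ 2)
    (2 * x ord0 j * (i == j)%:R).
  have /is_derive_comp1 := is_derive_coord j x (delta_mx ord0 i).
  move=> /(_ _ _ (is_derive_exprn 2 (x ord0 j))).
  by rewrite mxE eqxx eq_sym expr1.
apply: is_derive_partial.
have := @is_derive_sum _ _ _ n (fun j (x : 'rV[R]_n) => x ord0 j ^+ 2) x (delta_mx ord0 i) _ h.
have -> : \sum_(j < n) 2 * x ord0 j * (i == j)%:R = 2 * x ord0 i.
  rewrite (bigD1 i)//= eqxx mulr1 big1 ?addr0// => j.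
  by rewrite eq_sym => /negPf ->; rewrite mulr0.
congr (is_derive _ _ _ _).
by apply/funext => y; rewrite fct_sumE.
Qed.

Lemma open_sqn_lt c : open [set x | sqn x < c].
Proof.
rewrite openE => x xc; have /cvgr_lt h : sqn @ x --> sqn x by exact: continuous_sqn.
exact: h.
Qed.

Lemma open_sqn_gt c : open [set x | c < sqn x].
Proof.
rewrite openE => x xc; have /cvgr_gt h : sqn @ x --> sqn x by exact: continuous_sqn.
exact: h.
Qed.

Lemma open_hball r : open (hball r).
Proof. exact: open_sqn_lt. Qed.

Lemma open_ann t : open (ann t).
Proof.
rewrite (_ : ann t = [set x | t ^+ 2 < sqn x] `&` [set x | sqn x < (2 * t) ^+ 2]).
  by apply: openI; [exact: open_sqn_gt|exact: open_sqn_lt].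
by apply/seteqP; split => x /= => [/andP[]|[? ?]] //; apply/andP.
Qed.

(** It is 1 up to radius sqrt 2 t and 0 from sqrt 3 t on, so its derivatives live well inside
    [ann t] and vanish near every point of the complement. *)
Definition cutoff (t : R) x : R := step (sqn x / t ^+ 2).

Section cutoff_theory.
Variable t : R.
Hypothesis t0 : 0 < t.

Let t20 : 0 < t ^+ 2. Proof. by rewrite exprn_gt0. Qed.

Lemma cutoff1 x : sqn x <= 2 * t ^+ 2 -> cutoff t x = 1.
Proof. by move=> h; rewrite /cutoff step1// ler_pdivrMr. Qed.

Lemma cutoff0 x : 3 * t ^+ 2 <= sqn x -> cutoff t x = 0.
Proof. by move=> h; rewrite /cutoff step0// ler_pdivlMr. Qed.

Lemma cutoff_ge0 x : 0 <= cutoff t x. Proof. exact: step_ge0. Qed.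

Lemma cutoff_le1 x : cutoff t x <= 1. Proof. exact: step_le1. Qed.

Let Csc k : class_C k setT (fun x => sqn x / t ^+ 2).
Proof.
by apply: class_CM (class_C_sqn k) _; [exact: openT|apply: class_C_cst; exact: openT].
Qed.

Lemma class_C_cutoff : class_C 2 setT (cutoff t).
Proof.
by apply: (class_C_comp1 (J := setT)) => //; [exact: openT|exact: smooth1_step].
Qed.

Let partial_sc i x : partial i (fun x => sqn x / t ^+ 2) x = 2 * x ord0 i / t ^+ 2.
Proof.
rewrite (@partialM _ _ setT i x I _ (fun=> _) (class_C_sqn 1)); last first.
  by apply: class_C_cst; exact: openT.
by rewrite partial_cst mulr0 add0r partial_sqn mulrC.
Qed.

Lemma partial_cutoff i x :
  partial i (cutoff t) x = dstep (sqn x / t ^+ 2) * (2 * x ord0 i / t ^+ 2).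
Proof.
rewrite (@partial_comp1 _ _ setT i x I _ _ _ (Csc 1) (is_derive_step _)).
by rewrite partial_sc.
Qed.

Lemma partial2_cutoff i x : partial i (partial i (cutoff t)) x =
  ddstep (sqn x / t ^+ 2) * (2 * x ord0 i / t ^+ 2) ^+ 2 + dstep (sqn x / t ^+ 2) * (2 / t ^+ 2).
Proof.
rewrite (funext (partial_cutoff i)).
have C1 : class_C 1 setT (fun x => dstep (sqn x / t ^+ 2)).
  by apply: (class_C_comp1 (J := setT)) => //; [exact: openT|exact: smooth1_dstep].
have C2 : class_C 1 setT (fun x : 'rV[R]_n => x ord0 i * (2 / t ^+ 2)).
  by apply: class_CM; [exact: openT|apply: class_C_coord; exact: openT|
    apply: class_C_cst; exact: openT].
have -> : (fun x : 'rV[R]_n => dstep (sqn x / t ^+ 2) * (2 * x ord0 i / t ^+ 2)) =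
  (fun x => dstep (sqn x / t ^+ 2) * (x ord0 i * (2 / t ^+ 2))).
  by apply/funext => y; congr (_ * _); rewrite mulrA [2 * _]mulrC.
rewrite (@partialM _ _ setT i x I _ _ C1 C2).
rewrite (@partial_comp1 _ _ setT i x I _ _ _ (Csc 1) (is_derive_dstep _)) partial_sc.
rewrite (@partialM _ _ setT i x I _ (fun=> _) (class_C_coord 1 i openT)); last first.
  by apply: class_C_cst; exact: openT.
rewrite partial_cst partial_coord eqxx mulr0 add0r mulr1.
by move: (dstep _) (ddstep _) (x _ _) => a b c; rewrite expr2; ring.
Qed.

Let out x : ~ ann t x -> sqn x / t ^+ 2 < 2 \/ 3 < sqn x / t ^+ 2.
Proof.
rewrite /ann /= => /negP; rewrite negb_and -!leNgt exprMn ltr_pdivrMr// ltr_pdivlMr// => /orP[] h.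
  by left; move: (sqn x) h t20 => a; move: (t ^+ 2) => b; lra.
by right; move: (sqn x) h t20 => a; move: (t ^+ 2) => b; rewrite expr2; lra.
Qed.

Lemma partial_cutoff_out i x : ~ ann t x -> partial i (cutoff t) x = 0.
Proof. by move=> /out h; rewrite partial_cutoff dstep0// mul0r. Qed.

Lemma laplacian_cutoff_out x : ~ ann t x -> laplacian (cutoff t) x = 0.
Proof.
move=> /out h; rewrite /laplacian big1// => i _.
by rewrite partial2_cutoff dstep0// ddstep0// !mul0r addr0.
Qed.

End cutoff_theory.

(** On [ann t] every |x_j| is at most 2 t, hence |2 x_j / t^2| <= 4 / t, and a pure second
    derivative is at most (16 + 2) c / t^2. The point is a constant independent of t. *)
Lemma cutoff_bound : exists2 C : R, 0 <= C & forall t x i, 0 < t ->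
  `|partial i (cutoff t) x| <= C / t /\ `|laplacian (cutoff t) x| <= C / t ^+ 2.
Proof.
have [c c0 hc] := step_bound (R := R).
exists (4 * c + n%:R * (18 * c)); first by rewrite addr_ge0// !mulr_ge0.
move=> t x i t0; have t20 : 0 < t ^+ 2 by rewrite exprn_gt0.
have [ax|/[dup] ax1 ax2] := pselect (ann t x); last first.
  rewrite partial_cutoff_out// laplacian_cutoff_out// !normr0.
  by split; apply: divr_ge0; rewrite ?addr_ge0 ?mulr_ge0 ?(ltW t0) ?(ltW t20).
have xt j : `|x ord0 j| <= 2 * t.
  rewrite -(ler_pXn2r (n := 2))// ?nnegrE ?mulr_ge0 ?(ltW t0)// real_normK ?num_real//.
  by apply: le_trans (coord_le_sqn x j) _; case/andP: ax => _ /ltW.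
have xt2 j : `|2 * x ord0 j / t ^+ 2| <= 4 / t.
  rewrite normrM normfV (gtr0_norm t20) normrM normr_nat ler_pdivrMr//.
  rewrite (_ : 4 / t * t ^+ 2 = 2 * (2 * t)); last by field; exact: lt0r_neq0.
  by rewrite ler_pM2l.
have [h1 h2] := hc (sqn x / t ^+ 2).
split.
  rewrite partial_cutoff// normrM.
  apply: (@le_trans _ _ (c * (4 / t))); first exact: ler_pM.
  rewrite (_ : c * (4 / t) = 4 * c / t); last by rewrite mulrA [c * 4]mulrC.
  by rewrite ler_pM2r ?invr_gt0// lerDl !mulr_ge0.
have E : (4 * c + n%:R * (18 * c)) / t ^+ 2 = 4 * c / t ^+ 2 + \sum_(j < n) 18 * c / t ^+ 2.
  by rewrite sumr_const card_ord -mulr_natl; field; exact: lt0r_neq0.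
rewrite E; apply: le_trans (ler_norm_sum _ _ _) _; apply: ler_wpDl.
  by rewrite !mulr_ge0// invr_ge0 ltW.
apply: ler_sum => j _; rewrite partial2_cutoff//.
rewrite (le_trans (ler_normD _ _))// (_ : 18 * c / t ^+ 2 = c * (4 / t) ^+ 2 + c * (2 / t ^+ 2)); last first.
  by field; exact: lt0r_neq0.
apply: lerD; rewrite normrM; apply: ler_pM => //.
  by rewrite normrX ler_pXn2r// nnegrE// divr_ge0// ltW.
by rewrite normrM normfV normr_nat (gtr0_norm t20).
Qed.

(* comm chi f = Laplacian (chi f) - chi Laplacian f *)
Definition comm (chi f : 'rV[R]_n -> R) x : R := 2 * gdot chi f x + f x * laplacian chi x.

Lemma laplacianM U f g x : open U -> U x -> class_C 2 U f -> class_C 2 U g ->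
  laplacian (fun x => f x * g x) x = f x * laplacian g x + comm f g x.
Proof.
move=> oU Ux Cf Cg; have f1 := class_CW (leqnSn 1) Cf; have g1 := class_CW (leqnSn 1) Cg.
rewrite /comm /laplacian /gdot addrCA !mulr_sumr -!big_split /=; apply: eq_bigr => i _.
have E : {near x, (fun y => f y * partial i g y + g y * partial i f y) =1
    partial i (fun x => f x * g x)}.
  have := open_nbhs_nbhs (conj oU Ux); apply: filterS => y Uy.
  by rewrite (partialM i Uy).
have fi := class_C_partial i Cf; have gi := class_C_partial i Cg.
rewrite -(eq_partial_near i E) (partialD i Ux); last 2 first.
- exact: class_CM.
- exact: class_CM.
rewrite (partialM i Ux)// (partialM i Ux)//.
move: (partial i (partial i g) x) (partial i (partial i f) x) (partial i f x) (partial i g x).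
by move: (f x) (g x) => a b; clear => p q r s; ring.
Qed.

Lemma laplacianD U f g x : open U -> U x -> class_C 2 U f -> class_C 2 U g ->
  laplacian (fun x => f x + g x) x = laplacian f x + laplacian g x.
Proof.
move=> oU Ux Cf Cg; have f1 := class_CW (leqnSn 1) Cf; have g1 := class_CW (leqnSn 1) Cg.
rewrite /laplacian -big_split /=; apply: eq_bigr => i _.
rewrite -(partialD i Ux); [|exact: class_C_partial..].
apply/esym; apply: eq_partial_near.
by have := open_nbhs_nbhs (conj oU Ux); apply: filterS => y Uy; rewrite (partialD i Uy).
Qed.

Lemma laplacianZ U c f x : open U -> U x -> class_C 2 U f ->
  laplacian (fun x => c * f x) x = c * laplacian f x.
Proof.
move=> oU Ux Cf; have Cc := class_C_cst 2 c oU.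
rewrite (laplacianM oU Ux Cc Cf) /comm /gdot /laplacian.
have E i : partial i (fun=> c) = (fun=> 0) :> ('rV[R]_n -> R).
  by apply/funext => y; exact: partial_cst.
rewrite [X in 2 * X]big1 ?mulr0 ?add0r => [|i _]; last by rewrite E mul0r.
by rewrite [X in _ + f x * X]big1 ?mulr0 ?addr0// => i _; rewrite E partial_cst.
Qed.

Lemma laplacianB U f g x : open U -> U x -> class_C 2 U f -> class_C 2 U g ->
  laplacian (fun x => f x - g x) x = laplacian f x - laplacian g x.
Proof.
move=> oU Ux Cf Cg; rewrite (laplacianD (g := fun x => - g x) oU Ux Cf (class_CN oU Cg)).
rewrite -(mulN1r (laplacian g x)) -(laplacianZ (-1) oU Ux Cg).
have -> : (fun x => - g x) = (fun x => -1 * g x) by apply/funext => y; rewrite mulN1r.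
by [].
Qed.

Lemma laplacian_affine U f (a : 'rV[R]_n) (s : R) x : open U -> class_C 2 U f ->
  U (a + s *: x) ->
  laplacian (fun x => f (a + s *: x)) x = s ^+ 2 * laplacian f (a + s *: x).
Proof.
move=> oU Cf Ux; rewrite /laplacian mulr_sumr; apply: eq_bigr => i _.
have C1 := class_CW (leqnSn 1) Cf; have Ci := class_C_partial i Cf.
pose V := (fun x => a + s *: x) @^-1` U.
have oV : open V.
  apply: open_comp oU => y _; apply: (@continuousD _ _ _ (fun=> a) (fun x : 'rV[R]_n => s *: x)).
    exact: cst_continuous.
  exact: scaler_continuous.
have E : {near x, (fun y => s * partial i f (a + s *: y)) =1 partial i (fun x => f (a + s *: x))}.
  have := open_nbhs_nbhs (conj oV (Ux : V x)); apply: filterS => y Uy.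
  by rewrite (partial_affine i C1 Uy).
rewrite -(eq_partial_near i E).
rewrite (@partialM _ _ V i x Ux (fun=> s) (fun y => partial i f (a + s *: y))); last 2 first.
- exact: class_C_cst.
- exact: (class_C_affine oV oU).
by rewrite partial_cst mulr0 addr0 (partial_affine i Ci Ux) expr2 mulrA.
Qed.

Lemma eq_laplacian_near f g x : {near x, f =1 g} -> laplacian f x = laplacian g x.
Proof.
move=> fg; apply: eq_bigr => i _; apply: eq_partial_near.
have := near_join fg; apply: filterS => y fgy; exact: eq_partial_near.
Qed.

Lemma gdot_affine U f g (a : 'rV[R]_n) (s : R) x : class_C 1 U f -> class_C 1 U g ->
  U (a + s *: x) ->
  gdot (fun x => f (a + s *: x)) (fun x => g (a + s *: x)) x = s ^+ 2 * gdot f g (a + s *: x).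
Proof.
move=> Cf Cg Ux; rewrite /gdot mulr_sumr; apply: eq_bigr => i _.
by rewrite (partial_affine i Cf Ux) (partial_affine i Cg Ux); ring.
Qed.

End euclid.

(** * Integration by parts for functions vanishing at the boundary *)

Notation vint := (int (lebesgue_rV _)).
Notation vbmf := (@bmf _ 'rV[measurableTypeR _]_ _ _).
Notation vfin := (fin_meas (lebesgue_rV _)).

Section divergence.
Context {R : realType} {n : nat}.
Notation mR := (measurableTypeR R).
Implicit Types (D : set 'rV[R]_n) (f g w psi : 'rV[R]_n -> R).

Lemma cvg_bigsum (I : Type) (r : seq I) (F : I -> nat -> R) (l : I -> R) :
  (forall i, F i k @[k --> \oo] --> l i) ->
  \sum_(i <- r) F i k @[k --> \oo] --> \sum_(i <- r) l i.
Proof.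
move=> h; elim: r => [|i r IH].
  by under eq_fun do rewrite big_nil; rewrite big_nil; exact: cvg_cst.
by under eq_fun do rewrite big_cons; rewrite big_cons; apply: cvgD.
Qed.

Definition bounded_dom D : Prop := open D /\ exists c, D `<=` cube c.

Lemma bounded_dom_fin D : bounded_dom D -> vfin D.
Proof.
by move=> [oD [c Dc]]; exact: (fin_measS (open_measurable_rV oD) (fin_meas_cube n c) Dc).
Qed.

Lemma class_C_bmf k D f (M : R) : open D -> class_C k D f -> (forall x, D x -> `|f x| <= M) ->
  vbmf D f.
Proof.
move=> oD Cf fM; split; last by exists M.
by apply: continuous_measurable_rV => // x; exact: class_C_cont Cf.
Qed.

(** Zero boundary values in a form that asks for no extension of w: near each point outside D, on
    the boundary or not, w is small on D. *)
Definition vanish D w : Prop :=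
  forall x, ~ D x -> forall d : R, 0 < d -> \forall y \near x, D y -> `|w y| < d.

(** For bounded D these are the C^1 functions with compact support in D, already extended by 0 to
    the whole space so that integrals over lines apply to them. *)
Definition test D psi : Prop :=
  class_C 1 setT psi /\ forall x, ~ D x -> \forall y \near x, psi y = 0.

Lemma compact_cube (c : R) : compact (cube c : set 'rV[R]_n).
Proof.
have -> : cube c = [set v : 'rV[R]_n | forall i, `[- c, c]%classic (v ord0 i)].
  by apply/seteqP; split => x h i; have := h i; rewrite /= in_itv/= ler_norml.
exact: (@rV_compact R n (fun=> `[- c, c]%classic) (fun=> @segment_compact R (- c) c)).
Qed.

Lemma continuous_cube_bounded f (c : R) : continuous f ->
  exists M : R, forall x, cube c x -> `|f x| <= M.
Proof.
move=> cf; have [M [_ hM]] := compact_bounded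
  (continuous_compact (continuous_subspaceT cf) (@compact_cube c)).
exists (M + 1) => x cx; apply: hM; first by rewrite ltrDl.
by exists x.
Qed.

Lemma test_out D psi x : test D psi -> ~ D x -> psi x = 0.
Proof. by move=> [_ h] /h; exact: nbhs_singleton. Qed.

Lemma test_partial_out D psi i x : test D psi -> ~ D x -> partial i psi x = 0.
Proof.
move=> [_ h] /h h0; rewrite -(partial_cst i 0 x); apply: eq_partial_near.
exact: h0.
Qed.

Lemma test_cont D psi : test D psi -> continuous psi.
Proof. by move=> [C _] x; exact: (class_C_cont C (I : [set: _] x)). Qed.

Lemma test_partial_cont D psi i : test D psi -> continuous (partial i psi).
Proof. by move=> [C _] x; exact: (class_C_cont (class_C_partial i C) (I : [set: _] x)). Qed.

Lemma test_partial_bounded D psi i : bounded_dom D -> test D psi ->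
  exists M : R, forall x, `|partial i psi x| <= M.
Proof.
move=> [oD [c Dc]] tp; have [M hM] := continuous_cube_bounded c (test_partial_cont (i := i) tp).
exists (Num.max M 0) => x; rewrite le_max; have [Dx|nDx] := pselect (D x).
  by rewrite hM//; exact: Dc.
by rewrite (test_partial_out _ tp)// normr0 lexx orbT.
Qed.

Lemma test_bmf D psi : bounded_dom D -> test D psi -> vbmf D psi.
Proof.
move=> [oD [c Dc]] tp; have [M hM] := continuous_cube_bounded c (test_cont tp).
apply: (class_C_bmf (k := 1) (M := M)) => //; last by move=> x /Dc; exact: hM.
by apply: class_CS tp.1.
Qed.

Lemma test_partial_bmf D psi i : bounded_dom D -> test D psi -> vbmf D (partial i psi).
Proof.
move=> bD tp; have [M hM] := test_partial_bounded i bD tp.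
apply: (class_C_bmf (k := 0) (M := M)) => //; first exact: bD.1.
by apply: class_CS (class_C_partial i tp.1).
Qed.

Lemma int_partial_test D f i : bounded_dom D -> test D f -> vint D (partial i f) = 0.
Proof.
move=> bD tf; have [oD [c Dc]] := bD; have [M hM] := test_partial_bounded i bD tf.
have -> : vint D (partial i f) = fine (\int[lebesgue_rV n]_x (partial i f x)%:E)%E.
  rewrite /int /Rintegral integral_mkcond; congr fine; apply: eq_integral => x _.
  rewrite patchE; case: ifPn => //; rewrite notin_setE => nDx.
  by rewrite (test_partial_out _ tf).
rewrite (@integral_partial0 _ _ i f M c)//.
- by move=> x; have [_ /(_ i)[d _]] := tf.1; exact: d.
- exact: test_partial_cont tf.
- by move=> x nx; apply: (test_out tf) => /Dc.
Qed.

Lemma near_patch D f x : open D -> D x -> {near x, f =1 f \_ D}.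
Proof.
move=> oD Dx; have := open_nbhs_nbhs (conj oD Dx); apply: filterS => y Dy.
by rewrite patchE mem_set.
Qed.

Lemma test_patch D f : open D -> class_C 1 D f ->
  (forall x, ~ D x -> \forall y \near x, D y -> f y = 0) -> test D (f \_ D).
Proof.
move=> oD Cf f0; split => [|x nDx]; last first.
  have := f0 x nDx; apply: filterS => y h; rewrite patchE; case: ifPn => // /set_mem.
  exact: h.
apply: class_C_local => x _; have [Dx|nDx] := pselect (D x).
  exists D, f; split => // y Dy; by rewrite patchE mem_set.
have : nbhs x [set y | D y -> f y = 0] by exact: f0.
rewrite nbhsE => -[V [oV Vx] hV].
exists V, (fun=> 0); split => //; first exact: class_C_cst.
move=> y Vy; rewrite patchE; case: ifPn => // /set_mem; exact: hV.
Qed.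

Lemma partial_patch D f i x : open D -> D x -> partial i (f \_ D) x = partial i f x.
Proof. by move=> oD Dx; apply/esym/eq_partial_near; exact: near_patch. Qed.

(** Interior regularity of f is enough: the product psi f, cut to D, is again a test function,
    whatever f does at the boundary. *)
Lemma int_ibp_test D psi f i : bounded_dom D -> test D psi -> class_C 1 D f ->
  vbmf D (fun x => psi x * partial i f x + f x * partial i psi x) /\
  vint D (fun x => psi x * partial i f x + f x * partial i psi x) = 0.
Proof.
move=> bD tp Cf; have oD := bD.1.
have Cp : class_C 1 D psi by apply: class_CS tp.1.
have tpf : test D ((fun x => psi x * f x) \_ D).
  apply: (test_patch oD (class_CM oD Cp Cf)).
  by move=> x /tp.2; apply: filterS => y -> _; rewrite mul0r.
have E x : D x -> partial i ((fun x => psi x * f x) \_ D) x =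
    psi x * partial i f x + f x * partial i psi x.
  by move=> Dx; rewrite partial_patch// (partialM i Dx).
split; first exact: (eq_bmf E (test_partial_bmf i bD tpf)).
apply: etrans (int_partial_test i bD tpf); apply: eq_int => x Dx.
by rewrite E.
Qed.

Lemma vtrunc_test D w (d : R) : open D -> 0 < d -> class_C 1 D w -> vanish D w ->
  test D ((fun x => vtrunc d (w x)) \_ D).
Proof.
move=> oD d0 Cw vw.
apply: (test_patch oD (class_C_comp1 oD (fun _ _ => I) (smooth1_vtrunc d0) Cw)).
move=> x nDx; have := vw x nDx d d0; apply: filterS => y h Dy.
by rewrite vtrunc0// ltW// h.
Qed.

Lemma partial_vtrunc D w (d : R) i x : open D -> 0 < d -> class_C 1 D w -> D x ->
  partial i ((fun x => vtrunc d (w x)) \_ D) x = dvtrunc d (w x) * partial i w x.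
Proof.
move=> oD d0 Cw Dx; rewrite partial_patch//.
exact: (partial_comp1 i Dx Cw (is_derive_vtrunc _ d0)).
Qed.

(** The truncation of w at level 1 is a test function, hence bounded, and w differs from it by at
    most 2. *)
Lemma vanish_bmf D w : bounded_dom D -> class_C 1 D w -> vanish D w -> vbmf D w.
Proof.
move=> bD Cw vw; have oD := bD.1.
have tw := vtrunc_test oD (ltr01 : 0 < (1 : R)) Cw vw.
have [_ [M hM]] := test_bmf bD tw.
apply: (class_C_bmf (k := 1) (M := M + 2)) => // x Dx.
have := hM x Dx; rewrite patchE mem_set// => h.
have := vtrunc_dist (w x) (ltr01 : 0 < (1 : R)); rewrite mulr1 distrC => h2.
by rewrite -[w x](subrK (vtrunc 1 (w x))) addrC (le_trans (ler_normD _ _))// lerD.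
Qed.

Lemma measurable_dvtrunc D w (d : R) : open D -> 0 < d -> class_C 1 D w ->
  measurable_fun (D : set 'rV[mR]_n) (fun x => dvtrunc d (w x)).
Proof.
move=> oD d0 Cw; apply: continuous_measurable_rV => // x Dx.
have [_ [dF [hF [cF _]]]] := smooth1_vtrunc d0.
have E : dvtrunc d = dF.
  by apply/funext => y; have [_ <-] := hF y I; have [_ <-] := is_derive_vtrunc y d0.
rewrite E; apply: continuous_comp; first exact: class_C_cont Cw Dx.
exact: cF.
Qed.

Let dseq (k : nat) : R := k.+1%:R^-1.
Let dseq0 k : 0 < dseq k. Proof. by rewrite invr_gt0. Qed.

Lemma dvtrunc_cvg (w : R) : w != 0 -> dvtrunc (dseq k) w @[k --> \oo] --> (1 : R).
Proof.
move=> w0; have w2 : 0 < `|w| / 2 by rewrite divr_gt0// normr_gt0.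
apply: cvg_near_cst; have := near_infty_natSinv_lt (PosNum w2); apply: filterS => k /= h.
by rewrite dvtrunc1// mulrC -ltr_pdivlMr.
Qed.

Lemma vtrunc_cvg (w : R) : vtrunc (dseq k) w @[k --> \oo] --> w.
Proof.
apply/cvgrPdist_lt => e e0; have e2 : 0 < e / 2 by rewrite divr_gt0.
have := near_infty_natSinv_lt (PosNum e2); apply: filterS => k /= h.
by rewrite distrC (le_lt_trans (vtrunc_dist _ (dseq0 k)))// mulrC -ltr_pdivlMr.
Qed.

(* The gradient of w vanishes a.e. on { w = 0 }, which makes truncation harmless. *)
Lemma ae_dvtrunc_partial D w i : open D -> class_C 1 D w ->
  {ae lebesgue_rV n, forall x : 'rV[mR]_n, D x ->
     dvtrunc (dseq k) (w x) * partial i w x @[k --> \oo] --> partial i w x}.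
Proof.
move=> oD Cw; have := ae_partial0 i oD Cw; apply: filterS => x h Dx.
have [w0|w0] := eqVneq (w x) 0.
  rewrite h//; under eq_fun do rewrite mulr0; exact: cvg_cst.
rewrite -[X in _ --> X]mul1r; apply: cvgM; [exact: dvtrunc_cvg|exact: cvg_cst].
Qed.

(** Truncations of w are test functions, for which the identity is integration by parts. As the
    level tends to 0 the factors [dvtrunc] stay bounded and tend to 1 wherever w is not 0; on the
    zero set the gradient of w is 0 almost everywhere. Dominated convergence concludes, for a
    boundary of any shape. *)
Theorem divergence0 D w (X : 'I_n -> 'rV[R]_n -> R) : bounded_dom D ->
  class_C 1 D w -> vanish D w -> (forall i, vbmf D (partial i w)) ->
  (forall i, class_C 1 D (X i)) -> (forall i, vbmf D (X i)) ->
  vbmf D (fun x => \sum_i partial i (X i) x) ->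
  vint D (fun x => \sum_i partial i w x * X i x + w x * \sum_i partial i (X i) x) = 0.
Proof.
move=> bD Cw vw bw CX bX bdX; have oD := bD.1; have fD := bounded_dom_fin bD.
pose F k x := \sum_i (dvtrunc (dseq k) (w x) * partial i w x) * X i x +
  vtrunc (dseq k) (w x) * \sum_i partial i (X i) x.
have F0 k : vint D (F k) = 0.
  have tp := vtrunc_test oD (dseq0 k) Cw vw.
  transitivity (vint D (fun x => \sum_i (((fun x => vtrunc (dseq k) (w x)) \_ D) x * partial i (X i) x +
      X i x * partial i ((fun x => vtrunc (dseq k) (w x)) \_ D) x))).
    apply: eq_int => x Dx; rewrite big_split /= addrC /F; congr (_ + _).
      by apply: eq_bigr => i _; rewrite partial_vtrunc// mulrC.
    by rewrite mulr_sumr; apply: eq_bigr => i _; rewrite patchE mem_set.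
  rewrite int_sum// => [|i]; last exact: (int_ibp_test i bD tp (CX i)).1.
  by rewrite big1// => i _; exact: (int_ibp_test i bD tp (CX i)).2.
have [K K0 hK] := dvtrunc_bound (R := R).
have bw0 := vanish_bmf bD Cw vw.
have [Mw hMw] := bw0.2; have [Md hMd] := bdX.2.
have [MX hMX] : exists MX : R, forall i x, D x -> `|partial i w x * X i x| <= MX.
  have h i : exists M : R, forall x, D x -> `|partial i w x * X i x| <= M.
    by have [_] := bmfM (bw i) (bX i).
  have [MX hMX] := choice h.
  exists (\sum_i `|MX i|) => i x Dx; rewrite (le_trans (hMX i x Dx))//.
  by rewrite (le_trans (ler_norm _))// (bigD1 i)//= lerDl sumr_ge0.
have cv : vint D (F k) @[k --> \oo] --> vint D (fun x => \sum_i partial i w x * X i x + w x * \sum_i partial i (X i) x).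
  apply: (int_dct (M := \sum_(i < n) K * MX + (Mw + 2) * Md)) => //.
  - move=> k; apply: measurable_realfun.measurable_funD.
      apply: (@bmf_sum _ 'rV[mR]_n R D _ _ _ _ _).1 => i.
      apply: bmfM => //; apply: bmfM => //; split; first exact: measurable_dvtrunc.
      by exists K => x _; exact: hK.
    apply: measurable_realfun.measurable_funM; last exact: bdX.1.
    apply: continuous_measurable_rV => // x Dx; apply: continuous_comp.
      exact: class_C_cont Cw Dx.
    exact: is_derive_continuous (is_derive_vtrunc _ (dseq0 k)).
  - apply: (bmfD _ _).1; last exact: bmfM.
    by apply: bmf_sum => i; exact: bmfM.
  - move=> k x Dx; rewrite /F (le_trans (ler_normD _ _))// lerD//.
      rewrite (le_trans (ler_norm_sum _ _ _))//; apply: ler_sum => i _.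
      by rewrite -mulrA normrM ler_pM//; [exact: hK|exact: hMX].
    rewrite normrM ler_pM//; last exact: hMd.
    rewrite -[vtrunc _ _](subrK (w x)) addrC (le_trans (ler_normD _ _))// lerD//; first exact: hMw.
    rewrite (le_trans (vtrunc_dist _ (dseq0 k)))// -[leRHS]mulr1 ler_pM2l// invf_le1//.
    by rewrite ler1n.
  - have ae : {ae lebesgue_rV n, forall x : 'rV[mR]_n, D x -> forall i, dvtrunc (dseq k) (w x) * partial i w x @[k --> \oo] --> partial i w x}.
      have : {ae lebesgue_rV n, forall x : 'rV[mR]_n, forall i : 'I_n, D x -> dvtrunc (dseq k) (w x) * partial i w x @[k --> \oo] --> partial i w x}.
        by apply: filter_forall => i; exact: ae_dvtrunc_partial.
      by apply: filterS => x h Dx i; exact: h.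
    apply: filterS ae => x h Dx; apply: cvgD.
      apply: cvg_bigsum => i; apply: cvgM; [exact: h|exact: cvg_cst].
    by apply: cvgM; [exact: vtrunc_cvg|exact: cvg_cst].
have : vint D (F k) @[k --> \oo] --> (0 : R).
  by under eq_fun do rewrite F0; exact: cvg_cst.
exact: (cvg_unique (@Rhausdorff R) cv).
Qed.

Lemma green0 D w f : bounded_dom D ->
  class_C 1 D w -> vanish D w -> (forall i, vbmf D (partial i w)) ->
  class_C 2 D f -> (forall i, vbmf D (partial i f)) -> vbmf D (laplacian f) ->
  vint D (fun x => gdot w f x + w x * laplacian f x) = 0.
Proof.
move=> bD Cw vw bw Cf bf bl.
exact: (divergence0 bD Cw vw bw (fun i => class_C_partial i Cf) bf bl).
Qed.

End divergence.

(** * Hardy's inequality and commutator functionals *)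

Section hardy.
Context {R : realType} {n : nat}.
Notation mR := (measurableTypeR R).
Implicit Types (D X : set 'rV[R]_n) (f g h w psi : 'rV[R]_n -> R).

Definition dir D f g : R := vint D (gdot f g).

Lemma test_class_C D psi X : test D psi -> class_C 1 X psi.
Proof. by move=> [C _]; exact: class_CS C. Qed.

Lemma test_vanish D psi : test D psi -> vanish D psi.
Proof.
by move=> [_ h] x /h h0 d d0; apply: filterS h0 => y -> _; rewrite normr0.
Qed.

Lemma bmf_gdot (D : set 'rV[R]_n) f g : (forall i, vbmf D (partial i f)) ->
  (forall i, vbmf D (partial i g)) -> vbmf D (gdot f g).
Proof. by move=> bf bg; apply: bmf_sum => i; exact: bmfM. Qed.

Lemma test_gdot_bmf D f g : bounded_dom D -> test D f -> test D g -> vbmf D (gdot f g).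
Proof. by move=> bD tf tg; apply: bmf_gdot => i; exact: test_partial_bmf. Qed.

Lemma class_C_isq_sqn k (c : R) j : 0 < c -> class_C j setT (fun x : 'rV[R]_n => isq k (sqn x + c)).
Proof.
move=> c0; have pos (x : 'rV[R]_n) : setT x -> [set y | 0 < y] (sqn x + c).
  by move=> _ /=; rewrite ltr_wpDl// sqn_ge0.
have C1 : class_C j setT (fun x : 'rV[R]_n => sqn x + c).
  by apply: class_CD; [exact: openT|exact: class_C_sqn|apply: class_C_cst; exact: openT].
have := class_C_comp1 openT pos (smooth1_isq j k 1) C1.
by under eq_fun do rewrite mul1r.
Qed.

Lemma partial_isq_sqn k (c : R) i (x : 'rV[R]_n) : 0 < c ->
  partial i (fun x => isq k (sqn x + c)) x = - k%:R * isq k.+2 (sqn x + c) * x ord0 i.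
Proof.
move=> c0; have pos : 0 < sqn x + c by rewrite ltr_wpDl// sqn_ge0.
have C1 : class_C 1 setT (fun x : 'rV[R]_n => sqn x + c).
  by apply: class_CD; [exact: openT|exact: class_C_sqn|apply: class_C_cst; exact: openT].
rewrite (@partial_comp1 _ _ setT i x I _ _ _ C1 (is_derive_isq k pos)).
rewrite (partialD i (I : setT x) (class_C_sqn 1) (class_C_cst 1 c openT)).
rewrite partial_sqn partial_cst addr0.
by move: (isq _ _) (x _ _) => a b; field.
Qed.

Lemma discriminant_le (A B C : R) : 0 <= A ->
  (forall z, 0 <= A * z ^+ 2 + 2 * B * z + C) -> B ^+ 2 <= A * C.
Proof.
move=> A0 pos; have [A0'|A0'] := eqVneq A 0.
  have B0 : B = 0.
    apply/eqP/negP => /negP B0.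
    have := pos (- (C + 1) / (2 * B)); rewrite A0' mul0r add0r mulrCA mulfV ?mulr1 ?mulf_neq0//.
    by lra.
  by rewrite B0 A0' mul0r expr0n.
have Ap : 0 < A by rewrite lt_neqAle eq_sym A0' A0.
have := pos (- B / A).
rewrite (_ : _ + C = (A * C - B ^+ 2) / A); last by field.
by rewrite pmulr_lge0 ?invr_gt0// subr_ge0.
Qed.

(** The divergence theorem for psi^2 X with X = x / (|x|^2 + k). With q = 1 / (|x|^2 + k) one has
    div X >= (n-2) q >= q, and Young's inequality leaves half of it on the left. The shift k > 0
    keeps X smooth at the origin, which may lie in D; the constant 4 is the same for all k. *)
Lemma hardy D psi (k : R) : (3 <= n)%N -> bounded_dom D -> test D psi -> 0 < k ->
  vint D (fun x => psi x ^+ 2 * isq 2 (sqn x + k)) <= 4 * dir D psi psi.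
Proof.
move=> n3 bD tp k0; have oD := bD.1; have fD := bounded_dom_fin bD.
have [c Dc] := bD.2.
pose q (x : 'rV[R]_n) := isq 2 (sqn x + k).
pose X (i : 'I_n) (x : 'rV[R]_n) := q x * x ord0 i.
have pos (x : 'rV[R]_n) : 0 < sqn x + k by rewrite ltr_wpDl// sqn_ge0.
have Cq : class_C 1 D q by apply: class_CS (class_C_isq_sqn 2 1 k0).
have Cx i : class_C 1 D (fun x : 'rV[R]_n => x ord0 i) by exact: class_C_coord.
have q1 x : 0 <= q x <= k^-1.
  rewrite isq_ge0 /q isq2// lef_pV2// ?posrE// lerDr sqn_ge0//.
have bq : vbmf D q.
  apply: (class_C_bmf (k := 1) (M := k^-1)) => // x _; have /andP[a b] := q1 x.
  by rewrite ger0_norm.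
have bx i : vbmf D (fun x : 'rV[R]_n => x ord0 i).
  by exact: (class_C_bmf oD (Cx i) (fun x Dx => Dc x Dx i)).
have CX i : class_C 1 D (X i) := class_CM oD Cq (Cx i).
have bX i : vbmf D (X i) by exact: bmfM.
have dX i x : D x -> partial i (X i) x = q x - 2 * isq 4 (sqn x + k) * x ord0 i ^+ 2.
  move=> Dx; rewrite (partialM i Dx Cq (Cx i)) partial_coord eqxx mulr1 partial_isq_sqn//.
  by move: (isq 4 _) (q x) (x _ _) => a b d; rewrite expr2; ring.
have divX x : D x -> \sum_i partial i (X i) x = n%:R * q x - 2 * isq 4 (sqn x + k) * sqn x.
  move=> Dx; under eq_bigr do rewrite dX//.
  by rewrite big_split /= sumr_const card_ord sumrN -mulr_sumr -[q x *+ n]mulr_natl.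
have b4 : vbmf D (fun x => isq 4 (sqn x + k)).
  apply: (eq_bmf (f := fun x => q x * q x)); last exact: bmfM.
  by move=> x _; rewrite /q /isq -exprD.
have bs : vbmf D (@sqn R n) by apply: bmf_sum => i; exact: bmfX.
have bdX : vbmf D (fun x => \sum_i partial i (X i) x).
  apply: (eq_bmf (f := fun x => n%:R * q x - 2 * isq 4 (sqn x + k) * sqn x)).
    by move=> x Dx; rewrite divX.
  apply: bmfB; first exact: bmfZ.
  by apply: bmfM => //; exact: bmfZ.
have Cp := test_class_C D tp; have bp := test_bmf bD tp.
have bpi i := test_partial_bmf i bD tp.
have dpp i x : D x -> partial i (fun x => psi x * psi x) x = 2 * psi x * partial i psi x.
  by move=> Dx; rewrite (partialM i Dx)//; move: (psi x) (partial _ _ _) => a b; ring.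
have vp : vanish D (fun x => psi x * psi x).
  move=> x /tp.2 h d d0; apply: filterS h => y -> _.
  by rewrite mul0r normr0.
have bpp i : vbmf D (partial i (fun x => psi x * psi x)).
  apply: (eq_bmf (f := fun x => 2 * psi x * partial i psi x)).
    by move=> x Dx; rewrite dpp.
  exact: (bmfM (bmfZ 2 bp) (bpi i)).
have := divergence0 bD (class_CM oD Cp Cp) vp bpp CX bX bdX.
have bP : vbmf D (fun x => psi x ^+ 2 * q x) by apply: bmfM => //; exact: bmfX.
have bG := test_gdot_bmf bD tp tp.
have : vint D (fun x => 2^-1 * (psi x ^+ 2 * q x) - 2 * gdot psi psi x) <=
  vint D (fun x => \sum_i partial i (fun x => psi x * psi x) x * X i x + psi x * psi x * \sum_i partial i (X i) x).
  apply: le_int => //.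
  - by apply: bmfB; exact: bmfZ.
  - apply: bmfD; first by apply: bmf_sum => i; exact: bmfM.
    by apply: bmfM => //; exact: bmfM.
  move=> x Dx; rewrite divX//.
  have sq : sqn x * isq 4 (sqn x + k) <= q x.
    by rewrite /q -(isqSS 2 (pos x)) ler_wpM2r ?isq_ge0// lerDl ltW.
  (* Young's inequality in each coordinate, 2 psi X_i d_i psi >= - psi^2 X_i^2 / 2 - 2 (d_i psi)^2,
     together with |X|^2 <= q. *)
  have h1 : - (2^-1 * (psi x ^+ 2 * q x)) - 2 * gdot psi psi x <=
      \sum_i partial i (fun x => psi x * psi x) x * X i x.
    apply: (@le_trans _ _ (\sum_i (- (2^-1 * psi x ^+ 2 * (X i x) ^+ 2) - 2 * partial i psi x ^+ 2))).
      rewrite big_split /= !sumrN -!mulr_sumr -/(gdot psi psi x); apply: lerB.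
        rewrite lerN2 -mulrA ler_wpM2l ?invr_ge0// ler_wpM2l ?sqr_ge0//.
        rewrite (_ : \sum_i X i x ^+ 2 = sqn x * isq 4 (sqn x + k))//.
        rewrite /sqn mulr_suml; apply: eq_bigr => i _.
        by rewrite /X exprMn mulrC /q /isq -exprM.
      by rewrite le_eqVlt; apply/orP; left; apply/eqP.
    apply: ler_sum => i _; rewrite dpp//.
    have : 0 <= (psi x * X i x + 2 * partial i psi x) ^+ 2 by rewrite sqr_ge0.
    by move: (psi x) (X i x) (partial i psi x) => a b d; rewrite !expr2; lra.
  have h2 : psi x ^+ 2 * q x <= psi x * psi x * (n%:R * q x - 2 * isq 4 (sqn x + k) * sqn x).
    rewrite -expr2 ler_wpM2l ?sqr_ge0//.
    have : 3 * q x <= n%:R * q x.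
      by rewrite ler_wpM2r ?ler_nat//; have /andP[] := q1 x.
    rewrite -mulrA [isq 4 _ * _]mulrC; move: sq.
    by move: (n%:R * q x) (q x) (sqn x * _) => a b d; lra.
  move: h1 h2; move: (\sum_i _ * X i x) (psi x * psi x * _) (psi x ^+ 2 * q x) (gdot _ _ _).
  by move=> a b d e; lra.
move=> h h0; move: h; rewrite h0 intB// ?intZ//; [|exact: bmfZ..].
by rewrite -/(dir D psi psi); move: (vint D _) (dir _ _ _) => a b; lra.
Qed.

Lemma bmf_partial_cutoff D t i : measurable (D : set 'rV[mR]_n) -> 0 < t -> vbmf D (partial i (cutoff t)).
Proof.
move=> mD t0; have [C C0 hC] := cutoff_bound (R := R) (n := n).
apply: (bmfS (E := setT)) => //.
apply: (class_C_bmf (k := 1) (M := C / t)); first exact: openT.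
  exact: (class_C_partial i (class_C_cutoff t)).
by move=> x _; have [] := hC t x i t0.
Qed.

Lemma laplacian_cont U f : class_C 2 U f -> forall x, U x -> {for x, continuous (laplacian f)}.
Proof.
move=> Cf x Ux.
have : forall i, {for x, continuous (partial i (partial i f))}.
  by move=> i; exact: (class_C_cont (class_C_partial i (class_C_partial i Cf)) Ux).
rewrite /prop_for /laplacian; move: (index_enum _) => r h.
elim: r => [|i r IH].
  rewrite (_ : (fun x => _) = fun=> 0); first exact: cst_continuous.
  by apply/funext => y; rewrite big_nil.
rewrite (_ : (fun x => _) = fun x => partial i (partial i f) x + \sum_(j <- r) partial j (partial j f) x).
  by apply: continuousD => //; exact: h.
by apply/funext => y; rewrite big_cons.
Qed.

Lemma bmf_laplacian U f (M : R) : open U -> class_C 2 U f -> (forall x, U x -> `|laplacian f x| <= M) ->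
  vbmf U (laplacian f).
Proof.
move=> oU Cf fM; split; last by exists M.
by apply: continuous_measurable_rV => //; exact: laplacian_cont.
Qed.

Lemma bmf_laplacian_cutoff D t : measurable (D : set 'rV[mR]_n) -> 0 < t -> vbmf D (laplacian (cutoff t)).
Proof.
move=> mD t0; have [C C0 hC] := cutoff_bound (R := R) (n := n).
apply: (bmfS (E := setT)) => //.
have nz (x : 'rV[R]_n) : `|laplacian (cutoff t) x| <= C / t ^+ 2.
  have [|/negP n0] := pselect (n == 0)%N.
    move=> /eqP n0; rewrite /laplacian big1 ?normr0 ?divr_ge0// ?exprn_ge0 ?(ltW t0)//.
    by move=> [j /= hj]; exfalso; move: hj; rewrite n0.
  by move: n0; rewrite -lt0n => n0; have [] := hC t x (Ordinal n0) t0.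
exact: (bmf_laplacian openT (class_C_cutoff t) (fun x _ => nz x)).
Qed.

Lemma bmf_comm D t f : measurable (D : set 'rV[mR]_n) -> 0 < t ->
  vbmf D f -> (forall i, vbmf D (partial i f)) -> vbmf D (comm (cutoff t) f).
Proof.
move=> mD t0 bf bpf; apply: bmfD.
  by apply: bmfZ; apply: bmf_gdot => // i; exact: bmf_partial_cutoff.
by apply: bmfM => //; exact: bmf_laplacian_cutoff.
Qed.

Lemma comm_out t f x : 0 < t -> ~ ann t x -> comm (cutoff t) f x = 0.
Proof.
move=> t0 ax; rewrite /comm laplacian_cutoff_out// mulr0 addr0 /gdot big1 ?mulr0// => i _.
by rewrite partial_cutoff_out// mul0r.
Qed.

(* Both sides are the integral of the divergence of f g grad(cutoff t). *)
Lemma comm_skew D t f g : bounded_dom D -> 0 < t -> class_C 1 D f -> class_C 1 D g ->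
  vbmf D f -> vbmf D g -> (forall i, vbmf D (partial i f)) -> (forall i, vbmf D (partial i g)) ->
  (forall x, ~ D x -> forall i, \forall y \near x, D y -> f y * g y * partial i (cutoff t) y = 0) ->
  vint D (fun x => f x * comm (cutoff t) g x) = - vint D (fun x => g x * comm (cutoff t) f x).
Proof.
move=> bD t0 Cf Cg bf bg bpf bpg nz; have oD := bD.1; have fD := bounded_dom_fin bD.
have Cc : class_C 2 D (cutoff t) by apply: class_CS (class_C_cutoff t).
have Cfg := class_CM oD Cf Cg.
pose F i x := f x * g x * partial i (cutoff t) x.
have Cci i := class_C_partial i Cc.
have CF i : class_C 1 D (F i) := class_CM oD Cfg (Cci i).
have tF i : test D (F i \_ D).
  by apply: (test_patch oD (CF i)) => x nDx; exact: nz.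
have E x : D x -> \sum_i partial i (F i \_ D) x =
    2^-1 * (f x * comm (cutoff t) g x + g x * comm (cutoff t) f x).
  move=> Dx; rewrite /comm.
  have -> : \sum_i partial i (F i \_ D) x = \sum_i (f x * (partial i (cutoff t) x * partial i g x)
      + g x * (partial i (cutoff t) x * partial i f x) + f x * g x * partial i (partial i (cutoff t)) x).
    apply: eq_bigr => i _; rewrite (partial_patch _ _ oD Dx) (partialM i Dx Cfg (Cci i)).
    rewrite (partialM i Dx Cf Cg); move: (partial i (partial i (cutoff t)) x) (partial i (cutoff t) x) (partial i f x) (partial i g x).
    by move: (f x) (g x) => a b p q r s; ring.
  rewrite !big_split /= -!mulr_sumr -/(gdot _ _ _) -/(gdot _ _ _) -/(laplacian _ _).
  by move: (gdot _ _ _) (gdot _ _ _) (laplacian _ _) (f x) (g x) => a b d e r; field.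
have bfc : vbmf D (fun x => f x * comm (cutoff t) g x).
  by apply: bmfM => //; apply: bmf_comm => //; case: fD.
have bgc : vbmf D (fun x => g x * comm (cutoff t) f x).
  by apply: bmfM => //; apply: bmf_comm => //; case: fD.
have : vint D (fun x => \sum_i partial i (F i \_ D) x) = 0.
  rewrite int_sum// => [|i]; last exact: test_partial_bmf.
  by rewrite big1// => i _; exact: int_partial_test.
have -> : vint D (fun x => \sum_i partial i (F i \_ D) x) = vint D (fun x => 2^-1 *
    (f x * comm (cutoff t) g x + g x * comm (cutoff t) f x)) by exact: eq_int.
rewrite intZ//; last exact: bmfD.
by rewrite intD//; move: (vint D _) (vint D _) => a b; lra.
Qed.

(** By skewness this is, up to sign, the integral of psi against the commutator of h. With the
    derivatives moved to psi, only the sup norm of h is felt; this is how the Laplacian of a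
    truncated solution acts on test functions. *)
Definition lam X t h psi : R := vint X (fun x => h x * comm (cutoff t) psi x).

Lemma cutoff_near_out t (x : 'rV[R]_n) i : 0 < t -> ~ ann t x -> \forall y \near x, partial i (cutoff t) y = 0.
Proof.
move=> t0 /negP; rewrite negb_and -!leNgt => h.
have t20 : 0 < t ^+ 2 by rewrite exprn_gt0.
case/orP: h => h.
  have : \forall y \near x, [set z | sqn z < 2 * t ^+ 2] y.
    by apply: open_nbhs_nbhs; split; [exact: open_sqn_lt|rewrite /=; lra].
  by apply: filterS => y /= hy; rewrite partial_cutoff// dstep0 ?mul0r// ltr_pdivrMr//; left.
have : \forall y \near x, [set z | 3 * t ^+ 2 < sqn z] y.
  apply: open_nbhs_nbhs; split; first exact: open_sqn_gt.
  by rewrite /=; move: h; rewrite exprMn; move: (sqn x) => a; rewrite [2 ^+ 2]expr2; lra.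
by apply: filterS => y /= hy; rewrite partial_cutoff// dstep0 ?mul0r// ltr_pdivlMr//; right.
Qed.

(** No boundary term arises: psi is 0 near the complement of D, and the cutoff is locally constant
    near the complement of the annulus. *)
Lemma lam_dual D t psi f : bounded_dom D -> 0 < t -> test D psi ->
  class_C 1 (D `&` ann t) f -> vbmf (D `&` ann t) f ->
  (forall i, vbmf (D `&` ann t) (partial i f)) ->
  vint (D `&` ann t) (fun x => psi x * comm (cutoff t) f x) = - lam (D `&` ann t) t f psi.
Proof.
move=> bD t0 tp Cf bf bpf; have oD := bD.1.
have bO : bounded_dom (D `&` ann t).
  split; first by apply: openI => //; exact: open_ann.
  by have [c Dc] := bD.2; exists c => x [/Dc].
have mO := (bounded_dom_fin bO).1; have mD := (bounded_dom_fin bD).1.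
have DO : D `&` ann t `<=` D by move=> x [].
apply: comm_skew => //.
- exact: test_class_C tp.
- exact: (bmfS mD DO mO (test_bmf bD tp)).
- by move=> i; exact: (bmfS mD DO mO (test_partial_bmf i bD tp)).
move=> x nO i; have [Dx|nDx] := pselect (D x).
  have nax : ~ ann t x by move=> ax; apply: nO.
  by have := cutoff_near_out i t0 nax; apply: filterS => y -> _; rewrite mulr0.
by have := tp.2 x nDx; apply: filterS => y -> _; rewrite !mul0r.
Qed.

Lemma lebesgue_cube (c : R) : 0 <= c -> vol (lebesgue_rV n) (cube c : set 'rV[mR]_n) = (2 * c) ^+ n.
Proof.
move=> c0.
have E : cube c = [set x : 'rV[mR]_n | forall i, [set` `[- c, c]] (x ord0 i)].
  by apply/seteqP; split => x h i; have := h i; rewrite /= in_itv/= ler_norml.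
have H := @lebesgue_rV_box R n (fun=> [set` `[- c, c]]) (fun=> measurable_itv _).
rewrite /vol E; apply: etrans (congr1 fine H) _.
suff -> : (\prod_(i < n) lebesgue_measure ([set` `[(- c)%R, c]] : set mR))%E = ((2 * c) ^+ n)%:E by [].
elim: (n) => [|k IH]; first by rewrite big_ord0.
rewrite big_ord_recr /= IH lebesgue_measure_itv/= lte_fin.
case: ifPn => [_|]; first by rewrite -EFinD -EFinM exprSr; congr ((_ * _)%:E); ring.
rewrite -leNgt => h; have -> : c = 0 by lra.
by rewrite mulr0 mule0 exprS mul0r.
Qed.

(** Cauchy-Schwarz: the annulus has volume of order t^n, the squared commutator is at most of order
    t^(-2) times |grad psi|^2 + psi^2 / (|x|^2 + t^2), and Hardy's inequality with k = t^2 bounds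
    the integral of the sum. The factor t^(n-2) is the source of all later smallness. *)
Lemma lam_bound : (3 <= n)%N -> exists2 C : R, 0 <= C &
  forall D X t h (H : R) psi, bounded_dom D -> measurable (X : set 'rV[mR]_n) ->
  X `<=` D `&` ann t -> 0 < t -> vbmf X h -> (forall x, X x -> `|h x| <= H) -> 0 <= H ->
  test D psi -> lam X t h psi ^+ 2 <= C * H ^+ 2 * t ^+ (n - 2) * dir D psi psi.
Proof.
move=> n3; have [C C0 hC] := cutoff_bound (R := R) (n := n).
have n0 : (0 < n)%N by apply: leq_trans n3.
(* From (2a + b)^2 <= 8 a^2 + 2 b^2, the 10 being 2 * 5 as |x|^2 + t^2 < 5 t^2 on the annulus. In
   the final constant, 4^n t^n is the volume of a cube of side 4 t, and 5 = 1 + 4 adds the Dirichlet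
   and the Hardy terms. *)
pose K := 8 * n%:R * C ^+ 2 + 10 * C ^+ 2.
have K0 : 0 <= K by rewrite addr_ge0// !mulr_ge0// ?sqr_ge0.
exists (4 ^+ n * (5 * K)); first by rewrite mulr_ge0 ?exprn_ge0 ?mulr_ge0.
move=> D X t h H psi bD mX XD t0 bh hH H0 tp.
have t20 : 0 < t ^+ 2 by rewrite exprn_gt0.
have fD := bounded_dom_fin bD; have mD := fD.1.
have XD1 : X `<=` D by move=> x /XD[].
have fX : vfin X by exact: (fin_measS mX fD XD1).
have bp := test_bmf bD tp; have bpi i := test_partial_bmf i bD tp.
have bpX := bmfS mD XD1 mX bp.
have bpiX i := bmfS mD XD1 mX (bpi i).
have bc : vbmf X (comm (cutoff t) psi) by exact: bmf_comm.
have bG : vbmf D (gdot psi psi) by exact: bmf_gdot.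
pose q (x : 'rV[R]_n) := isq 2 (sqn x + t ^+ 2).
have bq : vbmf D (fun x => psi x ^+ 2 * q x).
  apply: bmfM; first exact: bmfX.
  have pos (x : 'rV[R]_n) : 0 < sqn x + t ^+ 2 by rewrite ltr_wpDl// sqn_ge0.
  apply: (class_C_bmf (k := 1) (M := (t ^+ 2)^-1)); first exact: bD.1.
    by apply: class_CS (class_C_isq_sqn 2 1 t20).
  move=> x _; rewrite ger0_norm ?isq_ge0// /q isq2// lef_pV2// ?posrE// lerDr sqn_ge0//.
have pw x : X x -> comm (cutoff t) psi x ^+ 2 <= K / t ^+ 2 * (gdot psi psi x + psi x ^+ 2 * q x).
  move=> Xx; have [_ ax] := XD x Xx.
  have hl : `|laplacian (cutoff t) x| <= C / t ^+ 2 by have [] := hC t x (Ordinal n0) t0.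
  have g2 : gdot (cutoff t) psi x ^+ 2 <= n%:R * (C / t) ^+ 2 * gdot psi psi x.
    apply: (@le_trans _ _ ((\sum_i partial i (cutoff t) x ^+ 2) * gdot psi psi x)).
      have pos (z : R) : 0 <= (\sum_i partial i (cutoff t) x ^+ 2) * z ^+ 2 +
          2 * gdot (cutoff t) psi x * z + gdot psi psi x.
        apply: (@le_trans _ _ (\sum_i (partial i (cutoff t) x * z + partial i psi x) ^+ 2)).
          by apply: sumr_ge0 => i _; rewrite sqr_ge0.
        rewrite le_eqVlt; apply/orP; left; apply/eqP.
        rewrite /gdot mulr_suml mulr_sumr mulr_suml -!big_split /=; apply: eq_bigr => i _.
        by move: (partial _ _ _) (partial _ _ _) => a b; ring.
      have A0 : 0 <= \sum_i partial i (cutoff t) x ^+ 2 by apply: sumr_ge0 => i _; rewrite sqr_ge0.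
      exact: (discriminant_le A0 pos).
    rewrite ler_wpM2r//; first by apply: sumr_ge0 => i _; rewrite -expr2 sqr_ge0.
    rewrite -[X in X%:R * _]card_ord -sum1_card natr_sum mulr_suml; apply: ler_sum => i _.
    rewrite mul1r -(real_normK (num_real (partial _ _ _))) ler_pXn2r// ?nnegrE//.
      by have [] := hC t x i t0.
    by rewrite divr_ge0// ltW.
  have l2 : psi x ^+ 2 * laplacian (cutoff t) x ^+ 2 <= psi x ^+ 2 * q x * (5 * C ^+ 2 / t ^+ 2).
    rewrite -mulrA ler_wpM2l ?sqr_ge0//.
    apply: (@le_trans _ _ ((C / t ^+ 2) ^+ 2)).
      by rewrite -(real_normK (num_real (laplacian _ _))) ler_pXn2r// ?nnegrE// divr_ge0// ltW.
    have pos : 0 < sqn x + t ^+ 2 by rewrite ltr_wpDl// sqn_ge0.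
    rewrite /q isq2// [leRHS]mulrC ler_pdivlMr//.
    rewrite (_ : 5 * C ^+ 2 / t ^+ 2 = (C / t ^+ 2) ^+ 2 * (5 * t ^+ 2)); last first.
      by field; exact: lt0r_neq0.
    rewrite ler_wpM2l ?sqr_ge0//.
    by case/andP: ax => _; rewrite exprMn; move: (sqn x) => a; rewrite [2 ^+ 2]expr2; lra.
  have e : comm (cutoff t) psi x ^+ 2 <=
      8 * gdot (cutoff t) psi x ^+ 2 + 2 * (psi x ^+ 2 * laplacian (cutoff t) x ^+ 2).
    rewrite /comm; have : 0 <= (2 * gdot (cutoff t) psi x - psi x * laplacian (cutoff t) x) ^+ 2 by rewrite sqr_ge0.
    by move: (gdot _ _ _) (psi x) (laplacian _ _) => a b d; rewrite !expr2; lra.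
  apply: (le_trans e); rewrite /K.
  have G0 : 0 <= gdot psi psi x by apply: sumr_ge0 => i _; rewrite -expr2 sqr_ge0.
  have P0 : 0 <= psi x ^+ 2 * q x by rewrite mulr_ge0 ?sqr_ge0// isq_ge0.
  have -> : (8 * n%:R * C ^+ 2 + 10 * C ^+ 2) / t ^+ 2 * (gdot psi psi x + psi x ^+ 2 * q x) =
    8 * (n%:R * (C / t) ^+ 2 * gdot psi psi x) + 2 * (psi x ^+ 2 * q x * (5 * C ^+ 2 / t ^+ 2))
    + (8 * n%:R * C ^+ 2 / t ^+ 2) * (psi x ^+ 2 * q x) + 10 * C ^+ 2 / t ^+ 2 * gdot psi psi x.
    move: (gdot _ _ _) (psi x ^+ 2 * q x) (n%:R : R) => a b d; field; exact: lt0r_neq0.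
  have z1 : 0 <= (8 * n%:R * C ^+ 2 / t ^+ 2) * (psi x ^+ 2 * q x).
    by rewrite mulr_ge0// divr_ge0 ?(ltW t20)// !mulr_ge0// sqr_ge0.
  have z2 : 0 <= 10 * C ^+ 2 / t ^+ 2 * gdot psi psi x.
    by rewrite mulr_ge0// divr_ge0 ?(ltW t20)// mulr_ge0// sqr_ge0.
  move: g2 l2 z1 z2.
  move: (gdot _ _ _ ^+ 2) (_ * laplacian _ _ ^+ 2) (_ * (psi x ^+ 2 * q x)) (_ * gdot psi psi x)
    (_ * gdot psi psi x) (_ * (5 * C ^+ 2 / t ^+ 2)) => a b d r p o.
  by lra.
have bc2 := bmfX 2 bc; have bh2 := bmfX 2 bh.
apply: le_trans (int_cauchy_schwarz fX bh bc) _.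
have B1 : vint X (fun x => h x ^+ 2) <= H ^+ 2 * (4 ^+ n * t ^+ n).
  apply: (@le_trans _ _ (vint X (fun=> H ^+ 2))).
    apply: le_int => // [|x Xx]; first exact: bmf_cst.
    by rewrite -(real_normK (num_real (h x))) ler_pXn2r// ?nnegrE// hH.
  rewrite int_cst// ler_wpM2l ?sqr_ge0// -exprMn.
  have t2 : 0 <= 2 * t by rewrite mulr_ge0// ltW.
  rewrite (_ : 4 * t = 2 * (2 * t)); last by ring.
  rewrite -lebesgue_cube//; apply: le_vol => //; first exact: fin_meas_cube.
  by move=> x /XD[_ /ann_hball]; exact: hball_cube.
have B2 : vint X (fun x => comm (cutoff t) psi x ^+ 2) <= K / t ^+ 2 * (5 * dir D psi psi).
  have Kt : 0 <= K / t ^+ 2 by rewrite divr_ge0// ltW.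
  have bb : vbmf D (fun x => gdot psi psi x + psi x ^+ 2 * q x) by exact: bmfD.
  apply: (@le_trans _ _ (vint X (fun x => K / t ^+ 2 * (gdot psi psi x + psi x ^+ 2 * q x)))).
    apply: le_int => //; apply: bmfZ; exact: (bmfS mD XD1 mX bb).
  rewrite intZ//; last exact: (bmfS mD XD1 mX bb).
  rewrite ler_wpM2l//; apply: (@le_trans _ _ (vint D (fun x => gdot psi psi x + psi x ^+ 2 * q x))).
    apply: le_int_set => // x _; rewrite addr_ge0//.
      by apply: sumr_ge0 => i _; rewrite -expr2 sqr_ge0.
    by rewrite mulr_ge0 ?sqr_ge0// isq_ge0.
  rewrite intD//; have := hardy n3 bD tp t20; rewrite -/(dir D psi psi).
  by move: (vint D _) (dir _ _ _) => a b; lra.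
have i0 : 0 <= vint X (fun x => comm (cutoff t) psi x ^+ 2) by apply: int_ge0 => x _; rewrite sqr_ge0.
have j0 : 0 <= vint X (fun x => h x ^+ 2) by apply: int_ge0 => x _; rewrite sqr_ge0.
apply: (le_trans (ler_pM j0 i0 B1 B2)).
have -> : t ^+ n = t ^+ (n - 2) * t ^+ 2 by rewrite -exprD subnK// ltnW.
rewrite le_eqVlt; apply/orP; left; apply/eqP.
by move: (dir _ _ _) (t ^+ (n - 2)) (4 ^+ n) => a b d; field; exact: lt0r_neq0.
Qed.

End hardy.

(** * Riesz representation by minimizing sequences *)

Section riesz.
Context {R : realType} {n : nat}.
Notation mR := (measurableTypeR R).
Variable D : set 'rV[R]_n.
Hypothesis bD : bounded_dom D.
Implicit Types (f g w psi phi : 'rV[R]_n -> R) (l : ('rV[R]_n -> R) -> R).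

Let oD : open D. Proof. by case: bD. Qed.
Let fD : vfin D. Proof. exact: bounded_dom_fin. Qed.

Lemma test_lin (a : R) f g : test D f -> test D g -> test D (fun x => a * f x + g x).
Proof.
move=> [Cf hf] [Cg hg]; split.
  exact: (class_CD openT (class_CZ a openT Cf) Cg).
by move=> x nDx; apply: filterS2 (hf x nDx) (hg x nDx) => y -> ->; rewrite mulr0 addr0.
Qed.

Lemma test0 : test D (fun=> 0).
Proof.
split; first exact: (class_C_cst 1 0 openT).
by move=> x _; near=> y.
Unshelve. all: by end_near.
Qed.

Lemma partial_lin (a : R) f g i x : class_C 1 D f -> class_C 1 D g -> D x ->
  partial i (fun x => a * f x + g x) x = a * partial i f x + partial i g x.
Proof.
move=> Cf Cg Dx; rewrite (partialD i Dx (class_CZ a oD Cf) Cg).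
by rewrite (partialM i Dx (class_C_cst 1 a oD) Cf) partial_cst mulr0 addr0.
Qed.

Lemma test_sub f g : test D f -> test D g -> test D (fun x => f x - g x).
Proof.
move=> tf tg; have := test_lin (-1) tg tf.
by under eq_fun do rewrite mulN1r addrC.
Qed.

Definition has_grad f := class_C 1 D f /\ forall i, vbmf D (partial i f).

Lemma test_has_grad f : test D f -> has_grad f.
Proof.
by move=> tf; split; [exact: test_class_C tf|move=> i; exact: test_partial_bmf].
Qed.

Lemma has_grad_lin (a : R) f g : has_grad f -> has_grad g -> has_grad (fun x => a * f x + g x).
Proof.
move=> [Cf bf] [Cg bg]; split; first exact: (class_CD oD (class_CZ a oD Cf) Cg).
move=> i; apply: (eq_bmf (f := fun x => a * partial i f x + partial i g x)).
  by move=> x Dx; rewrite partial_lin.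
exact: (bmfD (bmfZ a (bf i)) (bg i)).
Qed.

Lemma dirC f g : dir D f g = dir D g f.
Proof. by apply: eq_int => x _; apply: eq_bigr => i _; rewrite mulrC. Qed.

Lemma dir_linl (a : R) f g h : has_grad f -> has_grad g -> has_grad h ->
  dir D (fun x => a * f x + g x) h = a * dir D f h + dir D g h.
Proof.
move=> [Cf bf] [Cg bg] [_ bh].
have bfh := bmf_gdot bf bh; have bgh := bmf_gdot bg bh.
rewrite /dir -(intZ a fD bfh) -(intD fD (bmfZ a bfh) bgh); apply: eq_int => x Dx.
rewrite /gdot mulr_sumr -big_split /=; apply: eq_bigr => i _.
by rewrite partial_lin// mulrDl mulrA.
Qed.

Lemma dir_linr (a : R) f g h : has_grad f -> has_grad g -> has_grad h ->
  dir D h (fun x => a * f x + g x) = a * dir D h f + dir D h g.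
Proof.
by move=> hf hg hh; rewrite dirC (dir_linl a hf hg hh) (dirC f) (dirC g).
Qed.

Lemma dir_ge0 f : 0 <= dir D f f.
Proof. by apply: int_ge0 => x _; apply: sumr_ge0 => i _; rewrite -expr2 sqr_ge0. Qed.

Opaque dir.

Lemma dir_cauchy_schwarz f g : has_grad f -> has_grad g ->
  dir D f g ^+ 2 <= dir D f f * dir D g g.
Proof.
move=> hf hg; apply: discriminant_le; first exact: dir_ge0.
move=> z; have -> : dir D f f * z ^+ 2 + 2 * dir D f g * z + dir D g g =
    dir D (fun x => z * f x + g x) (fun x => z * f x + g x).
  have hz := has_grad_lin z hf hg.
  rewrite (dir_linl z hf hg hz) (dir_linr z hf hg hf) (dir_linr z hf hg hg) (dirC g f).
  by move: (dir D f f) (dir D f g) (dir D g g) => a b c; ring.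
exact: dir_ge0.
Qed.

Definition dnorm f : R := Num.sqrt (dir D f f).

Lemma dnorm_ge0 f : 0 <= dnorm f. Proof. exact: sqrtr_ge0. Qed.

Lemma dnorm_sqr f : dnorm f ^+ 2 = dir D f f.
Proof. by rewrite sqr_sqrtr// dir_ge0. Qed.

Lemma dir_le_dnorm f g : has_grad f -> has_grad g -> `|dir D f g| <= dnorm f * dnorm g.
Proof.
move=> hf hg; have := dir_cauchy_schwarz hf hg.
rewrite -(dnorm_sqr f) -(dnorm_sqr g) -exprMn -(real_normK (num_real (dir D f g))).
by rewrite ler_pXn2r// nnegrE// mulr_ge0// dnorm_ge0.
Qed.

Definition bddf l (k : R) : Prop :=
  [/\ forall a f g, test D f -> test D g -> l (fun x => a * f x + g x) = a * l f + l g,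
      0 <= k & forall psi, test D psi -> `|l psi| <= k * dnorm psi].

Lemma bddf_sub l k f g : bddf l k -> test D f -> test D g ->
  l (fun x => f x - g x) = l f - l g.
Proof.
move=> [h _ _] tf tg; have := h (-1) g f tg tf.
by rewrite mulN1r addrC => <-; congr l; apply/funext => x; rewrite mulN1r addrC.
Qed.

(** The test functions are not complete for the Dirichlet norm; an exact Riesz representative is
    replaced by one with an error d in the dual norm. *)
Definition rep_error l phi (d : R) : Prop :=
  test D phi /\ forall psi, test D psi -> `|l psi - dir D phi psi| <= d * dnorm psi.

(** Take phi within e^2 of the infimum of psi |-> [dir D psi psi - 2 * l psi]. Comparison with phi -
    z psi for every z gives a nonnegative quadratic polynomial in z, whose discriminant is the
    required bound. *)
Lemma riesz l k (e : R) : bddf l k -> 0 < e -> exists phi, rep_error l phi e.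
Proof.
move=> [lin k0 bl] e0; pose J psi := dir D psi psi - 2 * l psi.
pose S := [set J psi | psi in test D].
have lbS : lbound S (- k ^+ 2).
  move=> _ [psi tp <-]; rewrite /J -dnorm_sqr; have := bl _ tp; rewrite ler_norml => /andP[_ h].
  have : 0 <= (dnorm psi - k) ^+ 2 by rewrite sqr_ge0.
  by move: h; move: (dnorm psi) (l psi) => a b; rewrite !expr2; lra.
have S0 : has_inf S.
  by split; [exists (J (fun=> 0)), (fun=> 0) => //; exact: test0|exists (- k ^+ 2)].
have e20 : 0 < e ^+ 2 by rewrite exprn_gt0.
have [_ [phi tphi <-] hphi] := inf_adherent e20 S0.
exists phi; split => // psi tpsi.
have hf := test_has_grad tphi; have hg := test_has_grad tpsi.
rewrite -(ler_pXn2r (n := 2))// ?nnegrE ?mulr_ge0 ?dnorm_ge0 ?(ltW e0)//.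
rewrite real_normK ?num_real// exprMn dnorm_sqr mulrC.
apply: discriminant_le; first exact: dir_ge0.
move=> z; have tz := test_lin (- z) tpsi tphi.
have : inf S <= J (fun x => - z * psi x + phi x).
  by apply: (inf_lbound S0.2); exists (fun x => - z * psi x + phi x).
have hz := has_grad_lin (- z) hg hf.
rewrite /J (dir_linl (- z) hg hf hz) (dir_linr (- z) hg hf hg) (dir_linr (- z) hg hf hf).
rewrite (lin _ _ _ tpsi tphi) (dirC psi phi).
move: hphi; rewrite /J; move: (inf S) (dir D psi psi) (dir D phi psi) (dir D phi phi) (l psi) (l phi).
by move=> a b c d p q; rewrite !expr2; lra.
Qed.

(** Both error bounds are tested against the difference itself. Hence representatives whose errors
    tend to 0 form a Cauchy sequence. *)
Lemma rep_error_dist l phi psi d e : 0 <= d -> 0 <= e -> rep_error l phi d -> rep_error l psi e ->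
  dnorm (fun x => phi x - psi x) <= d + e.
Proof.
move=> d0 e0 [tp hp] [tq hq]; have tpq := test_sub tp tq.
have [->|pos] := eqVneq (dnorm (fun x => phi x - psi x)) 0; first exact: addr_ge0.
have {}pos : 0 < dnorm (fun x => phi x - psi x) by rewrite lt_neqAle eq_sym pos dnorm_ge0.
rewrite -(ler_pM2r pos) -expr2 dnorm_sqr mulrDl.
have hf := test_has_grad tp; have hg := test_has_grad tq; have hh := test_has_grad tpq.
have -> : dir D (fun x => phi x - psi x) (fun x => phi x - psi x) =
    dir D phi (fun x => phi x - psi x) - dir D psi (fun x => phi x - psi x).
  have E : (fun x => -1 * psi x + phi x) = (fun x => phi x - psi x).
    by apply/funext => x; rewrite mulN1r addrC.
  by have := dir_linl (-1) hg hf hh; rewrite E mulN1r addrC => ->.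
have := hp _ tpq; have := hq _ tpq.
move: (dnorm _) (dir D phi _) (dir D psi _) (l _) => a b c p.
by rewrite !ler_norml => /andP[? ?] /andP[? ?]; lra.
Qed.

Definition riesz_seq l : nat -> 'rV[R]_n -> R :=
  xget (fun _ _ => 0) [set phi | forall k, rep_error l (phi k) k.+1%:R^-1].

Lemma riesz_seqP l k j : bddf l k -> rep_error l (riesz_seq l j) j.+1%:R^-1.
Proof.
move=> bl; rewrite /riesz_seq; case: xgetP => [phi _ h|h]; first exact: h.
have ex i : exists phi, rep_error l phi i.+1%:R^-1.
  by apply: (riesz bl); rewrite invr_gt0.
by have [phi hphi] := choice ex; case: (h phi).
Qed.

(* The Dirichlet inner product of the representatives of l and l'. *)
Definition dual l l' : R := limn (fun k => l' (riesz_seq l k)).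

Lemma seq_inv_cvg0 : (fun k : nat => k.+1%:R^-1 : R) @ \oo --> (0 : R).
Proof.
apply/cvgrPdist_lt => e e0; have := near_infty_natSinv_lt (PosNum e0).
by apply: filterS => k /= h; rewrite sub0r normrN gtr0_norm ?invr_gt0.
Qed.

Lemma riesz_seq_cvg l l' k k' : bddf l k -> bddf l' k' ->
  (fun j => l' (riesz_seq l j)) @ \oo --> dual l l'.
Proof.
move=> bl bl'; apply/cauchy_cvgP/cauchy_exP => e e0.
have [_ k0 hl'] := bl'.
have k1 : 0 < k' + 1 by rewrite ltr_wpDl.
have e1 : 0 < e / (2 * (k' + 1)) by rewrite divr_gt0// mulr_gt0.
have [N _ hN] := near_infty_natSinv_lt (PosNum e1).
exists (l' (riesz_seq l N)); exists N => // j /= Nj.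
have rN := riesz_seqP N bl; have rj := riesz_seqP j bl.
rewrite -ball_normE /= -(bddf_sub bl' rN.1 rj.1).
apply: le_lt_trans (hl' _ (test_sub rN.1 rj.1)) _.
have := rep_error_dist (ltW _) (ltW _) rN rj.
rewrite !invr_gt0 !ltr0Sn => /(_ isT isT) hd.
have a1 := hN N (leqnn N); have a2 := hN j Nj; rewrite /= in a1 a2.
apply: (@le_lt_trans _ _ ((k' + 1) * (N.+1%:R^-1 + j.+1%:R^-1))).
  by apply: ler_pM => //; [exact: dnorm_ge0|rewrite lerDl].
rewrite -ltr_pdivlMl//; move: a1 a2; rewrite invfM mulrA => a1 a2.
rewrite (_ : (k' + 1)^-1 * e = e / 2 / (k' + 1) + e / 2 / (k' + 1)); first exact: ltrD.
by field; exact: lt0r_neq0.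
Qed.

(** Independence of the chosen sequence. Left linearity, left extensionality and the identification
    with classical solutions all exhibit a more convenient sequence of representatives. *)
Lemma dual_cvg l l' k k' (psi : nat -> 'rV[R]_n -> R) (d : nat -> R) :
  bddf l k -> bddf l' k' -> (forall j, 0 <= d j) -> d @ \oo --> (0 : R) ->
  (forall j, rep_error l (psi j) (d j)) -> (fun j => l' (psi j)) @ \oo --> dual l l'.
Proof.
move=> bl bl' d0 dcv hpsi; have [_ k0 hl'] := bl'.
have h1 := riesz_seq_cvg bl bl'.
have h2 : (fun j => l' (psi j) - l' (riesz_seq l j)) @ \oo --> (0 : R).
  have hd : (fun j => k' * (d j + j.+1%:R^-1)) @ \oo --> (0 : R).
    rewrite (_ : (0 : R) = k' * (0 + 0)); last by rewrite addr0 mulr0.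
    apply: cvgM; first exact: cvg_cst.
    by apply: cvgD => //; exact: seq_inv_cvg0.
  apply: norm_cvg0; apply: (squeeze_cvgr _ (cvg_cst 0) hd).
  near=> j; rewrite normr_ge0 /=.
  have rj := riesz_seqP j bl.
  rewrite -(bddf_sub bl' (hpsi j).1 rj.1).
  apply: le_trans (hl' _ (test_sub (hpsi j).1 rj.1)) _.
  rewrite ler_wpM2l//; apply: (rep_error_dist (d0 j) _ (hpsi j) rj).
  by rewrite invr_ge0.
rewrite (_ : (fun j => l' (psi j)) =
    (fun j => l' (riesz_seq l j) + (l' (psi j) - l' (riesz_seq l j)))); last first.
  by apply/funext => j; rewrite addrC subrK.
by rewrite -[dual l l']addr0; apply: cvgD.
Unshelve. all: by end_near. Qed.

(** Two functionals that agree on test functions may have different chosen sequences [riesz_seq], so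
    this needs a limit argument, unlike the right-hand version. *)
Lemma dual_extl l1 l2 l' k1 k2 k' : bddf l1 k1 -> bddf l2 k2 -> bddf l' k' ->
  (forall psi, test D psi -> l1 psi = l2 psi) -> dual l1 l' = dual l2 l'.
Proof.
move=> b1 b2 b' e.
have h : forall j, rep_error l2 (riesz_seq l1 j) j.+1%:R^-1.
  move=> j; have [t h] := riesz_seqP j b1; split => // psi tp; rewrite -e//; exact: h.
apply: (cvg_unique (@Rhausdorff R) (riesz_seq_cvg b1 b')).
by apply: (dual_cvg b2 b' _ seq_inv_cvg0 h) => j; rewrite invr_ge0.
Qed.

Lemma dual_extr l l1 l2 k : bddf l k ->
  (forall psi, test D psi -> l1 psi = l2 psi) -> dual l l1 = dual l l2.
Proof.
move=> b e; rewrite /dual.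
suff -> : (fun k => l1 (riesz_seq l k)) = (fun k => l2 (riesz_seq l k)) by [].
apply/funext => j; apply: e.
by have [] := riesz_seqP j b.
Qed.

Lemma dual_linr (a : R) l l1 l2 k k1 k2 : bddf l k -> bddf l1 k1 -> bddf l2 k2 ->
  dual l (fun psi => a * l1 psi + l2 psi) = a * dual l l1 + dual l l2.
Proof.
move=> b b1 b2.
have h : (fun j => a * l1 (riesz_seq l j) + l2 (riesz_seq l j)) @ \oo --> a * dual l l1 + dual l l2.
  apply: cvgD; last exact: (riesz_seq_cvg b b2).
  by apply: cvgM; [exact: cvg_cst|exact: (riesz_seq_cvg b b1)].
exact: (cvg_lim (@Rhausdorff R) h).
Qed.

Lemma bddf_lin (a : R) l1 l2 k1 k2 : bddf l1 k1 -> bddf l2 k2 ->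
  bddf (fun psi => a * l1 psi + l2 psi) (`|a| * k1 + k2).
Proof.
move=> [L1 k10 h1] [L2 k20 h2]; split.
- move=> b f g tf tg; rewrite L1// L2//.
  by move: (l1 f) (l1 g) (l2 f) (l2 g) => p q r s; ring.
- by rewrite addr_ge0// mulr_ge0.
- move=> psi tp; rewrite (le_trans (ler_normD _ _))// mulrDl lerD ?h2//.
  by rewrite normrM -mulrA ler_wpM2l// h1.
Qed.

Lemma dual_linl (a : R) l1 l2 l' k1 k2 k' : bddf l1 k1 -> bddf l2 k2 -> bddf l' k' ->
  dual (fun psi => a * l1 psi + l2 psi) l' = a * dual l1 l' + dual l2 l'.
Proof.
move=> b1 b2 b'; have b12 := bddf_lin a b1 b2.
pose psi j := (fun x => a * riesz_seq l1 j x + riesz_seq l2 j x).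
have hpsi j : rep_error (fun psi => a * l1 psi + l2 psi) (psi j) ((`|a| + 1) * j.+1%:R^-1).
  have [t1 h1] := riesz_seqP j b1; have [t2 h2] := riesz_seqP j b2.
  split; first exact: test_lin.
  move=> f tf; rewrite (dir_linl a (test_has_grad t1) (test_has_grad t2) (test_has_grad tf)).
  rewrite (_ : _ - _ = a * (l1 f - dir D (riesz_seq l1 j) f) + (l2 f - dir D (riesz_seq l2 j) f)); last first.
    by move: (l1 f) (l2 f) (dir _ _ _) (dir _ _ _) => p q r s; ring.
  rewrite (le_trans (ler_normD _ _))// -mulrA mulrDl mul1r lerD ?h2//.
  by rewrite normrM ler_wpM2l// h1.
have dcv : (fun j : nat => (`|a| + 1) * j.+1%:R^-1 : R) @ \oo --> (0 : R).
  by rewrite -[X in _ --> X](mulr0 (`|a| + 1)); apply: cvgM; [exact: cvg_cst|exact: seq_inv_cvg0].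
have c1 := dual_cvg b12 b' (fun j => mulr_ge0 (addr_ge0 (normr_ge0 a) ler01) (ltW _)) dcv hpsi.
have pos (j : nat) : 0 < (j.+1%:R^-1 : R) by rewrite invr_gt0.
have := c1 pos; have [L' _ _] := b'.
have -> : (fun j => l' (psi j)) = (fun j => a * l' (riesz_seq l1 j) + l' (riesz_seq l2 j)).
  by apply/funext => j; rewrite /psi (L' a _ _ (riesz_seqP j b1).1 (riesz_seqP j b2).1).
move=> c2; apply: (cvg_unique (@Rhausdorff R) c2).
apply: cvgD; last exact: (riesz_seq_cvg b2 b').
by apply: cvgM; [exact: cvg_cst|exact: (riesz_seq_cvg b1 b')].
Qed.

(** An approximate representative tested against itself has Dirichlet norm at most k plus its
    error. *)
Lemma dual_bound l l' k k' : bddf l k -> bddf l' k' -> `|dual l l'| <= k * k'.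
Proof.
move=> b b'; have [_ k0 hl] := b; have [_ k0' hl'] := b'.
have c : (fun j => `|l' (riesz_seq l j)|) @ \oo --> `|dual l l'|.
  by apply: cvg_norm; exact: (riesz_seq_cvg b b').
have c2 : (fun j : nat => k' * (k + j.+1%:R^-1)) @ \oo --> k * k'.
  rewrite (_ : k * k' = k' * (k + 0)); last by rewrite addr0 mulrC.
  apply: cvgM; first exact: cvg_cst.
  by apply: cvgD; [exact: cvg_cst|exact: seq_inv_cvg0].
apply: (ler_cvg_to c c2); near=> j.
have [t h] := riesz_seqP j b.
apply: le_trans (hl' _ t) _; rewrite ler_wpM2l//.
have [->|pos] := eqVneq (dnorm (riesz_seq l j)) 0; first by rewrite addr_ge0// invr_ge0.
have {}pos : 0 < dnorm (riesz_seq l j) by rewrite lt_neqAle eq_sym pos dnorm_ge0.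
rewrite -(ler_pM2r pos) -expr2 dnorm_sqr mulrDl.
have := h _ t; have := hl _ t; move: (dnorm _) (dir D _ _) (l _) (j.+1%:R^-1) => a p q r.
by rewrite !ler_norml => /andP[? ?] /andP[? ?]; lra.
Unshelve. all: by end_near. Qed.

(** The gradient of the error is (1 - dvtrunc) grad w: bounded, and tending to 0 almost everywhere
    because grad w vanishes a.e. on the zero set of w. *)
Lemma dir_vtrunc_cvg w : class_C 1 D w -> vanish D w -> (forall i, vbmf D (partial i w)) ->
  dir D (fun x => w x - ((fun x => vtrunc k.+1%:R^-1 (w x)) \_ D) x)
        (fun x => w x - ((fun x => vtrunc k.+1%:R^-1 (w x)) \_ D) x) @[k --> \oo] --> (0 : R).
Proof.
move=> Cw vw bw; pose d (k : nat) : R := k.+1%:R^-1.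
have d0 k : 0 < d k by rewrite invr_gt0.
have [K K0 hK] := dvtrunc_bound (R := R).
have P k i x : D x -> partial i (fun x => w x - ((fun x => vtrunc (d k) (w x)) \_ D) x) x =
    (1 - dvtrunc (d k) (w x)) * partial i w x.
  move=> Dx; have tw := vtrunc_test oD (d0 k) Cw vw.
  rewrite (partialB i Dx Cw (test_class_C D tw)) (partial_vtrunc i oD (d0 k) Cw Dx).
  by rewrite [RHS]mulrBl mul1r.
have [M hM] : exists M : R, forall x, D x -> gdot w w x <= M.
  have [_ [M hM]] := bmf_gdot bw bw; exists M => x /hM; apply: le_trans; exact: ler_norm.
pose F k x := \sum_i ((1 - dvtrunc (d k) (w x)) * partial i w x) ^+ 2.
have mF k : measurable_fun (D : set 'rV[mR]_n) (F k).
  apply: (@bmf_sum _ 'rV[mR]_n R D _ _ _ _ _).1 => i; apply: bmfX; apply: bmfM => //.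
  apply: bmfB; first exact: bmf_cst.
  by split; [exact: measurable_dvtrunc|exists K => x _; exact: hK].
have cv : vint D (F k) @[k --> \oo] --> vint D (fun=> 0).
  apply: (int_dct (M := (1 + K) ^+ 2 * M)) => //.
  - move=> k x Dx; rewrite ger0_norm; last by apply: sumr_ge0 => i _; rewrite sqr_ge0.
    apply: (@le_trans _ _ ((1 + K) ^+ 2 * gdot w w x)); last first.
      by rewrite ler_wpM2l ?sqr_ge0// hM.
    rewrite mulr_sumr; apply: ler_sum => i _; rewrite exprMn -expr2 ler_wpM2r ?sqr_ge0//.
    rewrite -(real_normK (num_real (1 - _))) ler_pXn2r ?nnegrE ?addr_ge0//.
    by rewrite (le_trans (ler_normB _ _))// normr1 lerD2l; exact: hK.
  - have ae : {ae lebesgue_rV n, forall x : 'rV[mR]_n, forall i : 'I_n, D x -> dvtrunc (d k) (w x) * partial i w x @[k --> \oo] --> partial i w x}.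
      by apply: filter_forall => i; exact: ae_dvtrunc_partial.
    apply: filterS ae => x h Dx.
    have -> : (0 : R) = \sum_(i < n) 0 by rewrite big1.
    apply: cvg_bigsum => i; rewrite (_ : (0 : R) = (partial i w x - partial i w x) ^+ 2); last first.
      by rewrite subrr expr0n.
    under eq_fun do rewrite mulrBl mul1r.
    have hi : (fun k => partial i w x - dvtrunc (d k) (w x) * partial i w x) @ \oo --> partial i w x - partial i w x.
      by apply: cvgB; [exact: cvg_cst|exact: h].
    under eq_fun do rewrite expr2; rewrite expr2.
    by apply: cvgM; exact: hi.
rewrite int0 in cv; apply: cvg_trans cv; apply: near_eq_cvg; near=> k.
apply: eq_int => x Dx; apply: eq_bigr => i _.
by rewrite P// expr2.
Unshelve. all: by end_near. Qed.

(* A classical function vanishing at the boundary is the representative of its weak Laplacian. *)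
Lemma dual_classical l l' k k' w (L : R) : bddf l k -> bddf l' k' ->
  class_C 1 D w -> vanish D w -> (forall i, vbmf D (partial i w)) ->
  (forall psi, test D psi -> dir D w psi = l psi) ->
  l' ((fun x => vtrunc j.+1%:R^-1 (w x)) \_ D) @[j --> \oo] --> L ->
  L = dual l l'.
Proof.
move=> bl bl' Cw vw bw hw cL.
pose W (j : nat) := (fun x => vtrunc j.+1%:R^-1 (w x)) \_ D.
have tW j : test D (W j) by apply: vtrunc_test => //; rewrite invr_gt0.
have hw0 : has_grad w by [].
have hWj j : has_grad (W j) by exact: test_has_grad.
have hd j : has_grad (fun x => w x - W j x).
  have := has_grad_lin (-1) (hWj j) hw0.
  by under eq_fun do rewrite mulN1r addrC.
have err j : rep_error l (W j) (dnorm (fun x => w x - W j x)).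
  split => // psi tp; rewrite -hw//.
  have := dir_linl (-1) (hWj j) hw0 (test_has_grad tp); rewrite mulN1r addrC => <-.
  have -> : (fun x => -1 * W j x + w x) = (fun x => w x - W j x).
    by apply/funext => x; rewrite mulN1r addrC.
  by apply: dir_le_dnorm => //; exact: test_has_grad.
have dcv : (fun j => dnorm (fun x => w x - W j x)) @ \oo --> (0 : R).
  have := dir_vtrunc_cvg Cw vw bw.
  move=> h; rewrite -(@sqrtr0 R).
  by rewrite /dnorm; apply: continuous_cvg; [exact: sqrt_continuous|exact: h].
exact: (cvg_unique (@Rhausdorff R) cL (dual_cvg bl bl' (fun j => dnorm_ge0 _) dcv err)).
Qed.

End riesz.

(** * Bounded bilinear forms from commutator functionals *)

Section lam_forms.
Context {R : realType} {n : nat}.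
Notation mR := (measurableTypeR R).
Implicit Types (D X : set 'rV[R]_n) (f g h w psi : 'rV[R]_n -> R).

Lemma comm_lin D chi (a : R) f g x : bounded_dom D -> class_C 1 D f -> class_C 1 D g -> D x ->
  comm chi (fun x => a * f x + g x) x = a * comm chi f x + comm chi g x.
Proof.
move=> bD Cf Cg Dx; rewrite /comm /gdot.
under eq_bigr do rewrite (partial_lin bD a _ Cf Cg Dx) mulrDr mulrCA.
rewrite big_split /= -mulr_sumr; move: (\sum_i _) (\sum_i _) (laplacian _ _) (f x) (g x).
by move=> p q r u v; ring.
Qed.

Lemma lam_linh D X t (a : R) h1 h2 psi : bounded_dom D -> measurable (X : set 'rV[mR]_n) -> X `<=` D ->
  0 < t -> vbmf X h1 -> vbmf X h2 -> test D psi ->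
  lam X t (fun x => a * h1 x + h2 x) psi = a * lam X t h1 psi + lam X t h2 psi.
Proof.
move=> bD mX XD t0 b1 b2 tp; have fD := bounded_dom_fin bD; have mD := fD.1.
have fX : vfin X by exact: (fin_measS mX fD XD).
have bc : vbmf X (comm (cutoff t) psi).
  apply: bmf_comm => //; first exact: (bmfS mD XD mX (test_bmf bD tp)).
  by move=> i; exact: (bmfS mD XD mX (test_partial_bmf i bD tp)).
have c1 := bmfM b1 bc; have c2 := bmfM b2 bc.
rewrite /lam -(intZ a fX c1) -(intD fX (bmfZ a c1) c2); apply: eq_int => x _.
by rewrite mulrDl mulrA.
Qed.

Lemma eq_lam X t h1 h2 psi : (forall x, X x -> h1 x = h2 x) -> lam X t h1 psi = lam X t h2 psi.
Proof. by move=> e; apply: eq_int => x Xx; rewrite e. Qed.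

Lemma lam_bddf : (3 <= n)%N -> exists2 C : R, 0 <= C &
  forall D X t h (H : R), bounded_dom D -> measurable (X : set 'rV[mR]_n) ->
  X `<=` D `&` ann t -> 0 < t -> vbmf X h -> (forall x, X x -> `|h x| <= H) -> 0 <= H ->
  bddf D (lam X t h) (Num.sqrt (C * t ^+ (n - 2)) * H).
Proof.
move=> n3; have [C C0 hC] := lam_bound (R := R) n3; exists C => //.
move=> D X t h H bD mX XD t0 bh hH H0; have oD := bD.1.
have fD := bounded_dom_fin bD; have mD := fD.1.
have XD1 : X `<=` D by move=> x /XD[].
have fX : vfin X by exact: (fin_measS mX fD XD1).
have bc psi : test D psi -> vbmf X (fun x => h x * comm (cutoff t) psi x).
  move=> tp; apply: bmfM => //; apply: bmf_comm => //.
    exact: (bmfS mD XD1 mX (test_bmf bD tp)).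
  by move=> i; exact: (bmfS mD XD1 mX (test_partial_bmf i bD tp)).
split.
- move=> a f g tf tg; rewrite /lam -(intZ a fX (bc _ tf)) -(intD fX (bmfZ a (bc _ tf)) (bc _ tg)).
  apply: eq_int => x Xx.
  rewrite (comm_lin _ a bD (test_class_C D tf) (test_class_C D tg) (XD1 _ Xx)).
  by rewrite mulrDr mulrCA.
- by rewrite mulr_ge0// sqrtr_ge0.
- move=> psi tp; have hl := hC D X t h H psi bD mX XD t0 bh hH H0 tp.
  have ct : 0 <= C * t ^+ (n - 2) by rewrite mulr_ge0// exprn_ge0// ltW.
  rewrite -(ler_pXn2r (n := 2))// ?nnegrE ?mulr_ge0 ?sqrtr_ge0 ?dnorm_ge0//.
  rewrite real_normK ?num_real// !exprMn sqr_sqrtr// dnorm_sqr.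
  by rewrite (mulrAC C).
Qed.

(** In [dual_classical] the functional is evaluated along truncations of w, as w itself is no test
    function; here the limit is computed for commutator functionals. *)
Lemma lam_vtrunc_cvg D X t h w : bounded_dom D -> measurable (X : set 'rV[mR]_n) -> X `<=` D ->
  0 < t -> vbmf X h -> class_C 1 D w -> vanish D w -> (forall i, vbmf D (partial i w)) ->
  lam X t h ((fun x => vtrunc j.+1%:R^-1 (w x)) \_ D) @[j --> \oo] --> lam X t h w.
Proof.
move=> bD mX XD t0 bh Cw vw bw; have oD := bD.1.
have fD := bounded_dom_fin bD; have mD := fD.1.
have fX : vfin X by exact: (fin_measS mX fD XD).
pose d (k : nat) : R := k.+1%:R^-1; have d0 k : 0 < d k by rewrite invr_gt0.
have d1 k : d k <= 1 by rewrite invf_le1// ler1n.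
have [K K0 hK] := dvtrunc_bound (R := R).
have bw0 := vanish_bmf bD Cw vw; have [Mw hMw] := bw0.2.
have [C C0 hC] := cutoff_bound (R := R) (n := n).
have [H hH] := bh.2.
have [L hL] := (bmf_laplacian_cutoff (t := t) mD t0).2.
have [M hM] : exists M : R, forall i x, D x -> `|partial i w x| <= M.
  have ex i : exists M : R, forall x, D x -> `|partial i w x| <= M by case: (bw i).
  have [M hM] := choice ex; exists (\sum_i `|M i|) => i x Dx.
  by rewrite (le_trans (hM i x Dx))// (le_trans (ler_norm _))// (bigD1 i)//= lerDl sumr_ge0.
pose W k := (fun x => vtrunc (d k) (w x)) \_ D.
have tW k : test D (W k) by exact: vtrunc_test.
have bW k : vbmf X (comm (cutoff t) (W k)).
  apply: bmf_comm => //; first exact: (bmfS mD XD mX (test_bmf bD (tW k))).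
  by move=> i; exact: (bmfS mD XD mX (test_partial_bmf i bD (tW k))).
have bwX : vbmf X (comm (cutoff t) w).
  apply: bmf_comm => //; first exact: (bmfS mD XD mX bw0).
  by move=> i; exact: (bmfS mD XD mX (bw i)).
apply: (int_dct (M := H * (2 * \sum_(i < n) (C / t * (K * M)) + (Mw + 2) * L))) => //.
- by move=> k; exact: (bmfM bh (bW k)).1.
- exact: (bmfM bh bwX).1.
- move=> k x Xx; have Dx := XD _ Xx; rewrite normrM ler_pM ?hH//.
  rewrite /comm (le_trans (ler_normD _ _))// lerD// normrM ?normr_nat.
    rewrite ler_pM2l//; apply: le_trans (ler_norm_sum _ _ _) _; apply: ler_sum => i _.
    rewrite (partial_vtrunc i oD (d0 k) Cw Dx) !normrM.
    by apply: ler_pM; rewrite ?mulr_ge0//; [have [] := hC t x i t0|apply: ler_pM; rewrite ?hK ?hM].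
  apply: ler_pM => //; last exact: hL.
  rewrite patchE mem_set// -[vtrunc _ _](subrK (w x)) addrC (le_trans (ler_normD _ _))// lerD ?hMw//.
  by rewrite (le_trans (vtrunc_dist _ (d0 k)))// -[leRHS]mulr1 ler_pM2l.
- have ae : {ae lebesgue_rV n, forall x : 'rV[mR]_n, forall i : 'I_n, D x ->
      dvtrunc (d k) (w x) * partial i w x @[k --> \oo] --> partial i w x}.
    by apply: filter_forall => i; exact: ae_dvtrunc_partial.
  apply: filterS ae => x h0 Xx; have Dx := XD _ Xx.
  apply: cvgM; first exact: cvg_cst.
  apply: cvgD.
    apply: cvgM; first exact: cvg_cst.
    apply: cvg_bigsum => i; apply: cvgM; first exact: cvg_cst.
    by under eq_fun do rewrite (partial_vtrunc i oD (d0 _) Cw Dx); exact: h0.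
  apply: cvgM; last exact: cvg_cst.
  by under eq_fun do rewrite patchE mem_set//; exact: vtrunc_cvg.
Qed.

Definition bd X h (H : R) : Prop :=
  [/\ measurable_fun (X : set 'rV[mR]_n) h, 0 <= H & forall x, X x -> `|h x| <= H].

Lemma bd_bmf X h H : bd X h H -> vbmf X h.
Proof. by case=> mh _ hH; split => //; exists H. Qed.

Lemma bmf_bd X h : vbmf X h -> exists H, bd X h H.
Proof.
move=> [mh [M hM]]; exists (Num.max M 0); split => //; first by rewrite le_max lexx orbT.
by move=> x Xx; rewrite le_max hM.
Qed.

Definition blin X (l : ('rV[R]_n -> R) -> R) (K : R) : Prop :=
  [/\ forall a f g, vbmf X f -> vbmf X g -> l (fun x => a * f x + g x) = a * l f + l g,
      0 <= K & forall f H, bd X f H -> `|l f| <= K * H].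

(** Joint continuity is stated as a bounded functional in each slot with the other one fixed, which
    is what allows a form to be applied termwise to a series in either slot. *)
Definition bbil X Y (B : ('rV[R]_n -> R) -> ('rV[R]_n -> R) -> R) (K : R) : Prop :=
  [/\ 0 <= K, (forall g H, bd Y g H -> blin X (fun f => B f g) (K * H)) &
     (forall f H, bd X f H -> blin Y (B f) (K * H))].

Lemma blin_sub X l K f g : blin X l K -> vbmf X f -> vbmf X g -> l (fun x => f x - g x) = l f - l g.
Proof.
move=> [lin _ _] bf bg; have := lin (-1) g f bg bf; rewrite mulN1r addrC => <-.
by congr l; apply/funext => x; rewrite mulN1r addrC.
Qed.

End lam_forms.

Section dual_form.
Context {R : realType} {n : nat}.
Notation mR := (measurableTypeR R).

(* The form (h1, h2) |-> dual (lam h1) (lam h2) only sees sup norms, by Hardy's inequality. *)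
Lemma dual_bbil : (3 <= n)%N -> exists2 C : R, 0 <= C &
  forall (D X Y : set 'rV[R]_n) (s t : R), bounded_dom D ->
  measurable (X : set 'rV[mR]_n) -> measurable (Y : set 'rV[mR]_n) ->
  X `<=` D `&` ann s -> Y `<=` D `&` ann t -> 0 < s -> 0 < t ->
  bbil X Y (fun f g => dual D (lam X s f) (lam Y t g))
    (Num.sqrt (C * s ^+ (n - 2)) * Num.sqrt (C * t ^+ (n - 2))).
Proof.
move=> n3; have [C C0 hC] := lam_bddf (R := R) n3; exists C => // D X Y s t bD mX mY XD YD s0 t0.
have bX f H : bd X f H -> bddf D (lam X s f) (Num.sqrt (C * s ^+ (n - 2)) * H).
  by move=> bf; have [mf H0 hH] := bf; apply: hC => //; exact: bd_bmf bf.
have bY f H : bd Y f H -> bddf D (lam Y t f) (Num.sqrt (C * t ^+ (n - 2)) * H).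
  by move=> bf; have [mf H0 hH] := bf; apply: hC => //; exact: bd_bmf bf.
have XD1 : X `<=` D by move=> x /XD[].
have YD1 : Y `<=` D by move=> x /YD[].
split; first by rewrite mulr_ge0// sqrtr_ge0.
- move=> g H bg; split; last 2 first.
  + by rewrite !mulr_ge0 ?sqrtr_ge0//; case: bg.
  + move=> f G bf; have := dual_bound bD (bX _ _ bf) (bY _ _ bg).
    by rewrite mulrACA [G * H]mulrC mulrA.
  move=> a f1 f2 b1 b2; have [H1 bd1] := bmf_bd b1; have [H2 bd2] := bmf_bd b2.
  rewrite -(dual_linl bD a (bX _ _ bd1) (bX _ _ bd2) (bY _ _ bg)).
  have [H3 bd3] := bmf_bd (bmfD (bmfZ a b1) b2).
  refine (dual_extl bD (bX _ _ bd3) (bddf_lin a (bX _ _ bd1) (bX _ _ bd2)) (bY _ _ bg) _).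
  by move=> psi tp; exact: (lam_linh a bD mX XD1 s0 b1 b2 tp).
- move=> f H bf; split; last 2 first.
  + by rewrite !mulr_ge0 ?sqrtr_ge0//; case: bf.
  + move=> g G bg; have := dual_bound bD (bX _ _ bf) (bY _ _ bg).
    by rewrite mulrACA mulrA.
  move=> a f1 f2 b1 b2; have [H1 bd1] := bmf_bd b1; have [H2 bd2] := bmf_bd b2.
  rewrite -(dual_linr bD a (bX _ _ bf) (bY _ _ bd1) (bY _ _ bd2)).
  apply: (dual_extr bD (bX _ _ bf)).
  by move=> psi tp; exact: (lam_linh a bD mY YD1 t0 b1 b2 tp).
Qed.

End dual_form.

(** * The fundamental solution and the representation formula *)

Section fundamental.
Context {R : realType} {n : nat}.
Notation mR := (measurableTypeR R).
Implicit Types (D E : set 'rV[R]_n) (f g W : 'rV[R]_n -> R) (c x y z : 'rV[R]_n).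

Lemma int_affine E f (a : 'rV[R]_n) (s : R) : 0 < s -> vfin E -> vbmf E f ->
  vfin [set x | E (a + s *: x)] /\
  vint E f = s ^+ n * vint [set x | E (a + s *: x)] (fun x => f (a + s *: x)).
Proof.
move=> s0 fE bf; have [mE ltE] := fE.
pose E' : set 'rV[mR]_n := [set x | E (a + s *: x)].
have mE' : measurable E'.
  by rewrite -[X in measurable X]setTI; exact: (measurable_affine a s).
have sn0 : 0 < s ^+ n by rewrite exprn_gt0.
have main g : vbmf E g -> (forall x, E x -> 0 <= g x) ->
    (\int[lebesgue_rV n]_(x in E) (g x)%:E =
     (s ^+ n)%:E * \int[lebesgue_rV n]_(x in E') (g (a + s *: x))%:E)%E.
  move=> [mg _] g0; rewrite integral_mkcond (tonelli_affine a s0); first last.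
  - by move=> x; rewrite patchE; case: ifPn => // /set_mem Ex; rewrite lee_fin g0.
  - apply/(measurable_restrictT _ mE); exact/measurable_EFinP.
  congr (_ * _)%E; rewrite [RHS]integral_mkcond; apply: eq_integral => x _.
  by rewrite !patchE /=; congr (if _ then _ else _); apply/idP/idP => /set_mem h; exact/mem_set.
have fE' : vfin E'.
  split => //; have := main (fun=> 1) (bmf_cst _ _) (fun _ _ => ler01).
  rewrite !integral_cst// !mul1e => h.
  have {}h : ((s ^+ n)%:E * lebesgue_rV n E' = lebesgue_rV n E)%E by rewrite h.
  rewrite ltNge; apply/negP; rewrite leye_eq => /eqP E'oo.
  have : (lebesgue_rV n E < +oo)%E := ltE; by rewrite -h E'oo mulry gtr0_sg// mul1e ltxx.
split => //.
have bf' g : vbmf E g -> vbmf E' (fun x => g (a + s *: x)).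
  move=> [mg [M gM]]; split; last by exists M => x; exact: gM.
  apply: (measurable_comp (F := E)) => //; last exact: measurable_funTS (measurable_affine a s).
  by move=> _ [x + <-].
have mainR g : vbmf E g -> (forall x, E x -> 0 <= g x) ->
    vint E g = s ^+ n * vint E' (fun x => g (a + s *: x)).
  move=> bg g0; have := main g bg g0.
  by rewrite (intE fE bg) (intE fE' (bf' g bg)) -EFinM => -[].
have [M hM] := bf.2.
(* Adding this constant makes f nonnegative, where Tonelli applies; the contribution of the constant
   is subtracted afterwards. *)
pose M' := Num.max M 0.
have b1 := bmfD bf (bmf_cst E M').
have h1 := mainR _ b1.
have h2 := mainR _ (bmf_cst E M').
move: h1 h2; rewrite intD//; last exact: bmf_cst.
rewrite (intD fE' (bf' _ bf) (bmf_cst E' M')) mulrDr => h1 h2.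
have {}h2 : vint E (fun=> M') = s ^+ n * vint E' (fun=> M').
  by apply: h2 => x _; rewrite le_max lexx orbT.
have : vint E f + vint E (fun=> M') = s ^+ n * vint E' (fun x => f (a + s *: x)) + s ^+ n * vint E' (fun=> M').
  apply: h1 => x Ex.
  have := hM x Ex; rewrite ler_norml => /andP[h _].
  by rewrite -lerBlDr sub0r (le_trans _ h)// lerN2 le_max lexx.
by rewrite h2 => /addIr.
Qed.

(** The singularity |y - c|^(2-n), smoothed at its pole at scale d. *)
Definition Gd (d : R) c y : R := isq (n - 2) (sqn (y - c) + d ^+ 2).

(** Minus the Laplacian of [Gd] centred at 0: an approximate identity at scale d, up to its total
    mass. *)
Definition psid (d : R) z : R :=
  n%:R * (n - 2)%:R * d ^+ 2 * isq (n + 2) (sqn z + d ^+ 2).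

Lemma class_C_isq_center k (d : R) j c : 0 < d ->
  class_C j setT (fun y : 'rV[R]_n => isq k (sqn (y - c) + d ^+ 2)).
Proof.
move=> d0; have d2 : 0 < d ^+ 2 by rewrite exprn_gt0.
have h := class_C_affine (a := - c) (s := 1) openT openT (fun _ _ => I) (@class_C_isq_sqn R n k (d ^+ 2) j d2).
apply: (eq_class_C openT _ h) => y _ /=.
by rewrite scale1r [- c + y]addrC.
Qed.

Lemma partial_isq_center k (d : R) c i y : 0 < d ->
  partial i (fun y : 'rV[R]_n => isq k (sqn (y - c) + d ^+ 2)) y =
  - k%:R * isq k.+2 (sqn (y - c) + d ^+ 2) * (y - c) ord0 i.
Proof.
move=> d0; have d2 : 0 < d ^+ 2 by rewrite exprn_gt0.
have E : (fun y : 'rV[R]_n => isq k (sqn (y - c) + d ^+ 2)) =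
    (fun y => (fun y => isq k (sqn y + d ^+ 2)) (- c + 1 *: y)).
  by apply/funext => z; rewrite scale1r [- c + z]addrC.
rewrite E (partial_affine i (@class_C_isq_sqn R n k (d ^+ 2) 1 d2) (I : setT _)).
by rewrite mul1r partial_isq_sqn// scale1r [- c + y]addrC.
Qed.

Lemma class_C_Gd (d : R) j c : 0 < d -> class_C j setT (Gd d c).
Proof. exact: class_C_isq_center. Qed.

Lemma laplacian_Gd (d : R) c y : (2 <= n)%N -> 0 < d -> laplacian (Gd d c) y = - psid d (y - c).
Proof.
move=> n2 d0; have d2 : 0 < d ^+ 2 by rewrite exprn_gt0.
have pos : 0 < sqn (y - c) + d ^+ 2 by rewrite ltr_wpDl// sqn_ge0.
pose k : R := (n - 2)%:R.
have n2k : (n - 2).+2 = n by rewrite -addn2 subnK.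
have E i : partial i (Gd d c) = fun y => (- k * isq n (sqn (y - c) + d ^+ 2)) * (y - c) ord0 i.
  by apply/funext => z; rewrite /Gd partial_isq_center// n2k.
have C1 : class_C 1 setT (fun y : 'rV[R]_n => - k * isq n (sqn (y - c) + d ^+ 2)).
  exact: (class_CZ (- k) openT (class_C_isq_center n 1 c d0)).
have C2 i : class_C 1 setT (fun y : 'rV[R]_n => (y - c) ord0 i).
  rewrite (_ : (fun y => _) = (fun y : 'rV[R]_n => y ord0 i - c ord0 i)).
    exact: (class_CB openT (class_C_coord 1 i openT) (class_C_cst 1 _ openT)).
  by apply/funext => z; rewrite !mxE.
have P2 i : partial i (fun y : 'rV[R]_n => (y - c) ord0 i) y = 1.
  rewrite (_ : (fun y => _) = (fun y : 'rV[R]_n => y ord0 i - c ord0 i)); last first.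
    by apply/funext => z; rewrite !mxE.
  rewrite (partialB i (I : setT y) (class_C_coord 1 i openT) (class_C_cst 1 _ openT)).
  by rewrite partial_cst partial_coord eqxx subr0.
have P1 i : partial i (fun y : 'rV[R]_n => - k * isq n (sqn (y - c) + d ^+ 2)) y =
    k * n%:R * isq (n + 2) (sqn (y - c) + d ^+ 2) * (y - c) ord0 i.
  rewrite (partialM i (I : setT y) (class_C_cst 1 (- k) openT) (class_C_isq_center n 1 c d0)).
  rewrite partial_cst mulr0 addr0 partial_isq_center// addn2.
  by move: (isq _ _) ((y - c) _ _) (n%:R : R) => a b e; ring.
rewrite /laplacian.
under eq_bigr => i _ do rewrite E (partialM i (I : setT y) C1 (C2 i)) P1 P2 mulr1.
rewrite big_split /= sumr_const card_ord.
have -> : \sum_(i < n) (y - c) ord0 i * (k * n%:R * isq (n + 2) (sqn (y - c) + d ^+ 2) * (y - c) ord0 i) =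
    k * n%:R * (sqn (y - c) * isq (n + 2) (sqn (y - c) + d ^+ 2)).
  rewrite {3}/sqn mulr_suml mulr_sumr; apply: eq_bigr => i _.
  by move: ((y - c) _ _) (isq _ _) => a b; rewrite expr2; ring.
have := isqSS n pos; rewrite -[n.+2]addn2 => <-.
rewrite /psid -/k mulr_natl.
move: (isq (n + 2) (sqn (y - c) + d ^+ 2)) (sqn (y - c)) => a b.
rewrite -[X in X + _ = _]mulr_natl -[k *+ n]mulr_natl.
move: (isq (n + 2) (b + d ^+ 2)) => p.
by move: (d ^+ 2) (n%:R : R) => q e; clearbody k; clear; ring.
Qed.

Lemma psid_ge0 d z : 0 <= psid d z.
Proof. by rewrite /psid mulr_ge0 ?isq_ge0// mulr_ge0 ?sqr_ge0. Qed.

Lemma continuous_psid d : 0 < d -> continuous (psid d).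
Proof.
move=> d0 z; have d2 : 0 < d ^+ 2 by rewrite exprn_gt0.
apply: (@continuousM _ _ (fun=> _) (fun z : 'rV[R]_n => isq (n + 2) (sqn z + d ^+ 2))).
  exact: cst_continuous.
exact: (class_C_cont (@class_C_isq_sqn R n (n + 2) (d ^+ 2) 0 d2) (I : setT z)).
Qed.

Lemma le_isq k (a b : R) : 0 < a -> a <= b -> isq k b <= isq k a.
Proof.
move=> a0 ab; have b0 := lt_le_trans a0 ab.
rewrite /isq; apply: lerXn2r; rewrite ?nnegrE ?invr_ge0 ?sqrtr_ge0//.
by rewrite lef_pV2 ?posrE ?sqrtr_gt0// ler_wsqrtr.
Qed.

Lemma psid_far d e z : 0 < d -> 0 < e -> e ^+ 2 <= sqn z ->
  psid d z <= n%:R * (n - 2)%:R * d ^+ 2 * isq (n + 2) (e ^+ 2).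
Proof.
move=> d0 e0 ez; rewrite /psid ler_wpM2l//; first by rewrite mulr_ge0 ?sqr_ge0.
apply: le_isq; first by rewrite exprn_gt0.
by rewrite (le_trans ez)// lerDl sqr_ge0.
Qed.

Lemma bmf_cube_cont (r : R) f : continuous f -> vbmf (cube r) f.
Proof.
move=> cf; have [M hM] := continuous_cube_bounded r cf; split; last by exists M.
apply: (@measurable_funS _ _ _ _ setT) => //.
by apply: (continuous_measurable_rV openT) => x _; exact: cf.
Qed.

Lemma bmf_cont D f : bounded_dom D -> continuous f -> vbmf D f.
Proof.
move=> bD cf; have [r Dr] := bD.2.
apply: (bmfS (fin_meas_cube n r).1 Dr (bounded_dom_fin bD).1).
exact: bmf_cube_cont.
Qed.

(* Green's second identity for W and the regularized Green function, cut off where W vanishes. *)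
Lemma prerepresentation D W (T d kap : R) c c' : (2 <= n)%N -> bounded_dom D -> 0 < T -> 0 < d ->
  class_C 2 D W -> vanish D W -> (forall i, vbmf D (partial i W)) -> vbmf D (laplacian W) ->
  (forall y, D y -> T ^+ 2 <= sqn y -> W y = 0) ->
  vanish D (fun y => cutoff T y * (Gd d c y - kap * Gd d c' y)) ->
  vint D (fun y => W y * (kap * psid d (y - c') - psid d (y - c))) =
  vint D (fun y => (Gd d c y - kap * Gd d c' y) * laplacian W y).
Proof.
move=> n2 bD T0 d0 CW vW bW blW W0 vb; have oD := bD.1; have fD := bounded_dom_fin bD.
pose G y := Gd d c y - kap * Gd d c' y.
have CG : class_C 2 setT G.
  exact: (class_CB openT (class_C_Gd 2 c d0) (class_CZ kap openT (class_C_Gd 2 c' d0))).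
have lG y : laplacian G y = kap * psid d (y - c') - psid d (y - c).
  rewrite /G (laplacianB openT (I : setT y) (class_C_Gd 2 c d0) (class_CZ kap openT (class_C_Gd 2 c' d0))).
  rewrite (laplacianZ kap openT (I : setT y) (class_C_Gd 2 c' d0)) !laplacian_Gd//.
  by rewrite mulrN opprK addrC.
have cGi i : continuous (partial i G).
  by move=> x; exact: (class_C_cont (class_C_partial i CG) (I : setT x)).
have clG : continuous (laplacian G).
  by move=> x; exact: (laplacian_cont CG (I : setT x)).
have cG : continuous G by move=> x; exact: (class_C_cont CG (I : setT x)).
have CW1 := class_CW (leqnSn 1) CW.
have CGD : class_C 2 D G by apply: class_CS CG.
have bGi i := bmf_cont bD (cGi i).
(* Green's first identity is used twice. Here W carries the zero boundary values, in [h2] the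
   cut-off Green function does; the gradient terms agree since W is 0 wherever the cutoff is not
   1. *)
have h1 := green0 bD CW1 vW bW CGD bGi (bmf_cont bD clG).
pose b y := cutoff T y * G y.
have Cb : class_C 2 setT b := class_CM openT (class_C_cutoff T) CG.
have cbi i : continuous (partial i b).
  by move=> x; exact: (class_C_cont (class_C_partial i Cb) (I : setT x)).
have Cb1 : class_C 1 D b by apply: class_CS (class_CW (leqnSn 1) Cb).
have h2 := green0 bD Cb1 vb (fun i => bmf_cont bD (cbi i)) CW bW blW.
have T20 : 0 < T ^+ 2 by rewrite exprn_gt0.
have cases y : D y -> sqn y < 2 * T ^+ 2 \/ \forall z \near y, D z /\ T ^+ 2 < sqn z.
  move=> Dy; have [h|h] := ltP (sqn y) (2 * T ^+ 2); [by left|right].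
  have oV : open (D `&` [set z | T ^+ 2 < sqn z]) by apply: openI => //; exact: open_sqn_gt.
  have Vy : (D `&` [set z | T ^+ 2 < sqn z]) y by split => //=; move: h T20; move: (sqn y) (T ^+ 2) => q t; clear; lra.
  exact: (open_nbhs_nbhs (conj oV Vy)).
have e1 y : D y -> gdot b W y = gdot W G y.
  move=> Dy; rewrite /gdot; apply: eq_bigr => i _; rewrite mulrC; have [h|h] := cases y Dy.
    congr (_ * _); apply: eq_partial_near.
    have := open_nbhs_nbhs (conj (@open_sqn_lt R n (2 * T ^+ 2)) h); apply: filterS => z /= hz.
    by rewrite /b cutoff1 ?mul1r// ltW.
  have -> : partial i W y = 0.
    rewrite -(partial_cst i 0 y); apply: eq_partial_near; apply: filterS h => z [Dz /ltW hz].
    exact: W0.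
  by rewrite !mul0r.
have e2 y : D y -> b y * laplacian W y = G y * laplacian W y.
  move=> Dy; have [h|h] := cases y Dy; first by rewrite /b cutoff1 ?mul1r// ltW.
  have -> : laplacian W y = 0.
    have -> : laplacian W y = laplacian (fun=> 0) y.
      by apply: eq_laplacian_near; apply: filterS h => z [Dz /ltW hz]; exact: W0.
    rewrite /laplacian big1// => i _.
    have -> : partial i (fun=> 0 : R) = (fun=> 0) :> ('rV[R]_n -> R).
      by apply/funext => z; exact: partial_cst.
    exact: partial_cst.
  by rewrite !mulr0.
have bWl : vbmf D (fun y => W y * laplacian G y).
  by apply: bmfM; [exact: vanish_bmf|exact: bmf_cont].
have bgl : vbmf D (fun y => G y * laplacian W y).
  by apply: bmfM => //; exact: bmf_cont.
have bgd : vbmf D (gdot W G) by exact: bmf_gdot.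
have h2' : vint D (fun y => gdot W G y + G y * laplacian W y) = 0.
  by rewrite -h2; apply: eq_int => y Dy; rewrite -e1// -e2.
have j1 := etrans (esym (intD fD bgd bWl)) h1.
have j2 := etrans (esym (intD fD bgd bgl)) h2'.
have -> : vint D (fun y => W y * (kap * psid d (y - c') - psid d (y - c))) =
    vint D (fun y => W y * laplacian G y) by apply: eq_int => y _; rewrite lG.
rewrite -/(vint D (fun y => G y * laplacian W y)).
exact: (addrI (vint D (gdot W G)) (etrans j1 (esym j2))).
Qed.

End fundamental.

Section representation.
Context {R : realType} {n : nat}.
Notation mR := (measurableTypeR R).
Implicit Types (D E : set 'rV[R]_n) (f g W : 'rV[R]_n -> R) (c x y z : 'rV[R]_n).
Let dseq (k : nat) : R := k.+1%:R^-1.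
Let dseq0 k : 0 < dseq k. Proof. by rewrite invr_gt0. Qed.
Let dseqX k : (dseq j) ^+ k.+1 @[j --> \oo] --> (0 : R).
Proof.
elim: k => [|k IH]; first by under eq_fun do rewrite expr1; exact: seq_inv_cvg0.
under eq_fun do rewrite exprS; rewrite -(mulr0 (0 : R)).
by apply: cvgM; [exact: seq_inv_cvg0|exact: IH].
Qed.

Lemma continuous_eps (T : topologicalType) (f : T -> R) (x : T) :
  {for x, continuous f} <-> (forall e, 0 < e -> \forall y \near x, `|f x - f y| < e).
Proof. by split => [h|h]; [exact/(@cvgrPdist_lt _ _ _ (nbhs x))|exact/(@cvgrPdist_lt _ _ _ (nbhs x))]. Qed.

(* The value at [z = 0] is the junk value [0]. *)
Definition Gam z : R := isq (n - 2) (sqn z).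

Lemma continuous_isq k (y : R) : 0 < y -> {for y, continuous (isq k)}.
Proof. by move=> y0; exact: (is_derive_continuous (is_derive_isq k y0)). Qed.

Lemma continuous_shift_sqn c : continuous (fun y => sqn (y - c)).
Proof.
move=> y; apply: (continuous_comp (f := fun y => y - c)); last exact: continuous_sqn.
by apply: continuousB => //; exact: cst_continuous.
Qed.

Lemma continuous_Gam y c : 0 < sqn (y - c) -> {for y, continuous (fun y => Gam (y - c))}.
Proof.
move=> y0; apply: (continuous_comp (f := fun y => sqn (y - c)) (g := isq (n - 2))).
  exact: continuous_shift_sqn.
exact: continuous_isq.
Qed.

Lemma Gd_cvg y c : 0 < sqn (y - c) -> Gd (dseq k) c y @[k --> \oo] --> Gam (y - c).
Proof.
move=> y0; rewrite /Gam /Gd; apply: continuous_cvg; first exact: continuous_isq.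
rewrite -[X in _ --> X]addr0; apply: cvgD; [exact: cvg_cst|exact: dseqX].
Qed.

Lemma bmf_GamM D f c (e : R) : vfin D -> open D -> vbmf D f -> 0 < e ->
  (forall y, D y -> sqn (y - c) <= e -> f y = 0) -> vbmf D (fun y => Gam (y - c) * f y).
Proof.
move=> fD oD bf e0 f0.
have oV : open [set y | e < sqn (y - c)].
  rewrite (_ : mkset _ = (fun y => sqn (y - c)) @^-1` [set t | e < t])//.
  by apply: open_comp; [move=> y _; exact: continuous_shift_sqn|exact: open_gt].
have mV := open_measurable_rV (openI oD oV).
apply: (bmf_ext0 (D := D `&` [set y | e < sqn (y - c)])) => //.
- exact: fD.1.
- apply: bmfM; last exact: (bmfS fD.1 (@subIsetl _ _ _) mV bf).
  split.
    by apply: continuous_measurable_rV; [exact: openI|move=> x [_ /= hx]; apply: continuous_Gam; exact: lt_trans hx].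
  exists (isq (n - 2) e) => x [_ /ltW hx]; rewrite ger0_norm ?isq_ge0//.
  exact: le_isq.
- move=> x Dx h; rewrite f0 ?mulr0// leNgt; apply/negP => hx; exact: h.
Qed.

Lemma Gd_int_cvg D f c (e : R) : vfin D -> open D -> vbmf D f -> 0 < e ->
  (forall y, D y -> sqn (y - c) <= e -> f y = 0) ->
  vint D (fun y => Gd (dseq k) c y * f y) @[k --> \oo] --> vint D (fun y => Gam (y - c) * f y).
Proof.
move=> fD oD bf e0 f0; have [M hM] := bf.2.
apply: (int_dct (M := isq (n - 2) e * `|M|)) => //.
- move=> k; apply: (measurable_funM _ bf.1); apply: measurable_funS (@subsetT _ D) _ => //.
  apply: (continuous_measurable_rV openT) => x _.
  exact: (class_C_cont (class_C_Gd 0 c (dseq0 k)) (I : setT x)).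
- exact: (bmf_GamM fD oD bf e0 f0).1.
- move=> k x Dx; have [h|h] := leP (sqn (x - c)) e.
    by rewrite (f0 _ Dx h) mulr0 normr0 mulr_ge0 ?isq_ge0.
  rewrite normrM ler_pM//; last exact: le_trans (hM x Dx) (ler_norm M).
  rewrite ger0_norm ?isq_ge0//; apply: le_isq => //.
  by rewrite (le_trans (ltW h))// lerDl sqr_ge0.
- apply: aeW => x Dx; have [h|h] := leP (sqn (x - c)) e.
    by rewrite (f0 _ Dx h) mulr0; under eq_fun do rewrite mulr0; exact: cvg_cst.
  by apply: cvgM; [apply: Gd_cvg; exact: lt_trans h|exact: cvg_cst].
Qed.

Let W1 : 'rV[R]_n -> R := cutoff 4^-1.
Let V1 : set 'rV[R]_n := hball 1.
Let bV1 : bounded_dom V1.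
Proof. by split; [exact: open_hball|exists 1; exact: hball_cube]. Qed.
Let mV1 := (bounded_dom_fin bV1).1.

(** As [W1] is 1 near 0, this is the mass of minus the distributional Laplacian of [Gam], that is
    (n-2) times the area of the unit sphere. Its value is never computed, only its positivity is
    established. *)
Definition mass : R := - vint V1 (fun y => Gam (y - 0) * laplacian W1 y).

Let cW1 : continuous W1.
Proof. by move=> x; exact: (class_C_cont (class_C_cutoff 4^-1) (I : setT x)). Qed.

Let W1_far t y : t ^+ 2 = 4^-1 -> t ^+ 2 <= sqn y -> W1 y = 0.
Proof. by move=> -> h; apply: cutoff0 => //; apply: le_trans h; lra. Qed.

Let W1_near y : sqn y <= 4^-1 ^+ 2 -> W1 y = 1.
Proof. by move=> h; apply: cutoff1 => //; apply: le_trans h _; lra. Qed.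

Let vanish_far w : (forall y, 3 / 4 <= sqn y -> w y = 0) -> vanish V1 w.
Proof.
move=> w0 x /negP; rewrite -leNgt expr1n => hx d d0.
have : [set z | 3 / 4 < sqn z] x by move: hx; rewrite /=; move: (sqn x) => q; lra.
move=> h; have := open_nbhs_nbhs (conj (@open_sqn_gt R n (3 / 4)) h); apply: filterS => y /ltW hy _.
by rewrite w0// normr0.
Qed.

Lemma mass_cvg : (2 <= n)%N ->
  vint V1 (fun y => W1 y * psid (dseq k) y) @[k --> \oo] --> mass.
Proof.
move=> n2; have t2 : 2^-1 ^+ 2 = 4^-1 :> R by lra.
have t0 : 0 < 4^-1 :> R by [].
have h0 : 0 < 2^-1 :> R by [].
have C2 := class_C_cutoff (n := n) (4^-1 : R).
have CV := class_CS (@subsetT _ V1) C2.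
have bl : vbmf V1 (laplacian W1) by exact: bmf_laplacian_cutoff.
have hq : 2^-1 ^+ 2 <= 3 / 4 :> R by rewrite t2; lra.
(* The weight 0 removes the second pole, and [W1] vanishes beyond radius 1/2. *)
have pre k := prerepresentation (c := 0) (c' := 0) (kap := 0) n2 bV1 h0 (dseq0 k) CV
  (vanish_far (fun y hy => W1_far t2 (le_trans hq hy)))
  (fun i => bmf_partial_cutoff i mV1 t0) bl (fun y _ => @W1_far 2^-1 y t2).
have key k : vint V1 (fun y => W1 y * psid (dseq k) y) =
    - vint V1 (fun y => Gd (dseq k) 0 y * laplacian W1 y).
  have bW : vbmf V1 (fun y => W1 y * psid (dseq k) y).
    by apply: bmf_cont => //; move=> x; apply: continuousM; [exact: cW1|exact: continuous_psid].
  have := pre k _.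
  have -> : vint V1 (fun y => cutoff 4^-1 y * (0 * psid (dseq k) (y - 0) - psid (dseq k) (y - 0))) =
     vint V1 (fun y => (-1) * (W1 y * psid (dseq k) y)).
    by apply: eq_int => y _; rewrite subr0 mul0r sub0r mulN1r mulrN.
  rewrite (intZ (-1) (bounded_dom_fin bV1) bW) mulN1r => h.
  rewrite -[LHS]opprK h; last by apply: vanish_far => y hy; rewrite cutoff0 ?mul0r// t2.
  by congr (- _); apply: eq_int => y _; rewrite mul0r subr0.
under eq_fun do rewrite key.
have e0 : 0 < 4^-1 ^+ 2 :> R by rewrite exprn_gt0.
have h := Gd_int_cvg (c := 0) (bounded_dom_fin bV1) (open_hball (r := 1)) bl e0.
apply: (cvgN (h _)) => y _; rewrite subr0 => hy; apply: (laplacian_cutoff_out t0) => /andP[h' _].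
by move: h'; rewrite ltNge hy.
Qed.

(** Subtracting [f 0 * W1] leaves a function g with g(0) = 0. Near 0 it is at most eta, against a
    kernel of bounded mass; away from 0 the kernel is of order d^2. *)
Lemma psid_cvg D f : (2 <= n)%N -> vfin D -> V1 `<=` D -> vbmf D f -> {for 0, continuous f} ->
  vint D (fun y => f y * psid (dseq k) y) @[k --> \oo] --> f 0 * mass.
Proof.
move=> n2 fD VD bf cf.
have bW : vbmf D W1.
  split; first by apply: measurable_funS (@subsetT _ D) (continuous_measurable_rV openT _) => // x _; exact: cW1.
  by exists 1 => y _; rewrite ger0_norm ?cutoff_ge0// cutoff_le1.
have bpsi k : vbmf D (psid (dseq k)).
  split.
    apply: measurable_funS (@subsetT _ D) (continuous_measurable_rV openT _) => // x _.
    exact: continuous_psid.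
  exists (n%:R * (n - 2)%:R * dseq k ^+ 2 * isq (n + 2) (dseq k ^+ 2)) => y _.
  rewrite ger0_norm ?psid_ge0// ler_wpM2l//; first by rewrite mulr_ge0 ?sqr_ge0.
  by apply: le_isq; rewrite ?exprn_gt0// lerDr sqn_ge0.
have bWp k : vbmf D (fun y => W1 y * psid (dseq k) y) by exact: bmfM.
have JW k : vint D (fun y => W1 y * psid (dseq k) y) = vint V1 (fun y => W1 y * psid (dseq k) y).
  apply: int_restrict => // y _ /negP; rewrite -leNgt expr1n => hy.
  by rewrite (@W1_far 2^-1) ?mul0r//; [|rewrite (le_trans _ hy)//]; lra.
pose g y := f y - f 0 * W1 y.
have bg : vbmf D g by apply: bmfB => //; exact: bmfZ.
have bgp k : vbmf D (fun y => g y * psid (dseq k) y) by exact: bmfM.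
have W10 : W1 0 = 1 by apply: W1_near; rewrite sqn0 sqr_ge0.
have g0 : g 0 = 0 by rewrite /g W10 mulr1 subrr.
have cg : {for 0, continuous g}.
  apply: continuousB => //; apply: (@continuousM _ _ (fun=> f 0) W1); [exact: cst_continuous|exact: cW1].
have dec k : vint D (fun y => f y * psid (dseq k) y) =
    vint D (fun y => g y * psid (dseq k) y) + f 0 * vint V1 (fun y => W1 y * psid (dseq k) y).
  rewrite -JW -(intZ (f 0) fD (bWp k)) -(intD fD (bgp k) (bmfZ (f 0) (bWp k))).
  by apply: eq_int => y _; rewrite /g mulrBl mulrA subrK.
under eq_fun do rewrite dec.
have mc := mass_cvg n2.
suff g_lim : vint D (fun y => g y * psid (dseq k) y) @[k --> \oo] --> (0 : R).
  have h := cvgD g_lim (cvgM (cvg_cst (f 0)) mc).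
  by rewrite add0r in h; exact: h.
have [M hM] := bg.2.
apply/cvgrPdist_lt => eps eps0.
pose eta := eps / (2 * (`|mass| + 1)).
have m1 : 0 < `|mass| + 1 by rewrite ltr_wpDl.
have eta0 : 0 < eta by rewrite divr_gt0// mulr_gt0.
have /(_ eta eta0) := (continuous_eps g 0).1 cg.
rewrite g0 => /nbhs_ballP[d /= d0 hd].
pose r := Num.min d 4^-1; have r0 : 0 < r by rewrite /r lt_min d0 /=.
have near_g y : sqn y < r ^+ 2 -> `|g y| <= eta /\ W1 y = 1.
  move=> hy; split; last first.
    apply: W1_near; rewrite (le_trans (ltW hy))//; apply: lerXn2r; rewrite ?nnegrE ?invr_ge0 ?(ltW r0)//.
    by rewrite /r ge_min lexx orbT.
  have := hd y; rewrite sub0r normrN => h; apply/ltW/h.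
  rewrite -ball_normE /= sub0r normrN; apply: rV_norm_lt => // i.
  rewrite (lt_le_trans (_ : _ < r)) ?ge_min ?lexx//.
  rewrite -(ltr_pXn2r (n := 2)) ?nnegrE ?normr_ge0 ?(ltW r0)// real_normK ?num_real//.
  exact: le_lt_trans (coord_le_sqn y i) hy.
pose K := n%:R * (n - 2)%:R * isq (n + 2) (r ^+ 2).
have K0 : 0 <= K by rewrite mulr_ge0 ?isq_ge0.
have bnd k : `|vint D (fun y => g y * psid (dseq k) y)| <=
    eta * vint V1 (fun y => W1 y * psid (dseq k) y) + `|M| * K * vol (lebesgue_rV n) D * dseq k ^+ 2.
  apply: le_trans (le_abs_int fD (bgp k)) _.
  rewrite -JW -(intZ eta fD (bWp k)).
  have -> : `|M| * K * vol (lebesgue_rV n) D * dseq k ^+ 2 = vint D (fun=> `|M| * K * dseq k ^+ 2).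
    by rewrite int_cst// mulrAC.
  rewrite -(intD fD (bmfZ eta (bWp k)) (bmf_cst _ _)).
  apply: le_int => //; [exact: bmf_norm|by apply: bmfD; [exact: bmfZ|exact: bmf_cst]|].
  move=> y Dy; rewrite normrM [X in _ * X]ger0_norm ?psid_ge0//.
  have [hy|hy] := ltP (sqn y) (r ^+ 2).
    have [h ->] := near_g y hy; rewrite mul1r ler_wpDr//.
      by rewrite mulr_ge0 ?sqr_ge0// mulr_ge0.
    by rewrite ler_wpM2r ?psid_ge0.
  rewrite ler_wpDl//.
    by rewrite mulr_ge0 ?(ltW eta0)// mulr_ge0 ?psid_ge0 ?cutoff_ge0.
  rewrite -mulrA ler_pM ?psid_ge0//; first exact: le_trans (hM y Dy) (ler_norm M).
  by rewrite (le_trans (psid_far (dseq0 k) r0 hy))// /K mulrAC.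
have lim : (fun k => eta * vint V1 (fun y => W1 y * psid (dseq k) y) +
    `|M| * K * vol (lebesgue_rV n) D * dseq k ^+ 2) @ \oo --> eta * mass.
  rewrite -[X in _ --> X]addr0; apply: cvgD.
    by apply: cvgM; [exact: cvg_cst|exact: mc].
  rewrite -(mulr0 (`|M| * K * vol (lebesgue_rV n) D)).
  by apply: cvgM; [exact: cvg_cst|exact: dseqX].
have etam : eta * mass < eps.
  rewrite (le_lt_trans (_ : _ <= eta * `|mass|)) ?ler_wpM2l ?ler_norm ?(ltW eta0)//.
  rewrite /eta mulrAC ltr_pdivrMr ?mulr_gt0// ltr_pM2l//.
  by move: (normr_ge0 mass); move: (`|mass|) => q; lra.
have near_lt : \forall k \near \oo, eta * vint V1 (fun y => W1 y * psid (dseq k) y) +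
    `|M| * K * vol (lebesgue_rV n) D * dseq k ^+ 2 < eps by exact: (cvgr_lt _ lim).
apply: filterS near_lt => k hk.
by rewrite sub0r normrN (le_lt_trans (bnd k)).
Qed.

(** The cube of half-side d/n lies in the ball of radius d, where the kernel is at least a constant
    times d^(-n); the volume (2d/n)^n cancels this power and leaves the bound [q], free of d. *)
Lemma mass_gt0 : (3 <= n)%N -> 0 < mass.
Proof.
move=> n3; have n2 : (2 <= n)%N by exact: ltnW.
have n0 : 0 < n%:R :> R by rewrite ltr0n (ltn_trans _ n3).
have n1 : 1 <= n%:R :> R by rewrite ler1n (ltn_trans _ n3).
pose q : R := n%:R * (n - 2)%:R * isq (n + 2) 2 * (2 / n%:R) ^+ n.
have q0 : 0 < q.
  by rewrite !mulr_gt0 ?exprn_gt0 ?isq_gt0 ?divr_gt0// ltr0n subn_gt0.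
apply: (lt_le_trans q0); apply: (cvgr_to_ge (mass_cvg n2)).
near=> k.
have d0 := dseq0 k.
have d4 : dseq k <= 4^-1.
  rewrite /dseq lef_pV2 ?posrE//.
  by rewrite (ler_nat _ 4); near: k; exists 3.
set d := dseq k in d0 d4 *.
have dn0 : 0 < d / n%:R by rewrite divr_gt0.
have sq y : cube (d / n%:R) y -> sqn y <= d ^+ 2.
  move=> /cube_sqn h; apply: (le_trans h).
  rewrite exprMn exprVn mulrCA -[leRHS]mulr1 ler_pM2l ?exprn_gt0//.
  by rewrite expr2 mulrA divff ?gt_eqF// mul1r invf_le1.
have bWV : vbmf V1 (fun y => W1 y * psid d y).
  by apply: bmf_cont => //; move=> x; apply: continuousM; [exact: cW1|exact: continuous_psid].
have cV : cube (d / n%:R) `<=` V1.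
  move=> y /sq h; rewrite /V1 /hball /= expr1n (le_lt_trans h)//.
  by rewrite (le_lt_trans (_ : _ <= 4^-1 ^+ 2)) ?ler_pXn2r ?nnegrE ?(ltW d0)//; lra.
have fc := fin_meas_cube n (d / n%:R).
have h1 := le_int_set (bounded_dom_fin bV1) fc.1 cV bWV (fun y _ => mulr_ge0 (cutoff_ge0 _ _) (psid_ge0 d y)).
apply: le_trans h1.
pose v := n%:R * (n - 2)%:R * d ^+ 2 * isq (n + 2) (2 * d ^+ 2).
have -> : q = vint (cube (d / n%:R) : set 'rV[R]_n) (fun=> v).
  rewrite int_cst// lebesgue_cube ?(ltW dn0)// /q /v.
  have -> : isq (n + 2) (2 * d ^+ 2) = isq (n + 2) 2 * d^-1 ^+ (n + 2).
    by rewrite /isq sqrtrM// sqrtr_sqr gtr0_norm// invfM exprMn.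
  have -> : 2 * (d / n%:R) = 2 / n%:R * d by rewrite mulrCA mulrC.
  rewrite [(_ * d) ^+ n]exprMn.
  have e1 : d^-1 ^+ (n + 2) * (d ^+ 2 * d ^+ n) = 1.
    by rewrite -exprD addnC -exprMn mulVf ?expr1n// gt_eqF.
  move: (isq (n + 2) 2) (d^-1 ^+ (n + 2)) ((2 / n%:R) ^+ n) (n%:R * (n - 2)%:R) e1 => a f g h e1.
  move: e1; move: (d ^+ n) (d ^+ 2) => b e e1.
  by transitivity (h * a * g * (f * (e * b))); [rewrite e1 mulr1|ring].
apply: le_int => //; first exact: bmf_cst.
  by apply: bmfS bWV => //; exact: fc.1.
move=> y /sq h; rewrite W1_near ?mul1r; last first.
  by rewrite (le_trans h)// ler_pXn2r// nnegrE ltW// invr_gt0.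
rewrite /psid /v ler_wpM2l//; first by rewrite mulr_ge0 ?sqr_ge0.
apply: le_isq; first by rewrite ltr_wpDl ?sqn_ge0 ?exprn_gt0.
by move: h; move: (sqn y) (d ^+ 2) => a b; lra.
Unshelve. all: by end_near. Qed.

(** The patched value serves both poles of a Green function: an inner one, where W is continuous,
    and a reflected one outside D, where the limit is 0 because W vanishes at the boundary. *)
Lemma psid_center_cvg D W c : (2 <= n)%N -> bounded_dom D -> class_C 1 D W -> vanish D W ->
  vint D (fun y => W y * psid (dseq k) (y - c)) @[k --> \oo] --> (W \_ D) c * mass.
Proof.
move=> n2 bD CW vW; have [oD [r Dr]] := bD.
have bW := vanish_bmf bD CW vW.
(* Large enough for the cube to contain both D and the unit ball about c, as [psid_cvg] requires
   after translation. *)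
pose s := \sum_i `|c ord0 i| + 1 + `|r|.
have Ds : D `<=` cube s.
  move=> y /Dr hy i; rewrite (le_trans (hy i))// (le_trans (ler_norm r))// /s lerDr.
  by rewrite addr_ge0// sumr_ge0.
have fc := fin_meas_cube n s.
have mD := (bounded_dom_fin bD).1.
have bWs : vbmf (cube s) (W \_ D).
  apply: (bmf_ext0 fc.1 mD Ds) => [|y _ nD]; last by rewrite patchE memNset.
  by apply: eq_bmf bW => y Dy; rewrite patchE mem_set.
have bps k : vbmf (cube s) (fun y => psid (dseq k) (y - c)).
  apply: bmf_cube_cont => y; apply: (continuous_comp (f := fun y => y - c)); last exact: continuous_psid.
  by apply: continuousB => //; exact: cst_continuous.
have bWp k := bmfM bWs (bps k).
pose D' := [set x | cube s (c + 1 *: x)].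
have e1 k : vint D (fun y => W y * psid (dseq k) (y - c)) =
    vint D' (fun x => (fun x => (W \_ D) (c + 1 *: x)) x * psid (dseq k) x).
  rewrite (_ : vint D _ = vint D (fun y => (W \_ D) y * psid (dseq k) (y - c))); last first.
    by apply: eq_int => y Dy; rewrite patchE mem_set.
  rewrite -(int_restrict fc mD Ds (bWp k)); last by move=> y _ nD; rewrite patchE memNset// mul0r.
  have [_ ->] := int_affine c ltr01 fc (bWp k); rewrite expr1n mul1r.
  by apply: eq_int => x _; rewrite scale1r [c + x]addrC addrK.
under eq_fun do rewrite e1.
have -> : (W \_ D) c = (fun x => (W \_ D) (c + 1 *: x)) 0 by rewrite scaler0 addr0.
have [fD' _] := int_affine c ltr01 fc bWs.
apply: psid_cvg => //.
- move=> x /hball_cube hx i; rewrite /= scale1r mxE (le_trans (ler_normD _ _))//.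
  rewrite /s (bigD1 i)//= -!addrA lerD2l (le_trans (hx ler01 i))// addrCA lerDl addr_ge0// sumr_ge0//.
- have [mW [M hM]] := bWs; split; last by exists M => x; exact: hM.
  apply: (measurable_comp (F := cube s)) => //; first exact: fc.1.
    by move=> _ [x + <-].
  exact: measurable_funTS (measurable_affine c 1).
- apply: (continuous_comp (f := fun x => c + 1 *: x)).
    apply: (@continuousD _ _ _ (fun=> c)); first exact: cst_continuous.
    rewrite (_ : *:%R 1 = id)//; apply/funext => x; exact: scale1r.
  rewrite scaler0 addr0; have [Dc|nDc] := pselect (D c).
    have hn := near_patch W oD Dc.
    apply: (continuous_near (f := W)); first exact: hn.
    exact: (class_C_cont CW Dc).
  apply/continuous_eps => eps eps0; have := vW c nDc eps eps0; apply: filterS => y hy.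
  rewrite [X in `|X - _|]patchE memNset// sub0r normrN patchE.
  by case: ifPn => [/set_mem|_]; [exact: hy|rewrite normr0].
Unshelve. all: by end_near. Qed.

(** The limit d -> 0 in [prerepresentation]: the left side concentrates at the poles, and the right
    side converges because the Laplacian of W is 0 near both. The weight is 1 for the half-space and
    0 for the whole space. *)
Theorem representation D W (T e kap : R) c c' : (3 <= n)%N -> bounded_dom D -> 0 < T -> 0 < e ->
  class_C 2 D W -> vanish D W -> (forall i, vbmf D (partial i W)) -> vbmf D (laplacian W) ->
  (forall y, D y -> T ^+ 2 <= sqn y -> W y = 0) ->
  (forall d, 0 < d -> vanish D (fun y => cutoff T y * (Gd d c y - kap * Gd d c' y))) ->
  D c -> ~ D c' ->
  (forall y, D y -> sqn (y - c) <= e -> laplacian W y = 0) ->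
  (forall y, D y -> sqn (y - c') <= e -> laplacian W y = 0) ->
  mass * W c = - vint D (fun y => (Gam (y - c) - kap * Gam (y - c')) * laplacian W y).
Proof.
move=> n3 bD T0 e0 CW vW bW blW W0 vG Dc nDc' l1 l2.
have n2 : (2 <= n)%N by exact: ltnW.
have oD := bD.1; have fD := bounded_dom_fin bD; have CW1 := class_CW (leqnSn 1) CW.
have bWD := vanish_bmf bD CW1 vW.
have bps k x : vbmf D (fun y => psid (dseq k) (y - x)).
  apply: bmf_cont => // y; apply: (continuous_comp (f := fun y => y - x)); last exact: continuous_psid.
  by apply: continuousB => //; exact: cst_continuous.
have bWp k x := bmfM bWD (bps k x).
have bGd k x : vbmf D (Gd (dseq k) x).
  by apply: bmf_cont => // y; exact: (class_C_cont (class_C_Gd 0 x (dseq0 k)) (I : setT y)).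
have bGl k x := bmfM (bGd k x) blW.
have pre k := prerepresentation n2 bD T0 (dseq0 k) CW vW bW blW W0 (vG _ (dseq0 k)).
have L k : vint D (fun y => W y * (kap * psid (dseq k) (y - c') - psid (dseq k) (y - c))) =
    kap * vint D (fun y => W y * psid (dseq k) (y - c')) - vint D (fun y => W y * psid (dseq k) (y - c)).
  rewrite -(intZ kap fD (bWp k c')) -(intB fD (bmfZ kap (bWp k c')) (bWp k c)).
  by apply: eq_int => y _; rewrite mulrBr mulrCA.
have Rk k : vint D (fun y => (Gd (dseq k) c y - kap * Gd (dseq k) c' y) * laplacian W y) =
    vint D (fun y => Gd (dseq k) c y * laplacian W y) - kap * vint D (fun y => Gd (dseq k) c' y * laplacian W y).
  rewrite -(intZ kap fD (bGl k c')) -(intB fD (bGl k c) (bmfZ kap (bGl k c'))).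
  by apply: eq_int => y _; rewrite mulrBl mulrA.
have bc := bmf_GamM fD oD blW e0 l1; have bc' := bmf_GamM fD oD blW e0 l2.
have -> : vint D (fun y => (Gam (y - c) - kap * Gam (y - c')) * laplacian W y) =
   vint D (fun y => Gam (y - c) * laplacian W y) - kap * vint D (fun y => Gam (y - c') * laplacian W y).
  rewrite -(intZ kap fD bc') -(intB fD bc (bmfZ kap bc')).
  by apply: eq_int => y _; rewrite mulrBl mulrA.
have c1 : (fun k => kap * vint D (fun y => W y * psid (dseq k) (y - c')) -
    vint D (fun y => W y * psid (dseq k) (y - c))) @ \oo --> kap * ((W \_ D) c' * mass) - (W \_ D) c * mass.
  by apply: cvgB; [apply: cvgM; [exact: cvg_cst|]|]; exact: psid_center_cvg.
have c2 : (fun k => kap * vint D (fun y => W y * psid (dseq k) (y - c')) -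
    vint D (fun y => W y * psid (dseq k) (y - c))) @ \oo -->
    vint D (fun y => Gam (y - c) * laplacian W y) - kap * vint D (fun y => Gam (y - c') * laplacian W y).
  under eq_fun => k do rewrite -L pre Rk.
  apply: cvgB; first exact: (Gd_int_cvg fD oD blW e0 l1).
  by apply: cvgM; [exact: cvg_cst|exact: (Gd_int_cvg fD oD blW e0 l2)].
have E : kap * ((W \_ D) c' * mass) - (W \_ D) c * mass =
    vint D (fun y => Gam (y - c) * laplacian W y) - kap * vint D (fun y => Gam (y - c') * laplacian W y).
  exact: (cvg_unique (@Rhausdorff R) c1 c2).
have e1 : (W \_ D) c = W c by rewrite patchE mem_set.
have e2 : (W \_ D) c' = 0 by rewrite patchE memNset.
move: E; rewrite e1 e2 mul0r mulr0 sub0r => <-.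
by rewrite opprK mulrC.
Qed.

End representation.

(** * Convergent series of separated monomials *)

Section series_algebra.
Context {R : realType} {n : nat}.
Notation mR := (measurableTypeR R).
Notation V := 'rV[R]_n.
Implicit Types (X Y Z : set V) (F G : R -> R -> V -> V -> R).

Lemma measurable_limit X (f : nat -> V -> R) (g : V -> R) :
  (forall k, measurable_fun (X : set 'rV[mR]_n) (f k)) ->
  (forall x, X x -> f k x @[k --> \oo] --> g x) ->
  measurable_fun (X : set 'rV[mR]_n) g.
Proof.
move=> mf fg; apply/measurable_EFinP.
apply: (emeasurable_fun_cvg (fun k x => (f k x)%:E)) => [k|x Xx].
  by apply/measurable_EFinP; exact: mf.
by apply: cvg_EFin; [exact: nearW|exact: fg].
Qed.

Lemma bd_cst X (c : R) : bd X (fun=> c) `|c|.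
Proof. by split => //; exact: measurable_cst. Qed.

Lemma bdM X f g (A B : R) : bd X f A -> bd X g B -> bd X (fun x => f x * g x) (A * B).
Proof.
move=> [mf A0 hf] [mg B0 hg]; split; [exact: measurable_funM|exact: mulr_ge0|].
by move=> x Xx; rewrite normrM ler_pM ?hf ?hg.
Qed.

Lemma bd_sub X Y f (A : R) : measurable (X : set 'rV[mR]_n) -> measurable (Y : set 'rV[mR]_n) ->
  Y `<=` X -> bd X f A -> bd Y f A.
Proof.
by move=> mX mY YX [mf A0 hf]; split => // [|x /YX]; [exact: measurable_funS mf|exact: hf].
Qed.

(* Functions of the two real parameters and of two space variables that are sums of separated
   monomials, with all the norms at |e_1|, |e_2| <= r summing up to at most C. *)
Inductive ser X Y (r : R) : R -> (R -> R -> V -> V -> R) -> Prop :=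
| ser_mono i j (al be : V -> R) (A B C : R) : bd X al A -> bd Y be B ->
    A * B * (r ^+ i * r ^+ j) <= C ->
    ser X Y r C (fun e1 e2 a b => e1 ^+ i * e2 ^+ j * (al a * be b))
| ser_series (c : nat -> R) (F : nat -> R -> R -> V -> V -> R) (C : R) G :
    (forall k, ser X Y r (c k) (F k)) -> (forall N : nat, \sum_(k < N) c k <= C) ->
    (forall e1 e2 a b, `|e1| <= r -> `|e2| <= r -> X a -> Y b ->
       \sum_(k < N) F k e1 e2 a b @[N --> \oo] --> G e1 e2 a b) ->
    ser X Y r C G.

Section fixed_domains.
Variables (X Y : set V) (r : R).
Hypothesis r0 : 0 <= r.

Lemma ser_ge0 C F : ser X Y r C F -> 0 <= C.
Proof.
elim => [i j al be A B {}C [_ A0 _] [_ B0 _] h|c {}F {}C G _ c0 cC _].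
  by apply: le_trans h; rewrite !mulr_ge0 ?exprn_ge0.
by apply: le_trans (cC 0%N); rewrite big_ord0.
Qed.

Lemma ser_bound C F : ser X Y r C F ->
  forall e1 e2 a b, `|e1| <= r -> `|e2| <= r -> X a -> Y b -> `|F e1 e2 a b| <= C.
Proof.
elim => [i j al be A B {}C [_ A0 hA] [_ B0 hB] h|c {}F {}C G _ hF cC cv] e1 e2 a b h1 h2 Xa Yb.
  apply: le_trans h; rewrite !normrM mulrC ler_pM ?mulr_ge0//.
    by rewrite ler_pM ?hA ?hB.
  by rewrite !normrX ler_pM ?exprn_ge0//; apply: lerXn2r; rewrite ?nnegrE.
apply: (cvgr_to_le (cvg_norm (cv _ _ _ _ h1 h2 Xa Yb))); apply: nearW => N.
apply: le_trans (cC N); apply: le_trans (ler_norm_sum _ _ _) _.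
by apply: ler_sum => k _; exact: hF.
Qed.

Lemma ser_bd C F : ser X Y r C F -> forall e1 e2, `|e1| <= r -> `|e2| <= r ->
  (forall a, X a -> bd Y (F e1 e2 a) C) /\ (forall b, Y b -> bd X (fun a => F e1 e2 a b) C).
Proof.
move=> sF e1 e2 h1 h2.
suff [ma mb] : (forall a, X a -> measurable_fun (Y : set 'rV[mR]_n) (F e1 e2 a)) /\
    (forall b, Y b -> measurable_fun (X : set 'rV[mR]_n) (fun a => F e1 e2 a b)).
  have C0 := ser_ge0 sF; split => [a Xa|b Yb]; split => //; try exact: ma; try exact: mb.
    by move=> b Yb; exact: (ser_bound sF).
  by move=> a Xa; exact: (ser_bound sF).
elim: sF => [i j al be A B {}C [ma _ _] [mb _ _] _|c {}F {}C G _ hF cC cv].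
  split => [a _|b _].
    by apply: measurable_funM; [exact: measurable_cst|apply: measurable_funM => //; exact: measurable_cst].
  by apply: measurable_funM; [exact: measurable_cst|apply: measurable_funM => //; exact: measurable_cst].
split => [a Xa|b Yb].
  apply: (measurable_limit (f := fun N b => \sum_(k < N) F k e1 e2 a b)).
    by move=> N; apply: measurable_sum => k; exact: (hF k).1.
  by move=> b Yb; exact: cv.
apply: (measurable_limit (f := fun N a => \sum_(k < N) F k e1 e2 a b)).
  by move=> N; apply: measurable_sum => k; exact: (hF k).2.
by move=> a Xa; exact: cv.
Qed.

Lemma ser_zero : ser X Y r 0 (fun _ _ _ _ => 0).
Proof.
have h := @ser_mono X Y r 0 0 (fun=> 0) (fun=> 0) `|0| `|0| 0 (bd_cst X 0) (bd_cst Y 0).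
rewrite !normr0 !mul0r in h; have {}h := h (lexx _).
apply: (ser_series (c := fun=> 0) (fun=> h)) => [N|]; first by rewrite big1.
move=> e1 e2 a b _ _ _ _; rewrite (_ : (fun N => _) = (fun=> 0 : R)); first exact: cvg_cst.
by apply/funext => N; rewrite big1 // => k _; rewrite !mulr0.
Qed.

Lemma cvg_eventually (u : nat -> R) (l : R) (K : nat) :
  (forall N, (K <= N)%N -> u N = l) -> u @ \oo --> l.
Proof. by move=> h; apply: cvg_near_cst; exists K => // N /=; exact: h. Qed.

(** A series with a single nonzero term: since [ser_series] asks for convergence on the domain only,
    it absorbs a change of the function elsewhere as well as a larger bound. *)
Lemma eq_ser C C' F G : ser X Y r C F -> C <= C' ->
  (forall e1 e2 a b, `|e1| <= r -> `|e2| <= r -> X a -> Y b -> F e1 e2 a b = G e1 e2 a b) ->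
  ser X Y r C' G.
Proof.
move=> sF CC' FG; have C0 := ser_ge0 sF.
apply: (ser_series (c := fun k => if k is 0 then C else 0)
  (F := fun k => if k is 0 then F else fun _ _ _ _ => 0)).
- by case => [|k] //; exact: ser_zero.
- case => [|N]; first by rewrite big_ord0 (le_trans C0).
  by rewrite big_ord_recl big1 ?addr0.
- move=> e1 e2 a b h1 h2 Xa Yb; apply: (@cvg_eventually _ _ 1) => -[|N]// _.
  by rewrite big_ord_recl big1 ?addr0 ?FG.
Qed.

Lemma le_ser C C' F : ser X Y r C F -> C <= C' -> ser X Y r C' F.
Proof. by move=> sF CC'; exact: (eq_ser sF CC'). Qed.

Lemma ser_cst (c : R) : ser X Y r `|c| (fun _ _ _ _ => c).
Proof.
have h : ser X Y r `|c| (fun e1 e2 a b => e1 ^+ 0 * e2 ^+ 0 * ((fun=> c) a * (fun=> 1) b)).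
  by apply: (ser_mono (bd_cst X c) (bd_cst Y 1)); rewrite normr1 !mulr1.
by apply: (eq_ser h) => // *; rewrite !expr0 !mulr1 mul1r.
Qed.

Lemma ser_e1 : ser X Y r r (fun e1 _ _ _ => e1).
Proof.
have h := @ser_mono X Y r 1 0 (fun=> 1) (fun=> 1) `|1| `|1| r (bd_cst X 1) (bd_cst Y 1).
rewrite normr1 !mulr1 mul1r expr1 in h; apply: (eq_ser (h (lexx _))) => // *.
by rewrite !mulr1 expr1.
Qed.

Lemma ser_e2 : ser X Y r r (fun _ e2 _ _ => e2).
Proof.
have h := @ser_mono X Y r 0 1 (fun=> 1) (fun=> 1) `|1| `|1| r (bd_cst X 1) (bd_cst Y 1).
rewrite normr1 !mulr1 !mul1r expr1 in h; apply: (eq_ser (h (lexx _))) => // *.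
by rewrite !mulr1 mul1r expr1.
Qed.

Lemma ser_a al (A : R) : bd X al A -> ser X Y r A (fun _ _ a _ => al a).
Proof.
move=> ba; have h := @ser_mono X Y r 0 0 al (fun=> 1) A `|1| A ba (bd_cst Y 1).
rewrite normr1 !mulr1 in h; apply: (eq_ser (h (lexx _))) => // *.
by rewrite !mulr1 mul1r.
Qed.

Lemma serD C1 C2 F G : ser X Y r C1 F -> ser X Y r C2 G ->
  ser X Y r (C1 + C2) (fun e1 e2 a b => F e1 e2 a b + G e1 e2 a b).
Proof.
move=> sF sG; have C10 := ser_ge0 sF; have C20 := ser_ge0 sG.
apply: (ser_series (c := fun k => match k with 0 => C1 | 1 => C2 | _ => 0 end)
  (F := fun k => match k with 0 => F | 1 => G | _ => fun _ _ _ _ => 0 end)).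
- by move=> [|[|k]] //; exact: ser_zero.
- move=> [|[|N]]; first by rewrite big_ord0 addr_ge0.
    by rewrite big_ord_recl big_ord0 addr0 lerDl.
  by rewrite !big_ord_recl big1 ?addr0.
- move=> e1 e2 a b h1 h2 Xa Yb; apply: (@cvg_eventually _ _ 2) => -[|[|N]]// _.
  by rewrite !big_ord_recl big1 ?addr0.
Qed.

Lemma ser_sum (I : Type) (s : seq I) (P : pred I) (c : I -> R) (F : I -> R -> R -> V -> V -> R) :
  (forall i, ser X Y r (c i) (F i)) ->
  ser X Y r (\sum_(i <- s | P i) c i) (fun e1 e2 a b => \sum_(i <- s | P i) F i e1 e2 a b).
Proof.
move=> sF; elim: s => [|i s IH].
  rewrite big_nil; apply: (eq_ser ser_zero) => // *; by rewrite big_nil.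
rewrite big_cons; case: ifP => Pi.
  by apply: (eq_ser (serD (sF i) IH)) => // *; rewrite big_cons Pi.
by apply: (eq_ser IH) => // *; rewrite big_cons Pi.
Qed.

(** Induction on both derivations: a fixed factor is distributed over the series until two monomials
    meet. *)
Lemma serM C1 C2 F G : ser X Y r C1 F -> ser X Y r C2 G ->
  ser X Y r (C1 * C2) (fun e1 e2 a b => F e1 e2 a b * G e1 e2 a b).
Proof.
move=> sF sG; have C20 := ser_ge0 sG.
elim: sF => [i j al be A B C ba bb hC|c {}F C {}F' sF hF cC cv]; last first.
  apply: (ser_series hF) => [N|e1 e2 a b h1 h2 Xa Yb].
    by rewrite -mulr_suml ler_wpM2r.
  under eq_fun do rewrite -mulr_suml.
  by apply: cvgM; [exact: cv|exact: cvg_cst].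
have [_ A0 _] := ba; have [_ B0 _] := bb.
have C0 : 0 <= C by apply: le_trans hC; rewrite !mulr_ge0 ?exprn_ge0.
elim: sG {C20} => [i' j' al' be' A' B' C' ba' bb' hC'|c {}F C' {}F' sF hF cC cv]; last first.
  apply: (ser_series hF) => [N|e1 e2 a b h1 h2 Xa Yb].
    by rewrite -mulr_sumr ler_wpM2l.
  under eq_fun do rewrite -mulr_sumr.
  by apply: cvgM; [exact: cvg_cst|exact: cv].
have [_ A0' _] := ba'; have [_ B0' _] := bb'.
have h := @ser_mono X Y r (i + i') (j + j') _ _ (A * A') (B * B') (C * C') (bdM ba ba') (bdM bb bb') _.
apply: (eq_ser (h _)) => //.
  apply: le_trans (ler_pM _ _ hC hC'); rewrite ?mulr_ge0 ?exprn_ge0//.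
  by rewrite !exprD; move: (r ^+ i) (r ^+ i') (r ^+ j) (r ^+ j') => p q s t; rewrite le_eqVlt; apply/orP; left; apply/eqP; ring.
move=> e1 e2 a b _ _ _ _; rewrite !exprD.
by move: (e1 ^+ _) (e1 ^+ _) (e2 ^+ _) (e2 ^+ _) (al a) (al' a) (be b) (be' b) => *; ring.
Qed.

Lemma serX C F k : ser X Y r C F -> ser X Y r (C ^+ k) (fun e1 e2 a b => F e1 e2 a b ^+ k).
Proof.
move=> sF; elim: k => [|k IH].
  by apply: (eq_ser (ser_cst 1)) => [|*]; rewrite ?normr1.
by apply: (eq_ser (serM sF IH)) => [|*]; rewrite exprS.
Qed.

Lemma serZ C F (c : R) : ser X Y r C F -> ser X Y r (`|c| * C) (fun e1 e2 a b => c * F e1 e2 a b).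
Proof. by move=> sF; exact: (serM (ser_cst c) sF). Qed.

Lemma serN C F : ser X Y r C F -> ser X Y r C (fun e1 e2 a b => - F e1 e2 a b).
Proof.
by move=> sF; apply: (eq_ser (serZ (-1) sF)) => [|*]; rewrite ?normrN1 ?mul1r ?mulN1r.
Qed.

Lemma serB C1 C2 F G : ser X Y r C1 F -> ser X Y r C2 G ->
  ser X Y r (C1 + C2) (fun e1 e2 a b => F e1 e2 a b - G e1 e2 a b).
Proof. by move=> sF sG; exact: (serD sF (serN sG)). Qed.

Lemma ser_geo C F : C < 1 -> ser X Y r C F ->
  ser X Y r (1 - C)^-1 (fun e1 e2 a b => (1 - F e1 e2 a b)^-1).
Proof.
move=> C1 sF; have C0 := ser_ge0 sF.
have geo (z : R) : `|z| < 1 -> \sum_(k < N) z ^+ k @[N --> \oo] --> (1 - z)^-1.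
  move=> z1; have := @cvg_geometric_series R 1 z z1; rewrite mul1r.
  rewrite (_ : series _ = fun N => \sum_(k < N) z ^+ k)//.
  by apply/funext => N; rewrite /series /= big_mkord; apply: eq_bigr => k _; rewrite /= mul1r.
apply: (ser_series (fun k => serX k sF)) => [N|e1 e2 a b h1 h2 Xa Yb].
  apply: (cvgr_to_ge (geo C _)); first by rewrite ger0_norm.
  exists N => // M /= NM; rewrite -(subnKC NM) big_split_ord /= lerDl sumr_ge0// => k _.
  exact: exprn_ge0.
by apply: geo; apply: le_lt_trans C1; exact: (ser_bound sF).
Qed.

End fixed_domains.

Lemma ser_b X Y r be (B : R) : 0 <= r -> bd Y be B -> ser X Y r B (fun _ _ _ b => be b).
Proof.
move=> r0 bb; have h := @ser_mono X Y r 0 0 (fun=> 1) be `|1| B B (bd_cst X 1) bb.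
rewrite normr1 !mulr1 mul1r in h; apply: (eq_ser r0 (h (lexx _))) => // *.
by rewrite !mul1r.
Qed.

Lemma ser_swap X Y r C F : 0 <= r -> ser X Y r C F -> ser Y X r C (fun e1 e2 a b => F e1 e2 b a).
Proof.
move=> r0; elim => [i j al be A B {}C ba bb hC|c {}F {}C G sF hF cC cv].
  apply: (eq_ser r0 (@ser_mono Y X r i j be al B A C bb ba _)) => //; first by rewrite (mulrC B).
  by move=> *; rewrite (mulrC (be _)).
by apply: (ser_series hF cC) => *; exact: cv.
Qed.

Lemma ser_sub X Y X' Y' r r' C F : 0 <= r' -> r' <= r ->
  measurable (X : set 'rV[mR]_n) -> measurable (Y : set 'rV[mR]_n) ->
  measurable (X' : set 'rV[mR]_n) -> measurable (Y' : set 'rV[mR]_n) ->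
  X' `<=` X -> Y' `<=` Y -> ser X Y r C F -> ser X' Y' r' C F.
Proof.
move=> r0 rr mX mY mX' mY' XX YY; elim => [i j al be A B {}C ba bb hC|c {}F {}C G sF hF cC cv].
  apply: ser_mono (bd_sub mX mX' XX ba) (bd_sub mY mY' YY bb) _.
  apply: le_trans hC; have [_ A0 _] := ba; have [_ B0 _] := bb.
  rewrite ler_wpM2l ?mulr_ge0// ler_pM ?exprn_ge0//; apply: lerXn2r; rewrite ?nnegrE// (le_trans r0)//.
apply: (ser_series hF cC) => e1 e2 a b h1 h2 /XX Xa /YY Yb.
by apply: cv => //; [exact: le_trans h1 rr|exact: le_trans h2 rr].
Qed.

(** The tails are bounded in sup norm by those of the majorant series c, so a functional bounded for
    the sup norm passes to the limit. *)
Lemma bd_lim X (l : (V -> R) -> R) (K C : R) (c : nat -> R) (f : nat -> V -> R) g :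
  blin X l K -> (forall k, bd X (f k) (c k)) -> (forall N : nat, \sum_(k < N) c k <= C) ->
  (forall x, X x -> \sum_(k < N) f k x @[N --> \oo] --> g x) ->
  \sum_(k < N) l (f k) @[N --> \oo] --> l g.
Proof.
move=> bl bf cC cv; have [lin K0 hK] := bl.
have c0 k : 0 <= c k by case: (bf k).
pose S N := \sum_(k < N) c k.
have Snd : nondecreasing_seq S.
  by move=> N M NM; rewrite /S -(subnKC NM) big_split_ord /= lerDl sumr_ge0.
have cS : cvgn S by apply: nondecreasing_is_cvgn => //; exists C => _ [N _ <-]; exact: cC.
have leS := nondecreasing_cvgn_le Snd cS.
pose fs N x := \sum_(k < N) f k x.
have bfs N : bmf (X : set 'rV[mR]_n) (fs N).
  split; first by apply: measurable_sum => k; case: (bf k).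
  exists (S N) => x Xx; apply: le_trans (ler_norm_sum _ _ _) _; apply: ler_sum => k _.
  by have [_ _] := bf k; exact.
have tail N : bd X (fun x => g x - fs N x) (limn S - S N).
  split.
  - apply: measurable_funB; last exact: (bfs N).1.
    by apply: (measurable_limit (f := fs)) => // k; exact: (bfs k).1.
  - by rewrite subr_ge0.
  - move=> x Xx; have h : `|fs M x - fs N x| @[M --> \oo] --> `|g x - fs N x|.
      by apply: cvg_norm; apply: cvgB; [exact: cv|exact: cvg_cst].
    apply: (cvgr_to_le h); exists N => // M /= NM.
    rewrite (le_trans (_ : _ <= S M - S N)) ?lerD2r//.
    rewrite /fs /S -(subnKC NM) !big_split_ord /= addrAC subrr add0r [X in _ <= X]addrAC subrr add0r.
    apply: le_trans (ler_norm_sum _ _ _) _; apply: ler_sum => k _.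
    by have [_ _] := bf (N + k)%N; exact.
have bg : bmf (X : set 'rV[mR]_n) g.
  have := bmfD (bd_bmf (tail 0%N)) (bfs 0%N); apply: eq_bmf => x _; exact: subrK.
have lfs N : l (fs N) = \sum_(k < N) l (f k).
  elim: N => [|N IH].
    rewrite big_ord0; apply/eqP; rewrite -normr_le0 -(mulr0 K); apply: hK; split => //.
      exact: (bfs 0%N).1.
    by move=> x _; rewrite /fs big_ord0 normr0.
  rewrite big_ord_recr /= -IH.
  have -> : fs N.+1 = fun x => 1 * fs N x + f N x.
    by apply/funext => x; rewrite mul1r /fs big_ord_recr.
  by rewrite lin ?mul1r//; exact: (bd_bmf (bf N)).
have t0 : limn S - S N @[N --> \oo] --> (0 : R).
  by rewrite -(subrr (limn S)); apply: cvgB; [exact: cvg_cst|exact: cS].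
have Kt0 : K * (limn S - S N) @[N --> \oo] --> (0 : R).
  by rewrite -(mulr0 K); apply: cvgM; [exact: cvg_cst|exact: t0].
apply/cvgrPdist_lt => e e0; have near_lt : \forall N \near \oo, K * (limn S - S N) < e.
  exact: (cvgr_lt _ Kt0).
apply: filterS near_lt => N hN; apply: le_lt_trans hN.
by rewrite -lfs -(blin_sub bl bg (bfs N)); exact: hK.
Qed.

Lemma blinZ X l (K a : R) f : blin X l K -> bmf (X : set 'rV[mR]_n) f -> l (fun x => a * f x) = a * l f.
Proof.
move=> [lin K0 hK] bf.
have l0 : l (fun=> 0) = 0.
  apply/eqP; rewrite -normr_le0 -[leRHS](mulr0 K); apply: hK; split => //.
  by move=> x _; rewrite normr0.
have := lin a f (fun=> 0) bf (bmf_cst _ _); rewrite l0 addr0 => <-.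
by congr l; apply/funext => x; rewrite addr0.
Qed.

Lemma ser_lin X Y Z r l (K C : R) F : 0 <= r -> blin Y l K -> ser X Y r C F ->
  ser X Z r (K * C) (fun e1 e2 a _ => l (F e1 e2 a)).
Proof.
move=> r0 bl; have [_ K0 hK] := bl.
elim => [i j al be A B {}C ba bb hC|c {}F {}C G sF hF cC cv].
  have [_ A0 _] := ba; have [_ B0 _] := bb.
  have h : ser X Z r (K * C) (fun e1 e2 a b => e1 ^+ i * e2 ^+ j * (al a * (fun=> l be) b)).
    apply: (ser_mono (A := A) (B := `|l be|)) ba (bd_cst _ _) _.
    apply: le_trans (_ : A * (K * B) * (r ^+ i * r ^+ j) <= _).
      by rewrite ler_wpM2r ?mulr_ge0 ?exprn_ge0// ler_wpM2l// hK.
    have -> : A * (K * B) * (r ^+ i * r ^+ j) = K * (A * B * (r ^+ i * r ^+ j)).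
      by rewrite (mulrCA A K B) -!mulrA.
    by rewrite ler_wpM2l.
  apply: (eq_ser r0 h) => // e1 e2 a b _ _ _ _.
  rewrite mulrA -(blinZ (e1 ^+ i * e2 ^+ j * al a) bl (bd_bmf bb)).
  by congr l; apply/funext => x; rewrite mulrA.
apply: (ser_series hF) => [N|e1 e2 a b h1 h2 Xa _].
  by rewrite -mulr_sumr ler_wpM2l.
have bf k : bd Y (F k e1 e2 a) (c k) by exact: (ser_bd r0 (sF k) h1 h2).1.
exact: (bd_lim bl bf cC (fun x Yx => cv e1 e2 a x h1 h2 Xa Yx)).
Qed.

(** A function of one space variable is encoded with a dummy second slot: for F it is evaluated at
    0, in the result it ranges over an arbitrary set [W]. *)
Lemma ser_bil X Y Z W r (bil : (V -> R) -> (V -> R) -> R) (K C1 C2 : R) F G : 0 <= r ->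
  bbil X Y bil K -> ser X setT r C1 F -> ser Z Y r C2 G ->
  ser Z W r (K * C1 * C2) (fun e1 e2 a _ => bil (fun x => F e1 e2 x 0) (G e1 e2 a)).
Proof.
move=> r0 [K0 bl1 bl2] sF sG; have C20 := ser_ge0 r0 sG.
elim: sF => [i j al be A B C ba bb hC|c {}F C {}F' sF hF cC cv].
  have [_ A0 _] := ba; have [_ B0 hB] := bb.
  have h1 : ser Z W r (B * (r ^+ i * r ^+ j)) (fun e1 e2 a b => e1 ^+ i * e2 ^+ j * ((fun=> be 0) a * (fun=> 1) b)).
    apply: (ser_mono (bd_cst Z (be 0)) (bd_cst W 1)).
    by rewrite normr1 mulr1 ler_wpM2r ?mulr_ge0 ?exprn_ge0// hB.
  apply: (eq_ser r0 (serM r0 h1 (ser_lin W r0 (bl2 _ _ ba) sG))).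
    rewrite (_ : _ * _ = K * (A * B * (r ^+ i * r ^+ j)) * C2); last first.
      by move: (r ^+ i) (r ^+ j) => *; ring.
    by rewrite ler_wpM2r// ler_wpM2l.
  move=> e1 e2 a b h1' h2' Za Wb; rewrite mulr1.
  have [_ _ hK] := bl2 _ _ ba.
  have bG := (ser_bd r0 sG h1' h2').1 a Za; have bl := bl1 _ _ bG.
  rewrite -(blinZ _ bl (bd_bmf ba)); congr bil; apply/funext => x.
  by rewrite -mulrA (mulrC (be 0)).
apply: (ser_series hF) => [N|e1 e2 a b h1 h2 Za _].
  by rewrite -mulr_suml -mulr_sumr ler_wpM2r// ler_wpM2l.
have bG := (ser_bd r0 sG h1 h2).1 a Za.
have bf k : bd X (fun x => F k e1 e2 x 0) (c k) by exact: (ser_bd r0 (sF k) h1 h2).2.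
exact: (bd_lim (bl1 _ _ bG) bf cC (fun x Xx => cv e1 e2 x 0 h1 h2 Xx I)).
Qed.

End series_algebra.

(** * Series for square roots and inverse distances, and the Neumann series *)

Section series_functions.
Context {R : realType} {n : nat}.
Notation mR := (measurableTypeR R).
Notation V := 'rV[R]_n.
Implicit Types (X Y Z : set V) (F G : R -> R -> V -> V -> R).

Lemma isqM k (a b : R) : 0 <= a -> isq k (a * b) = isq k a * isq k b.
Proof. by move=> a0; rewrite /isq sqrtrM// invfM exprMn. Qed.

Section sqrt.
Variables (X Y : set V) (r : R).
Hypothesis r0 : 0 <= r.

Let zit (w : R) k : R := iter k (fun z => (w - z ^+ 2) / 2) 0.

Let zitS w k : zit w k.+1 = (w - zit w k ^+ 2) / 2. Proof. by []. Qed.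

Let ser_zit C F k : C <= 4^-1 -> ser X Y r C F -> ser X Y r 2^-1 (fun e1 e2 a b => zit (F e1 e2 a b) k).
Proof.
move=> C4 sF; elim: k => [|k IH].
  by apply: (eq_ser r0 (ser_zero X Y r)) => //; rewrite invr_ge0.
have h := serZ r0 2^-1 (serB r0 sF (serX r0 2 IH)).
apply: (eq_ser r0 h) => [|e1 e2 a b _ _ _ _]; last by rewrite zitS mulrC.
by rewrite ger0_norm ?invr_ge0//; lra.
Qed.

(* The iteration z <- (w - z^2) / 2 converges geometrically to the root of (1 + z)^2 = 1 + w near 0. *)
Lemma ser_sqrt C F : C <= 4^-1 -> ser X Y r C F ->
  ser X Y r 4^-1 (fun e1 e2 a b => Num.sqrt (1 + F e1 e2 a b) - 1).
Proof.
move=> C4 sF; have C0 := ser_ge0 r0 sF.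
have sD k : ser X Y r (2^-1 ^+ k.+3) (fun e1 e2 a b => zit (F e1 e2 a b) k.+1 - zit (F e1 e2 a b) k).
  elim: k => [|k IH].
    apply: (eq_ser r0 (serZ r0 2^-1 sF)) => [|e1 e2 a b _ _ _ _].
      rewrite ger0_norm ?invr_ge0// !exprS expr0; move: C4; lra.
    by rewrite /zit /= subr0 expr0n subr0 mulrC.
  have h := serZ r0 2^-1 (serN r0 (serM r0 IH (serD r0 (ser_zit k.+1 C4 sF) (ser_zit k C4 sF)))).
  apply: (eq_ser r0 h) => [|e1 e2 a b _ _ _ _].
    rewrite ger0_norm ?invr_ge0// [leRHS]exprS; move: (2^-1 ^+ k.+3) => q; lra.
  rewrite [in RHS]zitS [X in _ = _ - X]zitS.
  by move: (F e1 e2 a b) (zit _ k.+1) (zit _ k) => w p q; field.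
have sumE N : \sum_(k < N) 2^-1 ^+ k.+3 = 4^-1 - 2^-1 ^+ N.+2 :> R.
  elim: N => [|N IH]; first by rewrite big_ord0 !exprS expr0; lra.
  rewrite big_ord_recr /= IH [2^-1 ^+ N.+3]exprS; move: (2^-1 ^+ N.+2) => q; lra.
apply: (ser_series sD) => [N|e1 e2 a b h1 h2 Xa Yb].
  by rewrite sumE lerBlDr lerDl exprn_ge0// invr_ge0.
set w := F e1 e2 a b.
have telE N : \sum_(k < N) (zit w k.+1 - zit w k) = zit w N.
  elim: N => [|N IH]; first by rewrite big_ord0.
  by rewrite big_ord_recr /= IH addrC subrK.
under eq_fun do rewrite telE.
have wC : `|w| <= 4^-1 by apply: le_trans C4; exact: (ser_bound r0 sF).
set s := Num.sqrt (1 + w); have s0 : 0 <= s := sqrtr_ge0 _.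
have ss : s ^+ 2 = 1 + w.
  by rewrite sqr_sqrtr//; move: wC; rewrite ler_norml => /andP[]; lra.
have s1 : `|s - 1| <= 2^-1.
  move: wC; rewrite !ler_norml => /andP[wl wu]; apply/andP; split.
    rewrite lerBrDr; rewrite -(ler_pXn2r (n := 2)) ?nnegrE//; last lra.
    by rewrite ss expr2; lra.
  rewrite lerBlDr -(ler_pXn2r (n := 2)) ?nnegrE//.
  by rewrite ss expr2; lra.
have err N : `|zit w N - (s - 1)| <= 2^-1 ^+ N.+1.
  elim: N => [|N IH]; first by rewrite /zit /= sub0r normrN expr1.
  have zN : `|zit w N| <= 2^-1 by exact: (ser_bound r0 (ser_zit N C4 sF)).
  have -> : zit w N.+1 - (s - 1) = - ((zit w N - (s - 1)) * (zit w N + (s - 1)) / 2).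
    rewrite zitS; have -> : w = s ^+ 2 - 1 by rewrite ss addrC addKr.
    by move: (zit w N) => z; field.
  rewrite normrN !normrM [`|2^-1|]ger0_norm ?invr_ge0// exprS [leRHS]mulrC ler_pM2r//.
  rewrite -[leRHS]mulr1 ler_pM// (le_trans (ler_normD _ _))//.
  by move: zN s1; move: (`|zit w N|) (`|s - 1|) => p q; lra.
have lim0 : 2^-1 ^+ N.+1 @[N --> \oo] --> (0 : R).
  have h : `|2^-1 : R| < 1 by rewrite ger0_norm ?invr_ge0// invf_lt1// ltr1n.
  have := @cvg_geometric R 2^-1 2^-1 h.
  rewrite (_ : geometric _ _ = fun N => 2^-1 ^+ N.+1)//.
  by apply/funext => N; rewrite /= exprS.
apply/cvgrPdist_lt => e e0; have near_lt : \forall N \near \oo, 2^-1 ^+ N.+1 < e by exact: (cvgr_lt _ lim0).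
by apply: filterS near_lt => N hN; rewrite distrC (le_lt_trans (err N)).
Qed.

Lemma ser_isqrt C F k : C <= 4^-1 -> ser X Y r C F ->
  ser X Y r ((4 / 3) ^+ k) (fun e1 e2 a b => isq k (1 + F e1 e2 a b)).
Proof.
move=> C4 sF; have C41 : 4^-1 < 1 :> R by lra.
have h := serX r0 k (ser_geo r0 C41 (serN r0 (ser_sqrt C4 sF))).
apply: (eq_ser r0 h) => [|e1 e2 a b _ _ _ _].
  by have -> : (1 - 4^-1)^-1 = 4 / 3 :> R by field.
by rewrite /isq; congr (_^-1 ^+ _); rewrite opprK addrC subrK.
Qed.

(* |Z + xi|^-1 = |Z|^-1 (1 + w)^(-1/2) with w = sum_i (2 Z_i xi_i + xi_i^2) / |Z|^2. *)
Lemma ser_dist k (Zf : V -> V) (xi : R -> R -> V -> V -> V) (z0 x0 : R) : open X ->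
  continuous Zf -> 0 < z0 -> (forall a, X a -> z0 ^+ 2 <= sqn (Zf a)) ->
  (forall i, ser X Y r x0 (fun e1 e2 a b => xi e1 e2 a b ord0 i)) ->
  0 <= x0 -> 16 * n.+1%:R * x0 <= z0 ->
  ser X Y r ((4 / 3 / z0) ^+ k) (fun e1 e2 a b => isq k (sqn (Zf a + xi e1 e2 a b))).
Proof.
move=> oX cZ z00 hZ sxi x00 xz; have mX := open_measurable_rV oX.
have z20 : 0 < z0 ^+ 2 by rewrite exprn_gt0.
pose q a : R := isq 1 (sqn (Zf a)).
have cq a : X a -> {for a, continuous q}.
  move=> Xa; apply: (continuous_comp (f := fun a => sqn (Zf a)) (g := isq 1)); last first.
    by apply: continuous_isq; exact: lt_le_trans (hZ _ Xa).
  by apply: (continuous_comp (f := Zf)); [exact: cZ|exact: continuous_sqn].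
have q0 a : 0 <= q a by exact: isq_ge0.
have bq : bd X q z0^-1.
  split; [exact: continuous_measurable_rV|by rewrite invr_ge0 ltW|].
  move=> a Xa; rewrite ger0_norm// (le_trans (le_isq 1 z20 (hZ _ Xa)))//.
  by rewrite /isq sqrtr_sqr gtr0_norm.
have bqZ i : bd X (fun a => q a * Zf a ord0 i) 1.
  split => //.
    apply: measurable_funM; [by case: bq|apply: continuous_measurable_rV => // a _].
    apply: (continuous_comp (f := Zf) (g := fun x : V => x ord0 i)); first exact: cZ.
    exact: (class_C_cont (class_C_coord 0 i openT) (I : setT _)).
  move=> a Xa; rewrite normrM (ger0_norm (q0 a)) /q /isq expr1.
  have pos : 0 < Num.sqrt (sqn (Zf a)) by rewrite sqrtr_gt0 (lt_le_trans z20 (hZ _ Xa)).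
  rewrite mulrC ler_pdivrMr// mul1r -sqrtr_sqr ler_wsqrtr//; exact: coord_le_sqn.
pose y := z0^-1 * x0.
have y0 : 0 <= y by rewrite mulr_ge0// invr_ge0 ltW.
have sq i : ser X Y r y (fun e1 e2 a b => q a * xi e1 e2 a b ord0 i).
  exact: (serM r0 (ser_a Y r0 bq) (sxi i)).
pose w e1 e2 a b := \sum_i (2 * (q a * Zf a ord0 i) * (q a * xi e1 e2 a b ord0 i) + (q a * xi e1 e2 a b ord0 i) ^+ 2).
have sw : ser X Y r 4^-1 w.
  have h i := serD r0 (serM r0 (serZ r0 2 (ser_a Y r0 (bqZ i))) (sq i)) (serX r0 2 (sq i)).
  apply: (eq_ser r0 (ser_sum r0 (index_enum _) xpredT h)) => //.
  rewrite sumr_const card_ord normr_nat mulr1 -[_ *+ n]mulr_natl.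
  (* From (n+1) y <= 1/16 the bound n (2 y + y^2) on w is at most 1/4, the radius accepted by
     [ser_isqrt]. *)
  have ny : n.+1%:R * y <= 16^-1.
    rewrite /y mulrCA ler_pdivrMl//; move: xz; rewrite -mulrA; move: (n.+1%:R * x0) => u.
    by rewrite mulrC => hu; rewrite ler_pdivlMr.
  move: ny; rewrite -natr1; have n0 : 0 <= n%:R :> R by [].
  move: (n%:R : R) n0 y0; move: (y) => t N N0 t0 ht.
  have t1 : t <= 16^-1 by nra.
  by rewrite expr2; nra.
have h := serM r0 (serX r0 k (ser_a Y r0 bq)) (ser_isqrt k (lexx _) sw).
apply: (eq_ser r0 h) => [|e1 e2 a b _ _ Xa Yb].
  by rewrite -exprMn (mulrC z0^-1).
have pos : 0 < sqn (Zf a) := lt_le_trans z20 (hZ _ Xa).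
have -> : sqn (Zf a + xi e1 e2 a b) = sqn (Zf a) * (1 + w e1 e2 a b).
  have qq : sqn (Zf a) * q a ^+ 2 = 1.
    by rewrite /q /isq expr1 exprVn sqr_sqrtr ?sqn_ge0// mulfV// gt_eqF.
  rewrite mulrDr mulr1 /w mulr_sumr [LHS]/sqn [X in _ = X + _]/sqn -big_split /=.
  apply: eq_bigr => i _; rewrite mxE; move: qq; rewrite expr2.
  move: (sqn _) (q a) (Zf a ord0 i) (xi e1 e2 a b ord0 i) => S p u v Sp.
  have -> : S * (2 * (p * u) * (p * v) + (p * v) ^+ 2) = S * (p * p) * (2 * u * v + v ^+ 2) by ring.
  by rewrite Sp mul1r; ring.
rewrite isqM ?sqn_ge0//; congr (_ * _).
Qed.

End sqrt.

(* A system of linear equations with small bilinear kernels is solved by its Neumann series. *)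
Lemma ser_fixed_point (J : finType) (X Y : J -> set V) (r theta M : R)
    (B : J -> (V -> R) -> (V -> R) -> R) (kap : J -> R)
    (K : J -> J -> R -> R -> V -> V -> R) (c : J -> J -> R)
    (f : J -> R -> R -> V -> R) :
  0 <= r -> 0 <= theta < 1 -> (forall j, bbil (X j) (Y j) (B j) (kap j)) ->
  (forall i j, ser (X i) (Y j) r (c i j) (K i j)) ->
  (forall i, \sum_j kap j * c i j <= theta) ->
  (forall i, ser (X i) setT r M (fun e1 e2 a _ => f i e1 e2 a)) ->
  exists (F : J -> R -> R -> V -> R),
    (forall i, ser (X i) setT r (M * (1 - theta)^-1) (fun e1 e2 a _ => F i e1 e2 a)) /\
    forall e1 e2 (u : J -> V -> R), `|e1| <= r -> `|e2| <= r ->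
      (forall i, bmf (X i : set 'rV[mR]_n) (u i)) ->
      (forall i a, X i a -> u i a = f i e1 e2 a + \sum_j B j (u j) (K i j e1 e2 a)) ->
      forall i a, X i a -> u i a = F i e1 e2 a.
Proof.
move=> r0 /andP[th0 th1] hB hK hc hf.
have M0 (i : J) : 0 <= M by exact: (ser_ge0 r0 (hf i)).
(* The source is left out of [T], so that [G k] is the k-th power of the operator applied to f, a
   single term of the Neumann series. *)
pose T (g : J -> R -> R -> V -> R) i e1 e2 a := \sum_j B j (g j e1 e2) (K i j e1 e2 a).
pose G k := iter k T f.
have sG k i : ser (X i) setT r (M * theta ^+ k) (fun e1 e2 a _ => G k i e1 e2 a).
  elim: k i => [|k IH] i; first by rewrite mulr1; exact: hf.
  have h j := ser_bil setT r0 (hB j) (IH j) (hK i j).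
  apply: (eq_ser r0 (ser_sum r0 (index_enum _) xpredT h)) => //.
  rewrite exprSr mulrA.
  have -> : \sum_j kap j * (M * theta ^+ k) * c i j = M * theta ^+ k * \sum_j kap j * c i j.
    by rewrite mulr_sumr; apply: eq_bigr => j _; rewrite mulrAC mulrC.
  by rewrite ler_wpM2l// mulr_ge0 ?exprn_ge0// (M0 i).
pose F i e1 e2 a := limn (fun N => \sum_(k < N) G k i e1 e2 a).
have geoc (i : J) : \sum_(k < N) M * theta ^+ k @[N --> \oo] --> M * (1 - theta)^-1.
  have thn : `|theta| < 1 by rewrite ger0_norm.
  have := @cvg_geometric_series R M theta thn.
  rewrite (_ : series _ = fun N => \sum_(k < N) M * theta ^+ k)//.
  by apply/funext => N; rewrite /series /= big_mkord.
have geob (i : J) N : \sum_(k < N) M * theta ^+ k <= M * (1 - theta)^-1.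
  apply: (cvgr_to_ge (geoc i)); exists N => // P /= NP.
  rewrite -(subnKC NP) big_split_ord /= lerDl sumr_ge0// => k _.
  by rewrite mulr_ge0 ?exprn_ge0// (M0 i).
exists F; split.
  move=> i; apply: (ser_series (fun k => sG k i) (geob i)) => e1 e2 a b h1 h2 Xa _.
  have cn : cvgn (series (fun k => `|G k i e1 e2 a|)).
    apply: nondecreasing_is_cvgn.
      by move=> N P NP; rewrite /series /= !big_mkord -(subnKC NP) big_split_ord /= lerDl sumr_ge0.
    exists (M * (1 - theta)^-1) => _ [N _ <-]; rewrite /series /= big_mkord.
    apply: le_trans (geob i N); apply: ler_sum => k _.
    exact: (ser_bound r0 (sG k i) h1 h2 Xa (I : setT (0 : V))).
  have := normed_cvg cn; rewrite /F (_ : series _ = fun N => \sum_(k < N) G k i e1 e2 a)//.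
  by apply/funext => N; rewrite /series /= big_mkord.
move=> e1 e2 u h1 h2 bu hu i a Xa.
have bG k j : bd (X j) (G k j e1 e2) (M * theta ^+ k).
  exact: ((ser_bd r0 (sG k j) h1 h2).2 0 I).
have [U bU] : exists U, forall j, bd (X j) (u j) U.
  have ex j := bmf_bd (bu j); have [H hH] := choice ex.
  exists (\sum_j H j) => j; have [m _ hb] := hH j; split => //.
    by rewrite sumr_ge0// => k _; case: (hH k).
  move=> x Xx; rewrite (le_trans (hb x Xx))// (bigD1 j)//= lerDl sumr_ge0// => k _.
  by case: (hH k).
(* The remainder of a bounded solution u satisfies d (N+1) = T (d N), hence is at most U theta^N,
   and u is the sum of the series. Uniqueness suffices, as the solution is given. *)
pose d N j x := u j x - \sum_(k < N) G k j e1 e2 x.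
have bd_d N j : bd (X j) (d N j) (U * theta ^+ N).
  elim: N j => [|N IH] j.
    rewrite mulr1; have [m H0 hb] := bU j; split => //.
      by apply: measurable_funB => //; apply: measurable_sum => k; case: (bG k j).
    by move=> x Xx; rewrite /d big_ord0 subr0 hb.
  split.
  - apply: measurable_funB; first by case: (bU j).
    by apply: measurable_sum => k; case: (bG k j).
  - by rewrite mulr_ge0 ?exprn_ge0//; case: (bU j).
  - move=> x Xx.
    have -> : d N.+1 j x = \sum_l B l (d N l) (K j l e1 e2 x).
      rewrite /d big_ord_recl (hu j x Xx) opprD addrA [X in X + _ - _]addrC addrK.
      have -> : \sum_(k < N) G (lift ord0 k) j e1 e2 x = \sum_l \sum_(k < N) B l (G k l e1 e2) (K j l e1 e2 x).
        rewrite exchange_big /=; apply: eq_bigr => k _.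
        by [].
      rewrite -sumrB; apply: eq_bigr => l _.
      have bK := (ser_bd r0 (hK j l) h1 h2).1 x Xx.
      have [_ hB1 _] := hB l; have bl := hB1 _ _ bK.
      have bs P : bmf (X l : set 'rV[mR]_n) (fun x => \sum_(k < P) G k l e1 e2 x).
        by apply: bmf_sum => k; exact: bd_bmf (bG k l).
      rewrite (blin_sub bl (bu l) (bs N)); congr (_ - _).
      elim: (N) => [|P IHP].
        have E := blinZ 0 bl (bs 0%N); rewrite mul0r in E; rewrite big_ord0 -[LHS]E.
        by congr (B l _ _); apply/funext => y; rewrite big_ord0 mul0r.
      rewrite big_ord_recr /= IHP; have [lin _ _] := bl.
      have := lin 1 _ _ (bs P) (bd_bmf (bG P l)); rewrite mul1r => <-.
      by congr (B l _ _); apply/funext => y; rewrite mul1r big_ord_recr.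
    apply: le_trans (ler_norm_sum _ _ _) _.
    apply: (@le_trans _ _ (\sum_l kap l * c j l * (U * theta ^+ N))).
      apply: ler_sum => l _; have bK := (ser_bd r0 (hK j l) h1 h2).1 x Xx.
      by have [_ hB1 _] := hB l; have [_ _ hb] := hB1 _ _ bK; exact: hb.
    rewrite -mulr_suml exprSr (mulrA U) [leRHS]mulrC; apply: ler_wpM2r => //.
    by rewrite mulr_ge0 ?exprn_ge0//; case: (bU j).
have lim : \sum_(k < N) G k i e1 e2 a @[N --> \oo] --> u i a.
  have lim0 : U * theta ^+ N @[N --> \oo] --> (0 : R).
    have thn : `|theta| < 1 by rewrite ger0_norm.
    exact: (@cvg_geometric R U theta thn).
  apply/cvgrPdist_lt => e e0; have near_lt : \forall N \near \oo, U * theta ^+ N < e by exact: (cvgr_lt _ lim0).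
  apply: filterS near_lt => N hN; apply: le_lt_trans hN.
  by have [_ _ h] := bd_d N i; exact: h.
by apply/esym/cvg_lim.
Qed.

End series_functions.

(** * From separated series to convergent power series in the two parameters *)

Section real_analyticity.
Context {R : realType} {n : nat}.
Notation mR := (measurableTypeR R).
Notation V := 'rV[R]_n.
Implicit Types (X Y Z : set V) (F G : R -> R -> V -> V -> R).

(** A monomial in the shifted parameters is expanded by the product rules, and its bound at radius
    rho is at most the old one at radius |a_i| + rho <= r. *)
Lemma ser_shift X Y r rho a1 a2 C F : 0 <= rho -> `|a1| + rho <= r -> `|a2| + rho <= r ->
  ser X Y r C F -> ser X Y rho C (fun e1 e2 a b => F (a1 + e1) (a2 + e2) a b).
Proof.
move=> rho0 h1 h2; have r0 : 0 <= r by apply: le_trans h1; rewrite addr_ge0.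
elim => [i j al be A B {}C ba bb hC|c {}F {}C G sF hF cC cv]; last first.
  apply: (ser_series hF cC) => e1 e2 a b l1 l2; apply: cv.
    by rewrite (le_trans (ler_normD _ _))// (le_trans _ h1)// lerD2l.
  by rewrite (le_trans (ler_normD _ _))// (le_trans _ h2)// lerD2l.
have s1 := serX rho0 i (serD rho0 (ser_cst X Y rho0 a1) (ser_e1 X Y rho0)).
have s2 := serX rho0 j (serD rho0 (ser_cst X Y rho0 a2) (ser_e2 X Y rho0)).
have s3 := serM rho0 (serM rho0 s1 s2) (serM rho0 (ser_a Y rho0 ba) (ser_b X rho0 bb)).
apply: (eq_ser rho0 s3) => //; apply: le_trans hC; rewrite mulrC.
have [_ A0 _] := ba; have [_ B0 _] := bb.
rewrite ler_wpM2l ?mulr_ge0// ler_pM ?exprn_ge0 ?addr_ge0//.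
  by apply: lerXn2r; rewrite ?nnegrE ?addr_ge0.
by apply: lerXn2r; rewrite ?nnegrE ?addr_ge0.
Qed.

Definition hom (c : nat -> nat -> R) (k : nat) (h1 h2 : R) : R :=
  \sum_(i < k.+1) c i (k - i)%N * (h1 ^+ i * h2 ^+ (k - i)).

(** A multi-index of degree k in two variables is determined by its first entry. *)
Lemma hom_part c k (x : 'rV[R]_2) :
  homog_part (fun nu => c (nu ord0) (nu ord_max)) k x = hom c k (x ord0 ord0) (x ord0 ord_max).
Proof.
pose h (i : 'I_k.+1) : {ffun 'I_2 -> 'I_k.+1} :=
  [ffun j => if j == ord0 then i else inord (k - i)].
have h0 i : h i ord0 = i by rewrite ffunE eqxx.
have h1 i : h i ord_max = (k - i)%N :> nat by rewrite ffunE /= inordK// ltnS leq_subr.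
have two (P : pred 'I_2 -> Prop) (j : 'I_2) : j = ord0 \/ j = ord_max.
  by case: j => -[|[|m]] hm //; [left|right]; exact: val_inj.
rewrite /homog_part (reindex_onto h (fun nu => nu ord0)) /=; last first.
  move=> nu /eqP; rewrite big_ord_recl big_ord1 => hk; apply/ffunP => j.
  have [->|->] := two (fun=> True) j; first by rewrite h0.
  apply: val_inj; rewrite /= h1; have -> : ord_max = lift ord0 ord0 :> 'I_2 by exact: val_inj.
  by rewrite -[RHS](addKn (nu ord0)) hk.
apply: congr_big => // [i|i _].
  rewrite h0 eqxx andbT big_ord_recl big_ord1 h0.
  have -> : lift ord0 ord0 = ord_max :> 'I_2 by exact: val_inj.
  by rewrite h1 subnKC ?eqxx// -ltnS.
have E j : [ffun l => nat_of_ord (h i l)] j = h i j by rewrite ffunE.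
rewrite !E h0 h1 big_ord_recl big_ord1 h0.
have -> : lift ord0 ord0 = ord_max :> 'I_2 by exact: val_inj.
by rewrite h1.
Qed.

Lemma hom_abs_mono (c : nat -> nat -> R) k (h1 h2 rho : R) : 0 <= h1 -> h1 <= rho -> 0 <= h2 -> h2 <= rho ->
  hom (fun i j => `|c i j|) k h1 h2 <= hom (fun i j => `|c i j|) k rho rho.
Proof.
move=> h10 h1r h20 h2r; apply: ler_sum => i _; rewrite ler_wpM2l//.
have rho0 := le_trans h10 h1r.
by rewrite ler_pM ?exprn_ge0//; apply: lerXn2r; rewrite ?nnegrE.
Qed.

Lemma hom_abs_ge0 (c : nat -> nat -> R) k (h1 h2 : R) : 0 <= h1 -> 0 <= h2 -> 0 <= hom (fun i j => `|c i j|) k h1 h2.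
Proof. by move=> h10 h20; apply: sumr_ge0 => i _; rewrite !mulr_ge0 ?exprn_ge0. Qed.

Lemma hom_mono c0 i0 j0 k h1 h2 :
  hom (fun i j => if (i == i0) && (j == j0) then c0 else 0) k h1 h2 =
  if k == (i0 + j0)%N then c0 * (h1 ^+ i0 * h2 ^+ j0) else 0.
Proof.
rewrite /hom; case: eqP => [->|hk].
  have lt : (i0 < (i0 + j0).+1)%N by rewrite ltnS leq_addr.
  rewrite (bigD1 (Ordinal lt))//= addKn !eqxx big1 ?addr0// => i ni.
  rewrite ifF ?mul0r//; apply/negbTE; apply: contraNN ni => /andP[/eqP ii _].
  by apply/eqP/val_inj.
rewrite big1// => i _; rewrite ifF ?mul0r//; apply/negP => /andP[/eqP hi /eqP hj]; apply: hk.
by rewrite -hj -hi subnKC// -ltnS.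
Qed.

Lemma hom_sum (N k : nat) (c : nat -> nat -> nat -> R) h1 h2 :
  \sum_(m < N) hom (c m) k h1 h2 = hom (fun i j => \sum_(m < N) c m i j) k h1 h2.
Proof. by rewrite /hom exchange_big; apply: eq_bigr => i _; rewrite mulr_suml. Qed.

Lemma hom_cvg (c : nat -> nat -> nat -> R) c' k h1 h2 :
  (forall i j, c N i j @[N --> \oo] --> c' i j) ->
  hom (c N) k h1 h2 @[N --> \oo] --> hom c' k h1 h2.
Proof.
move=> h; rewrite /hom; apply: cvg_bigsum => i.
by apply: cvgM; [exact: h|exact: cvg_cst].
Qed.

(** Coefficients of a series are sums of the coefficients of its terms. The remainder is stated with
    the factor th^N because this survives limits in the induction: on the polydisc of radius th r a
    monomial of degree at least N gains exactly that factor. *)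
Lemma ser_coef X Y r C F a b : 0 <= r -> ser X Y r C F -> X a -> Y b -> exists c : nat -> nat -> R,
  (forall N, \sum_(k < N) hom (fun i j => `|c i j|) k r r <= C) /\
  forall (N : nat) (th h1 h2 : R), 0 <= th <= 1 -> `|h1| <= th * r -> `|h2| <= th * r ->
    `|F h1 h2 a b - \sum_(k < N) hom c k h1 h2| <= C * th ^+ N.
Proof.
move=> r0 sF Xa Yb; elim: sF => [i j al be A B {}C ba bb hC|c {}F {}C G sF hF cC cv].
  have [_ A0 hA] := ba; have [_ B0 hB] := bb.
  have C0 : 0 <= C by apply: le_trans hC; rewrite !mulr_ge0 ?exprn_ge0.
  have hAB : `|al a * be b| * (r ^+ i * r ^+ j) <= C.
    by apply: le_trans hC; rewrite ler_wpM2r ?mulr_ge0 ?exprn_ge0// normrM ler_pM ?hA ?hB.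
  exists (fun i' j' => if (i' == i) && (j' == j) then al a * be b else 0); split.
    move=> N; pose c' i' j' := if (i' == i) && (j' == j) then `|al a * be b| else 0.
    have -> : (fun i' j' => `|if (i' == i) && (j' == j) then al a * be b else 0|) = c'.
      by apply/funext => i'; apply/funext => j'; rewrite /c'; case: ifP => // _; rewrite normr0.
    under eq_bigr do rewrite /c' hom_mono.
    rewrite -big_mkcond /=; have [lt|ge] := ltnP (i + j)%N N.
      by rewrite (big_pred1 (Ordinal lt)) //.
    by rewrite big1// => k /eqP hk; move: (ltn_ord k); rewrite hk ltnNge ge.
  move=> N th h1 h2 /andP[th0 th1] hh1 hh2.
  under eq_bigr do rewrite hom_mono.
  rewrite -big_mkcond /=; have [lt|ge] := ltnP (i + j)%N N.
    rewrite (big_pred1 (Ordinal lt)) //= [X in _ - X]mulrC subrr normr0.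
    by rewrite mulr_ge0 ?exprn_ge0.
  rewrite big1 ?subr0; last by move=> k /eqP hk; move: (ltn_ord k); rewrite hk ltnNge ge.
  rewrite normrM mulrC [`|h1 ^+ i * _|]normrM !normrX.
  apply: (@le_trans _ _ (`|al a * be b| * ((th * r) ^+ i * (th * r) ^+ j))).
    have thr : 0 <= th * r by rewrite mulr_ge0.
    by rewrite ler_wpM2l// ler_pM ?exprn_ge0//; apply: lerXn2r; rewrite ?nnegrE.
  have -> : `|al a * be b| * ((th * r) ^+ i * (th * r) ^+ j) = `|al a * be b| * (r ^+ i * r ^+ j) * th ^+ (i + j).
    by rewrite !exprMn exprD; move: (`|_|) (th ^+ i) (th ^+ j) (r ^+ i) (r ^+ j) => *; ring.
  by rewrite ler_pM ?exprn_ge0 ?mulr_ge0 ?exprn_ge0// ler_wiXn2l.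
have [d hd] := choice hF.
have c0 k : 0 <= c k by exact: (ser_ge0 r0 (sF k)).
pose aa m i j := `|d m i j|.
have coef_le m i j : aa m i j * (r ^+ i * r ^+ j) <= c m.
  have [h _] := hd m; apply: le_trans (h (i + j).+1).
  rewrite big_ord_recr /= -[leLHS]add0r lerD//.
    by apply: sumr_ge0 => k _; exact: hom_abs_ge0.
  have lt : (i < (i + j).+1)%N by rewrite ltnS leq_addr.
  rewrite /hom (bigD1 (Ordinal lt))//= addKn lerDl sumr_ge0// => k _.
  by rewrite !mulr_ge0 ?exprn_ge0.
(* For r = 0 the norms say nothing about coefficients of positive degree, so the value at the origin
   is taken as the only coefficient. *)
have [rz|rpos] := eqVneq r 0.
  exists (fun i j => if (i == 0%N) && (j == 0%N) then G 0 0 a b else 0).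
  have Gb : `|G 0 0 a b| <= C.
    have s := ser_series sF cC cv.
    by apply: (ser_bound r0 s) => //; rewrite normr0.
  split.
    move=> N; pose c' i' j' := if (i' == 0%N) && (j' == 0%N) then `|G 0 0 a b| else 0.
    have -> : (fun i' j' => `|if (i' == 0%N) && (j' == 0%N) then G 0 0 a b else 0|) = c'.
      by apply/funext => i'; apply/funext => j'; rewrite /c'; case: ifP => // _; rewrite normr0.
    under eq_bigr do rewrite /c' hom_mono.
    rewrite -big_mkcond /=; case: N => [|N]; first by rewrite big_ord0 (le_trans _ Gb).
    by rewrite (big_pred1 ord0) // expr0 !mulr1.
  move=> N th h1 h2 /andP[th0 th1]; rewrite rz mulr0 !normr_le0 => /eqP -> /eqP ->.
  under eq_bigr do rewrite hom_mono.
  rewrite -big_mkcond /=; case: N => [|N]; first by rewrite big_ord0 subr0 mulr1.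
  rewrite (big_pred1 ord0) // expr0 !mulr1 subrr normr0 mulr_ge0 ?exprn_ge0//.
  by rewrite (le_trans _ Gb).
have rgt : 0 < r by rewrite lt_neqAle eq_sym rpos r0.
have acv i j : cvgn (series (fun m => aa m i j)).
  have p0 : 0 < r ^+ i * r ^+ j by rewrite mulr_gt0 ?exprn_gt0.
  apply: nondecreasing_is_cvgn.
    move=> N P NP; rewrite /series /= !big_mkord -(subnKC NP) big_split_ord /= lerDl sumr_ge0// => k _.
    exact: normr_ge0.
  exists (C / (r ^+ i * r ^+ j)) => _ [N _ <-]; rewrite /series /= big_mkord ler_pdivlMr// mulr_suml.
  by apply: le_trans (cC N); apply: ler_sum => m _; exact: coef_le.
pose c' i j := limn (series (fun m => d m i j)).
have c'cv i j : \sum_(m < N) d m i j @[N --> \oo] --> c' i j.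
  have := normed_cvg (acv i j); rewrite /c' (_ : series _ = fun N => \sum_(m < N) d m i j)//.
  by apply/funext => N; rewrite /series /= big_mkord.
exists c'; split.
  move=> N.
  have lim : \sum_(k < N) hom (fun i j => `|\sum_(m < M) d m i j|) k r r @[M --> \oo] -->
      \sum_(k < N) hom (fun i j => `|c' i j|) k r r.
    apply: cvg_bigsum => k.
    by apply: (hom_cvg (c := fun M i j => `|\sum_(m < M) d m i j|)) => i j; apply: cvg_norm; exact: c'cv.
  apply: (cvgr_to_le lim); apply: nearW => M.
  apply: (@le_trans _ _ (\sum_(k < N) \sum_(m < M) hom (aa m) k r r)).
    apply: ler_sum => k _; rewrite hom_sum; apply: ler_sum => i _.
    by rewrite ler_wpM2r ?mulr_ge0 ?exprn_ge0// ler_norm_sum.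
  rewrite exchange_big /=; apply: le_trans (cC M); apply: ler_sum => m _.
  by have [h _] := hd m; exact: h.
move=> N th h1 h2 hth hh1 hh2; have /andP[th0 th1] := hth.
have thr : th * r <= r by rewrite -[leRHS]mul1r ler_wpM2r.
have lim : `|\sum_(m < M) F m h1 h2 a b - \sum_(k < N) hom (fun i j => \sum_(m < M) d m i j) k h1 h2| @[M --> \oo] -->
    `|G h1 h2 a b - \sum_(k < N) hom c' k h1 h2|.
  apply: cvg_norm; apply: cvgB.
    by apply: cv => //; [exact: le_trans hh1 thr|exact: le_trans hh2 thr].
  apply: cvg_bigsum => k.
  by apply: (hom_cvg (c := fun M i j => \sum_(m < M) d m i j)) => i j; exact: c'cv.
apply: (cvgr_to_le lim); apply: nearW => M.
have -> : \sum_(k < N) hom (fun i j => \sum_(m < M) d m i j) k h1 h2 = \sum_(m < M) \sum_(k < N) hom (d m) k h1 h2.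
  by rewrite exchange_big /=; apply: eq_bigr => k _; rewrite hom_sum.
rewrite -sumrB; apply: le_trans (ler_norm_sum _ _ _) _.
apply: (@le_trans _ _ (\sum_(m < M) c m * th ^+ N)).
  by apply: ler_sum => m _; have [_ h] := hd m; exact: h.
by rewrite -mulr_suml ler_wpM2r ?exprn_ge0.
Qed.

Lemma ser_real_analytic (A : set 'rV[R]_2) r C F (a b : V) : 0 <= r -> ser setT setT r C F ->
  (forall e, A e -> `|eps1 e| < r /\ `|eps2 e| < r) ->
  real_analytic_on A (fun e => F (eps1 e) (eps2 e) a b).
Proof.
move=> r0 sF Ar e Ae; have [h1 h2] := Ar e Ae.
(* The distance from e to the boundary of the polydisc; convergence on half of it corresponds to th
   = 1/2 in [ser_coef]. *)
pose rho := Num.min (r - `|eps1 e|) (r - `|eps2 e|).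
have rho0 : 0 < rho by rewrite lt_min !subr_gt0 h1.
have s1 : `|eps1 e| + rho <= r by rewrite -lerBrDl ge_min lexx.
have s2 : `|eps2 e| + rho <= r by rewrite -lerBrDl ge_min lexx orbT.
have [c [cb hc]] := ser_coef (ltW rho0) (ser_shift (ltW rho0) s1 s2 sF) (I : setT a) (I : setT b).
have C0 := ser_ge0 r0 sF.
exists (fun nu => c (nu ord0) (nu ord_max)), (2^-1 * rho); split; first by rewrite mulr_gt0.
move=> x hx.
have hcoord i : `|(x - e) ord0 i| <= 2^-1 * rho.
  apply: le_trans (ltW hx); rewrite -sqrtr_sqr; apply: ler_wsqrtr; exact: coord_le_sqn.
have half : 2^-1 * rho <= rho by rewrite -[leRHS]mul1r ler_wpM2r ?(ltW rho0)// invf_le1// ler1n.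
split.
  apply: nondecreasing_is_cvgn.
    move=> N P NP; rewrite /series /= !big_mkord -(subnKC NP) big_split_ord /= lerDl sumr_ge0// => k _.
    by rewrite (hom_part (fun i j => `|c i j|)) hom_abs_ge0// mxE normr_ge0.
  exists C => _ [N _ <-]; rewrite /series /= big_mkord.
  apply: le_trans (cb N); apply: ler_sum => k _; rewrite (hom_part (fun i j => `|c i j|)).
  have mx j : (\row_i `|(x - e) ord0 i|) ord0 j = `|(x - e) ord0 j| by rewrite mxE.
  by apply: hom_abs_mono; rewrite mx ?normr_ge0// (le_trans (hcoord _)).
move=> Ax; rewrite (_ : series _ = fun N => \sum_(k < N) hom c k ((x - e) ord0 ord0) ((x - e) ord0 ord_max)); last first.
  by apply/funext => N; rewrite /series /= big_mkord; apply: eq_bigr => k _; rewrite hom_part.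
have lim0 : C * 2^-1 ^+ N @[N --> \oo] --> (0 : R).
  have h : `|2^-1 : R| < 1 by rewrite ger0_norm ?invr_ge0// invf_lt1// ltr1n.
  exact: (@cvg_geometric R C 2^-1 h).
apply/cvgrPdist_lt => eps eps0; have near_lt : \forall N \near \oo, C * 2^-1 ^+ N < eps by exact: (cvgr_lt _ lim0).
apply: filterS near_lt => N hN; apply: le_lt_trans hN.
have := hc N 2^-1 ((x - e) ord0 ord0) ((x - e) ord0 ord_max) _ (hcoord _) (hcoord _).
rewrite !mxE /= -/(eps1 _) -/(eps2 _).
rewrite [eps1 e + _]addrC subrK [eps2 e + _]addrC subrK; apply.
by rewrite invr_ge0 ler0n invf_le1// ler1n.
Qed.

End real_analyticity.

(** * Classical functions with bounded derivatives, and the weak identities they satisfy *)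

Section regular.
Context {R : realType} {n : nat}.
Notation mR := (measurableTypeR R).
Notation V := 'rV[R]_n.
Implicit Types (D E X Y : set V) (f g h w psi : V -> R).

(** The Laplacian is bounded, but not each second derivative: a harmonic function that is
    C^{1,alpha} up to the boundary need not have bounded second derivatives. Cutoffs preserve this
    class, since they only add a commutator to the Laplacian. *)
Definition reg D f : Prop :=
  [/\ class_C 2 D f, vbmf D f, forall i, vbmf D (partial i f) & vbmf D (laplacian f)].

Lemma reg_sub D E f : open D -> open E -> E `<=` D -> reg D f -> reg E f.
Proof.
move=> oD oE ED [Cf bf bp bl].
have mD := open_measurable_rV oD; have mE := open_measurable_rV oE.
split; [exact: class_CS Cf|exact: bmfS bf|by move=> i; exact: (bmfS mD ED mE (bp i))|exact: bmfS bl].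
Qed.

Lemma near_open D x : open D -> D x -> \forall y \near x, D y.
Proof. by move=> oD Dx; exact: (open_nbhs_nbhs (conj oD Dx)). Qed.

Lemma laplacian_zero_near f x : (\forall y \near x, f y = 0) -> laplacian f x = 0.
Proof.
move=> f0; rewrite (eq_laplacian_near (g := fun=> 0) f0) /laplacian big1// => i _.
by rewrite (_ : partial i (fun=> 0) = fun=> 0) ?partial_cst//; apply/funext => y; exact: partial_cst.
Qed.

(** Meant for truncated functions, regular where the factor lives and locally 0 elsewhere. *)
Lemma reg_ext D E f : open D -> open E -> E `<=` D -> reg E f ->
  (forall x, D x -> E x \/ \forall y \near x, f y = 0) -> reg D f.
Proof.
move=> oD oE ED [Cf bf bp bl] cases.
have mD := open_measurable_rV oD; have mE := open_measurable_rV oE.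
have zero x : D x -> ~ E x -> \forall y \near x, f y = 0 by move=> /cases[].
have pz i x : D x -> ~ E x -> partial i f x = 0.
  by move=> Dx nE; rewrite -(partial_cst i 0 x); apply: eq_partial_near; exact: zero.
have lz x : D x -> ~ E x -> laplacian f x = 0.
  by move=> Dx nE; exact: laplacian_zero_near (zero _ Dx nE).
split.
- apply: class_C_local => x Dx; have [Ex|nE] := pselect (E x); first by exists E, f.
  exists (interior [set y | f y = 0]), (fun=> 0); split.
  - exact: open_interior.
  - exact: (zero x Dx nE).
  - exact: (class_C_cst 2 0 (@open_interior _ _)).
  - by move=> y /interior_subset.
- by apply: (bmf_ext0 mD mE ED bf) => x Dx nE; exact: (nbhs_singleton (zero x Dx nE)).
- by move=> i; exact: (bmf_ext0 mD mE ED (bp i) (pz i)).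
- exact: (bmf_ext0 mD mE ED bl lz).
Qed.

Lemma regB D f g : open D -> reg D f -> reg D g -> reg D (fun x => f x - g x).
Proof.
move=> oD [Cf bf bpf blf] [Cg bg bpg blg]; split.
- exact: (class_CB oD Cf Cg).
- exact: bmfB.
- move=> i; apply: (eq_bmf _ (bmfB (bpf i) (bpg i))) => x Dx.
  by rewrite (partialB i Dx (class_CW (leqnSn 1) Cf) (class_CW (leqnSn 1) Cg)).
- by apply: (eq_bmf _ (bmfB blf blg)) => x Dx; rewrite (laplacianB oD Dx Cf Cg).
Qed.

Lemma reg_cutoffM D t f : open D -> 0 < t -> reg D f -> reg D (fun x => cutoff t x * f x).
Proof.
move=> oD t0 [Cf bf bpf blf]; have mD := open_measurable_rV oD.
have Cc : class_C 2 D (cutoff t) by apply: class_CS (class_C_cutoff t).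
have bc : vbmf D (cutoff t).
  apply: (class_C_bmf (k := 2) (M := 1)) => // x _.
  by rewrite ger0_norm ?cutoff_ge0// cutoff_le1.
have bpc i : vbmf D (partial i (cutoff t)) by exact: bmf_partial_cutoff.
split.
- exact: (class_CM oD Cc Cf).
- exact: bmfM.
- move=> i; apply: (eq_bmf _ (bmfD (bmfM bc (bpf i)) (bmfM bf (bpc i)))) => x Dx.
  by rewrite (partialM i Dx (class_CW (leqnSn 1) Cc) (class_CW (leqnSn 1) Cf)).
- apply: (eq_bmf _ (bmfD (bmfM bc blf) (bmf_comm mD t0 bf bpf))) => x Dx.
  by rewrite (laplacianM oD Dx Cc Cf).
Qed.

Lemma sqn_lt_near c x : sqn x < c -> \forall y \near (x : V), sqn y < c.
Proof. by move=> h; exact: (near_open (open_sqn_lt (c := c)) h). Qed.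

Lemma sqn_gt_near c x : c < sqn x -> \forall y \near (x : V), c < sqn y.
Proof. by move=> h; exact: (near_open (open_sqn_gt (c := c)) h). Qed.

Lemma cutoff_near1 t x : 0 < t -> sqn x < 2 * t ^+ 2 -> \forall y \near (x : V), cutoff t y = 1.
Proof. by move=> t0 h; have := sqn_lt_near h; apply: filterS => y /ltW; exact: cutoff1. Qed.

Lemma cutoff_near0 t x : 0 < t -> 3 * t ^+ 2 < sqn x -> \forall y \near (x : V), cutoff t y = 0.
Proof. by move=> t0 h; have := sqn_gt_near h; apply: filterS => y /ltW; exact: cutoff0. Qed.

Lemma reg_cutoff D t f : open D -> 0 < t -> reg (D `&` hball (2 * t)) f ->
  reg D (fun x => cutoff t x * f x).
Proof.
move=> oD t0 rf; have oE : open (D `&` hball (2 * t)) by apply: openI => //; exact: open_hball.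
apply: (reg_ext oD oE (@subIsetl _ _ _) (reg_cutoffM oE t0 rf)) => x Dx.
have [h|h] := ltP (sqn x) ((2 * t) ^+ 2); [by left|right].
have h3 : 3 * t ^+ 2 < sqn x.
  by rewrite (lt_le_trans _ h)// exprMn ltr_pM2r ?exprn_gt0// [2 ^+ 2]expr2; lra.
by have := cutoff_near0 t0 h3; apply: filterS => y ->; rewrite mul0r.
Qed.

Lemma reg_cocutoff D t f : open D -> 0 < t -> reg (D `&` [set x | t ^+ 2 < sqn x]) f ->
  reg D (fun x => f x - cutoff t x * f x).
Proof.
move=> oD t0 rf.
have oE : open (D `&` [set x | t ^+ 2 < sqn x]) by apply: openI => //; exact: open_sqn_gt.
apply: (reg_ext oD oE (@subIsetl _ _ _) (regB oE rf (reg_cutoffM oE t0 rf))) => x Dx.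
have [h|h] := ltP (t ^+ 2) (sqn x); [by left|right].
have h2 : sqn x < 2 * t ^+ 2.
  by rewrite (le_lt_trans h)// ltr_pMl ?exprn_gt0// ltr1n.
by have := cutoff_near1 t0 h2; apply: filterS => y ->; rewrite mul1r subrr.
Qed.

Lemma continuous_affine (a : V) (s : R) : continuous (fun x : V => a + s *: x).
Proof.
move=> x; apply: (@continuousD _ _ _ (fun=> a) (fun x : V => s *: x)); first exact: cst_continuous.
exact: (@continuousZ _ _ _ (fun=> s) id x (@cst_continuous _ _ _ _) (fun _ => id)).
Qed.

Lemma open_affine (a : V) (s : R) D : open D -> open [set x | D (a + s *: x)].
Proof. by move=> oD; apply: (@open_comp _ _ (fun x : V => a + s *: x)) => // x _; exact: continuous_affine. Qed.

Lemma near_affine (a : V) (s : R) y (P : V -> Prop) : (\forall z \near (a + s *: y), P z) ->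
  \forall x \near y, P (a + s *: x).
Proof. by move=> h; have := @continuous_affine a s y _ h. Qed.

Lemma bmf_affine D E g (a : V) (s : R) : measurable (D : set 'rV[mR]_n) -> (forall x, E x -> D (a + s *: x)) ->
  vbmf D g -> vbmf E (fun x => g (a + s *: x)).
Proof.
move=> mD ED [mg [M gM]]; split; last by exists M => x /ED; exact: gM.
apply: (measurable_comp (F := D)) => //; last exact: measurable_funTS (measurable_affine a s).
by move=> _ [x /ED + <-].
Qed.

Lemma reg_affine D E f (a : V) (s : R) : open D -> open E -> (forall x, E x -> D (a + s *: x)) ->
  reg D f -> reg E (fun x => f (a + s *: x)).
Proof.
move=> oD oE ED [Cf bf bp bl].
have mD := open_measurable_rV oD; have mE := open_measurable_rV oE.
have comp g := bmf_affine (g := g) mD ED.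
split.
- exact: (class_C_affine oE oD ED Cf).
- exact: comp.
- move=> i; apply: (eq_bmf _ (bmfZ s (comp _ (bp i)))) => x /ED Dx.
  by rewrite (partial_affine i (class_CW (leqnSn 1) Cf) Dx).
- apply: (eq_bmf _ (bmfZ (s ^+ 2) (comp _ bl))) => x /ED Dx.
  by rewrite (laplacian_affine oD Cf Dx).
Qed.

Lemma gdotC f g x : gdot f g x = gdot g f x.
Proof. by apply: eq_bigr => i _; rewrite mulrC. Qed.

Lemma eq_gdot_near f f' g g' x : {near x, f =1 f'} -> {near x, g =1 g'} -> gdot f g x = gdot f' g' x.
Proof. by move=> hf hg; apply: eq_bigr => i _; rewrite (eq_partial_near i hf) (eq_partial_near i hg). Qed.

Lemma eq_comm_near chi f g x : {near x, f =1 g} -> comm chi f x = comm chi g x.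
Proof.
move=> fg; have cc : {near x, chi =1 chi} by apply: filterS fg.
by rewrite /comm (nbhs_singleton fg) (eq_gdot_near cc fg).
Qed.

(** By Green's identity w is the Riesz representative of l, so evaluating the functional at w is a
    pairing in which w no longer occurs explicitly. *)
Lemma lam_eq_dual D w Y t h l k : (3 <= n)%N -> bounded_dom D -> reg D w -> vanish D w ->
  measurable (Y : set 'rV[mR]_n) -> Y `<=` D `&` ann t -> 0 < t -> vbmf Y h -> bddf D l k ->
  (forall psi, test D psi -> vint D (fun x => psi x * laplacian w x) = - l psi) ->
  lam Y t h w = dual D l (lam Y t h).
Proof.
move=> n3 bD [Cw bw bpw blw] vw mY YD t0 bh bl hl.
have [C C0 hC] := lam_bddf (R := R) n3; have [H [mh H0 hH]] := bmf_bd bh.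
have bl' := hC D Y t h H bD mY YD t0 bh hH H0.
have Cw1 := class_CW (leqnSn 1) Cw; have fD := bounded_dom_fin bD.
apply: (dual_classical bD bl bl' Cw1 vw bpw); last first.
  by apply: lam_vtrunc_cvg => // x /YD[].
move=> psi tp; have bpsi i := test_partial_bmf i bD tp.
have g0 := green0 bD (test_class_C D tp) (test_vanish tp) bpsi Cw bpw blw.
have b1 : vbmf D (gdot psi w) by exact: bmf_gdot.
have b2 : vbmf D (fun x => psi x * laplacian w x) by apply: bmfM => //; exact: test_bmf.
have := etrans (esym (intD fD b1 b2)) g0; rewrite hl// => /subr0_eq <-.
by apply: eq_int => x _; exact: gdotC.
Qed.

Lemma laplacian_cutoffM D t f x : open D -> D x -> class_C 2 D f -> laplacian f x = 0 ->
  laplacian (fun x => cutoff t x * f x) x = comm (cutoff t) f x.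
Proof.
move=> oD Dx Cf f0; have Cc : class_C 2 D (cutoff t) by apply: class_CS (class_C_cutoff t).
by rewrite (laplacianM oD Dx Cc Cf) f0 mulr0 add0r.
Qed.

Lemma laplacian_cutoff_ext D t f x : open D -> 0 < t -> class_C 2 (D `&` hball (2 * t)) f ->
  (forall y, (D `&` hball (2 * t)) y -> laplacian f y = 0) -> D x ->
  laplacian (fun x => cutoff t x * f x) x = comm (cutoff t) f x.
Proof.
move=> oD t0 Cf f0 Dx; have oE : open (D `&` hball (2 * t)) by apply: openI => //; exact: open_hball.
have [h|h] := ltP (sqn x) ((2 * t) ^+ 2).
  have Ex : (D `&` hball (2 * t)) x by [].
  exact: (laplacian_cutoffM t oE Ex Cf (f0 x Ex)).
have h3 : 3 * t ^+ 2 < sqn x.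
  by rewrite (lt_le_trans _ h)// exprMn ltr_pM2r ?exprn_gt0// [2 ^+ 2]expr2; lra.
rewrite comm_out//; last by move=> /andP[_]; rewrite ltNge h.
by apply: laplacian_zero_near; have := cutoff_near0 t0 h3; apply: filterS => y ->; rewrite mul0r.
Qed.

Lemma laplacian_cocutoff D t f x : open D -> 0 < t -> class_C 2 (D `&` [set x | t ^+ 2 < sqn x]) f ->
  (forall y, (D `&` [set x | t ^+ 2 < sqn x]) y -> laplacian f y = 0) -> D x ->
  laplacian (fun x => f x - cutoff t x * f x) x = - comm (cutoff t) f x.
Proof.
move=> oD t0 Cf f0 Dx.
have oE : open (D `&` [set x | t ^+ 2 < sqn x]) by apply: openI => //; exact: open_sqn_gt.
have [h|h] := ltP (t ^+ 2) (sqn x).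
  have Ex : (D `&` [set x | t ^+ 2 < sqn x]) x by [].
  have Cc : class_C 2 (D `&` [set x | t ^+ 2 < sqn x]) (cutoff t) by apply: class_CS (class_C_cutoff t).
  rewrite (laplacianB oE Ex Cf (class_CM oE Cc Cf)) f0// sub0r.
  by rewrite (laplacian_cutoffM t oE Ex Cf (f0 x Ex)).
have h2 : sqn x < 2 * t ^+ 2.
  by rewrite (le_lt_trans h)// ltr_pMl ?exprn_gt0// ltr1n.
rewrite comm_out ?oppr0//; last by move=> /andP[]; rewrite ltNge h.
by apply: laplacian_zero_near; have := cutoff_near1 t0 h2; apply: filterS => y ->; rewrite mul1r subrr.
Qed.

Lemma int_comm D t f psi : bounded_dom D -> 0 < t -> test D psi -> reg (D `&` ann t) f ->
  vbmf D (fun x => psi x * comm (cutoff t) f x) /\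
  vint D (fun x => psi x * comm (cutoff t) f x) = - lam (D `&` ann t) t f psi.
Proof.
move=> bD t0 tp [Cf bf bpf blf].
have oX : open (D `&` ann t) by apply: openI; [exact: bD.1|exact: open_ann].
have mX := open_measurable_rV oX; have fD := bounded_dom_fin bD.
have XD : D `&` ann t `<=` D by move=> x [].
have bX : vbmf (D `&` ann t) (fun x => psi x * comm (cutoff t) f x).
  by apply: bmfM; [exact: (bmfS fD.1 XD mX (test_bmf bD tp))|exact: bmf_comm].
have z x : D x -> ~ (D `&` ann t) x -> psi x * comm (cutoff t) f x = 0.
  by move=> Dx nX; rewrite comm_out ?mulr0// => ax; apply: nX.
have bDx := bmf_ext0 fD.1 mX XD bX z.
split => //; rewrite (int_restrict fD mX XD bDx z).
by apply: lam_dual => //; exact: class_CW Cf.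
Qed.

End regular.

(** * Truncated solutions near the hole and near the outer boundary *)

Section identities.
Context {R : realType} {n : nat}.
Notation mR := (measurableTypeR R).
Notation V := 'rV[R]_n.
Implicit Types (D K Om : set V) (f g h w v W : V -> R).

Lemma near_and (x : V) (P Q : V -> Prop) : (\forall y \near x, P y) -> (\forall y \near x, Q y) ->
  \forall y \near x, P y /\ Q y.
Proof. by move=> hP hQ; near=> y; split; near: y. Unshelve. all: by end_near. Qed.

Lemma open_setD K D : open D -> closed K -> open (D `&` ~` K).
Proof. by move=> oD cK; apply: openI => //; exact: closed_openC. Qed.

Lemma bounded_domI D E : bounded_dom D -> open E -> bounded_dom (D `&` E).
Proof. by move=> [oD [c Dc]] oE; split; [exact: openI|exists c => x [/Dc]]. Qed.

Lemma bounded_hball (r : R) : 0 <= r -> bounded_dom (hball r : set V).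
Proof. by move=> r0; split; [exact: open_hball|exists r; exact: hball_cube]. Qed.

Lemma le_hball (r s : R) : 0 <= r -> r <= s -> hball r `<=` (hball s : set V).
Proof.
move=> r0 rs x /= h; rewrite /hball /= (lt_le_trans h)//; apply: lerXn2r; rewrite ?nnegrE//.
exact: le_trans rs.
Qed.

Lemma sqn_le_sqr (r s : R) (x : V) : 0 <= r -> r <= s -> sqn x <= r ^+ 2 -> sqn x <= s ^+ 2.
Proof.
by move=> r0 rs h; rewrite (le_trans h)//; apply: lerXn2r; rewrite ?nnegrE// (le_trans r0).
Qed.

(* cutoff la * f - cutoff rho * W vanishes at the boundary of hball (3 la) \ K and equals f on the
   annulus 2 rho; its Laplacian is carried by the annuli la and rho. *)
Lemma inner_identity K (rho la : R) f W h : (3 <= n)%N -> closed K -> K `<=` hball rho ->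
  0 < rho -> 4 * rho <= la ->
  reg (hball (3 * la) `&` ~` K) f -> (forall t, (hball (3 * la) `&` ~` K) t -> laplacian f t = 0) ->
  reg (hball (2 * rho) `&` ~` K) W -> (forall t, (hball (2 * rho) `&` ~` K) t -> laplacian W t = 0) ->
  (forall t, K t -> forall d, 0 < d -> \forall z \near t, ~ K z -> `|f z - W z| < d) ->
  vbmf (ann (2 * rho)) h ->
  lam (ann (2 * rho)) (2 * rho) h f =
  dual (hball (3 * la) `&` ~` K) (fun psi => lam (ann la) la f psi - lam (ann rho) rho W psi)
    (lam (ann (2 * rho)) (2 * rho) h).
Proof.
move=> n3 cK Krho rho0 rl rf f0 rW W0 fW bh.
set D := hball (3 * la) `&` ~` K.
have la0 : 0 < la by apply: lt_le_trans rl; rewrite mulr_gt0.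
have oD : open D by apply: open_setD => //; exact: open_hball.
have bD : bounded_dom D.
  by apply: bounded_domI; [apply: bounded_hball; rewrite mulr_ge0// ltW|exact: closed_openC].
have annD t : rho <= t -> t <= la -> ann t `<=` D.
  move=> rt tl x /andP[x1 x2]; split.
    have t0 : 0 < t := lt_le_trans rho0 rt.
    rewrite /hball /= (lt_le_trans x2)//; apply: lerXn2r; rewrite ?nnegrE ?mulr_ge0 ?(ltW t0) ?(ltW la0)//.
    by move: tl la0; lra.
  move=> /Krho; rewrite /hball /=; apply/negP; rewrite -leNgt (le_trans _ (ltW x1))//.
  by apply: lerXn2r; rewrite ?nnegrE ?(ltW rho0)// (le_trans (ltW rho0)).
have r2 : rho <= 2 * rho by move: rho0; lra.
have rla : rho <= la by move: rho0 rl; lra.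
have aD := annD la rla (lexx _); have bDr := annD rho (lexx _) rla.
have cD : ann (2 * rho) `<=` D by apply: annD => //; move: rho0 rl; lra.
have oA t : open (ann t : set V) by exact: open_ann.
have mA t := open_measurable_rV (oA t).
have EK : D `&` hball (2 * rho) `<=` hball (2 * rho) `&` ~` K by move=> x [[_ nK] hx].
have oE : open (D `&` hball (2 * rho)) by apply: openI => //; exact: open_hball.
have oK : open (hball (2 * rho) `&` ~` K) by apply: open_setD => //; exact: open_hball.
have oF : open (D `&` hball (2 * la)) by apply: openI => //; exact: open_hball.
have rWE := reg_sub oK oE EK rW.
have rfE := reg_sub oD oF (@subIsetl _ _ _) rf.
have rw := regB oD (reg_cutoff oD la0 rfE) (reg_cutoff oD rho0 rWE).
set w := (fun x => _) in rw.
have [Cf _ _ _] := rfE; have [CW _ _ _] := rWE.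
have [Cfc _ _ _] := reg_cutoff oD la0 rfE; have [CWc _ _ _] := reg_cutoff oD rho0 rWE.
have lw x : D x -> laplacian w x = comm (cutoff la) f x - comm (cutoff rho) W x.
  move=> Dx; rewrite /w (laplacianB oD Dx Cfc CWc); congr (_ - _).
    by apply: (laplacian_cutoff_ext oD la0 Cf _ Dx) => y [Dy _]; exact: f0.
  by apply: (laplacian_cutoff_ext oD rho0 CW _ Dx) => y /EK; exact: W0.
have vw : vanish D w.
  move=> x nDx d d0; have [h3|h3] := ltP (sqn x) ((3 * la) ^+ 2).
    have Kx : K x by apply: contrapT => nK; apply: nDx.
    have c1 : sqn x < 2 * la ^+ 2.
      apply: lt_le_trans (Krho _ Kx) _; apply: (@le_trans _ _ (la ^+ 2)).
        by apply: lerXn2r; rewrite ?nnegrE ?(ltW rho0) ?(ltW la0).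
      by rewrite ler_pMl ?exprn_gt0// ler1n.
    have c2 : sqn x < 2 * rho ^+ 2.
      by apply: lt_le_trans (Krho _ Kx) _; rewrite ler_pMl ?exprn_gt0// ler1n.
    have n1 := cutoff_near1 la0 c1; have n2 := cutoff_near1 rho0 c2.
    have := near_and (near_and n1 n2) (fW x Kx d d0); apply: filterS => y [[y1 y2] y3] [_ nKy].
    by rewrite /w y1 y2 !mul1r; exact: y3.
  have c1 : 3 * la ^+ 2 < sqn x.
    by rewrite (lt_le_trans _ h3)// exprMn ltr_pM2r ?exprn_gt0// [3 ^+ 2]expr2; lra.
  have c2 : 3 * rho ^+ 2 < sqn x.
    rewrite (le_lt_trans _ c1)// ler_pM2l//; apply: lerXn2r; rewrite ?nnegrE ?(ltW rho0) ?(ltW la0)//.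
  have := near_and (cutoff_near0 la0 c1) (cutoff_near0 rho0 c2); apply: filterS => y [y1 y2] _.
  by rewrite /w y1 y2 !mul0r subrr normr0.
have DI t : ann t `<=` D -> D `&` ann t = ann t by move=> h'; apply/setIidr.
have rfla : reg (D `&` ann la) f by apply: (reg_sub oD _ (@subIsetl _ _ _) rf); apply: openI.
have rWrho : reg (D `&` ann rho) W.
  apply: (reg_sub oK _ _ rW); first exact: openI.
  by move=> x [[_ nK] /ann_hball].
have lam_eq : lam (ann (2 * rho)) (2 * rho) h f = lam (ann (2 * rho)) (2 * rho) h w.
  apply: eq_int => x ax; congr (_ * _); apply: eq_comm_near.
  have c1 : sqn x < 2 * la ^+ 2.
    case/andP: ax => _ ax; apply: (lt_le_trans ax); apply: (@le_trans _ _ (la ^+ 2)).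
      apply: lerXn2r; rewrite ?nnegrE ?mulr_ge0 ?(ltW rho0) ?(ltW la0)//.
      by move: rl rho0; lra.
    by rewrite ler_pMl ?exprn_gt0// ler1n.
  have c2 : 3 * rho ^+ 2 < sqn x.
    case/andP: ax => ax _; apply: (le_lt_trans _ ax); rewrite exprMn ler_pM2r ?exprn_gt0//.
    by rewrite [2 ^+ 2]expr2; lra.
  have := near_and (cutoff_near1 la0 c1) (cutoff_near0 rho0 c2); apply: filterS => y [y1 y2].
  by rewrite /w y1 y2 mul1r mul0r subr0.
rewrite lam_eq; have [C C0 hC] := lam_bddf (R := R) n3.
have [bf bW] : vbmf (ann la) f /\ vbmf (ann rho) W.
  by move: rfla rWrho; rewrite (DI _ aD) (DI _ bDr) => -[_ bf _ _] [_ bW _ _].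
have [H1 [_ H10 hH1]] := bmf_bd bf; have [H2 [_ H20 hH2]] := bmf_bd bW.
have bl1 := hC D (ann la) la f H1 bD (mA _) (fun x ax => conj (aD x ax) ax) la0 bf hH1 H10.
have bl2 := hC D (ann rho) rho W H2 bD (mA _) (fun x ax => conj (bDr x ax) ax) rho0 bW hH2 H20.
have bl := bddf_lin (-1) bl2 bl1.
have bl' : exists k, bddf D (fun psi => lam (ann la) la f psi - lam (ann rho) rho W psi) k.
  eexists; have -> : (fun psi => lam (ann la) la f psi - lam (ann rho) rho W psi) =
      (fun psi => -1 * lam (ann rho) rho W psi + lam (ann la) la f psi).
    by apply/funext => psi; rewrite mulN1r addrC.
  exact: bl.
have [k bk] := bl'.
apply: (lam_eq_dual n3 bD rw vw (mA _) _ _ bh bk) => [x ax||psi tp].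
- by split => //; exact: cD.
- by rewrite mulr_gt0.
- have [b1 e1] := int_comm bD la0 tp rfla; have [b2 e2] := int_comm bD rho0 tp rWrho.
  rewrite (DI _ aD) in e1; rewrite (DI _ bDr) in e2.
  apply: etrans (_ : vint D (fun x => psi x * comm (cutoff la) f x - psi x * comm (cutoff rho) W x) = _).
    by apply: eq_int => x Dx; rewrite lw// mulrBr.
  apply: etrans (intB (bounded_dom_fin bD) b1 b2) _.
  apply: etrans (congr2 (fun a b => a - b) e1 e2) _.
  by move: (lam (ann la) la f psi) (lam (ann rho) rho W psi) => a b; rewrite opprK opprB addrC.
Qed.

(** The function v minus its cutoff is 0 near the hole, vanishes at the outer boundary, and equals v
    on the annulus tau; its Laplacian is carried by the annulus mu. It represents a functional that
    sees v only there. *)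
Lemma outer_identity Om (mu tau : R) v h : (3 <= n)%N -> bounded_dom Om -> 0 < mu -> 2 * mu <= tau ->
  reg (Om `&` [set x | mu ^+ 2 < sqn x]) v ->
  (forall x, (Om `&` [set x | mu ^+ 2 < sqn x]) x -> laplacian v x = 0) ->
  vanish Om (fun x => v x - cutoff mu x * v x) -> vbmf (Om `&` ann tau) h ->
  lam (Om `&` ann tau) tau h v =
  dual Om (lam (Om `&` ann mu) mu (fun x => - v x)) (lam (Om `&` ann tau) tau h).
Proof.
move=> n3 bOm mu0 mt rv v0 vv bh; have oOm := bOm.1.
have tau0 : 0 < tau by apply: lt_le_trans mt; rewrite mulr_gt0.
have rw := reg_cocutoff oOm mu0 rv.
have oY t : open (Om `&` ann t) by apply: openI => //; exact: open_ann.
have mY t := open_measurable_rV (oY t).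
have oE : open (Om `&` [set x | mu ^+ 2 < sqn x]) by apply: openI => //; exact: open_sqn_gt.
have lam_eq : lam (Om `&` ann tau) tau h v = lam (Om `&` ann tau) tau h (fun x => v x - cutoff mu x * v x).
  apply: eq_int => x [_ /andP[ax _]]; congr (_ * _); apply: eq_comm_near.
  have c2 : 3 * mu ^+ 2 < sqn x.
    apply: (le_lt_trans _ ax); apply: (@le_trans _ _ ((2 * mu) ^+ 2)).
      by rewrite exprMn ler_pM2r ?exprn_gt0// [2 ^+ 2]expr2; lra.
    by apply: lerXn2r; rewrite ?nnegrE ?mulr_ge0 ?(ltW mu0) ?(ltW tau0).
  by have := cutoff_near0 mu0 c2; apply: filterS => y ->; rewrite mul0r subr0.
have rvm : reg (Om `&` ann mu) v.
  by apply: (reg_sub oE (oY mu) _ rv) => x [Ox /andP[]].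
have [Cv bv bpv blv] := rvm; have bNv := bmfN bv.
have [C C0 hC] := lam_bddf (R := R) n3; have [H [_ H0 hH]] := bmf_bd bNv.
have bl := hC Om (Om `&` ann mu) mu _ H bOm (mY mu) (fun x ax => ax) mu0 bNv hH H0.
rewrite lam_eq; apply: (lam_eq_dual n3 bOm rw vv (mY tau) _ tau0 bh bl) => // psi tp.
have [b1 e1] := int_comm bOm mu0 tp rvm; have [Cv0 _ _ _] := rv.
have -> : vint Om (fun x => psi x * laplacian (fun x => v x - cutoff mu x * v x) x) =
    vint Om (fun x => - (psi x * comm (cutoff mu) v x)).
  by apply: eq_int => x Ox; rewrite (laplacian_cocutoff oOm mu0 Cv0 v0 Ox) mulrN.
rewrite intN ?e1 ?opprK; [|exact: (bounded_dom_fin bOm)|exact: b1].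
rewrite /lam -intN; first by apply: eq_int => x _; rewrite mulNr opprK.
  exact: (bounded_dom_fin (bounded_domI bOm (open_ann (t := mu)))).
apply: bmfM => //; apply: bmf_comm => //; first exact: (bmfS (open_measurable_rV oOm) (@subIsetl _ _ _) (mY mu) (test_bmf bOm tp)).
by move=> i; exact: (bmfS (open_measurable_rV oOm) (@subIsetl _ _ _) (mY mu) (test_partial_bmf i bOm tp)).
Qed.

End identities.

Lemma expr_scaling (R : realType) k (s : R) : (3 <= k)%N -> 0 < s -> s^-1 ^+ 2 * s ^+ k = s ^+ (k - 2).
Proof.
move=> k3 s0; have k2 : (2 <= k)%N := ltnW k3.
rewrite -[in LHS](subnK k2) exprD mulrCA -exprMn mulVf ?gt_eqF// expr1n.
exact: mulr1.
Qed.

(** * The Green function of the half-space *)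
Section half_space.
Context {R : realType} {m : nat}.
Notation n := m.+1.
Notation mR := (measurableTypeR R).
Notation V := 'rV[R]_n.
Implicit Types (x y z t c : V) (v f : V -> R).

Definition star x : V := \row_i (if i == ord_max then - x ord0 i else x ord0 i).

(** Used twice: on the boundary hyperplane the two distances agree, so the Green function vanishes
    there; inside the half-space the reflected pole is the farther one. *)
Lemma sqn_sub_star x y : sqn (y - star x) = sqn (y - x) + 4 * (x ord0 ord_max * y ord0 ord_max).
Proof.
rewrite /sqn (bigD1 ord_max)//= [X in _ = X + _](bigD1 ord_max)//=.
rewrite !mxE eqxx [X in _ + X = _](_ : _ = \sum_(i < n | i != ord_max) (y - x) ord0 i ^+ 2); last first.
  by apply: eq_bigr => i ni; rewrite !mxE (negbTE ni).
by move: (\sum_(i | _) _) (x _ _) (y _ _) => S a b; ring.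
Qed.

(* The Green function of the half-space, up to the factor mass. *)
Definition gk x y : R := Gam (y - x) - Gam (y - star x).

Lemma near_sqn x (P : V -> Prop) : (\forall y \near x, P y) ->
  exists e : R, 0 < e /\ forall y, sqn (y - x) <= e -> P y.
Proof.
move=> /nbhs_ballP[d /= d0 hd]; have d2 : 0 < d / 2 by rewrite divr_gt0.
exists ((d / 2) ^+ 2); split; first by rewrite exprn_gt0.
move=> y hy; apply: hd; rewrite -ball_normE /= distrC; apply: rV_norm_lt => // i.
have := sqn_cube (ltW d2) hy i; move=> h; apply: (le_lt_trans h).
by rewrite ltr_pdivrMr// ltr_pMr// ltr1n.
Qed.

Lemma open_halfspace : open (halfspace m : set V).
Proof.
rewrite (_ : halfspace m = (fun x : V => x ord0 ord_max) @^-1` [set r | 0 < r])//.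
apply: open_comp; last exact: open_gt.
by move=> x _; exact: (class_C_cont (class_C_coord 0 ord_max openT) (I : setT x)).
Qed.

Definition halfball (r : R) : set V := hball r `&` halfspace m.

Lemma open_halfball r : open (halfball r).
Proof. by apply: openI; [exact: open_hball|exact: open_halfspace]. Qed.

Lemma bounded_halfball r : 0 <= r -> bounded_dom (halfball r).
Proof. by move=> r0; apply: bounded_domI; [exact: bounded_hball|exact: open_halfspace]. Qed.

Lemma halfspace_neg_near y : ~ halfspace m y -> y ord0 ord_max != 0 ->
  \forall z \near y, ~ halfspace m z.
Proof.
move=> /negP; rewrite -leNgt => h1 h2.
have lt0 : y ord0 ord_max < 0 by rewrite lt_neqAle h2 h1.
have oN : open [set x : V | x ord0 ord_max < 0].
  rewrite (_ : mkset _ = (fun x : V => x ord0 ord_max) @^-1` [set r | r < 0])//.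
  apply: open_comp; last exact: open_lt.
  by move=> x _; exact: (class_C_cont (class_C_coord 0 ord_max openT) (I : setT x)).
by have := near_open oN lt0; apply: filterS => z /= hz; apply/negP; rewrite -leNgt ltW.
Qed.

(** The cutoff settles the spherical part of the boundary, the equality of the two distances its
    flat part. *)
Lemma vanish_green (tau d : R) x : 0 < tau -> 0 < d ->
  vanish (halfball (4 * tau)) (fun y => cutoff (2 * tau) y * (Gd d x y - 1 * Gd d (star x) y)).
Proof.
move=> tau0 d0 y nHy eps eps0.
have t20 : 0 < 2 * tau by rewrite mulr_gt0.
have [h|h] := ltP (sqn y) ((4 * tau) ^+ 2); last first.
  have h3 : 3 * (2 * tau) ^+ 2 < sqn y.
    rewrite (lt_le_trans _ h)// !exprMn mulrA ltr_pM2r ?exprn_gt0// !expr2; lra.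
  have := cutoff_near0 t20 h3; apply: filterS => z -> _.
  by rewrite mul0r normr0.
have nh : ~ halfspace m y by move=> hy; exact: nHy.
have [y0|y0] := eqVneq (y ord0 ord_max) 0; last first.
  by have := halfspace_neg_near nh y0; apply: filterS => z nz [_ /nz].
pose b (y : V) := cutoff (2 * tau) y * (Gd d x y - 1 * Gd d (star x) y).
have Cb : class_C 0 setT b.
  apply: class_CM; [exact: openT|exact: class_CW (class_C_cutoff _)|].
  apply: class_CB; [exact: openT|exact: class_C_Gd|].
  by apply: class_CZ; [exact: openT|exact: class_C_Gd].
have by0 : b y = 0.
  rewrite /b /Gd sqn_sub_star y0 mulr0 mulr0 addr0 mul1r subrr mulr0 //.
have := (continuous_eps b y).1 (class_C_cont Cb (I : setT y)) eps eps0.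
by rewrite by0; apply: filterS => z hz _; move: hz; rewrite sub0r normrN.
Qed.

Section representation_hole.
Variables (tau rho s : R) (c : V) (v : V -> R).
Hypotheses (n3 : (3 <= n)%N) (tau0 : 0 < tau) (rho0 : 0 < rho) (s0 : 0 < s).
Let inv y : V := - s^-1 *: c + s^-1 *: y.
Let H : set V := halfball (4 * tau).
Let E : set V := H `&` [set y | rho ^+ 2 < sqn (inv y)].
Hypothesis hole : forall t, sqn t <= (4 * rho) ^+ 2 -> sqn (c + s *: t) < tau ^+ 2 /\ halfspace m (c + s *: t).
Hypotheses (rv : reg E v) (v0 : forall y, E y -> laplacian v y = 0).
Hypothesis vv : forall y, ~ halfspace m y -> forall d, 0 < d -> \forall z \near y, E z -> `|v z| < d.

Lemma affineK t : inv (c + s *: t) = t.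
Proof. by rewrite /inv scalerDr scalerA mulVf ?gt_eqF// scale1r addrA scaleNr addNr add0r. Qed.

Lemma affineVK y : c + s *: inv y = y.
Proof.
rewrite /inv scalerDr !scalerA mulfV ?gt_eqF// scale1r mulrN mulfV ?gt_eqF//.
by rewrite scaleN1r addrA subrr add0r.
Qed.

Let vt t := v (c + s *: t).
Let D : set V := [set t | H (c + s *: t)].
(** Truncation at both ends: [F] removes v near the hole, in rescaled coordinates, and [W] also
    removes it far away. Thus [W] vanishes on the whole boundary of the half-ball and equals v in
    between. *)
Let F t := vt t - cutoff (2 * rho) t * vt t.
Let f y := F (inv y).
Let W y := cutoff tau y * f y.
Let rho20 : 0 < 2 * rho. Proof. by rewrite mulr_gt0. Qed.
Let oH : open H. Proof. exact: open_halfball. Qed.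

Let oD : open D. Proof. exact: open_affine. Qed.
Let oE : open E.
Proof. by apply: openI => //; apply: (@open_affine R n (- s^-1 *: c) s^-1 [set x | rho ^+ 2 < sqn x]); exact: open_sqn_gt. Qed.

Let oF : open (D `&` [set t | (2 * rho) ^+ 2 < sqn t]).
Proof. by apply: openI => //; exact: open_sqn_gt. Qed.

Let FE t : (D `&` [set t | (2 * rho) ^+ 2 < sqn t]) t -> E (c + s *: t).
Proof.
move=> [Dt ht]; split => //=; rewrite affineK (le_lt_trans _ ht)//.
by apply: lerXn2r; rewrite ?nnegrE ?mulr_ge0 ?(ltW rho0)// ler_pMl// ler1n.
Qed.

Let rvt : reg (D `&` [set t | (2 * rho) ^+ 2 < sqn t]) vt.
Proof. exact: (reg_affine oE oF FE rv). Qed.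

Let vt0 t : (D `&` [set t | (2 * rho) ^+ 2 < sqn t]) t -> laplacian vt t = 0.
Proof.
move=> /FE Et; have [Cv _ _ _] := rv.
by rewrite (laplacian_affine oE Cv Et) v0// mulr0.
Qed.

Let rF : reg D F. Proof. exact: (reg_cocutoff oD rho20 rvt). Qed.

Let HD y : H y -> D (- s^-1 *: c + s^-1 *: y).
Proof. by move=> Hy; rewrite /D /=; have := affineVK y; rewrite /inv => ->. Qed.

Let rf : reg H f. Proof. exact: (reg_affine oD oH HD rF). Qed.
Let rW : reg H W. Proof. exact: (reg_cutoffM oH tau0 rf). Qed.

Let lf y : H y -> laplacian f y = - (s^-1 ^+ 2 * comm (cutoff (2 * rho)) vt (inv y)).
Proof.
move=> Hy; have [CF _ _ _] := rF; have [Cvt _ _ _] := rvt.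
rewrite (laplacian_affine oD CF (HD Hy)) -mulrN; congr (_ * _).
exact: (laplacian_cocutoff oD rho20 Cvt vt0 (HD Hy)).
Qed.

Let far y : tau ^+ 2 <= sqn y -> (4 * rho) ^+ 2 < sqn (inv y).
Proof.
move=> hy; rewrite ltNge; apply/negP => h; have [h2 _] := hole h.
by move: h2; rewrite affineVK ltNge hy.
Qed.

(** By [hole], each of the two cutoffs is constant where the other one varies, so the commutators do
    not interact. *)
Let lW y : H y -> laplacian W y =
  comm (cutoff tau) v y - s^-1 ^+ 2 * comm (cutoff (2 * rho)) vt (inv y).
Proof.
move=> Hy; have [Cf _ _ _] := rf.
have Cc : class_C 2 H (cutoff tau) by apply: class_CS (class_C_cutoff tau).
rewrite (laplacianM oH Hy Cc Cf) lf// addrC; congr (_ + _).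
  have [a|na] := pselect (ann tau y); last by rewrite !comm_out.
  apply: eq_comm_near; have /andP[a1 _] := a; have Ha : (H `&` [set z | tau ^+ 2 < sqn z]) y by [].
  have oA : open (H `&` [set z : V | tau ^+ 2 < sqn z]) by apply: openI => //; exact: open_sqn_gt.
  have := near_open oA Ha; apply: filterS => z [_ /ltW /far hz].
  rewrite /f /F cutoff0 ?mul0r ?subr0 /vt ?affineVK//.
  rewrite (le_trans _ (ltW hz))// !exprMn mulrA ler_pM2r ?exprn_gt0// !expr2; lra.
have [a|na] := pselect (ann (2 * rho) (inv y)); last by rewrite comm_out// mulr0 !oppr0 mulr0.
rewrite cutoff1 ?mul1r//.
have /andP[_ a2] := a; have a3 : sqn (inv y) <= (4 * rho) ^+ 2.
  by rewrite (le_trans (ltW a2))// mulrA le_eqVlt; apply/orP; left; apply/eqP; congr (_ ^+ 2); ring.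
have [h _] := hole a3; move: h; rewrite affineVK => /ltW h.
by rewrite (le_trans h)// ler_pMl ?exprn_gt0// ler1n.
Qed.

Let vW : vanish H W.
Proof.
move=> y nHy d d0; have [hy|nhy] := pselect (halfspace m y); last first.
  have := vv nhy d0; apply: filterS => z hz Hz.
  have [h|h] := ltP (rho ^+ 2) (sqn (inv z)); last first.
    have c1 : cutoff (2 * rho) (inv z) = 1.
      apply: cutoff1 => //; apply: (le_trans h); rewrite exprMn mulrA ler_pMl ?exprn_gt0//.
      by rewrite expr2; lra.
    by rewrite /W /f /F c1 mul1r subrr mulr0 normr0.
  apply: le_lt_trans (hz (conj Hz h)).
  have -> : W z = cutoff tau z * (1 - cutoff (2 * rho) (inv z)) * v z.
    by rewrite /W /f /F /vt affineVK; ring.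
  rewrite normrM ler_piMl// normrM mulr_ile1 ?normr_ge0//.
    by rewrite ger0_norm ?cutoff_ge0// cutoff_le1.
  by rewrite ger0_norm ?subr_ge0 ?cutoff_le1// gerBl cutoff_ge0.
have h3 : 3 * tau ^+ 2 < sqn y.
  have : (4 * tau) ^+ 2 <= sqn y by rewrite leNgt; apply/negP => h; exact: nHy.
  by apply: lt_le_trans; rewrite exprMn ltr_pM2r ?exprn_gt0// expr2; lra.
by have := cutoff_near0 tau0 h3; apply: filterS => z h _; rewrite /W h mul0r normr0.
Qed.

(** [representation] applied to [W] gives one term per annulus. In the term at the hole, the
    Laplacian contributes s^(-2) and the change of variables s^n. *)
Theorem half_representation x : halfspace m x -> sqn x < tau ^+ 2 -> (4 * rho) ^+ 2 < sqn (inv x) ->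
  @mass R n * v x = s ^+ (n - 2) * lam (ann (2 * rho)) (2 * rho) (fun t => gk x (c + s *: t)) vt
    - lam (halfball (4 * tau) `&` ann tau) tau (gk x) v.
Proof.
move=> hx xtau xrho; have Hx : H x.
  split => //; rewrite /hball /= (lt_le_trans xtau)//.
  by apply: lerXn2r; rewrite ?nnegrE ?mulr_ge0 ?(ltW tau0)// ler_pMl// ler1n.
pose A y := comm (cutoff tau) v y; pose B y := comm (cutoff (2 * rho)) vt (inv y).
have [e [e0 he]] : exists e : R, 0 < e /\ forall y, sqn (y - x) <= e -> A y = 0 /\ B y = 0.
  apply: near_sqn.
  have n1 := sqn_lt_near xtau.
  have oI : open [set y | (4 * rho) ^+ 2 < sqn (inv y)].
    by apply: (@open_affine R n (- s^-1 *: c) s^-1 [set x | (4 * rho) ^+ 2 < sqn x]); exact: open_sqn_gt.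
  have n2 := near_open oI xrho.
  have := near_and n1 n2; apply: filterS => y [y1 y2]; split.
    by apply: comm_out => // /andP[]; rewrite ltNge (ltW y1).
  apply: comm_out => // /andP[_]; rewrite ltNge mulrA [2 * 2](_ : _ = 4) ?(ltW y2)//; ring.
(* Points of [H] are nearer to x than to its reflection, so the same radius e works for the second
   pole. *)
have he' y : H y -> sqn (y - star x) <= e -> A y = 0 /\ B y = 0.
  move=> [_ hy]; rewrite sqn_sub_star => h; apply: he; apply: le_trans h.
  by rewrite lerDl mulr_ge0// mulr_ge0// ltW.
have bH : bounded_dom H by apply: bounded_halfball; rewrite mulr_ge0// ltW.
have fH := bounded_dom_fin bH; have mH := fH.1.
have t20 : 0 < 2 * tau by rewrite mulr_gt0.
have [CW bW bpW blW] := rW.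
have WT y : H y -> (2 * tau) ^+ 2 <= sqn y -> W y = 0.
  move=> _ h; rewrite /W cutoff0 ?mul0r// (le_trans _ h)// exprMn ler_pM2r ?exprn_gt0//.
  by rewrite expr2; lra.
have nH : ~ H (star x).
  by move=> [_]; rewrite /halfspace /= mxE eqxx oppr_gt0 => /lt_trans/(_ hx); rewrite ltxx.
have l1 y : H y -> sqn (y - x) <= e -> laplacian W y = 0.
  by move=> Hy /he[a b]; rewrite lW// -/(A y) -/(B y) a b mulr0 subrr.
have l2 y : H y -> sqn (y - star x) <= e -> laplacian W y = 0.
  by move=> Hy /(he' _ Hy)[a b]; rewrite lW// -/(A y) -/(B y) a b mulr0 subrr.
have rep := representation n3 bH t20 e0 CW vW bpW blW WT (fun d d0 => @vanish_green tau d x tau0 d0) Hx nH l1 l2.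
have Wx : W x = v x.
  rewrite /W /f /F cutoff1 ?mul1r//; last by rewrite (le_trans (ltW xtau))// ler_pMl ?exprn_gt0// ler1n.
  rewrite cutoff0 ?mul0r ?subr0 /vt ?affineVK//.
  rewrite (le_trans _ (ltW xrho))// !exprMn mulrA ler_pM2r ?exprn_gt0// !expr2; lra.
rewrite -Wx rep.
have oX : open (H `&` ann tau) by apply: openI => //; exact: open_ann.
have mX := open_measurable_rV oX.
have XE : H `&` ann tau `<=` E.
  move=> y [Hy /andP[/ltW /far h _]]; split => //=; rewrite (le_lt_trans _ h)//.
  by apply: lerXn2r; rewrite ?nnegrE ?mulr_ge0 ?(ltW rho0)// ler_pMl// ler1n.
have [Cv bv bpv blv] := reg_sub oE oX XE rv.
have A0 y : H y -> ~ (H `&` ann tau) y -> A y = 0.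
  by move=> Hy nX; apply: comm_out => // ax; apply: nX.
have bA : vbmf H A.
  by apply: (bmf_ext0 mH mX (@subIsetl _ _ _) _ A0); exact: bmf_comm.
have b1B : vbmf H (fun y => s^-1 ^+ 2 * B y).
  by apply: (eq_bmf _ (bmfB bA blW)) => y Hy; rewrite lW// opprB addrC subrK.
have bB : vbmf H B.
  apply: (eq_bmf _ (bmfZ (s ^+ 2) b1B)) => y Hy.
  by rewrite mulrA -exprMn mulfV ?gt_eqF// expr1n mul1r.
have gM h : vbmf H h -> (forall y, H y -> sqn (y - x) <= e -> h y = 0) ->
    (forall y, H y -> sqn (y - star x) <= e -> h y = 0) -> vbmf H (fun y => gk x y * h y).
  move=> bh h1 h2; have := bmfB (bmf_GamM fH oH bh e0 h1) (bmf_GamM fH oH bh e0 h2).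
  by apply: eq_bmf => y _; rewrite mulrBl.
have bgA : vbmf H (fun y => gk x y * A y).
  exact: (gM _ bA (fun y _ h => (he y h).1) (fun y Hy h => (he' y Hy h).1)).
have bgB : vbmf H (fun y => gk x y * B y).
  exact: (gM _ bB (fun y _ h => (he y h).2) (fun y Hy h => (he' y Hy h).2)).
have -> : vint H (fun y => (Gam (y - x) - 1 * Gam (y - star x)) * laplacian W y) =
    vint H (fun y => gk x y * A y - s^-1 ^+ 2 * (gk x y * B y)).
  by apply: eq_int => y Hy; rewrite lW// mul1r -/(gk x y) mulrBr mulrCA.
rewrite (intB fH bgA (bmfZ _ bgB)) (intZ _ fH bgB).
have iA : vint H (fun y => gk x y * A y) = lam (H `&` ann tau) tau (gk x) v.
  apply: (int_restrict fH mX (@subIsetl _ _ _) bgA) => y Hy nX.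
  by rewrite (A0 _ Hy nX) mulr0.
have [fD iB0] := int_affine c s0 fH bgB.
have annD : ann (2 * rho) `<=` [set t | H (c + s *: t)].
  move=> t /andP[_ /ltW h]; have h4 : sqn t <= (4 * rho) ^+ 2.
    by rewrite (le_trans h)// mulrA le_eqVlt; apply/orP; left; apply/eqP; congr (_ ^+ 2); ring.
  have [h1 h2] := hole h4; split => //; rewrite /hball /= (lt_le_trans h1)//.
  by apply: lerXn2r; rewrite ?nnegrE ?mulr_ge0 ?(ltW tau0)// ler_pMl// ler1n.
have mA := open_measurable_rV (@open_ann R n (2 * rho)).
have iB : vint [set t | H (c + s *: t)] (fun t => gk x (c + s *: t) * B (c + s *: t)) =
    lam (ann (2 * rho)) (2 * rho) (fun t => gk x (c + s *: t)) vt.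
  have e1 : vint [set t | H (c + s *: t)] (fun t => gk x (c + s *: t) * B (c + s *: t)) =
      vint [set t | H (c + s *: t)] (fun t => gk x (c + s *: t) * comm (cutoff (2 * rho)) vt t).
    by apply: eq_int => t _; rewrite /B affineK.
  apply: (etrans e1); apply: (int_restrict fD mA annD).
    have := bmf_affine mH (fun t (h : [set t | H (c + s *: t)] t) => h) bgB.
    by apply: eq_bmf => t _; rewrite /B affineK.
  by move=> t _ nA; rewrite comm_out ?mulr0.
have alg (p q L1 L2 : R) : p = L1 -> q = s ^+ n * L2 ->
    - (p - s^-1 ^+ 2 * q) = s ^+ (n - 2) * L2 - L1.
  move=> -> ->; rewrite opprB mulrA; congr (_ * _ - _).
  exact: expr_scaling.
exact: (alg _ _ _ _ iA (etrans iB0 (congr1 (fun q : R => s ^+ n * q) iB))).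
Qed.

End representation_hole.

Lemma full_representation (tau : R) v x : (3 <= n)%N -> 0 < tau -> reg (hball (4 * tau)) v ->
  (forall y, hball (4 * tau) y -> laplacian v y = 0) -> sqn x < tau ^+ 2 ->
  @mass R n * v x = - lam (ann tau) tau (fun y => Gam (y - x)) v.
Proof.
move=> n3 tau0 rv v0 xtau; pose D : set V := hball (4 * tau).
have tau2 : 0 < tau ^+ 2 by rewrite exprn_gt0.
have oD : open D by exact: open_hball.
have bD : bounded_dom D by apply: bounded_hball; rewrite mulr_ge0// ltW.
have fD := bounded_dom_fin bD.
have [CW bW bpW blW] := reg_cutoffM oD tau0 rv.
have [Cv bv bpv blv] := rv.
have lW y : D y -> laplacian (fun y => cutoff tau y * v y) y = comm (cutoff tau) v y.
  by move=> Dy; exact: (laplacian_cutoffM tau oD Dy Cv (v0 y Dy)).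
have t20 : 0 < 2 * tau by rewrite mulr_gt0.
have far0 (w : V -> R) : (forall y, (4 * tau) ^+ 2 <= sqn y -> \forall z \near y, w z = 0) -> vanish D w.
  move=> h y /negP; rewrite -leNgt => hy d d0; have := h y hy; apply: filterS => z -> _.
  by rewrite normr0.
have vW : vanish D (fun y => cutoff tau y * v y).
  apply: far0 => y h; have h3 : 3 * tau ^+ 2 < sqn y.
    by rewrite (lt_le_trans _ h)// exprMn ltr_pM2r// expr2; lra.
  by have := cutoff_near0 tau0 h3; apply: filterS => z ->; rewrite mul0r.
(* With weight 0 the second pole contributes nothing; at distance 8 tau from the origin it lies
   outside the ball of radius 4 tau, farther than tau from it. *)
pose c' : V := (8 * tau) *: delta_mx ord0 ord0.
have sc' : sqn c' = 64 * tau ^+ 2.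
  rewrite sqnZ (_ : sqn (delta_mx ord0 ord0) = 1) ?mulr1 ?exprMn//; last first.
    rewrite /sqn (bigD1 ord0)//= mxE !eqxx expr1n big1 ?addr0// => i ni.
    by rewrite mxE eqxx (negbTE ni) expr0n.
  by rewrite [8 ^+ 2]expr2; move: (tau ^+ 2) => q; ring.
have [e [e0 he]] := near_sqn (sqn_lt_near xtau).
pose e' := Num.min e (tau ^+ 2); have e'0 : 0 < e' by rewrite lt_min e0.
have rep := representation (kap := 0) (c := x) (c' := c') n3 bD t20 e'0 CW vW bpW blW.
have Dx : D x.
  rewrite /D /hball /= (lt_le_trans xtau)//.
  by apply: lerXn2r; rewrite ?nnegrE ?mulr_ge0 ?(ltW tau0)// ler_pMl// ler1n.
have Wx : cutoff tau x * v x = v x.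
  by rewrite cutoff1 ?mul1r// (le_trans (ltW xtau))// ler_pMl// ler1n.
rewrite -Wx rep//.
- congr (- _).
  have mA := open_measurable_rV (@open_ann R n tau).
  have AD : ann tau `<=` D.
    move=> y /ann_hball; apply: le_hball; first by rewrite mulr_ge0// ltW.
    by rewrite ler_pM2r// ler_nat.
  have l1 y : D y -> sqn (y - x) <= e -> comm (cutoff tau) v y = 0.
    by move=> _ /he h; apply: comm_out => // /andP[]; rewrite ltNge (ltW h).
  have bc : vbmf D (comm (cutoff tau) v) by apply: bmf_comm => //; exact: fD.1.
  have bg := bmf_GamM fD oD bc e0 l1.
  have -> : vint D (fun y => (Gam (y - x) - 0 * Gam (y - c')) * laplacian (fun y => cutoff tau y * v y) y) =
      vint D (fun y => Gam (y - x) * comm (cutoff tau) v y).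
    by apply: eq_int => y Dy; rewrite mul0r subr0 lW.
  by apply: (int_restrict fD mA AD bg) => y _ nA; rewrite comm_out ?mulr0.
- move=> y _ h; rewrite cutoff0 ?mul0r// (le_trans _ h)// exprMn ler_pM2r//.
  by rewrite expr2; lra.
- move=> d d0; apply: far0 => y h; have h3 : 3 * (2 * tau) ^+ 2 < sqn y.
    by rewrite (lt_le_trans _ h)// !exprMn mulrA ltr_pM2r// !expr2; lra.
  by have := cutoff_near0 t20 h3; apply: filterS => z ->; rewrite mul0r.
- rewrite /D /hball /= sc' exprMn => /lt_geF; rewrite ler_pM2r// expr2 => /negP; apply; lra.
- move=> y Dy; rewrite le_min => /andP[/he h _]; rewrite lW//.
  by apply: comm_out => // /andP[]; rewrite ltNge (ltW h).
- move=> y Dy; rewrite le_min => /andP[_ h]; exfalso.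
  have hs : sqn (c' - y) = sqn (y - c') by rewrite -sqnN opprB.
  have := sqnB_ge c' y; rewrite hs sc'; move: Dy h; rewrite /D /hball /= exprMn [4 ^+ 2]expr2.
  move: (sqn y) (sqn (y - c')) tau2; move: (tau ^+ 2) => q a b; lra.
Qed.

End half_space.

(** * Energy of the perturbed solution, by Green's identities *)

Lemma lt_three_sqr (R : realType) (t : R) : 0 < t -> 3 * t ^+ 2 < (2 * t) ^+ 2.
Proof. by move=> t0; rewrite exprMn ltr_pM2r ?exprn_gt0// expr2; lra. Qed.

(** Linear bookkeeping on real atoms, kept apart so that [lra] never meets the integrals they stand
    for; the same holds for the next two lemmas. *)
Lemma arith_variation (R : realType) (p p0 p1 p2 r1 r2 x1 x2 x3 x4 : R) :
  x1 = 0 -> x2 = 0 -> x1 = x3 - r1 -> x2 = x4 - r2 -> x3 = p - p1 -> x4 = p2 - p0 -> p1 = p2 ->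
  p = p0 + (r1 + r2).
Proof. lra. Qed.

Lemma arith_swap (R : realType) (x y l l' i1 i2 : R) :
  y = 2 * x -> y = i1 - i2 -> i1 = l -> i2 = l' -> l' = - l -> x = l.
Proof. lra. Qed.

Lemma arith_energy (R : realType) (p S x1 x2 x3 x4 k y1 y2 l1 l2 l3 l4 l5 b : R) :
  k + x4 = 0 -> y1 = x3 -> y2 = b -> x1 - y2 = l1 -> x2 - y1 = l3 -> l2 = - l5 -> l4 = - l4 ->
  p + (S * (x1 - x2) + S * (x3 - x4)) = p + S * k + S * (b + (l1 - l2 - (l3 - l4)) - l5).
Proof.
move=> h1 h2 h3 h4 h5 h6 h7.
have -> : x4 = - k by lra.
have -> : x1 = l1 + b by lra.
have -> : x2 = l3 + x3 by lra.
have -> : l4 = 0 by lra.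
by rewrite h6; ring.
Qed.

Section energy_difference.
Context {R : realType} {m : nat}.
Notation n := m.+1.
Notation mR := (measurableTypeR R).
Notation V := 'rV[R]_n.
Implicit Types (D X : set V) (f g h w : V -> R).

Lemma gdotB D f g h x : D x -> class_C 1 D f -> class_C 1 D g ->
  gdot (fun x => f x - g x) h x = gdot f h x - gdot g h x.
Proof.
move=> Dx Cf Cg; rewrite /gdot -sumrB; apply: eq_bigr => i _.
by rewrite (partialB i Dx Cf Cg) mulrBl.
Qed.

Lemma gdotM D f g h x : D x -> class_C 1 D f -> class_C 1 D g ->
  gdot (fun x => f x * g x) h x = f x * gdot g h x + g x * gdot f h x.
Proof.
move=> Dx Cf Cg; rewrite /gdot !mulr_sumr -big_split /=; apply: eq_bigr => i _.
by rewrite (partialM i Dx Cf Cg) mulrDl !mulrA.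
Qed.

Lemma reg_gdot D f g : reg D f -> reg D g -> vbmf D (gdot f g).
Proof. by move=> [_ _ bf _] [_ _ bg _]; exact: bmf_gdot. Qed.

Lemma reg_C1 D f : reg D f -> class_C 1 D f.
Proof. by move=> [Cf _ _ _]; exact: class_CW Cf. Qed.

Lemma green_harmonic D w f : bounded_dom D -> reg D w -> vanish D w -> reg D f ->
  (forall x, D x -> laplacian f x = 0) -> vint D (gdot w f) = 0.
Proof.
move=> bD rw vw [Cf bf bpf blf] f0; have [_ _ bpw _] := rw.
rewrite -(green0 bD (reg_C1 rw) vw bpw Cf bpf blf); apply: eq_int => x Dx.
by rewrite f0// mulr0 addr0.
Qed.

Lemma int_gdotB D f g h : vfin D -> reg D f -> reg D g -> reg D h ->
  vint D (gdot (fun x => f x - g x) h) = vint D (gdot f h) - vint D (gdot g h).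
Proof.
move=> fD rf rg rh; rewrite -(intB fD (reg_gdot rf rh) (reg_gdot rg rh)).
by apply: eq_int => x Dx; rewrite (gdotB _ Dx (reg_C1 rf) (reg_C1 rg)).
Qed.

Lemma int_gdot_affine D f g (c : V) (s : R) : (3 <= n)%N -> 0 < s -> vfin D -> class_C 1 D f -> class_C 1 D g ->
  vbmf D (gdot f g) ->
  vint D (gdot f g) = s ^+ (n - 2) *
    vint [set t | D (c + s *: t)] (gdot (fun t => f (c + s *: t)) (fun t => g (c + s *: t))).
Proof.
move=> n3 s0 fD Cf Cg bfg; have [fE ->] := int_affine c s0 fD bfg.
have bE := bmf_affine fD.1 (fun t (h : [set t | D (c + s *: t)] t) => h) bfg.
have -> : vint [set t | D (c + s *: t)] (gdot (fun t => f (c + s *: t)) (fun t => g (c + s *: t))) =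
    vint [set t | D (c + s *: t)] (fun t => s ^+ 2 * gdot f g (c + s *: t)).
  by apply: eq_int => t Dt; rewrite (gdot_affine Cf Cg Dt).
rewrite (intZ _ fE bE) mulrA; congr (_ * _).
rewrite -(expr_scaling n3 s0) mulrAC -exprMn mulVf ?gt_eqF// expr1n; exact/esym/mul1r.
Qed.

Lemma lam_skew t f h : 0 < t -> reg (ann t) f -> reg (ann t) h ->
  lam (ann t) t f h = - lam (ann t) t h f.
Proof.
move=> t0 [Cf bf bpf _] [Ch bh bph _]; apply: comm_skew => //.
- split; first exact: open_ann.
  by exists (2 * t) => x /ann_hball; apply: hball_cube; rewrite mulr_ge0// ltW.
- exact: class_CW Cf.
- exact: class_CW Ch.
by move=> x nx i; have := cutoff_near_out i t0 nx; apply: filterS => y ->; rewrite mulr0.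
Qed.

Lemma reg_bmf_comm D t f : open D -> 0 < t -> reg D f -> vbmf D (comm (cutoff t) f).
Proof. by move=> oD t0 [_ bf bp _]; apply: bmf_comm => //; exact: open_measurable_rV. Qed.

Lemma lamBl X t f g h : open X -> vfin X -> 0 < t -> vbmf X f -> vbmf X g -> reg X h ->
  lam X t (fun x => f x - g x) h = lam X t f h - lam X t g h.
Proof.
move=> oX fX t0 bf bg rh; have bc := reg_bmf_comm oX t0 rh.
rewrite /lam -(intB fX (bmfM bf bc) (bmfM bg bc)).
by apply: eq_int => x _; rewrite mulrBl.
Qed.

Lemma lamBr X t f g h : open X -> vfin X -> 0 < t -> vbmf X h -> reg X f -> reg X g ->
  lam X t h (fun x => f x - g x) = lam X t h f - lam X t h g.
Proof.
move=> oX fX t0 bh rf rg.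
rewrite /lam -(intB fX (bmfM bh (reg_bmf_comm oX t0 rf)) (bmfM bh (reg_bmf_comm oX t0 rg))).
apply: eq_int => x Xx; rewrite -mulrBr; congr (_ * _); rewrite /comm.
rewrite gdotC (gdotB _ Xx (reg_C1 rf) (reg_C1 rg)) !(gdotC _ (cutoff t)).
by move: (gdot _ _ _) (gdot _ _ _) (laplacian _ _) (f x) (g x) => *; ring.
Qed.

Section hole.
Variables (Om K : set V) (rho s : R) (c : V) (u u0 G : V -> R).
Hypotheses (n3 : (3 <= n)%N) (bOm : bounded_dom Om) (cK : closed K) (Krho : K `<=` hball rho).
Hypotheses (rho0 : 0 < rho) (s0 : 0 < s).
Let t := 2 * rho.
Let A : set V := hball (2 * t).
Hypothesis AOm : forall z, A z -> Om (c + s *: z).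
Let inv y : V := - s^-1 *: c + s^-1 *: y.
Let P : set V := Om `&` [set x | ~ K (inv x)].
Let Ak : set V := A `&` ~` K.
Hypotheses (ru : reg P u) (hu : forall x, P x -> laplacian u x = 0).
Hypotheses (ru0 : reg Om u0) (hu0 : forall x, Om x -> laplacian u0 x = 0).
Hypotheses (rG : reg Ak G) (hG : forall z, Ak z -> laplacian G z = 0).
Hypothesis Vout : forall y, ~ Om y -> forall d, 0 < d -> \forall z \near y, P z -> `|u z - u0 z| < d.
Hypothesis Vin : forall z, K z -> forall d, 0 < d -> \forall x \near z, ~ K x -> `|u (c + s *: x) - G x| < d.

Let t0 : 0 < t. Proof. by rewrite mulr_gt0. Qed.
Let oA : open A. Proof. exact: open_hball. Qed.
Let oAk : open Ak. Proof. exact: open_setD. Qed.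
Let oP : open P.
Proof. by apply: openI; [exact: bOm.1|apply: (@open_affine R n (- s^-1 *: c) s^-1 (~` K)); exact: closed_openC]. Qed.
Let bP : bounded_dom P.
Proof. by split; [exact: oP|have [_ [b Ob]] := bOm; exists b => x [/Ob]]. Qed.
Let bA : bounded_dom A. Proof. by apply: bounded_hball; rewrite mulr_ge0// ltW. Qed.
Let bAk : bounded_dom Ak. Proof. by apply: bounded_domI => //; exact: closed_openC. Qed.
Let fP := bounded_dom_fin bP.
Let fA := bounded_dom_fin bA.
Let fAk := bounded_dom_fin bAk.
Let fOm := bounded_dom_fin bOm.

Let chi : V -> R := cutoff t.
Let U z := u0 (c + s *: z).
Let uu z := u (c + s *: z).
Let Pt : set V := [set z | P (c + s *: z)].
(** The correction carrying the jump between u0 and the values on the hole. With g the same function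
    in the original variables, u - u0 - g vanishes on the whole boundary of [P]. *)
Let q z := chi z * (G z - U z).
Let g x := q (inv x).

Let invK z : inv (c + s *: z) = z. Proof. exact: affineK. Qed.
Let invVK y : c + s *: inv y = y. Proof. exact: affineVK. Qed.

Let PtE z : Pt z <-> Om (c + s *: z) /\ ~ K z.
Proof. by rewrite /Pt /P /= invK. Qed.

Let AkPt : Ak `<=` Pt.
Proof. by move=> z [Az nK]; apply/PtE; split => //; exact: AOm. Qed.

Let rU : reg A U. Proof. exact: (reg_affine bOm.1 oA AOm ru0). Qed.
Let hU z : A z -> laplacian U z = 0.
Proof.
move=> Az; have [C0 _ _ _] := ru0.
by rewrite (laplacian_affine bOm.1 C0 (AOm Az)) (hu0 (AOm Az)) mulr0.
Qed.
Let rUk : reg Ak U. Proof. exact: (reg_sub oA oAk (@subIsetl _ _ _) rU). Qed.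
Let ruu : reg Ak uu. Proof. exact: (reg_affine oP oAk AkPt ru). Qed.

Let oPt : open Pt. Proof. exact: (@open_affine R n c s P oP). Qed.

Let rq : reg Pt q.
Proof.
apply: (reg_cutoff oPt t0); apply: (reg_sub oAk _ _ (regB oAk rG rUk)).
  by apply: openI; [exact: oPt|exact: open_hball].
by move=> z [/PtE[_ nK] Az].
Qed.

Let PPt x : P x -> Pt (- s^-1 *: c + s^-1 *: x).
Proof. by move=> Px; rewrite /Pt /= -/(inv x) invVK. Qed.

Let rg : reg P g. Proof. exact: (reg_affine oPt oP PPt rq). Qed.
Let ru0P : reg P u0. Proof. exact: (reg_sub bOm.1 oP (@subIsetl _ _ _) ru0). Qed.

Let chi0 z : (2 * t) ^+ 2 <= sqn z -> \forall x \near z, chi x = 0.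
Proof.
by move=> h; apply: cutoff_near0 => //; exact: lt_le_trans (lt_three_sqr t0) h.
Qed.

Let chi1 z : K z -> \forall x \near z, chi x = 1.
Proof.
move=> /Krho h; apply: cutoff_near1 => //; apply: (lt_le_trans h).
by rewrite /t exprMn mulrA ler_pMl ?exprn_gt0// expr2; lra.
Qed.

Let w x := u x - u0 x - g x.
Let rw : reg P w. Proof. exact: (regB oP (regB oP ru ru0P) rg). Qed.

Let vw : vanish P w.
Proof.
move=> y nPy d d0; have [Oy|nOy] := pselect (Om y).
  have Ky : K (inv y) by apply: contrapT => nK; apply: nPy.
  have h := near_affine (near_and (chi1 Ky) (Vin Ky d0)).
  apply: filterS h => x [h1 h2] [Ox nKx].
  have := h2 nKx; rewrite -/(inv x) invVK /w /g /q h1 mul1r /U invVK.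
  by rewrite opprB addrA subrK.
have far : (2 * t) ^+ 2 <= sqn (inv y).
  by rewrite leNgt; apply/negP => h; apply: nOy; rewrite -(invVK y); exact: AOm.
have := near_and (near_affine (chi0 far)) (Vout nOy d0); apply: filterS => x [h1 h2] Px.
by rewrite /w /g /q /inv h1 mul0r subr0; exact: h2.
Qed.

(** [w] is orthogonal to both harmonic functions u and u0; the sum of the two relations cancels the
    mixed term. *)
Let first_variation : vint P (gdot u u) =
  vint P (gdot u0 u0) + (vint P (gdot g u) + vint P (gdot g u0)).
Proof.
have e1 := green_harmonic bP rw vw ru hu.
have e2 := green_harmonic bP rw vw ru0P (fun x (Px : P x) => hu0 Px.1).
have rv := regB oP ru ru0P.
have a1 := int_gdotB fP rv rg ru; have a2 := int_gdotB fP rv rg ru0P.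
have b1 := int_gdotB fP ru ru0P ru; have b2 := int_gdotB fP ru ru0P ru0P.
have sym : vint P (gdot u0 u) = vint P (gdot u u0) by apply: eq_int => x _; exact: gdotC.
exact: (arith_variation e1 e2 a1 a2 b1 b2 sym).
Qed.

Let scale_g f : reg P f -> vint P (gdot g f) = s ^+ (n - 2) * vint Ak (gdot q (fun z => f (c + s *: z))).
Proof.
move=> rf; apply: etrans (int_gdot_affine c n3 s0 fP (reg_C1 rg) (reg_C1 rf) (reg_gdot rg rf)) _.
apply: (congr1 (fun k : R => s ^+ (n - 2) * k)).
have gq : (fun z => g (c + s *: z)) = q by apply/funext => z; rewrite /g invK.
apply: etrans (congr1 (fun k => vint Pt (gdot k (fun z => f (c + s *: z)))) gq) _.
have fPt : vfin Pt := (int_affine c s0 fP (reg_gdot rg rf)).1.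
have rff : reg Pt (fun z => f (c + s *: z)) by exact: (@reg_affine R n P Pt f c s oP oPt (fun z (h : Pt z) => h) rf).
apply: (int_restrict fPt fAk.1 AkPt (reg_gdot rq rff)) => z /PtE[Oz nK] nAk.
have h : (2 * t) ^+ 2 <= sqn z by rewrite leNgt; apply/negP => h; apply: nAk.
have q0 : {near z, q =1 fun=> 0} by have := chi0 h; apply: filterS => x; rewrite /q => ->; exact: mul0r.
rewrite /gdot big1// => i _; rewrite (eq_partial_near i q0) partial_cst; exact: mul0r.
Qed.

Let cG z := chi z * G z.
Let cU z := chi z * U z.
Let cu z := chi z * uu z.
Let rcG : reg Ak cG. Proof. exact: (reg_cutoffM oAk t0 rG). Qed.
Let rcU : reg Ak cU. Proof. exact: (reg_cutoffM oAk t0 rUk). Qed.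
Let rcu : reg Ak cu. Proof. exact: (reg_cutoffM oAk t0 ruu). Qed.

Let qB f : reg Ak f -> vint Ak (gdot q f) = vint Ak (gdot cG f) - vint Ak (gdot cU f).
Proof.
move=> rf; rewrite -(int_gdotB fAk rcG rcU rf).
by have -> : q = (fun z => cG z - cU z) by apply/funext => z; rewrite /q mulrBr.
Qed.

(** The truncations of the rescaled u and of G have the same boundary values, so a harmonic f is
    orthogonal to their difference. This trades the unknown u for the fixed G. *)
Let orth f : reg Ak f -> (forall z, Ak z -> laplacian f z = 0) -> vint Ak (gdot cu f) = vint Ak (gdot cG f).
Proof.
move=> rf hf; apply/eqP; rewrite -subr_eq0 -(int_gdotB fAk rcu rcG rf); apply/eqP.
apply: (green_harmonic bAk (regB oAk rcu rcG) _ rf hf) => z nz d d0.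
have [h|h] := leP ((2 * t) ^+ 2) (sqn z).
  by have := chi0 h; apply: filterS => x hx _; rewrite /cu /cG hx !mul0r subrr normr0.
have Kz : K z by apply: contrapT => nK; apply: nz.
have := near_and (chi1 Kz) (Vin Kz d0); apply: filterS => x [h1 h2] [_ nKx].
by rewrite /cu /cG h1 !mul1r; exact: h2.
Qed.

Let oann : open (ann t : set V). Proof. exact: open_ann. Qed.
Let annAk : ann t `<=` Ak.
Proof.
move=> z az; split; first exact: ann_hball az.
move=> /Krho; case/andP: az => az _; rewrite /hball /=; apply/negP; rewrite -leNgt (le_trans _ (ltW az))//.
by apply: lerXn2r; rewrite ?nnegrE ?(ltW rho0) ?(ltW t0)// ler_pMl// ler1n.
Qed.
Let fann : vfin (ann t : set V).
Proof. exact: (fin_measS (open_measurable_rV oann) fAk annAk). Qed.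
Let ra f : reg Ak f -> reg (ann t) f.
Proof. exact: (reg_sub oAk oann annAk). Qed.

(** After the exchange only derivatives of the cutoff survive: half the difference of two commutator
    pairings, which are opposite by skewness. *)
Let swap f h : reg Ak f -> reg Ak h ->
  vint Ak (gdot (fun z => chi z * h z) f) - vint Ak (gdot (fun z => chi z * f z) h) = lam (ann t) t h f.
Proof.
move=> rf rh; have rcf := reg_cutoffM oAk t0 rf; have rch := reg_cutoffM oAk t0 rh.
have b1 : vbmf Ak (fun z => h z * comm chi f z).
  by have [_ bh _ _] := rh; apply: bmfM => //; exact: reg_bmf_comm.
have b2 : vbmf Ak (fun z => f z * comm chi h z).
  by have [_ bf _ _] := rf; apply: bmfM => //; exact: reg_bmf_comm.
have i1 : vint Ak (fun z => h z * comm chi f z) = lam (ann t) t h f.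
  apply: (int_restrict fAk (open_measurable_rV oann) annAk b1) => z _ nz.
  by rewrite comm_out ?mulr0.
have i2 : vint Ak (fun z => f z * comm chi h z) = lam (ann t) t f h.
  apply: (int_restrict fAk (open_measurable_rV oann) annAk b2) => z _ nz.
  by rewrite comm_out ?mulr0.
have e := intB fAk b1 b2; have sk := lam_skew t0 (ra rf) (ra rh).
have e2 : vint Ak (fun z => h z * comm chi f z - f z * comm chi h z) =
    2 * (vint Ak (gdot (fun z => chi z * h z) f) - vint Ak (gdot (fun z => chi z * f z) h)).
  have bg1 := reg_gdot rch rf; have bg2 := reg_gdot rcf rh.
  rewrite -(intB fAk bg1 bg2) -(intZ 2 fAk (bmfB bg1 bg2)); apply: eq_int => z Az.
  have Cchi : class_C 1 Ak chi by apply: class_CS (class_CW (leqnSn 1) (class_C_cutoff t)).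
  rewrite (gdotM f Az Cchi (reg_C1 rh)) (gdotM h Az Cchi (reg_C1 rf)) (gdotC h f) /comm.
  by move: (gdot f h z) (gdot chi f z) (gdot chi h z) (laplacian chi z) => *; ring.
exact: (arith_swap e2 e i1 i2 sk).
Qed.

(** U is harmonic across the hole, hence orthogonal to its own truncation on the full ball; on [K]
    the cutoff is 1. This cancels the energy of u0 inside the hole. *)
Let hole_energy : vint K (gdot U U) + vint Ak (gdot cU U) = 0.
Proof.
have rcUA := reg_cutoffM oA t0 rU.
have vcU : vanish A cU.
  move=> z /negP; rewrite -leNgt => h d d0; have := chi0 h; apply: filterS => x hx _.
  by rewrite /cU hx mul0r normr0.
have e := green_harmonic bA rcUA vcU rU hU.
have mK : measurable (K : set 'rV[mR]_n) by exact: closed_measurable_rV.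
have KA : K `<=` A.
  by move=> z /Krho; apply: le_hball; [exact: ltW|rewrite /t mulrA ler_pMl// -natrM ler1n].
have e2 := int_sub fA mK KA (reg_gdot rcUA rU).
have e3 : vint K (gdot cU U) = vint K (gdot U U).
  apply: eq_int => z Kz; apply: eq_bigr => i _; congr (_ * _); apply: eq_partial_near.
  by have := chi1 Kz; apply: filterS => x hx; rewrite /cU hx mul1r.
by rewrite -e3; exact: (etrans (esym e2) e).
Qed.

Let outer_energy : vint Om (gdot u0 u0) = vint P (gdot u0 u0) + s ^+ (n - 2) * vint K (gdot U U).
Proof.
pose S : set V := Om `\` P.
have mP := open_measurable_rV oP.
have SOm : S `<=` Om by move=> x [].
have mS : measurable (S : set 'rV[mR]_n) by apply: measurableD => //; exact: fOm.1.
have fS := fin_measS mS fOm SOm.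
have bg := reg_gdot ru0 ru0.
rewrite (int_sub fOm mP (@subIsetl _ _ _) bg); congr (_ + _).
have C1 : class_C 1 S u0 by apply: class_CS (reg_C1 ru0).
rewrite (int_gdot_affine c n3 s0 fS C1 C1 (bmfS fOm.1 SOm mS bg)); congr (_ * int _ _ _).
apply/seteqP; split => z /=.
  by move=> [Oz nP]; apply: contrapT => nK; apply: nP; split => //=; rewrite invK.
move=> Kz; have Oz : Om (c + s *: z).
  by apply: AOm; move: (Krho Kz); apply: le_hball; [exact: ltW|rewrite /t mulrA ler_pMl// -natrM ler1n].
by split => // -[_]; rewrite /= invK.
Qed.

(** In the outcome u occurs only in one commutator pairing on an annulus, and the Dirichlet integral
    left over is that of the fixed function G. *)
Theorem energy_identity : vint P (gdot u u) = vint Om (gdot u0 u0) +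
  s ^+ (n - 2) * (vint Ak (gdot cG G) + lam (ann t) t (fun z => G z - U z) (fun z => uu z - U z)
    - lam (ann t) t U G).
Proof.
have [raG raU rau] := And3 (ra rG) (ra rUk) (ra ruu).
have [_ bG _ _] := raG; have [_ bU _ _] := raU.
rewrite first_variation outer_energy (scale_g ru) (scale_g ru0P).
rewrite (qB ruu) (qB rUk).
rewrite (lamBl oann fann t0 bG bU (regB oann rau raU)).
rewrite (lamBr oann fann t0 bG rau raU) (lamBr oann fann t0 bU rau raU).
have o1 := orth rUk (fun z (Az : Ak z) => hU Az.1); have o2 := orth rG hG.
have s1 := swap ruu rG; have s2 := swap ruu rUk.
have k1 := lam_skew t0 raG raU; have k2 := lam_skew t0 raU raU; have he := hole_energy.
exact: (arith_energy _ _ he o1 o2 s1 s2 k1 k2).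
Qed.

End hole.

End energy_difference.

(** * Analytic dependence of the kernels on the parameters *)
Section kernels.
Context {R : realType} {m : nat}.
Notation n := m.+1.
Notation mR := (measurableTypeR R).
Notation V := 'rV[R]_n.
Implicit Types (X Y Z : set V) (x y z t p : V).

Lemma gkC x y : gk x y = gk y x.
Proof.
rewrite /gk /Gam -(sqnN (y - x)) opprB; congr (_ - isq _ _).
by rewrite !sqn_sub_star -(sqnN (y - x)) opprB (mulrC (x _ _)).
Qed.

Definition place p (e1 e2 : R) t : V := e1 *: p + (e1 * e2) *: t.

Lemma abs_coord_le x i : `|x ord0 i| <= 1 + sqn x.
Proof.
have := coord_le_sqn x i; rewrite -real_normK ?num_real//; move: (normr_ge0 (x ord0 i)).
by move: (sqn x) `|_| => a b b0; nra.
Qed.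

Lemma bd_coord X (l : R) i : measurable (X : set 'rV[mR]_n) -> 0 <= l -> X `<=` hball l ->
  bd X (fun a => a ord0 i) l.
Proof.
move=> mX l0 Xl; split => //; first exact: measurable_funTS (measurable_coord i).
move=> x /Xl h; have := le_lt_trans (coord_le_sqn x i) h.
by rewrite -real_normK ?num_real// => h2; rewrite -(ler_pXn2r (ltn0Sn 1)) ?nnegrE// ltW.
Qed.

Lemma ser_place X Y (r l : R) p i : 0 <= r <= 1 -> measurable (Y : set 'rV[mR]_n) -> 0 <= l -> Y `<=` hball l ->
  ser X Y r (r * (1 + sqn p + l)) (fun e1 e2 _ b => place p e1 e2 b ord0 i).
Proof.
move=> /andP[r0 r1] mY l0 Yl.
have s1 := ser_e1 X Y r0; have s2 := ser_e2 X Y r0.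
have h := serD r0 (serM r0 s1 (ser_cst X Y r0 (p ord0 i))) (serM r0 (serM r0 s1 s2) (ser_b X r0 (bd_coord i mY l0 Yl))).
apply: (eq_ser r0 h) => [|e1 e2 a b _ _ _ _]; last by rewrite !mxE.
rewrite mulrDr lerD ?ler_wpM2l ?abs_coord_le//.
by rewrite ler_wpM2r// ler_piMl.
Qed.

(** Both distances expand around z, the reflection changing only the sign of one small
    coordinate. *)
Lemma ser_gk Z Y (r z0 x0 : R) (xi : R -> R -> V -> V) : 0 <= r -> open Z -> 0 < z0 ->
  (forall z, Z z -> z0 ^+ 2 <= sqn z) ->
  (forall i, ser Z Y r x0 (fun e1 e2 _ b => xi e1 e2 b ord0 i)) -> 0 <= x0 -> 16 * n.+1%:R * x0 <= z0 ->
  ser Z Y r (2 * (4 / 3 / z0) ^+ (n - 2)) (fun e1 e2 z b => gk (xi e1 e2 b) z).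
Proof.
move=> r0 oZ z00 Zz sx x00 small.
have s1 : forall i, ser Z Y r x0 (fun e1 e2 _ b => (- xi e1 e2 b) ord0 i).
  by move=> i; apply: (eq_ser r0 (serN r0 (sx i))) => // e1 e2 a b _ _ _ _; rewrite !mxE.
have s2 : forall i, ser Z Y r x0 (fun e1 e2 _ b => (- star (xi e1 e2 b)) ord0 i).
  move=> i; have [e|e] := eqVneq i ord_max.
    by apply: (eq_ser r0 (sx i)) => // e1 e2 a b _ _ _ _; rewrite !mxE e eqxx opprK.
  by apply: (eq_ser r0 (serN r0 (sx i))) => // e1 e2 a b _ _ _ _; rewrite !mxE (negPf e).
have cid : continuous (fun z : V => z) by move=> z; exact: cvg_id.
have h1 := ser_dist r0 (n - 2) oZ cid z00 Zz s1 x00 small.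
have h2 := ser_dist r0 (n - 2) oZ cid z00 Zz s2 x00 small.
apply: (eq_ser r0 (serB r0 h1 h2)) => //.
by rewrite [leRHS]mulr_natl [leRHS]mulr2n.
Qed.

(** The whole vector scales with e1; by homogeneity e1 then drops out of the reflected term of the
    rescaled Green function. *)
Lemma place_star p (e1 e2 : R) t t' :
  place p e1 e2 t' - star (place p e1 e2 t) = e1 *: ((p - star p) + e2 *: (t' - star t)).
Proof.
by apply/rowP => i; rewrite !mxE; case: eqVneq => _; ring.
Qed.

Lemma place_sub p (e1 e2 : R) t t' : place p e1 e2 t' - place p e1 e2 t = (e1 * e2) *: (t' - t).
Proof. by apply/rowP => i; rewrite !mxE; ring. Qed.

Lemma GamZ (a : R) x : 0 < a -> a ^+ (n - 2) * Gam (a *: x) = Gam x.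
Proof.
move=> a0; rewrite /Gam sqnZ isqM ?sqr_ge0// mulrA /isq sqrtr_sqr gtr0_norm// -exprMn mulfV ?gt_eqF//.
by rewrite expr1n mul1r.
Qed.

(* The Green function at two rescaled points, times (e1 e2)^(n-2); it no longer depends on e1. *)
Definition hole_kernel p (e2 : R) t t' : R :=
  Gam (t' - t) - e2 ^+ (n - 2) * Gam ((p - star p) + e2 *: (t' - star t)).

Lemma hole_kernelE p (e1 e2 : R) t t' : 0 < e1 -> 0 < e2 ->
  (e1 * e2) ^+ (n - 2) * gk (place p e1 e2 t) (place p e1 e2 t') = hole_kernel p e2 t t'.
Proof.
move=> e10 e20; rewrite /gk /hole_kernel place_sub place_star mulrBr GamZ ?mulr_gt0//.
by rewrite exprMn (mulrC (e1 ^+ _)) -mulrA GamZ.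
Qed.

Lemma sqn_sub_star_self p : sqn (p - star p) = (2 * p ord0 ord_max) ^+ 2.
Proof. by rewrite sqn_sub_star subrr sqn0 add0r -expr2 exprMn; congr (_ * _); rewrite expr2; ring. Qed.

(** Two expansions of inverse distances: one around -t with |t| >= la, giving the decay la^(2-n),
    and one around p - star p, whose length 2 p_n is positive, for e2 of either sign. *)
Lemma ser_hole_kernel X Y (r la lb : R) p : 0 <= r -> open X -> measurable (Y : set 'rV[mR]_n) ->
  0 < la -> 0 <= lb -> (forall x, X x -> la ^+ 2 <= sqn x) -> X `<=` hball (2 * la) -> Y `<=` hball lb ->
  16 * n.+1%:R * lb <= la -> 0 < p ord0 ord_max -> 16 * n.+1%:R * (r * (lb + 2 * la)) <= 2 * p ord0 ord_max ->
  ser X Y r ((4 / 3 / la) ^+ (n - 2) + r ^+ (n - 2) * (4 / 3 / (2 * p ord0 ord_max)) ^+ (n - 2))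
    (fun _ e2 t t' => hole_kernel p e2 t t').
Proof.
move=> r0 oX mY la0 lb0 Xla Xb Yb h1 p0 h2.
have mX := open_measurable_rV oX.
have cid : continuous (fun z : V => - z) by move=> z; apply: continuousN; exact: cvg_id.
have cc : continuous (fun _ : V => p - star p) by apply: cst_continuous.
have sb i := ser_b X r0 (bd_coord i mY lb0 Yb).
have la20 : 0 <= 2 * la by rewrite mulr_ge0// ltW.
have sa i := ser_a Y r0 (bd_coord i mX la20 Xb).
have z1 : forall a, X a -> la ^+ 2 <= sqn (- a) by move=> a /Xla; rewrite sqnN.
have g1 := ser_dist r0 (n - 2) oX cid la0 z1 (fun i => sb i) lb0 h1.
have s2 : forall i, ser X Y r (r * (lb + 2 * la)) (fun e1 e2 a b => (e2 *: (b - star a)) ord0 i).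
  move=> i; have [e|e] := eqVneq i ord_max.
    apply: (eq_ser r0 (serM r0 (ser_e2 X Y r0) (serD r0 (sb i) (sa i)))) => // e1 e2 a b _ _ _ _.
    by rewrite !mxE e eqxx opprK.
  apply: (eq_ser r0 (serM r0 (ser_e2 X Y r0) (serB r0 (sb i) (sa i)))) => // e1 e2 a b _ _ _ _.
  by rewrite !mxE (negPf e).
have z2 : forall a, X a -> (2 * p ord0 ord_max) ^+ 2 <= sqn (p - star p) by move=> a _; rewrite sqn_sub_star_self.
have g2 := ser_dist r0 (n - 2) oX cc (mulr_gt0 (ltr0Sn _ 1) p0) z2 s2 (mulr_ge0 r0 (addr_ge0 lb0 la20)) h2.
apply: (eq_ser r0 (serB r0 g1 (serM r0 (serX r0 (n - 2) (ser_e2 X Y r0)) g2))) => // e1 e2 a b _ _ _ _.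
by rewrite /hole_kernel /Gam (addrC (- a)).
Qed.

Lemma ser_place_Gam Z Y (r z0 x0 : R) p : 0 <= r <= 1 -> open Z -> 0 < z0 ->
  (forall z, Z z -> z0 ^+ 2 <= sqn z) -> measurable (Y : set 'rV[mR]_n) -> 0 <= x0 -> Y `<=` hball x0 ->
  16 * n.+1%:R * (r * (1 + sqn p + x0)) <= z0 ->
  ser Z Y r ((4 / 3 / z0) ^+ (n - 2)) (fun e1 e2 z b => Gam (z - place p e1 e2 b)).
Proof.
move=> r01 oZ z00 Zz mY x00 Yx small; have /andP[r0 _] := r01.
have sx i := ser_place Z p i r01 mY x00 Yx.
have s1 : forall i, ser Z Y r (r * (1 + sqn p + x0)) (fun e1 e2 _ b => (- place p e1 e2 b) ord0 i).
  by move=> i; apply: (eq_ser r0 (serN r0 (sx i))) => // e1 e2 a b _ _ _ _; rewrite [RHS]mxE.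
have cid : continuous (fun z : V => z) by move=> z; exact: cvg_id.
have pos : 0 <= r * (1 + sqn p + x0) by rewrite mulr_ge0// addr_ge0// addr_ge0// sqn_ge0.
exact: (ser_dist r0 (n - 2) oZ cid z00 Zz s1 pos small).
Qed.

End kernels.

(** * Integral equations for the perturbation *)
Section hole_equations.
Context {R : realType} {m : nat}.
Notation n := m.+1.
Notation mR := (measurableTypeR R).
Notation V := 'rV[R]_n.

Lemma lamZ (X : set V) t (a : R) h f : vfin X -> open X -> 0 < t -> vbmf X h -> reg X f ->
  lam X t (fun x => a * h x) f = a * lam X t h f.
Proof.
move=> fX oX t0 bh rf; rewrite /lam -(intZ _ fX (bmfM bh (reg_bmf_comm oX t0 rf))).
by apply: eq_int => x _; rewrite mulrA.
Qed.

Variables (Om K : set V) (rho la mu tau e1 e2 : R) (p : V) (u u0 G : V -> R).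
Hypotheses (n3 : (3 <= n)%N) (bOm : bounded_dom Om) (Omhalf : Om `<=` halfspace m).
Hypotheses (cK : closed K) (Krho : K `<=` hball rho).
Hypotheses (rho0 : 0 < rho) (rhola : 4 * rho <= la) (mu0 : 0 < mu) (mutau : 2 * mu <= tau).
Hypotheses (e10 : 0 < e1) (e20 : 0 < e2) (tauOm : halfball (4 * tau) `<=` Om).
Hypothesis small : forall t, sqn t <= (3 * la) ^+ 2 ->
  sqn (place p e1 e2 t) < mu ^+ 2 /\ halfspace m (place p e1 e2 t).
Let s := e1 * e2.
Let c := e1 *: p.
Let inv y : V := - s^-1 *: c + s^-1 *: y.
Let P : set V := Om `&` [set x | ~ K (inv x)].
Hypotheses (ru : reg P u) (hu : forall x, P x -> laplacian u x = 0).
Hypotheses (ru0 : reg Om u0) (hu0 : forall x, Om x -> laplacian u0 x = 0).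
Let Ak : set V := hball (2 * (2 * rho)) `&` ~` K.
Hypotheses (rG : reg Ak G) (hG : forall z, Ak z -> laplacian G z = 0).
Hypothesis Vout : forall y, ~ Om y -> forall d, 0 < d -> \forall z \near y, P z -> `|u z - u0 z| < d.
Hypothesis Vin : forall z, K z -> forall d, 0 < d ->
  \forall x \near z, ~ K x -> `|u (place p e1 e2 x) - G x| < d.

Let v x := u x - u0 x.
Let Vt t := v (place p e1 e2 t).
Let W t := G t - u0 (place p e1 e2 t).

(** The domains of these three forms are fixed, so e1 and e2 enter the equations through the
    arguments only. *)
Definition form_in (f g : V -> R) : R :=
  dual (hball (3 * la) `&` ~` K) (lam (ann la) la f) (lam (ann (2 * rho)) (2 * rho) g).
Definition form_src (f g : V -> R) : R :=
  dual (hball (3 * la) `&` ~` K) (lam (ann rho) rho f) (lam (ann (2 * rho)) (2 * rho) g).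
Definition form_out (f g : V -> R) : R :=
  dual Om (lam (Om `&` ann mu) mu f) (lam (Om `&` ann tau) tau g).

Let s0 : 0 < s. Proof. exact: mulr_gt0. Qed.
Let la0 : 0 < la. Proof. by apply: lt_le_trans rhola; rewrite mulr_gt0. Qed.
Let tau0 : 0 < tau. Proof. by apply: lt_le_trans mutau; rewrite mulr_gt0. Qed.
Let rho20 : 0 < 2 * rho. Proof. by rewrite mulr_gt0. Qed.
Let invK t : inv (place p e1 e2 t) = t. Proof. exact: affineK. Qed.
Let invVK y : place p e1 e2 (inv y) = y. Proof. exact: affineVK. Qed.
Let oOm : open Om := bOm.1.
Let oP : open P.
Proof. by apply: openI; [exact: bOm.1|apply: (@open_affine R n (- s^-1 *: c) s^-1 (~` K)); exact: closed_openC]. Qed.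
Let Din : set V := hball (3 * la) `&` ~` K.
Let oDin : open Din. Proof. apply: open_setD => //; exact: open_hball. Qed.
Let bDin : bounded_dom Din.
Proof. by apply: bounded_domI; [apply: bounded_hball; rewrite mulr_ge0// ltW|exact: closed_openC]. Qed.

Let place_Om (t : V) : sqn t <= (3 * la) ^+ 2 -> Om (place p e1 e2 t).
Proof.
move=> h; have [h1 h2] := small h; apply: tauOm; split=> //.
apply: (lt_le_trans h1); apply: lerXn2r; rewrite ?nnegrE ?(ltW mu0) ?mulr_ge0 ?(ltW tau0)//.
by move: mutau mu0; lra.
Qed.

Let hDin (t : V) : sqn t <= rho ^+ 2 \/ sqn t <= (4 * rho) ^+ 2 -> sqn t <= (3 * la) ^+ 2.
Proof.
have l3 : 4 * rho <= 3 * la by move: rhola rho0; lra.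
have r4 : 0 <= 4 * rho by rewrite mulr_ge0// ltW.
have rr : rho <= 4 * rho by move: rhola rho0; lra.
case=> h; apply: (sqn_le_sqr _ l3 _) => //.
exact: (sqn_le_sqr (ltW rho0) rr h).
Qed.

Let near_hole x : mu ^+ 2 <= sqn x -> (3 * la) ^+ 2 < sqn (inv x).
Proof.
move=> h; rewrite ltNge; apply/negP => /small[]; rewrite invVK => h1 _.
by have := lt_le_trans h1 h; rewrite ltxx.
Qed.

Let out_P x : Om x -> mu ^+ 2 <= sqn x -> P x.
Proof.
move=> Ox h; split=> //= Kx.
have := near_hole h; rewrite ltNge => /negP; apply; apply: hDin; left.
by apply: ltW; exact: Krho.
Qed.

Let rv : reg P v.
Proof. by apply: (regB oP ru); exact: (reg_sub oOm oP (@subIsetl _ _ _) ru0). Qed.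
Let hv x : P x -> laplacian v x = 0.
Proof.
move=> Px; have [Cu _ _ _] := ru; have [C0 _ _ _] := reg_sub oOm oP (@subIsetl _ _ _) ru0.
by rewrite /v (laplacianB oP Px Cu C0) hu// hu0 ?subrr//; case: Px.
Qed.

Let DinP t : Din t -> P (place p e1 e2 t).
Proof. by move=> [ht nK]; split; [apply: place_Om; exact: ltW|rewrite /= -/(inv _) invK]. Qed.

Let rVt : reg Din Vt. Proof. exact: (reg_affine oP oDin DinP rv). Qed.
Let hVt t : Din t -> laplacian Vt t = 0.
Proof.
move=> Dt; have [Cv _ _ _] := rv.
by rewrite (laplacian_affine oP Cv (DinP Dt)) (hv (DinP Dt)) mulr0.
Qed.

Let AkDin : Ak `<=` Din.
Proof.
move=> t [ht nK]; split=> //; apply: (le_hball _ _ ht); first by rewrite !mulr_ge0// ltW.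
by move: rhola rho0; lra.
Qed.
Let oAk : open Ak. Proof. apply: open_setD => //; exact: open_hball. Qed.

Let rU : reg Ak (fun t => u0 (place p e1 e2 t)).
Proof. by apply: (reg_affine oOm oAk _ ru0) => t /AkDin/DinP[]. Qed.
Let hU t : Ak t -> laplacian (fun t => u0 (place p e1 e2 t)) t = 0.
Proof.
move=> /AkDin/DinP[Ot _]; have [C0 _ _ _] := ru0.
by rewrite (laplacian_affine oOm C0 Ot) (hu0 Ot) mulr0.
Qed.
Let rW : reg Ak W. Proof. exact: (regB oAk rG rU). Qed.
Let hW t : Ak t -> laplacian W t = 0.
Proof.
move=> At; have [CG _ _ _] := rG; have [CU _ _ _] := rU.
by rewrite /W (laplacianB oAk At CG CU) hG// hU// subrr.
Qed.

Let WAk : hball (2 * rho) `&` ~` K `<=` Ak.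
Proof.
move=> t [ht nK]; split=> //; apply: (le_hball _ _ ht); first exact: ltW.
by rewrite ler_pMl// ler1n.
Qed.

Let ann_Din (r : R) : 0 < r -> rho <= r -> 2 * r <= 3 * la -> ann r `<=` Din.
Proof.
move=> t0 h1 h2 x ax; split; first exact: (le_hball (mulr_ge0 (ler0n _ 2) (ltW t0)) h2 (ann_hball ax)).
move=> /Krho h; move: ax => /andP[ax _]; have := lt_trans ax h.
by apply/negP; rewrite -leNgt; apply: lerXn2r; rewrite ?nnegrE ?(ltW rho0) ?(ltW t0).
Qed.

Let annla_Din : ann la `<=` Din.
Proof. by apply: ann_Din => //; move: rhola rho0; lra. Qed.
Let ann2_Din : ann (2 * rho) `<=` Din.
Proof. by apply: ann_Din => //; move: rhola rho0; lra. Qed.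
Let ann1_Din : ann rho `<=` Din.
Proof. by apply: ann_Din => //; move: rhola rho0; lra. Qed.
Let ann_fin (r : R) : 0 < r -> vfin (ann r : set V).
Proof.
move=> r0; apply: (fin_measS (open_measurable_rV (@open_ann R n r)) (bounded_dom_fin (@bounded_hball R n (2 * r) _)) (@ann_hball R n r)).
by rewrite mulr_ge0// ltW.
Qed.
Let ann_Ak (r : R) : 0 < r -> rho <= r -> 2 * r <= 2 * (2 * rho) -> ann r `<=` Ak.
Proof.
move=> t0 h1 h2 x ax; split; first exact: (le_hball (mulr_ge0 (ler0n _ 2) (ltW t0)) h2 (ann_hball ax)).
move=> /Krho h; move: ax => /andP[ax _]; have := lt_trans ax h.
by apply/negP; rewrite -leNgt; apply: lerXn2r; rewrite ?nnegrE ?(ltW rho0) ?(ltW t0).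
Qed.

Let bddf_ann (r : R) f : 0 < r -> ann r `<=` Din -> vbmf (ann r) f -> exists k, bddf Din (lam (ann r) r f) k.
Proof.
move=> r0 rD bf; have [C C0 /(_ Din (ann r) r f)] := @lam_bddf R n n3.
have [H [_ H0 fH]] := bmf_bd bf.
move=> /(_ H bDin (open_measurable_rV (@open_ann R n r))) h.
by exists (Num.sqrt (C * r ^+ (n - 2)) * H); apply: h => // x ax; split => //; exact: rD.
Qed.

(** At [K] the difference of [Vt] and [W] is that of the rescaled u and G, which tends to 0; hence
    [inner_identity] applies. *)
Let split_source h : vbmf (ann (2 * rho)) h ->
  lam (ann (2 * rho)) (2 * rho) h Vt = form_in Vt h - form_src W h.
Proof.
move=> bh.
have fW z : K z -> forall d, 0 < d -> \forall x \near z, ~ K x -> `|Vt x - W x| < d.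
  move=> Kz d d0; apply: filterS (Vin Kz d0) => x hx nK; rewrite /Vt /W /v.
  by rewrite opprB addrA addrNK; exact: hx.
have bVt : vbmf (ann la) Vt.
  have [_ b _ _] := reg_sub oDin (@open_ann R n la) annla_Din rVt; exact: b.
have bW : vbmf (ann rho) W.
  have rr : ann rho `<=` Ak by apply: ann_Ak => //; move: rho0; lra.
  by have [_ b _ _] := reg_sub oAk (@open_ann R n rho) rr rW.
have [k1 b1] := bddf_ann la0 annla_Din bVt.
have [k2 b2] := bddf_ann rho0 ann1_Din bW.
have [k3 b3] := bddf_ann rho20 ann2_Din bh.
have rWs : reg (hball (2 * rho) `&` ~` K) W.
  by apply: (reg_sub oAk _ WAk rW); apply: open_setD => //; exact: open_hball.
have := inner_identity n3 cK Krho rho0 rhola rVt hVt rWs (fun t ht => hW (WAk ht)) fW bh.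
move=> ->.
have -> : (fun psi => lam (ann la) la Vt psi - lam (ann rho) rho W psi) =
    (fun psi => -1 * lam (ann rho) rho W psi + lam (ann la) la Vt psi).
  by apply/funext => psi; rewrite mulN1r addrC.
by rewrite (dual_linl bDin (-1) b2 b1 b3) mulN1r addrC.
Qed.

Let far := Om `&` [set x : V | mu ^+ 2 < sqn x].
Let farP : far `<=` P. Proof. by move=> x [Ox h]; apply: out_P => //; exact: ltW. Qed.
Let ofar : open far. Proof. by apply: openI => //; exact: open_sqn_gt. Qed.
Let annOm (r : R) : 0 < r -> open (Om `&` ann r). Proof. by move=> _; apply: openI => //; exact: open_ann. Qed.

Let vanish_out : vanish Om (fun x => v x - cutoff mu x * v x).
Proof.
move=> y nO d d0; have h := Vout nO d0; apply: filterS h => z hz Oz.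
have [zm|zm] := leP (sqn z) (2 * mu ^+ 2).
  by rewrite cutoff1// mul1r subrr normr0.
have Pz : P z.
  apply: out_P => //; apply: ltW; apply: le_lt_trans zm.
  by rewrite ler_pMl ?exprn_gt0// ler1n.
apply: le_lt_trans (hz Pz); rewrite -[X in X - _]mul1r -mulrBl normrM ler_piMl//.
have := cutoff_ge0 mu z; have := cutoff_le1 mu z.
by move: (cutoff mu z) => q q1 q0; rewrite ger0_norm; lra.
Qed.

Let split_outer h : vbmf (Om `&` ann tau) h ->
  lam (Om `&` ann tau) tau h v = - form_out v h.
Proof.
move=> bh.
rewrite (outer_identity n3 bOm mu0 mutau (reg_sub oP ofar farP rv) (fun x fx => hv (farP fx)) vanish_out bh).
have [C C0 hb] := @dual_bbil R n n3.
have mX := open_measurable_rV (annOm mu0); have mY := open_measurable_rV (annOm tau0).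
have [_ + _] := hb Om _ _ mu tau bOm mX mY (@subset_refl _ _) (@subset_refl _ _) mu0 tau0.
have [H bH] := bmf_bd bh => /(_ h H bH) bl.
have bv : vbmf (Om `&` ann mu) v.
  have sub : Om `&` ann mu `<=` P by move=> x [Ox /andP[/ltW h1 _]]; exact: out_P.
  by have [_ b _ _] := reg_sub oP (annOm mu0) sub rv.
have := blinZ (-1) bl bv; rewrite mulN1r => <-; rewrite /form_out.
by have -> : (fun x => - v x) = (fun x => -1 * v x) by apply/funext => x; rewrite mulN1r.
Qed.

Let Hhalf : set V := halfball (4 * tau).
Let E : set V := Hhalf `&` [set y | rho ^+ 2 < sqn (inv y)].
Let EP : E `<=` P.
Proof.
move=> y [Hy ry]; split; first exact: tauOm.
by move=> /= /Krho; rewrite /hball /= => h; have := lt_trans ry h; rewrite ltxx.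
Qed.
Let oE : open E.
Proof.
apply: openI; first exact: open_halfball.
exact: (@open_affine R n (- s^-1 *: c) s^-1 _ (@open_sqn_gt R n (rho ^+ 2))).
Qed.

Let mu_tau : mu ^+ 2 <= tau ^+ 2.
Proof. by apply: lerXn2r; rewrite ?nnegrE ?(ltW mu0) ?(ltW tau0)//; move: mutau mu0; lra. Qed.

Let repr x : halfspace m x -> sqn x < tau ^+ 2 -> (4 * rho) ^+ 2 < sqn (inv x) ->
  @mass R n * v x = s ^+ (n - 2) * lam (ann (2 * rho)) (2 * rho) (fun t => gk x (place p e1 e2 t)) Vt
    - lam (Om `&` ann tau) tau (gk x) v.
Proof.
move=> hx xt xr.
have hole : forall t, sqn t <= (4 * rho) ^+ 2 -> sqn (c + s *: t) < tau ^+ 2 /\ halfspace m (c + s *: t).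
  move=> t ht; have [h1 h2] := small (hDin (or_intror ht)); split=> //.
  exact: lt_le_trans h1 mu_tau.
have vv y : ~ halfspace m y -> forall d, 0 < d -> \forall z \near y, E z -> `|v z| < d.
  move=> nh d d0; have h := Vout (fun Oy => nh (Omhalf Oy)) d0.
  by apply: filterS h => z hz /EP; exact: hz.
have := half_representation n3 tau0 rho0 s0 hole (reg_sub oP oE EP rv) (fun y Ey => hv (EP Ey)) vv hx xt xr.
move=> ->; congr (_ - lam _ _ _ _); apply/seteqP; split=> y [hy ay].
  by split=> //; exact: tauOm.
split=> //; split; last exact: Omhalf.
apply: (lt_trans (ann_hball ay)); rewrite ltrXn2r ?nnegrE ?mulr_ge0 ?(ltW tau0)//.
by move: tau0; lra.
Qed.

(** Both points of the Green function lie at the scale of the hole, and the factor s^(n-2) of the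
    representation is absorbed by homogeneity. *)
Lemma hole_equation t : ann la t -> vbmf (ann (2 * rho)) (fun t' => gk (place p e1 e2 t) (place p e1 e2 t')) ->
  vbmf (ann (2 * rho)) (hole_kernel p e2 t) -> vbmf (Om `&` ann tau) (gk (place p e1 e2 t)) ->
  @mass R n * Vt t = form_in Vt (hole_kernel p e2 t) - form_src W (hole_kernel p e2 t)
    + form_out v (gk (place p e1 e2 t)).
Proof.
move=> at_ b1 b2 b3; have Dt := annla_Din at_.
have [h1 h2] := small (ltW Dt.1).
have far4 : (4 * rho) ^+ 2 < sqn (inv (place p e1 e2 t)).
  rewrite invK; case/andP: at_ => h _; apply: le_lt_trans h.
  by apply: lerXn2r; rewrite ?nnegrE ?mulr_ge0 ?(ltW rho0) ?(ltW la0).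
rewrite (repr h2 (lt_le_trans h1 mu_tau) far4) split_outer// opprK; congr (_ + _).
rewrite -split_source//.
have rV2 := reg_sub oDin (@open_ann R n (2 * rho)) ann2_Din rVt.
rewrite -(lamZ _ (ann_fin rho20) (@open_ann R n (_)) rho20 b1 rV2).
by congr (lam _ _ _ _); apply/funext => t'; rewrite hole_kernelE.
Qed.

(** Here the pole stays away from the hole, the kernel is regular, and s^(n-2) remains as a small
    factor. *)
Lemma outer_equation x : (Om `&` ann mu) x -> vbmf (ann (2 * rho)) (fun t => gk x (place p e1 e2 t)) ->
  vbmf (Om `&` ann tau) (gk x) ->
  @mass R n * v x = form_in Vt (fun t => s ^+ (n - 2) * gk x (place p e1 e2 t))
    - form_src W (fun t => s ^+ (n - 2) * gk x (place p e1 e2 t)) + form_out v (gk x).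
Proof.
move=> [Ox ax] b1 b2; have /andP[ax1 ax2] := ax.
have far4 : (4 * rho) ^+ 2 < sqn (inv x).
  apply: le_lt_trans (near_hole (ltW ax1)); apply: lerXn2r; rewrite ?nnegrE ?mulr_ge0 ?(ltW rho0) ?(ltW la0)//.
  by move: rhola rho0; lra.
have xt : sqn x < tau ^+ 2.
  by apply: (lt_le_trans ax2); apply: lerXn2r; rewrite ?nnegrE ?mulr_ge0 ?(ltW mu0) ?(ltW tau0).
rewrite (repr (Omhalf Ox) xt far4) split_outer// opprK; congr (_ + _).
have rV2 := reg_sub oDin (@open_ann R n (2 * rho)) ann2_Din rVt.
rewrite -split_source; first exact/esym/(lamZ _ (ann_fin rho20) (@open_ann R n (_)) rho20 b1 rV2).
exact: bmfZ.
Qed.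

Lemma perturbation_bmf : vbmf (ann la) Vt /\ vbmf (Om `&` ann mu) v.
Proof.
have sub : Om `&` ann mu `<=` P by move=> x [Ox /andP[/ltW h1 _]]; exact: out_P.
have [_ b1 _ _] := reg_sub oDin (@open_ann R n la) annla_Din rVt.
by have [_ b2 _ _] := reg_sub oP (annOm mu0) sub rv.
Qed.

Lemma perturbed_energy : vint P (gdot u u) = vint Om (gdot u0 u0) +
  s ^+ (n - 2) * (vint Ak (gdot (fun z => cutoff (2 * rho) z * G z) G)
    + (form_in Vt W - form_src W W)
    - lam (ann (2 * rho)) (2 * rho) (fun t => u0 (place p e1 e2 t)) G).
Proof.
have AOm z : hball (2 * (2 * rho)) z -> Om (c + s *: z).
  move=> hz; apply: (@place_Om z); apply: hDin; right.
  by apply/ltW; move: hz; rewrite /hball /= mulrA -natrM.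
rewrite (energy_identity n3 bOm cK Krho rho0 s0 AOm ru hu ru0 hu0 rG hG Vout Vin) -split_source//.
have r2 : ann (2 * rho) `<=` Ak by apply: ann_Ak => //; move: rho0; lra.
by have [_ b _ _] := reg_sub oAk (@open_ann R n (2 * rho)) r2 rW.
Qed.

End hole_equations.

(** * Elementary inequalities and the choice of the radii *)

Lemma arith_place (R : realType) (e1 e2 r q l a : R) : `|e1| <= r -> `|e2| <= r -> r <= 1 -> 0 <= q -> 0 <= l ->
  0 <= a -> a <= l ^+ 2 -> 2 * (e1 ^+ 2 * q) + 2 * ((e1 * e2) ^+ 2 * a) <= (r * (1 + q + 2 * l)) ^+ 2.
Proof.
move=> h1 h2 r1 q0 l0 a0 al; have r0 := le_trans (normr_ge0 _) h1.
have f1 : e1 ^+ 2 <= r ^+ 2 by rewrite -real_normK ?num_real// lerXn2r ?nnegrE.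
have f2 : e2 ^+ 2 <= 1.
  by rewrite -real_normK ?num_real// -[leRHS](expr1n _ 2) lerXn2r ?nnegrE//; exact: le_trans r1.
have e20 := sqr_ge0 e2; have e10 := sqr_ge0 e1.
rewrite !exprMn; move: (e1 ^+ 2) (e2 ^+ 2) (r ^+ 2) (sqr_ge0 r) f1 f2 e10 e20 => x y z z0 xz y1 x0 y0.
have k1 : x * q <= z * q by rewrite ler_wpM2r.
have k2 : x * y * a <= z * l ^+ 2.
  apply: ler_pM => //; first exact: mulr_ge0.
  by apply: le_trans xz; rewrite ler_piMr.
have k3 : 2 * q + 2 * l ^+ 2 <= (1 + q + 2 * l) ^+ 2.
  have ql : 0 <= q * l by exact: mulr_ge0.
  by have := sqr_ge0 q; have := sqr_ge0 l; rewrite !expr2; lra.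
have k4 : z * (2 * q + 2 * l ^+ 2) <= z * (1 + q + 2 * l) ^+ 2 by rewrite ler_wpM2l.
by lra.
Qed.

Lemma arith_front (R : realType) (e1 e2 r t l pn : R) : 0 < e1 -> 0 < e2 -> e2 <= r -> r * l < pn -> 0 <= l ->
  `|t| <= l -> 0 < e1 * pn + e1 * e2 * t.
Proof.
move=> e10 e20 er rl l0 tl; rewrite -mulrA -mulrDr mulr_gt0//.
have h : `|e2 * t| <= r * l by rewrite normrM ler_pM// gtr0_norm.
have := ler_norm (- (e2 * t)); rewrite normrN; lra.
Qed.

Lemma arith_scale (R : realType) (N : nat) (x y : R) : 0 < y -> 0 <= x -> 16 * N.+1%:R * x <= y ->
  x < y /\ 2 * x <= y.
Proof.
move=> y0 x0 h.
have : 16 * x <= 16 * N.+1%:R * x by rewrite ler_wpM2r// ler_peMr// ler1n.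
by split; lra.
Qed.

Lemma arith_eqn (R : realType) (M N v a b c : R) : N * M = 1 -> M * (N * v) = M * (a - b + c) -> v = - (M * b) + (M * c + M * a).
Proof.
move=> h e; have : M * (N * v) = v by rewrite mulrA (mulrC M) h mul1r.
by rewrite e => <-; ring.
Qed.

Lemma arith_total (R : realType) (x E s g a a' b b' c c' : R) : a = a' -> b = b' -> c = c' ->
  x = E + s * (g + (a - b) - c) -> x = E + s * (g + (a' - b') - c').
Proof. by move=> -> -> ->. Qed.

(** The shares 1/8, 1/8 and 1/4 are provided by [pick_large], [pick_tiny] and [pick_small]
    respectively. *)
Lemma arith_theta0 (R : realType) (k M q x z y : R) : k * (M * q) <= 8^-1 ->
  k * (M * z) * x <= 8^-1 -> y <= 4^-1 -> k * (M * (q + x * z)) + y <= 2^-1.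
Proof. by move=> h1 h2 h3; lra. Qed.

Lemma arith_theta1 (R : realType) (k M x z y : R) :
  k * (M * z) * x <= 8^-1 -> y <= 4^-1 -> k * (M * (x * z)) + y <= 2^-1.
Proof. by move=> h2 h3; lra. Qed.

Lemma arith_kap (R : realType) (a b c d q l : R) : a * b * c * (d * (q * l)) = a * c * d * q * (b * l).
Proof. by ring. Qed.

Lemma half_lt1 (R : realType) : 0 <= 2^-1 :> R /\ 2^-1 < 1 :> R.
Proof. by split; lra. Qed.

(** The form grows like la^(k/2), the kernel decays like la^(-k). With la = L^2 the square root
    disappears and the product is A L^(-k). *)
Lemma pick_large (R : realType) (A B : R) k : 0 <= A -> (0 < k)%N ->
  exists la : R, [/\ 0 < la, B <= la & A * (Num.sqrt (la ^+ k) * la^-1 ^+ k) <= 8^-1].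
Proof.
move=> A0 k0; pose L := 1 + `|B| + 8 * A; have B0 := normr_ge0 B.
have L1 : 1 <= L by rewrite /L; lra.
have Lp : 0 < L := lt_le_trans ltr01 L1.
exists (L ^+ 2); split; first exact: exprn_gt0.
  by have := ler_norm B; rewrite expr2 /L => h; nra.
have Lk : L <= L ^+ k by rewrite -(prednK k0) exprS ler_peMr ?exprn_ege1// ltW.
have Lkp := lt_le_trans Lp Lk.
rewrite exprVn -exprM mulnC exprM sqrtr_sqr gtr0_norm//.
have -> : L ^+ k * (L ^+ k ^+ 2)^-1 = (L ^+ k)^-1 by rewrite expr2 invfM mulrA mulfV ?mul1r// gt_eqF.
rewrite ler_pdivrMr// ler_pdivlMl//; apply: le_trans Lk.
by rewrite /L; lra.
Qed.

(** The same device with mu = L^(-2): the form is then of order L^(-k), and no kernel has to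
    compensate. *)
Lemma pick_small (R : realType) (A B : R) k : 0 <= A -> 0 < B -> (0 < k)%N ->
  exists mu : R, [/\ 0 < mu, mu <= B & A * Num.sqrt (mu ^+ k) <= 4^-1].
Proof.
move=> A0 B0 k0; pose L := 1 + B^-1 + 4 * A; have Bi : 0 < B^-1 by rewrite invr_gt0.
have L1 : 1 <= L by rewrite /L; lra.
have Lp : 0 < L := lt_le_trans ltr01 L1.
have i1 : L^-1 <= 1 by rewrite invf_le1.
have i0 : 0 < L^-1 by rewrite invr_gt0.
exists (L^-1 ^+ 2); split; first exact: exprn_gt0.
  apply: le_trans (_ : L^-1 <= _); first by rewrite expr2 ler_piMl// ltW.
  by rewrite -(invrK B) lef_pV2 ?posrE// /L; lra.
rewrite -exprM mulnC exprM sqrtr_sqr gtr0_norm ?exprn_gt0//.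
apply: le_trans (_ : A * L^-1 <= _).
  rewrite ler_wpM2l// -(prednK k0) exprS ler_piMr ?(ltW i0)//.
  by rewrite exprn_ile1// ltW.
by rewrite ler_pdivrMr// ler_pdivlMl// /L; lra.
Qed.

Lemma pick_tiny (R : realType) (A B C D E : R) : 0 <= A -> 0 <= B -> 0 <= C -> 0 <= D -> 0 <= E ->
  exists r : R, [/\ 0 < r <= 1, A * r <= 8^-1, B * r <= 8^-1, C * r <= 8^-1 & D * r <= 8^-1 /\ E * r <= 8^-1].
Proof.
move=> A0 B0 C0 D0 E0; pose L := 1 + 8 * (A + B + C + D + E).
have L1 : 1 <= L by rewrite /L; lra.
have Lp : 0 < L := lt_le_trans ltr01 L1.
exists L^-1; rewrite invr_gt0 Lp invf_le1// L1.
by split=> //; last split; rewrite ler_pdivrMr// ler_pdivlMl// /L; lra.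
Qed.

(** * Solving the system: the energy as a series in the parameters *)

Section perturbation.
Context {R : realType} {m : nat}.
Notation n := m.+1.
Notation mR := (measurableTypeR R).
Notation V := 'rV[R]_n.

(** With f fixed, a crude constant is enough: the bound only serves to apply the functional termwise
    to a series in h. *)
Lemma blin_lam (X : set V) t f : open X -> vfin X -> 0 < t -> reg X f ->
  exists k, blin X (fun h => lam X t h f) k.
Proof.
move=> oX fX t0 rf; have bc := reg_bmf_comm oX t0 rf.
have [A [_ A0 hA]] := bmf_bd bc.
have v0 : 0 <= A * vol (lebesgue_rV n) X by rewrite mulr_ge0// vol_ge0.
exists (A * vol (lebesgue_rV n) X); split => //.
- move=> a g h bg bh.
  rewrite /lam -(intZ a fX (bmfM bg bc)) -(intD fX (bmfZ a (bmfM bg bc)) (bmfM bh bc)).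
  by apply: eq_int => x _; rewrite mulrDl mulrA.
move=> g H [mg H0 gH]; have bg : vbmf X g by split => //; exists H.
apply: le_trans (abs_int_le fX (bmfM bg bc) (M := H * A) _) _; last by rewrite [leRHS]mulrC mulrA.
by move=> x Xx; rewrite normrM ler_pM// ?gH ?hA.
Qed.

Lemma sqn_place_le p (e1 e2 r l : R) (t : V) : `|e1| <= r -> `|e2| <= r -> r <= 1 -> 0 <= l ->
  sqn t <= l ^+ 2 -> sqn (place p e1 e2 t) <= (r * (1 + sqn p + 2 * l)) ^+ 2.
Proof.
move=> h1 h2 r1 l0 tl; apply: le_trans (sqnD_le _ _) _; rewrite !sqnZ.
exact: (arith_place h1 h2 r1 (sqn_ge0 p) l0 (sqn_ge0 t) tl).
Qed.

(* The unperturbed solution near the hole, through its representation on a fixed annulus. *)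
Lemma ser_source (r l tau : R) (p : V) (U0 : V -> R) : (3 <= n)%N -> 0 < r <= 1 -> 0 <= l -> 0 < tau ->
  16 * n.+1%:R * (r * (1 + sqn p + 2 * l)) <= tau -> reg (hball (4 * tau)) U0 ->
  (forall y, hball (4 * tau) y -> laplacian U0 y = 0) ->
  exists (U : R -> R -> V -> R) (C : R),
    ser (hball l) setT r C (fun e1 e2 t _ => U e1 e2 t) /\
    forall e1 e2 t, `|e1| <= r -> `|e2| <= r -> hball l t -> U e1 e2 t = U0 (place p e1 e2 t).
Proof.
move=> n3 /andP[r0 r1] l0 tau0 small rU hU; have r0' := ltW r0.
have q0 := sqn_ge0 p; have N0 : 0 <= 1 + sqn p + 2 * l by rewrite !addr_ge0// mulr_ge0.
have [s1 _] := arith_scale tau0 (mulr_ge0 r0' N0) small.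
have oA : open (ann tau : set V) by exact: open_ann.
have sub : ann tau `<=` (hball (4 * tau) : set V).
  move=> y ay; apply: (le_hball _ _ (ann_hball ay)); first by rewrite mulr_ge0// ltW.
  by move: tau0; lra.
have b4 : bounded_dom (hball (4 * tau) : set V) by apply: bounded_hball; rewrite mulr_ge0// ltW.
have fA := fin_measS (open_measurable_rV oA) (bounded_dom_fin b4) sub.
have [k bl] := blin_lam oA fA tau0 (reg_sub (@open_hball R n (4 * tau)) oA sub rU).
have far : forall z, (ann tau : set V) z -> tau ^+ 2 <= sqn z by move=> z /andP[/ltW].
have mB := open_measurable_rV (@open_hball R n l).
have l2 : 0 <= 2 * l by rewrite mulr_ge0.
have sub2 : hball l `<=` (hball (2 * l) : set V) by apply: le_hball => //; lra.
have r01 : 0 <= r <= 1 by rewrite r0' r1.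
have s := ser_swap r0' (ser_place_Gam r01 oA tau0 far mB l2 sub2 small).
have s2 := serZ r0' (- (@mass R n)^-1) (ser_lin setT r0' bl s).
eexists; eexists; split; first exact: s2.
move=> e1 e2 t h1 h2 ht /=.
have pt : sqn (place p e1 e2 t) < tau ^+ 2.
  apply: le_lt_trans (sqn_place_le p h1 h2 r1 l0 (ltW ht)) _.
  by rewrite ltrXn2r ?nnegrE ?mulr_ge0 ?(ltW tau0).
have := full_representation n3 tau0 rU hU pt; have M0 := @mass_gt0 R n n3.
move=> /(congr1 (fun q => (@mass R n)^-1 * q)).
by rewrite mulrA mulVf ?gt_eqF// mul1r mulrN -mulNr => ->.
Qed.

Variables (Om K : set V) (rho tau : R) (p : V) (u0 U0 G : V -> R) (u : R -> R -> V -> R).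
Hypotheses (n3 : (3 <= n)%N) (bOm : bounded_dom Om) (Omhalf : Om `<=` halfspace m).
Hypotheses (cK : closed K) (Krho : K `<=` hball rho) (rho0 : 0 < rho) (tau0 : 0 < tau).
Hypotheses (tauOm : halfball (4 * tau) `<=` Om) (hp : 0 < p ord0 ord_max).
Hypotheses (rU0 : reg (hball (4 * tau)) U0) (hU0 : forall x, hball (4 * tau) x -> laplacian U0 x = 0).
Hypothesis U0u0 : forall x, halfball (4 * tau) x -> U0 x = u0 x.
Hypotheses (ru0 : reg Om u0) (hu0 : forall x, Om x -> laplacian u0 x = 0).
Let Ak : set V := hball (2 * (2 * rho)) `&` ~` K.
Hypotheses (rG : reg Ak G) (hG : forall z, Ak z -> laplacian G z = 0).

Let P (e1 e2 : R) : set V := Om `&` [set x | ~ K (- (e1 * e2)^-1 *: (e1 *: p) + (e1 * e2)^-1 *: x)].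

(* The data on the hole enter only through G, whose values at K the rescaled solution must match. *)
Definition solves (e1 e2 : R) : Prop :=
  [/\ reg (P e1 e2) (u e1 e2), forall x, P e1 e2 x -> laplacian (u e1 e2) x = 0,
      forall y, ~ Om y -> forall d, 0 < d -> \forall z \near y, P e1 e2 z -> `|u e1 e2 z - u0 z| < d &
      forall z, K z -> forall d, 0 < d ->
        \forall x \near z, ~ K x -> `|u e1 e2 (place p e1 e2 x) - G x| < d].

Section constants.
Variables (la mu r kap0 kap1 kap2 : R).
Hypothesis b0 : bbil (ann la) (ann (2 * rho)) (form_in K rho la) kap0.
Hypothesis b1 : bbil (Om `&` ann mu) (Om `&` ann tau) (form_out Om mu tau) kap1.
Hypothesis b2 : bbil (ann rho) (ann (2 * rho)) (form_src K rho la) kap2.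
Let M : R := (@mass R n)^-1.
Hypotheses (hla : 16 * n.+1%:R * (4 * rho) <= la) (mu0 : 0 < mu) (hmu : 16 * n.+1%:R * (2 * mu) <= tau).
Hypotheses (r01 : 0 < r <= 1).
Let N : R := 1 + sqn p + 2 * (3 * la).
Hypotheses (hrp : 16 * n.+1%:R * (r * N) <= p ord0 ord_max) (hrmu : 16 * n.+1%:R * (r * N) <= mu).
(** Bounds of the kernels: [c00] and [c10] multiply the inner form and are small through la and r;
    [c01] is merely bounded, and the outer form it multiplies is small through mu. *)
Let c00 := M * ((4 / 3 / la) ^+ (n - 2) + r ^+ (n - 2) * (4 / 3 / (2 * p ord0 ord_max)) ^+ (n - 2)).
Let c01 := M * (2 * (4 / 3 / tau) ^+ (n - 2)).
Let c10 := M * ((r * r) ^+ (n - 2) * (2 * (4 / 3 / mu) ^+ (n - 2))).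
Hypotheses (th0 : kap0 * c00 + kap1 * c01 <= 2^-1) (th1 : kap0 * c10 + kap1 * c01 <= 2^-1).

Let Mgt0 : 0 < M. Proof. by rewrite invr_gt0 mass_gt0. Qed.
Let r0 : 0 <= r. Proof. by case/andP: r01 => /ltW. Qed.
Let r1 : r <= 1. Proof. by case/andP: r01. Qed.
Let rho4 : 0 < 4 * rho. Proof. by rewrite mulr_gt0. Qed.
Let la0 : 0 < la.
Proof. by apply: lt_le_trans hla; rewrite !mulr_gt0. Qed.
Let rhola : 4 * rho <= la. Proof. exact: ltW (arith_scale la0 (ltW rho4) hla).1. Qed.
Let mutau2 : 2 * mu < tau /\ 2 * (2 * mu) <= tau.
Proof. by apply: (arith_scale tau0 _ hmu); rewrite mulr_ge0// ltW. Qed.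
Let mutau : 2 * mu <= tau := ltW mutau2.1.
Let N0 : 0 <= N. Proof. by rewrite !addr_ge0 ?sqn_ge0// !mulr_ge0// ltW. Qed.
Let rN0 : 0 <= r * N. Proof. exact: mulr_ge0. Qed.
Let rNp : r * N < p ord0 ord_max := (arith_scale hp rN0 hrp).1.
Let rNmu : r * N < mu := (arith_scale mu0 rN0 hrmu).1.

Let small e1 e2 (t : V) : 0 < e1 -> 0 < e2 -> e1 <= r -> e2 <= r -> sqn t <= (3 * la) ^+ 2 ->
  sqn (place p e1 e2 t) < mu ^+ 2 /\ halfspace m (place p e1 e2 t).
Proof.
move=> e10 e20 h1 h2 ht.
have l0 : 0 <= 3 * la by rewrite mulr_ge0// ltW.
split.
  have := @sqn_place_le p e1 e2 r (3 * la) t; rewrite !gtr0_norm// => /(_ h1 h2 r1 l0 ht) h.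
  by apply: (le_lt_trans h); rewrite ltrXn2r ?nnegrE ?(ltW mu0).
rewrite /halfspace /= !mxE; apply: (arith_front e10 e20 h2 _ l0).
  apply: le_lt_trans rNp; rewrite ler_wpM2l// /N; have := sqn_ge0 p; have := ltW la0; lra.
have := le_trans (coord_le_sqn t ord_max) ht.
by rewrite -real_normK ?num_real// ler_pXn2r ?nnegrE.
Qed.

(** Here [false] refers to the rescaled annulus at the hole and [true] to the annulus in [Om]. [X b]
    carries the unknown trace and [Y b] the second argument of its form; [kern i j] has its pole in
    [X i] and is paired with the trace on [X j]. *)
Let X (b : bool) : set V := if b then Om `&` ann mu else ann la.
Let Y (b : bool) : set V := if b then Om `&` ann tau else ann (2 * rho).
Let B (b : bool) := if b then form_out Om mu tau else form_in K rho la.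
Let kap (b : bool) : R := if b then kap1 else kap0.
Let c (i j : bool) : R := if j then c01 else if i then c10 else c00.
Let kern (i j : bool) (e1 e2 : R) (x y : V) : R := M *
  (if j then (if i then gk x y else gk (place p e1 e2 x) y)
   else (if i then (e1 * e2) ^+ (n - 2) * gk x (place p e1 e2 y) else hole_kernel p e2 x y)).

Let oOm : open Om := bOm.1.
Let oX b : open (X b). Proof. by case: b; [apply: openI => //|]; exact: open_ann. Qed.
Let oY b : open (Y b). Proof. by case: b; [apply: openI => //|]; exact: open_ann. Qed.
Let mX b := @open_measurable_rV R n (X b) (@oX b).
Let mY b := @open_measurable_rV R n (Y b) (@oY b).
Let bB b : bbil (X b) (Y b) (B b) (kap b). Proof. by case: b. Qed.
Let rr01 : 0 <= r <= 1. Proof. by rewrite r0 r1. Qed.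

Let Y1far z : Y true z -> tau ^+ 2 <= sqn z. Proof. by move=> [_ /andP[/ltW]]. Qed.
Let X1far z : X true z -> mu ^+ 2 <= sqn z. Proof. by move=> [_ /andP[/ltW]]. Qed.
Let X0far z : X false z -> la ^+ 2 <= sqn z. Proof. by move=> /andP[/ltW]. Qed.
Let X0ball : X false `<=` hball (2 * (3 * la)).
Proof.
move=> z h; apply: (le_hball _ _ (ann_hball h)); have := la0 => h0; first by rewrite mulr_ge0// ltW.
by lra.
Qed.
Let Y0ball : Y false `<=` hball (2 * (3 * la)).
Proof.
move=> z h; apply: (le_hball _ _ (ann_hball h)); first by rewrite !mulr_ge0// ltW.
by have := la0; have := rhola; have := rho0; lra.
Qed.
Let la6 : 0 <= 2 * (3 * la). Proof. by rewrite !mulr_ge0// ltW. Qed.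

Let ser_kern i j : ser (X i) (Y j) r (c i j) (kern i j).
Proof.
have wrap C F : ser (X i) (Y j) r C F -> ser (X i) (Y j) r (M * C) (fun e1 e2 x y => M * F e1 e2 x y).
  by move=> h; have := serZ r0 M h; rewrite gtr0_norm.
rewrite /kern /c; case: i wrap => wrap; case: j wrap => wrap; apply: wrap.
- have mu2 : 0 <= 2 * mu by rewrite mulr_ge0// ltW.
  have sub : X true `<=` hball (2 * mu) by move=> z [_]; exact: ann_hball.
  have sx i := ser_b (Y true) r0 (bd_coord i (mX true) mu2 sub).
  have h := ser_gk (xi := fun _ _ b => b) r0 (@oY true) tau0 Y1far sx mu2 hmu.
  by apply: (eq_ser r0 (ser_swap r0 h)) => // e1 e2 a b _ _ _ _; rewrite gkC.
- have sx i := ser_place (X true) p i rr01 (mY false) la6 Y0ball.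
  have h := ser_gk r0 (@oX true) mu0 X1far sx rN0 hrmu.
  have e12 := serX r0 (n - 2) (serM r0 (ser_e1 (X true) (Y false) r0) (ser_e2 (X true) (Y false) r0)).
  by apply: (eq_ser r0 (serM r0 e12 h)) => // e1 e2 a b _ _ _ _; rewrite gkC.
- have sx i := ser_place (Y true) p i rr01 (mX false) la6 X0ball.
  have hr : 16 * n.+1%:R * (r * N) <= tau.
    by apply: le_trans hrmu _; have := mutau; have := mu0; lra.
  exact: (ser_swap r0 (ser_gk r0 (@oY true) tau0 Y1far sx rN0 hr)).
apply: (ser_hole_kernel r0 (@oX false) (mY false) la0 (ltW rho4) X0far (@ann_hball _ _ la) _ hla hp).
  by move=> z h; have := ann_hball h; rewrite mulrA -natrM.
apply: le_trans (_ : 16 * n.+1%:R * (r * N) <= _); last by apply: le_trans hrp _; have := hp; lra.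
rewrite ler_wpM2l// ?mulr_ge0// ler_wpM2l// /N.
by have := sqn_ge0 p; have := rhola; have := la0; lra.
Qed.


Let bmf_unscale (Z : set V) (a : R) f : a != 0 -> vbmf Z (fun x => a * f x) -> vbmf Z f.
Proof.
move=> a0 b; apply: (eq_bmf _ (bmfZ a^-1 b)) => x _.
by rewrite mulrA mulVf// mul1r.
Qed.

Let bmf_kern i j e1 e2 a : `|e1| <= r -> `|e2| <= r -> X i a -> vbmf (Y j) (fun y => M^-1 * kern i j e1 e2 a y).
Proof.
move=> h1 h2 Xa; have [/(_ a Xa) b _] := ser_bd r0 (ser_kern i j) h1 h2.
exact: (bmfZ M^-1 (bd_bmf b)).
Qed.

Let MM : @mass R n * M = 1. Proof. by rewrite mulfV// gt_eqF// mass_gt0. Qed.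
Let M1 (y : R) : M^-1 * (M * y) = y.
Proof. by rewrite mulrA mulVf ?mul1r// gt_eqF. Qed.

Let bbilZr (Z1 Z2 : set V) (Q : (V -> R) -> (V -> R) -> R) k f g (a : R) : bbil Z1 Z2 Q k -> vbmf Z1 f -> vbmf Z2 g ->
  Q f (fun y => a * g y) = a * Q f g.
Proof. by move=> [_ _ h] /bmf_bd[H bH] bg; exact: (blinZ a (h f H bH) bg). Qed.

Let eq_src f f' g : (forall x, ann rho x -> f x = f' x) -> form_src K rho la f g = form_src K rho la f' g.
Proof.
move=> ff; rewrite /form_src; suff -> : lam (ann rho) rho f = lam (ann rho) rho f' by [].
by apply/funext => psi; exact: eq_lam.
Qed.

Let eq_srcr f g g' : (forall x, ann (2 * rho) x -> g x = g' x) -> form_src K rho la f g = form_src K rho la f g'.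
Proof.
move=> gg; rewrite /form_src; suff -> : lam (ann (2 * rho)) (2 * rho) g = lam (ann (2 * rho)) (2 * rho) g' by [].
by apply/funext => psi; exact: eq_lam.
Qed.

Let eq_in f f' g g' : (forall x, ann la x -> f x = f' x) -> (forall x, ann (2 * rho) x -> g x = g' x) ->
  form_in K rho la f g = form_in K rho la f' g'.
Proof.
move=> ff gg; rewrite /form_in; suff -> : lam (ann (2 * rho)) (2 * rho) g = lam (ann (2 * rho)) (2 * rho) g'.
  suff -> : lam (ann la) la f = lam (ann la) la f' by [].
  by apply/funext => psi; exact: eq_lam.
by apply/funext => psi; exact: eq_lam.
Qed.

Let annAk (t : R) : 0 < t -> rho <= t -> t <= 2 * rho -> ann t `<=` Ak.
Proof.
move=> t0 h1 h2 x ax; split.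
  by apply: (le_hball _ _ (ann_hball ax)); [rewrite mulr_ge0// ltW|rewrite ler_wpM2l].
move=> /Krho h; move: ax => /andP[ax _]; have := lt_trans ax h.
by apply/negP; rewrite -leNgt; apply: lerXn2r; rewrite ?nnegrE ?(ltW rho0) ?(ltW t0).
Qed.
Let rho20 : 0 < 2 * rho. Proof. by rewrite mulr_gt0. Qed.
Let oAk : open Ak. Proof. by apply: open_setD => //; exact: open_hball. Qed.
Let ann1 : ann rho `<=` Ak. Proof. by apply: annAk => //; have := rho0; lra. Qed.
Let ann2 : ann (2 * rho) `<=` Ak. Proof. by apply: annAk => //; have := rho0; lra. Qed.
Let bG (t : R) : ann t `<=` Ak -> exists H, bd (ann t) G H.
Proof. by move=> h; apply: bmf_bd; have [_ b _ _] := reg_sub oAk (@open_ann R n t) h rG; exact: b. Qed.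

Lemma analytic_energy_const : exists (F : R -> R -> R) (C : R),
  [/\ ser setT setT r C (fun e1 e2 (_ _ : V) => F e1 e2), F 0 0 = vint Om (gdot u0 u0) &
    forall e1 e2, 0 < e1 <= r -> 0 < e2 <= r -> solves e1 e2 ->
      vint (P e1 e2) (gdot (u e1 e2) (u e1 e2)) = F e1 e2].
Proof.
have hrtau : 16 * n.+1%:R * (r * (1 + sqn p + 2 * (4 * rho))) <= tau.
  apply: le_trans (_ : 16 * n.+1%:R * (r * N) <= _).
    rewrite ler_wpM2l// ?mulr_ge0// ler_wpM2l// /N.
    by have := rhola; have := la0; lra.
  by apply: le_trans hrmu _; have := mutau; have := mu0; lra.
have [U [CU [sU UE]]] := ser_source n3 r01 (ltW rho4) tau0 hrtau rU0 hU0.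
have sub (t : R) : 0 < t -> t <= 2 * rho -> ann t `<=` (hball (4 * rho) : set V).
  move=> t0 ht x ax; apply: (le_hball _ _ (ann_hball ax)); first by rewrite mulr_ge0// ltW.
  by have := ht; lra.
have sub1 : ann rho `<=` (hball (4 * rho) : set V) by apply: sub => //; have := rho0; lra.
have sub2 : ann (2 * rho) `<=` (hball (4 * rho) : set V) by apply: sub.
have mT : measurable (setT : set 'rV[mR]_n) by exact: measurableT.
have mH := open_measurable_rV (@open_hball R n (4 * rho)).
have mA1 := open_measurable_rV (@open_ann R n rho).
have mA2 := open_measurable_rV (@open_ann R n (2 * rho)).
have sU1 := ser_sub r0 (lexx r) mH mT mA1 mT sub1 (@subset_refl _ _) sU.
have sU2 := ser_sub r0 (lexx r) mH mT mA2 mT sub2 (@subset_refl _ _) sU.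
have [A1 bG1] := bG ann1; have [A2 bG2] := bG ann2.
pose W e1 e2 t := G t - U e1 e2 t.
have sW1 : ser (ann rho) setT r (A1 + CU) (fun e1 e2 t _ => W e1 e2 t) by exact: (serB r0 (ser_a _ r0 bG1) sU1).
have sW2 : ser (ann (2 * rho)) setT r (A2 + CU) (fun e1 e2 t _ => W e1 e2 t) by exact: (serB r0 (ser_a _ r0 bG2) sU2).
have sW2' := ser_swap r0 sW2.
(* The known part of each equation is the datum on the hole, which enters through the inner kernels
   only. *)
pose f i e1 e2 a := - form_src K rho la (W e1 e2) (kern i false e1 e2 a).
have sf i : ser (X i) setT r (kap2 * (A1 + CU) * c i false) (fun e1 e2 a _ => f i e1 e2 a).
  exact: (serN r0 (ser_bil setT r0 b2 sW1 (ser_kern i false))).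
pose M0 := kap2 * (A1 + CU) * c true false + kap2 * (A1 + CU) * c false false.
have sf' i : ser (X i) setT r M0 (fun e1 e2 a _ => f i e1 e2 a).
  apply: (le_ser r0 (sf i)); have ge j := ser_ge0 r0 (sf j).
  by case: i; [rewrite /M0 lerDl|rewrite /M0 lerDr]; exact: ge.
have th i : \sum_j kap j * c i j <= 2^-1.
  by rewrite big_bool /= addrC; case: i; [exact: th1|exact: th0].
have half01 : 0 <= (2^-1 : R) < 1 by have [-> ->] := half_lt1 R.
have [F [sF uniq]] := ser_fixed_point r0 half01 bB ser_kern th sf'.
have rG2 := reg_sub oAk (@open_ann R n (2 * rho)) ann2 rG.
have fA2 : vfin (ann (2 * rho) : set V).
  have b4 : bounded_dom (hball (4 * rho) : set V) by apply: bounded_hball; exact: ltW.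
  exact: (fin_measS mA2 (bounded_dom_fin b4) sub2).
have [kG bl] := blin_lam (@open_ann R n (2 * rho)) fA2 rho20 rG2.
pose E0 := vint Om (gdot u0 u0).
pose eG := vint Ak (gdot (fun z => cutoff (2 * rho) z * G z) G).
have t1 := ser_bil setT r0 b0 (sF false) sW2'.
have t2 := ser_bil setT r0 b2 sW1 sW2'.
have t3 := ser_lin setT r0 bl (ser_swap r0 sU2).
have e12 := serX r0 (n - 2) (serM r0 (ser_e1 (setT : set V) (setT : set V) r0) (ser_e2 (setT : set V) (setT : set V) r0)).
have tot := serD r0 (ser_cst (setT : set V) (setT : set V) r0 E0) (serM r0 e12 (serB r0 (serD r0 (ser_cst (setT : set V) (setT : set V) r0 eG) (serB r0 t1 t2)) t3)).
(* The formula of [perturbed_energy] with the traces replaced by their series, which makes sense for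
   parameters of either sign. *)
exists (fun e1 e2 => E0 + (e1 * e2) ^+ (n - 2) * (eG + (form_in K rho la (F false e1 e2) (W e1 e2)
  - form_src K rho la (W e1 e2) (W e1 e2)) - lam (ann (2 * rho)) (2 * rho) (U e1 e2) G)).
eexists; split; first exact: tot.
  (* As n - 2 > 0, the whole correction vanishes at the origin. *)
  by rewrite mulr0 expr0n subn_eq0 leqNgt n3 mul0r addr0.
move=> e1 e2 /andP[e10 h1] /andP[e20 h2] [ru hu Vout Vin].
have a1 : `|e1| <= r by rewrite gtr0_norm.
have a2 : `|e2| <= r by rewrite gtr0_norm.
have sm t := @small e1 e2 t e10 e20 h1 h2.
have s0 : (e1 * e2) ^+ (n - 2) != 0 by rewrite expf_neq0// mulf_neq0// gt_eqF.
(* For positive parameters the rescaled points lie in the half-space, where [U0] and [u0] agree. *)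
have UU t : hball (4 * rho) t -> U e1 e2 t = u0 (place p e1 e2 t).
  move=> ht; rewrite (UE e1 e2 t a1 a2 ht); apply: U0u0.
  have l43 : 4 * rho <= 3 * la by have := rhola; have := la0; lra.
  have [q1 q2] := sm t (sqn_le_sqr (ltW rho4) l43 (ltW ht)).
  split=> //; apply: (lt_trans q1); rewrite ltrXn2r ?nnegrE ?mulr_ge0 ?(ltW mu0) ?(ltW tau0)//.
  by have := mutau; have := mu0; lra.
pose v x := u e1 e2 x - u0 x.
pose Vt t := v (place p e1 e2 t).
pose W' t := G t - u0 (place p e1 e2 t).
have WW1 t : ann rho t -> W' t = W e1 e2 t by move=> /sub1/UU; rewrite /W /W' => ->.
have WW2 t : ann (2 * rho) t -> W' t = W e1 e2 t by move=> /sub2/UU; rewrite /W /W' => ->.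
have [bV bv] := perturbation_bmf bOm cK Krho rho0 rhola mu0 mutau e10 e20 tauOm sm ru ru0.
pose uu (b : bool) := if b then v else Vt.
have buu b : vbmf (X b) (uu b) by case: b.
have eqn i a : X i a -> uu i a = f i e1 e2 a + \sum_j B j (uu j) (kern i j e1 e2 a).
  move=> Xa; rewrite big_bool /f.
  have bk0 := bmf_kern false a1 a2 Xa; have bk1 := bmf_kern true a1 a2 Xa.
  have kk j (g : V -> R) : (forall y, M^-1 * kern i j e1 e2 a y = g y) -> vbmf (Y j) g ->
      B j (uu j) (kern i j e1 e2 a) = M * B j (uu j) g.
    move=> kg bg; rewrite -(bbilZr M (bB j) (buu j) bg); congr (B j (uu j) _).
    by apply/funext => y; rewrite -kg mulrA mulfV ?mul1r// gt_eqF.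
  have ks (g : V -> R) : (forall y, M^-1 * kern i false e1 e2 a y = g y) -> vbmf (ann (2 * rho)) g ->
      form_src K rho la (W e1 e2) (kern i false e1 e2 a) = M * form_src K rho la W' g.
    move=> kg bg; rewrite (eq_src g WW1); have [_ bW] := ser_bd r0 sW1 a1 a2.
    rewrite -(bbilZr M b2 (bd_bmf (bW 0 Logic.I)) bg); congr (form_src _ _ _ _ _).
    by apply/funext => y; rewrite -kg mulrA mulfV ?mul1r// gt_eqF.
  case: i Xa bk0 bk1 kk ks => Xa bk0 bk1 kk ks.
    have bg0 : vbmf (ann (2 * rho)) (fun t => (e1 * e2) ^+ (n - 2) * gk a (place p e1 e2 t)).
      by apply: eq_bmf bk0 => y _; exact: M1.
    have bg1 : vbmf (Om `&` ann tau) (gk a) by apply: eq_bmf bk1 => y _; exact: M1.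
    rewrite (kk true _ (fun y => M1 _) bg1) (kk false _ (fun y => M1 _) bg0) (ks _ (fun y => M1 _) bg0).
    have := outer_equation n3 bOm Omhalf cK Krho rho0 rhola mu0 mutau e10 e20 tauOm sm ru hu ru0 hu0
      rG hG Vout Vin Xa (bmf_unscale s0 bg0) bg1.
    by move=> /(congr1 (fun q => M * q)); exact: (arith_eqn MM).
  have bg0 : vbmf (ann (2 * rho)) (hole_kernel p e2 a) by apply: eq_bmf bk0 => y _; exact: M1.
  have bg1 : vbmf (Om `&` ann tau) (gk (place p e1 e2 a)) by apply: eq_bmf bk1 => y _; exact: M1.
  have bgp : vbmf (ann (2 * rho)) (fun t' => gk (place p e1 e2 a) (place p e1 e2 t')).
    by apply: (bmf_unscale s0); apply: eq_bmf bg0 => y _; rewrite hole_kernelE.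
  rewrite (kk true _ (fun y => M1 _) bg1) (kk false _ (fun y => M1 _) bg0) (ks _ (fun y => M1 _) bg0).
  have := hole_equation n3 bOm Omhalf cK Krho rho0 rhola mu0 mutau e10 e20 tauOm sm ru hu ru0 hu0
    rG hG Vout Vin Xa bgp bg0 bg1.
  by move=> /(congr1 (fun q => M * q)); exact: (arith_eqn MM).
have sol t : ann la t -> Vt t = F false e1 e2 t by exact: (uniq e1 e2 uu a1 a2 buu eqn false).
have := perturbed_energy n3 bOm cK Krho rho0 rhola mu0 mutau e10 e20 tauOm sm ru hu ru0 hu0
    rG hG Vout Vin.
have i1 := eq_in sol WW2.
have i2 : form_src K rho la W' W' = form_src K rho la (W e1 e2) (W e1 e2).
  exact: etrans (eq_src W' WW1) (eq_srcr (W e1 e2) WW2).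
have i3 : lam (ann (2 * rho)) (2 * rho) (fun t => u0 (place p e1 e2 t)) G = lam (ann (2 * rho)) (2 * rho) (U e1 e2) G.
  by apply: eq_lam => t /sub2/UU.
exact: (arith_total i1 i2 i3).
Qed.
End constants.

Theorem analytic_energy (rad : R) : 0 < rad ->
  (forall e1 e2, 0 < e1 < rad -> 0 < e2 < rad -> solves e1 e2) ->
  exists (r : R) (F : R -> R -> R) (C : R),
  [/\ 0 < r < rad, ser setT setT r C (fun e1 e2 (_ _ : V) => F e1 e2), F 0 0 = vint Om (gdot u0 u0) &
    forall e1 e2, 0 < e1 <= r -> 0 < e2 <= r ->
      vint (P e1 e2) (gdot (u e1 e2) (u e1 e2)) = F e1 e2].
Proof.
move=> rad0 sol; have [C C0 hC] := @dual_bbil R n n3.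
have k0 : (0 < n - 2)%N by rewrite subn_gt0.
have M0 : 0 < (@mass R n)^-1 by rewrite invr_gt0 mass_gt0.
have rho20 : 0 < 2 * rho by rewrite mulr_gt0.
have rho4 : 0 < 4 * rho by rewrite mulr_gt0.
(* The order matters: la is fixed by [rho], mu by [tau], and r comes last because its conditions
   involve both. *)
have [la [la0 hla th]] := @pick_large R
  (Num.sqrt C * Num.sqrt (C * (2 * rho) ^+ (n - 2)) * (@mass R n)^-1 * (4 / 3) ^+ (n - 2))
  (16 * n.+1%:R * (4 * rho)) _ (ltac:(by rewrite !mulr_ge0 ?sqrtr_ge0 ?exprn_ge0 ?(ltW M0))) k0.
have [mu [mu0 hmu th']] := @pick_small R
  (Num.sqrt C * Num.sqrt (C * tau ^+ (n - 2)) * (@mass R n)^-1 * (2 * (4 / 3 / tau) ^+ (n - 2)))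
  (tau / (16 * n.+1%:R * 2)) _
  (ltac:(by rewrite !mulr_ge0 ?sqrtr_ge0 ?exprn_ge0 ?(ltW M0)// ?divr_ge0 ?(ltW tau0)))
  (ltac:(by rewrite divr_gt0 ?mulr_gt0)) k0.
set kap0 := Num.sqrt (C * la ^+ (n - 2)) * Num.sqrt (C * (2 * rho) ^+ (n - 2)).
set kap1 := Num.sqrt (C * mu ^+ (n - 2)) * Num.sqrt (C * tau ^+ (n - 2)).
have rhola : 4 * rho <= la by exact: ltW (arith_scale la0 (ltW rho4) hla).1.
have bDin : bounded_dom (hball (3 * la) `&` ~` K).
  by apply: bounded_domI; [apply: bounded_hball; rewrite mulr_ge0// ltW|exact: closed_openC].
have annD (t : R) : 0 < t -> rho <= t -> 2 * t <= 3 * la -> ann t `<=` (hball (3 * la) `&` ~` K) `&` ann t.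
  move=> t0 h1 h2 x ax; split=> //; split; first exact: (le_hball (mulr_ge0 (ler0n _ 2) (ltW t0)) h2 (ann_hball ax)).
  move=> /Krho h; move: ax => /andP[ax _]; have := lt_trans ax h.
  by apply/negP; rewrite -leNgt; apply: lerXn2r; rewrite ?nnegrE ?(ltW rho0) ?(ltW t0).
have mA (t : R) := open_measurable_rV (@open_ann R n t).
have d0 : ann la `<=` (hball (3 * la) `&` ~` K) `&` ann la by apply: annD => //; move: rhola rho0; lra.
have d2 : ann (2 * rho) `<=` (hball (3 * la) `&` ~` K) `&` ann (2 * rho) by apply: annD => //; move: rhola rho0; lra.
have d1 : ann rho `<=` (hball (3 * la) `&` ~` K) `&` ann rho by apply: annD => //; move: rhola rho0; lra.
have mO (t : R) : measurable (Om `&` ann t : set 'rV[mR]_n).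
  by apply: open_measurable_rV; apply: openI; [exact: bOm.1|exact: open_ann].
have b0 := hC _ _ _ _ _ bDin (mA la) (mA (2 * rho)) d0 d2 la0 rho20.
have b2 := hC _ _ _ _ _ bDin (mA rho) (mA (2 * rho)) d1 d2 rho0 rho20.
have b1 := hC _ _ _ _ _ bOm (mO mu) (mO tau) (@subset_refl _ _) (@subset_refl _ _) mu0 tau0.
pose N : R := 1 + sqn p + 2 * (3 * la).
have N0 : 0 < N by rewrite /N addr_gt0 ?mulr_gt0// ltr_pwDl// sqn_ge0.
pose M := (@mass R n)^-1.
pose T1 := kap0 * (M * (4 / 3 / (2 * p ord0 ord_max)) ^+ (n - 2)).
pose T2 := kap0 * (M * (2 * (4 / 3 / mu) ^+ (n - 2))).
pose T3 := 16 * n.+1%:R * N / p ord0 ord_max.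
pose T4 := 16 * n.+1%:R * N / mu.
have kap00 : 0 <= kap0 by rewrite mulr_ge0// sqrtr_ge0.
have T10 : 0 <= T1 by rewrite mulr_ge0// mulr_ge0 ?(ltW M0)// exprn_ge0// divr_ge0// ?mulr_ge0// ltW.
have T20 : 0 <= T2 by rewrite mulr_ge0// mulr_ge0 ?(ltW M0)// mulr_ge0// exprn_ge0// divr_ge0// ltW.
have T30 : 0 <= T3 by rewrite divr_ge0 ?(ltW hp)// !mulr_ge0// ltW.
have T40 : 0 <= T4 by rewrite divr_ge0 ?(ltW mu0)// !mulr_ge0// ltW.
have ri0 : 0 <= rad^-1 by rewrite invr_ge0 ltW.
(* [T1] and [T2] govern the kernel terms that carry a power of r; [T3] and [T4] keep the hole in the
   half-space and inside radius mu; the last condition yields r < [rad]. *)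
have [r [/andP[r0 r1] q1 q2 q3 [q4 q5]]] := pick_tiny T10 T20 T30 T40 ri0.
have hrN (y : R) : 0 < y -> 16 * n.+1%:R * N / y * r <= 8^-1 -> 16 * n.+1%:R * (r * N) <= y.
  move=> y0 h; have : 16 * n.+1%:R * N / y * r * y <= y.
    by apply: le_trans (_ : 8^-1 * y <= _); [rewrite ler_wpM2r// ltW|lra].
  by rewrite mulrAC mulfVK ?gt_eqF// -!mulrA (mulrC N).
have rk : r ^+ (n - 2) <= r by rewrite -(prednK k0) exprS ler_piMr ?(ltW r0)// exprn_ile1// ltW.
have rrk : (r * r) ^+ (n - 2) <= r.
  by rewrite exprMn (le_trans _ rk)// ler_piMr ?exprn_ge0 ?(ltW r0)// exprn_ile1// ltW.
have a1 : kap1 * (M * (2 * (4 / 3 / tau) ^+ (n - 2))) <= 4^-1.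
  apply: le_trans th'; rewrite le_eqVlt; apply/orP; left; apply/eqP.
  by rewrite /kap1 (sqrtrM _ C0) /M; move: (4 / 3 / tau) => q; move: (q ^+ _) (Num.sqrt _) (Num.sqrt _) (Num.sqrt _) => *; ring.
have a0 : kap0 * (M * ((4 / 3 / la) ^+ (n - 2))) <= 8^-1.
  apply: le_trans th; rewrite le_eqVlt; apply/orP; left; apply/eqP.
  have e : (4 / 3 / la) ^+ (n - 2) = (4 / 3) ^+ (n - 2) * la^-1 ^+ (n - 2) by rewrite exprMn.
  by rewrite /kap0 (sqrtrM _ C0) /M e; exact: arith_kap.
have th0 : kap0 * (M * ((4 / 3 / la) ^+ (n - 2) + r ^+ (n - 2) * (4 / 3 / (2 * p ord0 ord_max)) ^+ (n - 2)))
    + kap1 * (M * (2 * (4 / 3 / tau) ^+ (n - 2))) <= 2^-1.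
  have h : T1 * r ^+ (n - 2) <= 8^-1 by apply: le_trans q1; rewrite ler_wpM2l.
  exact: (arith_theta0 a0 h a1).
have th1 : kap0 * (M * ((r * r) ^+ (n - 2) * (2 * (4 / 3 / mu) ^+ (n - 2))))
    + kap1 * (M * (2 * (4 / 3 / tau) ^+ (n - 2))) <= 2^-1.
  have h : T2 * (r * r) ^+ (n - 2) <= 8^-1 by apply: le_trans q2; rewrite ler_wpM2l.
  exact: (arith_theta1 h a1).
have hmu' : 16 * n.+1%:R * (2 * mu) <= tau.
  by move: hmu; rewrite ler_pdivlMr ?mulr_gt0// => h; rewrite mulrA mulrC.
have r01 : 0 < r <= 1 by rewrite r0.
have [F [C1 [sF F0 FE]]] := analytic_energy_const b0 b1 b2 hla mu0 hmu' r01 (hrN _ hp q3) (hrN _ mu0 q4) th0 th1.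
have rrad : r < rad.
  have : rad^-1 * r * rad < rad.
    by apply: le_lt_trans (_ : 8^-1 * rad < _); [rewrite ler_wpM2r// ltW|lra].
  by rewrite mulrAC mulVf ?mul1r// gt_eqF.
exists r, F, C1; split; [by rewrite r0|exact: sF|exact: F0|].
move=> e1 e2 h1 h2; apply: (FE e1 e2 h1 h2 (sol e1 e2 _ _)).
  by case/andP: h1 => -> h; exact: le_lt_trans rrad.
by case/andP: h2 => -> h; exact: le_lt_trans rrad.
Qed.
End perturbation.

(** * From Schauder classes and the geometry of the hole to the abstract setting *)

Section schauder.
Context {R : realType} {m : nat}.
Notation n := m.+1.
Notation mR := (measurableTypeR R).
Notation V := 'rV[R]_n.
Implicit Types (A D E : set V) (f g : V -> R).

Lemma bounded_set_cube A : bounded_set A -> exists c, A `<=` cube c.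
Proof.
move=> [M [_ hM]]; exists (M + 1) => x Ax i; apply: le_trans (le_coord_norm x i) _.
by apply: hM Ax; rewrite ltrDl.
Qed.

Lemma closure_cube A (c : R) : A `<=` cube c -> closure A `<=` cube c.
Proof.
have cc : closed (cube c : set V) by apply: compact_closed; [exact: norm_hausdorff|exact: compact_cube].
by move=> Ac; rewrite closureE => x; apply.
Qed.

Lemma compact_closure A (c : R) : A `<=` cube c -> compact (closure A).
Proof.
move=> /closure_cube Ac; apply: subclosed_compact Ac; [exact: closed_closure|exact: compact_cube].
Qed.

Lemma compact_within_bounded A f : compact A -> {within A, continuous f} ->
  exists M : R, forall x, A x -> `|f x| <= M.
Proof.
move=> cA cf; have [M [_ hM]] := compact_bounded (continuous_compact cf cA).
by exists (M + 1) => x Ax; apply: hM; [rewrite ltrDl|exists x].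
Qed.

Lemma enorm_sqn (x : V) : enorm x = Num.sqrt (sqn x). Proof. by []. Qed.

Lemma eball_hball (r : R) : 0 < r -> eball (0 : V) r = hball r.
Proof.
move=> r0; apply/seteqP; split=> x; rewrite /eball /hball /= subr0 enorm_sqn.
  by move=> h; rewrite -(sqr_sqrtr (sqn_ge0 x)) ltrXn2r ?nnegrE ?sqrtr_ge0 ?(ltW r0).
by move=> h; rewrite -(gtr0_norm r0) -sqrtr_sqr ltr_sqrt// exprn_gt0.
Qed.

Lemma holder_bounded A (alpha c : R) f : 0 < alpha -> A `<=` cube c -> holder alpha A f ->
  exists M : R, forall x, A x -> `|f x| <= M.
Proof.
move=> a0 Ac [C hC]; have [[y Ay]|nA] := pselect (exists y, A y); last first.
  by exists 0 => x Ax; case: nA; exists x.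
exists (`|f y| + `|C| * (Num.sqrt (n%:R * (2 * c) ^+ 2)) `^ alpha) => x Ax.
have -> : f x = f y + (f x - f y) by rewrite addrC subrK.
apply: le_trans (ler_normD _ _) _; rewrite lerD2l; apply: le_trans (hC _ _ Ax Ay) _.
apply: le_trans (_ : `|C| * enorm (x - y) `^ alpha <= _).
  by rewrite ler_wpM2r ?powR_ge0 ?ler_norm.
rewrite ler_wpM2l//; apply: ge0_ler_powR; rewrite ?nnegrE ?sqrtr_ge0 ?(ltW a0)//.
rewrite enorm_sqn; apply: ler_wsqrtr; apply: cube_sqn => i; rewrite !mxE.
apply: le_trans (ler_normB _ _) _; have := Ac _ Ax i; have := Ac _ Ay i.
by move: `|_| `|_| => p q hp hq; lra.
Qed.

Lemma reg_of_bounds D f : open D -> class_C 2 D f -> (forall x, D x -> laplacian f x = 0) ->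
  (exists M : R, forall x, D x -> `|f x| <= M) ->
  (forall i, exists M : R, forall x, D x -> `|partial i f x| <= M) -> reg D f.
Proof.
move=> oD Cf hf [M fM] pM; split => //.
- exact: (class_C_bmf oD Cf fM).
- move=> i; have [N hN] := pM i; exact: (class_C_bmf oD (class_C_partial i Cf) hN).
have b0 : vbmf D (fun=> (0 : R)) by exact: bmf_cst.
by apply: eq_bmf b0 => x Dx; rewrite hf.
Qed.

(** Each first derivative extends to a Hoelder function on the bounded closure and is therefore
    bounded, as [reg] asks; the Laplacian is 0. *)
Lemma reg_schauder D (alpha c : R) f : 0 < alpha -> open D -> D `<=` cube c ->
  C1a_closure alpha D f -> harmonic_on D f -> reg D f.
Proof.
move=> a0 oD Dc [_ cf hp] [C2 h0]; apply: reg_of_bounds => //.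
  have [M hM] := compact_within_bounded (compact_closure Dc) cf.
  by exists M => x /(@subset_closure _ D); exact: hM.
move=> i; have [g [hg gE]] := hp i.
have [M hM] := holder_bounded a0 (closure_cube Dc) hg.
by exists M => x Dx; rewrite -gE//; apply: hM; exact: subset_closure.
Qed.

(** For [U0], known only in the interior of a ball: the bounds come from compactness of a smaller
    closed ball. *)
Lemma reg_compactly D E f : open D -> open E -> compact (closure D) -> closure D `<=` E ->
  harmonic_on E f -> reg D f.
Proof.
move=> oD oE cD DE [C2 h0].
have sub := @subset_closure _ D.
have bnd g : class_C 0 E g -> exists M : R, forall x, D x -> `|g x| <= M.
  move=> Cg; have [|M hM] := @compact_within_bounded _ g cD.
    apply: continuous_in_subspaceT => x; rewrite inE => /DE Ex.
    exact: (class_C_cont Cg Ex).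
  by exists M => x /sub; exact: hM.
apply: reg_of_bounds => //.
- by apply: class_CS C2 => x /sub; exact: DE.
- by move=> x /sub/DE; exact: h0.
- by apply: bnd; exact: class_CW C2.
by move=> i; apply: bnd; apply: class_CW (class_C_partial i C2).
Qed.

(** One inclusion holds for every affine map; the other follows by applying it to the inverse
    map. *)
Lemma closure_affine A (a : V) (s : R) : s != 0 ->
  closure [set x | A (a + s *: x)] = [set x | closure A (a + s *: x)].
Proof.
have one (B : set V) (b : V) (t : R) : closure [set x | B (b + t *: x)] `<=` [set x : V | closure B (b + t *: x)].
  rewrite [in X in X `<=` _]closureE => x; apply; split.
    apply: (@closed_comp _ _ (fun x : V => b + t *: x)) => [y _|]; last exact: closed_closure.
    exact: continuous_affine.
  by move=> y /= By; exact: (@subset_closure _ B).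
move=> s0; apply/seteqP; split; first exact: one.
move=> x Ax; have := @one [set x | A (a + s *: x)] (- (s^-1 *: a)) s^-1 (a + s *: x).
have e y : - (s^-1 *: a) + s^-1 *: (a + s *: y) = y.
  by rewrite scalerDr scalerA mulVf// scale1r addKr.
rewrite /= e; apply; have -> // : [set y : V | A (a + s *: (- (s^-1 *: a) + s^-1 *: y))] = A.
apply/seteqP; split=> y /=; by rewrite scalerDr scalerN !scalerA mulfV// !scale1r addrA subrr add0r.
Qed.

Lemma within_near A f (y : V) (d : R) : {within A, continuous f} -> A y -> 0 < d ->
  \forall z \near y, A z -> `|f y - f z| < d.
Proof.
move=> /subspace_continuousP cf Ay d0; have := cf y Ay.
by move=> /cvgrPdist_lt /(_ d d0).
Qed.

Lemma near_notin_closure A (y : V) : ~ closure A y -> \forall z \near y, ~ A z.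
Proof.
move=> nA; have o : open (~` closure A) by apply: closed_openC; exact: closed_closure.
apply: filterS (near_open o nA) => z nz Az; apply: nz; exact: subset_closure.
Qed.

Lemma energyE D f : vfin D -> reg D f -> energy D f = (vint D (gdot f f))%:E.
Proof.
move=> fD rf; rewrite -(intE fD (reg_gdot rf rf)) /energy.
by apply: eq_integral => x _; congr EFin; apply: eq_bigr => i _; rewrite expr2.
Qed.

Variables (p : V) (om : set V) (e1 e2 : R).
Let s := e1 * e2.
Hypotheses (s0 : 0 < s) (oom : open om).
Let inv x : V := - s^-1 *: (e1 *: p) + s^-1 *: x.

Definition pair (a b : R) : 'rV[R]_2 := \row_i (if i == ord0 then a else b).

Lemma eps1_pair a b : eps1 (pair a b) = a. Proof. by rewrite /eps1 mxE. Qed.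
Lemma eps2_pair a b : eps2 (pair a b) = b. Proof. by rewrite /eps2 mxE. Qed.

Lemma pair_eps (e : 'rV[R]_2) : pair (eps1 e) (eps2 e) = e.
Proof.
apply/rowP => i; rewrite mxE; case: eqVneq => [->//|i0]; rewrite /eps2.
by congr (e _ _); apply/val_inj => /=; case: i i0 => -[|[|]].
Qed.

Lemma rect_eps (f g h : 'rV[R]_2) : eps1 f < eps1 g < eps1 h -> eps2 f < eps2 g < eps2 h -> rect f h g.
Proof.
move=> h1 h2 i; have [->//|i0] := eqVneq i ord0.
suff -> : i = ord_max by [].
by apply/val_inj => /=; case: i i0 => -[|[|]].
Qed.

Lemma holeE : hole p om (pair e1 e2) = [set x | om (inv x)].
Proof.
rewrite /hole eps1_pair eps2_pair; apply/seteqP; split=> x /=.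
  by move=> [y oy <-]; rewrite /inv affineK.
by move=> h; exists (inv x) => //; exact: affineVK.
Qed.

Lemma closure_hole : closure (hole p om (pair e1 e2)) = [set x | closure om (inv x)].
Proof. by rewrite holeE closure_affine// gt_eqF// invr_gt0. Qed.

Lemma perforatedE Om : perforated Om p om (pair e1 e2) = Om `&` [set x | ~ closure om (inv x)].
Proof. by rewrite /perforated closure_hole. Qed.

Lemma boundary_hole t : closure om t -> ~ om t -> boundary (hole p om (pair e1 e2)) (place p e1 e2 t).
Proof.
move=> ct nt; have e : inv (place p e1 e2 t) = t by exact: affineK.
split; first by rewrite closure_hole /= e.
by move=> /interior_subset; rewrite holeE /= e.
Qed.

(** A point outside [Om] either has no points of [P] nearby or is a boundary point, where both
    functions are continuous with the same value. *)
Lemma outer_boundary (P Om : set V) (u u0 : V -> R) : open Om -> P `<=` Om -> {within closure P, continuous u} ->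
  {within closure Om, continuous u0} -> (forall y, boundary Om y -> u y = u0 y) ->
  forall y, ~ Om y -> forall d, 0 < d -> \forall z \near y, P z -> `|u z - u0 z| < d.
Proof.
move=> oO PO cu cu0 uu0 y nO d d0; have [Py|nP] := pselect (closure P y); last first.
  by apply: filterS (near_notin_closure nP) => z nPz /nPz.
have Oy : closure Om y := closure_subset PO Py.
have By : boundary Om y by split => // /interior_subset.
have d2 : 0 < d / 2 by rewrite divr_gt0.
have := near_and (within_near cu Py d2) (within_near cu0 Oy d2).
apply: filterS => z [h1 h2] Pz; have := h1 (subset_closure Pz); have := h2 (subset_closure (PO _ Pz)).
rewrite (uu0 y By) => a1 a2; have -> : u z - u0 z = (u0 y - u0 z) - (u0 y - u z) by ring.
by apply: le_lt_trans (ler_normB _ _) _; move: a1 a2; move: `|_| `|_| => a b; lra.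
Qed.

(** Continuity up to the boundary, read in the rescaled variable, where the hole no longer moves
    with the parameters. *)
Lemma inner_boundary (Om : set V) (u : V -> R) (gi : V -> R) : open Om ->
  closure (hole p om (pair e1 e2)) `<=` Om -> {within closure (perforated Om p om (pair e1 e2)), continuous u} ->
  (forall x, boundary (hole p om (pair e1 e2)) x -> u x = gi (s^-1 *: (x - e1 *: p))) ->
  forall z, closure om z -> ~ om z -> forall d, 0 < d ->
    \forall x \near z, ~ closure om x -> `|u (place p e1 e2 x) - gi z| < d.
Proof.
move=> oO hO cu ug z cz nz d d0; set P := perforated _ _ _ _ in cu.
have Pin x : Om (place p e1 e2 x) -> ~ closure om x -> P (place p e1 e2 x).
  by move=> Ox nx; split=> //; rewrite closure_hole /= /inv affineK.
have bz := boundary_hole cz nz.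
have Oz : \forall x \near z, Om (place p e1 e2 x) by apply: near_affine; apply: near_open => //; apply: hO; exact: bz.1.
have [Pz|nP] := pselect (closure P (place p e1 e2 z)); last first.
  apply: filterS (near_and Oz (near_affine (near_notin_closure nP))) => x [Ox nx] nc.
  by case: nx; exact: Pin.
have uz : u (place p e1 e2 z) = gi z.
  by rewrite (ug _ bz) /place addrAC subrr add0r scalerA mulVf ?scale1r// gt_eqF.
have := near_and Oz (near_affine (within_near cu Pz d0)); apply: filterS => x [Ox h] nc.
by rewrite distrC -uz; apply: h; apply: subset_closure; exact: Pin.
Qed.

End schauder.

(* The dimension is n = m.+1 >= 3. *)
Theorem theorem3p9 (R : realType) (m : nat) (hn : (3 <= m.+1)%N)
  (alpha : R) (halpha : 0 < alpha < 1)
  (Om : set 'rV[R]_m.+1)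
  (Om_open : open Om) (Om_bounded : bounded_set Om) (Om_conn : connected Om)
  (Om_half : Om `<=` halfspace m) (Om_C1a : C1a_set alpha Om)
  (Om_bd0 : exists r : R, 0 < r /\
     eball 0 r `&` boundary (halfspace m) `<=` boundary0 Om)
  (Om_bdp_compact : compact (closure (boundary_plus Om)))
  (Om_bdp : C1a_hypersurface_with_boundary alpha (closure (boundary_plus Om)))
  (om : set 'rV[R]_m.+1)
  (om_open : open om) (om_bounded : bounded_set om) (om_conn : connected om)
  (om_C1a : C1a_set alpha om) (om0 : om 0)
  (p : 'rV[R]_m.+1) (hp : halfspace m p)
  (ead : 'rV[R]_2)
  (ead1_pos : 0 < eps1 ead) (ead2_pos : 0 < eps2 ead)
  (ead1_lt1 : eps1 ead < 1) (ead2_gt1 : 1 < eps2 ead)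
  (ead2_lt : eps2 ead < (eps1 ead)^-1)
  (hole_sub : forall e, rect 0 ead e -> closure (hole p om e) `<=` Om)
  (go gi : 'rV[R]_m.+1 -> R)
  (go_C1a : C1a_boundary alpha Om go) (gi_C1a : C1a_boundary alpha om gi)
  (r0 : R) (r0_pos : 0 < r0)
  (go_analytic : real_analytic_on
     (@flat R m @^-1` (eball 0 r0 `&` boundary0 Om)) (go \o @flat R m))
  (u : 'rV[R]_2 -> 'rV[R]_m.+1 -> R)
  (hu : forall e, rect 0 ead e ->
     [/\ C1a_closure alpha (perforated Om p om e) (u e),
         harmonic_on (perforated Om p om e) (u e),
         (forall x, boundary Om x -> u e x = go x) &
         (forall x, boundary (hole p om e) x ->
            u e x = gi ((eps1 e * eps2 e)^-1 *: (x - eps1 e *: p)))])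
  (u0 : 'rV[R]_m.+1 -> R)
  (u0_C1a : C1a_closure alpha Om u0) (u0_harm : harmonic_on Om u0)
  (u0_bd : forall x, boundary Om x -> u0 x = go x)
  (r1 : R) (hr1 : 0 < r1 <= r0)
  (r1_sub : eball 0 r1 `&` halfspace m `<=` Om)
  (U0 : 'rV[R]_m.+1 -> R) (U0_harm : harmonic_on (eball 0 r1) U0)
  (U0_u0 : forall x, closure (eball 0 r1 `&` halfspace m) x -> U0 x = u0 x)
  (hole_small : forall e, rect (- ead) ead e ->
     hole p (closure om) e `<=` eball 0 r1) :
  exists eE : 'rV[R]_2, rect 0 ead eE /\
  exists E : 'rV[R]_2 -> R,
    [/\ real_analytic_on (rect (- eE) eE) E,
        (forall e, rect 0 eE e ->
           energy (perforated Om p om e) (u e) = (E e)%:E) &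
        energy Om u0 = (E 0)%:E].
Proof.

have a0 : 0 < alpha by case/andP: halpha.
have [c Oc] := bounded_set_cube Om_bounded.
have bOm : bounded_dom Om := conj Om_open (ex_intro _ c Oc).
have [c' omc] := bounded_set_cube om_bounded.
pose K := closure om; have cK : closed K := @closed_closure _ om.
(* On [K] one has |x|^2 <= n c'^2, which is less than (1 + n c'^2)^2. *)
pose rho : R := 1 + m.+1%:R * c' ^+ 2.
have q0 : 0 <= m.+1%:R * c' ^+ 2 by rewrite mulr_ge0// sqr_ge0.
have rho0 : 0 < rho by rewrite /rho ltr_pwDl.
have Krho : K `<=` hball rho.
  move=> x /(closure_cube omc) /cube_sqn h; apply: (le_lt_trans h).
  by rewrite /rho; move: (m.+1%:R * c' ^+ 2) q0 => q hq; rewrite expr2; nra.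
have ru0 := reg_schauder a0 Om_open Oc u0_C1a u0_harm.
have hu0 := u0_harm.2.
have r10 : 0 < r1 by case/andP: hr1.
(* The closed ball of radius 4 tau = r1 / 2 lies inside the ball where [U0] is harmonic. *)
pose tau := r1 / 8; have tau0 : 0 < tau by rewrite divr_gt0.
have tau4 : 4 * tau < r1 by rewrite /tau; lra.
have tau40 : 0 <= 4 * tau by rewrite mulr_ge0// ltW.
have eb := eball_hball r10 : eball (0 : 'rV[R]_m.+1) r1 = hball r1.
have half_sub : halfball (4 * tau) `<=` eball 0 r1 `&` halfspace m.
  by move=> x [hx px]; split=> //; rewrite eb; exact: (le_hball tau40 (ltW tau4) hx).
have tauOm : halfball (4 * tau) `<=` Om by move=> x /half_sub; exact: r1_sub.
have ball_sub : closure (hball (4 * tau)) `<=` eball (0 : 'rV[R]_m.+1) r1.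
  suff h : closure (hball (4 * tau)) `<=` [set y : 'rV[R]_m.+1 | sqn y <= (4 * tau) ^+ 2].
    move=> x /h hx; rewrite eb; apply: (le_lt_trans hx).
    by rewrite ltrXn2r ?nnegrE ?(ltW r10).
  rewrite closureE => x; apply; split.
    rewrite (_ : [set y | _] = ~` [set y | (4 * tau) ^+ 2 < sqn y]); last first.
      by apply/seteqP; split=> y /=; rewrite leNgt => /negP.
    by apply: open_closedC; exact: open_sqn_gt.
  by move=> y; exact: ltW.
have oeb : open (eball (0 : 'rV[R]_m.+1) r1) by rewrite eb; exact: open_hball.
have rU0 := reg_compactly (@open_hball R m.+1 _) oeb (compact_closure (hball_cube tau40)) ball_sub U0_harm.
have hU0 x : hball (4 * tau) x -> laplacian U0 x = 0.
  by move=> hx; apply: U0_harm.2; apply: ball_sub; exact: subset_closure.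
have UU x : halfball (4 * tau) x -> U0 x = u0 x.
  by move=> /half_sub hx; apply: U0_u0; exact: subset_closure.
pose Pe (e1 e2 : R) := Om `&` [set x | ~ K (- (e1 * e2)^-1 *: (e1 *: p) + (e1 * e2)^-1 *: x)].
have oPe e1 e2 : open (Pe e1 e2).
  apply: openI => //; apply: (@open_affine R m.+1 (- (e1 * e2)^-1 *: (e1 *: p)) (e1 * e2)^-1 (~` K)).
  exact: closed_openC.
have rect_ead e1 e2 : 0 < e1 < eps1 ead -> 0 < e2 < eps2 ead -> rect 0 ead (pair e1 e2).
  by move=> h1 h2; apply: rect_eps; rewrite ?eps1_pair ?eps2_pair /eps1 /eps2 mxE.
have PeE e1 e2 : 0 < e1 -> 0 < e2 -> perforated Om p om (pair e1 e2) = Pe e1 e2.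
  by move=> h1 h2; exact: (perforatedE _ _ (mulr_gt0 h1 h2)).
have regu e1 e2 : 0 < e1 < eps1 ead -> 0 < e2 < eps2 ead ->
    reg (Pe e1 e2) (u (pair e1 e2)) /\ forall x, Pe e1 e2 x -> laplacian (u (pair e1 e2)) x = 0.
  move=> h1 h2; have [Cu Hu _ _] := hu _ (rect_ead _ _ h1 h2).
  have h10 : 0 < e1 by case/andP: h1.
  have h20 : 0 < e2 by case/andP: h2.
  rewrite (PeE _ _ h10 h20) in Cu Hu; split; last exact: Hu.2.
  have Pc : Pe e1 e2 `<=` cube c by move=> x [/Oc].
  exact: (reg_schauder a0 (oPe e1 e2) Pc Cu Hu).
have hp0 : 0 < p ord0 ord_max by exact: hp.
pose N : R := 1 + sqn p + 2 * (2 * (2 * rho)).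
have N0 : 0 < N by rewrite /N addr_gt0 ?mulr_gt0// ltr_pwDl// sqn_ge0.
have d1 : 0 <= N / p ord0 ord_max by rewrite divr_ge0// ltW.
have d2 : 0 <= N / r1 by rewrite divr_ge0// ltW.
have d3 : 0 <= (eps1 ead)^-1 by rewrite invr_ge0 ltW.
have d4 : 0 <= (eps2 ead)^-1 by rewrite invr_ge0 ltW.
(* A fixed reference parameter (s, s), admissible and so small that the ball of radius 4 rho is
   carried into [Om]. *)
have [s [/andP[s0 s1] q1 q2 q3 [q4 _]]] := pick_tiny d1 d2 d3 d4 (lexx 0).
have below (x y : R) : 0 < y -> x / y * s <= 8^-1 -> x * s < y.
  move=> y0 h; have : x / y * s * y < y.
    by apply: le_lt_trans (_ : 8^-1 * y < _); [rewrite ler_wpM2r// ltW|lra].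
  by rewrite mulrAC mulfVK ?gt_eqF.
have sp := below _ _ hp0 q1; have sr := below _ _ r10 q2.
have se1 : 0 < s < eps1 ead by rewrite s0 -[X in X < _]mul1r below// mul1r.
have se2 : 0 < s < eps2 ead by rewrite s0 -[X in X < _]mul1r below// mul1r.
have rho4 : 0 <= 2 * (2 * rho) by rewrite !mulr_ge0// ltW.
have AOm z : hball (2 * (2 * rho)) z -> Om (place p s s z).
  move=> hz; apply: r1_sub; split.
    rewrite eb; have sn : `|s| <= s by rewrite gtr0_norm.
    apply: le_lt_trans (sqn_place_le p sn sn s1 rho4 (ltW hz)) _.
    by rewrite ltrXn2r ?nnegrE ?(ltW r10) ?mulr_ge0 ?(ltW s0) ?(ltW N0)// mulrC.
  rewrite /halfspace /= !mxE; apply: (arith_front s0 s0 (lexx s) _ rho4).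
    apply: le_lt_trans sp; rewrite mulrC ler_wpM2r ?(ltW s0)// /N.
    by have := sqn_ge0 p; move: (sqn p) rho4 => q; lra.
  have := le_trans (coord_le_sqn z ord_max) (ltW hz).
  by rewrite -real_normK ?num_real// ler_pXn2r ?nnegrE.
(* This function is harmonic around the hole and attains [gi] on it. *)
pose G t := u (pair s s) (place p s s t).
pose Ak : set 'rV[R]_m.+1 := hball (2 * (2 * rho)) `&` ~` K.
have oAk : open Ak by apply: open_setD => //; exact: open_hball.
have ss0 : 0 < s * s by exact: mulr_gt0.
have AkP z : Ak z -> Pe s s (place p s s z).
  by move=> [/AOm Oz nK]; split=> //=; rewrite (affineK _ ss0).
have [rus hus] := regu s s se1 se2.
have rG : reg Ak G by exact: (reg_affine (oPe s s) oAk AkP rus).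
have hG z : Ak z -> laplacian G z = 0.
  move=> /AkP Pz; have [Cu _ _ _] := rus.
  by rewrite (laplacian_affine (oPe s s) Cu Pz) (hus _ Pz) mulr0.
pose rad := Num.min (eps1 ead) (eps2 ead).
have rad0 : 0 < rad by rewrite lt_min ead1_pos.
have inner e1 e2 z d : 0 < e1 < eps1 ead -> 0 < e2 < eps2 ead -> K z -> ~ om z -> 0 < d ->
    \forall x \near z, ~ K x -> `|u (pair e1 e2) (place p e1 e2 x) - gi z| < d.
  move=> h1 h2 Kz nz d0; have re := rect_ead _ _ h1 h2.
  have [[_ cu _] _ _ ug] := hu _ re.
  have s12 : 0 < e1 * e2 by case/andP: h1 => ? _; case/andP: h2 => ? _; rewrite mulr_gt0.
  rewrite eps1_pair eps2_pair in ug.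
  exact: (inner_boundary s12 Om_open (hole_sub _ re) cu ug Kz nz d0).
have sol e1 e2 : 0 < e1 < rad -> 0 < e2 < rad -> solves Om K p u0 G (fun a b => u (pair a b)) e1 e2.
  rewrite !lt_min => /andP[e10 /andP[h1 _]] /andP[e20 /andP[_ h2]].
  have h1' : 0 < e1 < eps1 ead by rewrite e10.
  have h2' : 0 < e2 < eps2 ead by rewrite e20.
  have [ru hu'] := regu e1 e2 h1' h2'; split=> //.
    have [[_ cu _] _ ug _] := hu _ (rect_ead _ _ h1' h2'); have [_ cu0 _] := u0_C1a.
    rewrite (PeE _ _ e10 e20) in cu.
    apply: (outer_boundary Om_open _ cu cu0) => [x []//|y By].
    by rewrite ug// u0_bd.
  (* Near an interior point of the hole there are no points outside [K]. *)
  move=> z Kz d d0; have [oz|nz] := pselect (om z).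
    by apply: filterS (near_open om_open oz) => x /(@subset_closure _ om) Kx nK.
  have d20 : 0 < d / 2 by rewrite divr_gt0.
  (* Both rescaled solutions tend to [gi z] at a boundary point z of the hole, so their difference
     tends to 0. *)
  have := near_and (inner _ _ _ _ h1' h2' Kz nz d20) (inner _ _ _ _ se1 se2 Kz nz d20).
  apply: filterS => x [a1 a2] nK; have := a1 nK; have := a2 nK; rewrite -/(G x).
  move: (u _ _) (G x) (gi z) => a b g h3 h4; have -> : a - b = (a - g) - (b - g) by ring.
  by apply: le_lt_trans (ler_normB _ _) _; move: h3 h4; move: `|_| `|_| => k l; lra.
have [r [F [C [/andP[r0' rrad] sF F0 FE]]]] := analytic_energy hn bOm Om_half cK Krho rho0 tau0
  tauOm hp0 rU0 hU0 UU ru0 hu0 rG hG rad0 sol.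
have rr1 : r < eps1 ead by move: rrad; rewrite lt_min => /andP[].
have rr2 : r < eps2 ead by move: rrad; rewrite lt_min => /andP[].
exists (pair r r); split; first by apply: rect_ead; rewrite r0'.
exists (fun e => F (eps1 e) (eps2 e)); split.
- apply: (ser_real_analytic (0 : 'rV[R]_m.+1) (0 : 'rV[R]_m.+1) (ltW r0') sF) => e he.
  have := he ord0; have := he ord_max; rewrite !mxE /= => h2 h1.
  by rewrite !ltr_norml.
- move=> e he; have := he ord0; have := he ord_max; rewrite !mxE /= => /andP[e20 h2] /andP[e10 h1].
  have h1' : 0 < eps1 e < eps1 ead by apply/andP; split=> //; exact: lt_trans rr1.
  have h2' : 0 < eps2 e < eps2 ead by apply/andP; split=> //; exact: lt_trans rr2.
  have [ru _] := regu _ _ h1' h2'; 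
  have bP : bounded_dom (Pe (eps1 e) (eps2 e)).
    by split; [exact: oPe|exists c => x [/Oc]].
  rewrite -(pair_eps e) eps1_pair eps2_pair (PeE _ _ e10 e20) (energyE (bounded_dom_fin bP) ru).
  by congr EFin; apply: FE; apply/andP; split=> //; exact: ltW.
rewrite /eps1 /eps2 !mxE F0; exact: (energyE (bounded_dom_fin bOm) ru0).
Qed.
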